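(* Let $N\ge 2$, $\Omega\subset\mathbb{R}^N$ a bounded domain, $s_1\in(0,1)$, $p\ge2$ and $s_p\in\left(\frac{p-1}{p},1\right)$. Let $u$ be a locally bounded weak solution of $(-\Delta_1)^{s_1}u+(-\Delta_p)^{s_p}u=0$ in $\Omega$. Then $u\in W^{1,q}_{\mathrm{loc}}(\Omega)$ for every $q\ge p$. Moreover, there exist constants $C,\kappa>0$ depending only on $N,p,q,s_1,s_p$ such that for every ball $B_R=B_R(x_0)\subset\subset\Omega$ with $R\in(0,1)$ and every $r\in(0,R)$, $$\|\nabla u\|^q_{L^q(B_r)}\le \frac{C\left(\mathcal{T}+[u]_{W^{s_p,p}(B_R)}+1\right)^q}{(R-r)^\kappa},\qquad \mathcal{T}:=\|u\|_{L^\infty(B_R(x_0))}+\mathrm{Tail}(u;x_0,R).$$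
   Context: Notation: $B_\rho=B_\rho(x_0)$ is the open ball of radius $\rho$ centered at $x_0$; $A\subset\subset\Omega$ means $\overline A$ is compact and contained in $\Omega$. For $\gamma\in(0,1)$, $q\ge1$ and an open set $U$, $[w]_{W^{\gamma,q}(U)}:=\left(\int_U\int_U\frac{|w(x)-w(y)|^q}{|x-y|^{N+\gamma q}}dxdy\right)^{1/q}$ and $W^{\gamma,q}(U)=\{w\in L^q(U):[w]_{W^{\gamma,q}(U)}<\infty\}$. $W^{\gamma,q}_{\mathrm{loc}}(\Omega)$ (and similarly $W^{1,q}_{\mathrm{loc}}$, $L^\infty_{\mathrm{loc}}$) denotes functions belonging to the corresponding space on every ball $B\subset\subset\Omega$. $W^{\gamma,q}_0(\Omega)$ denotes functions in $W^{\gamma,q}(\mathbb{R}^N)$ vanishing a.e. outside $\Omega$. The tail space $L^{p-1}_{s_pp}(\mathbb{R}^N)$ consists of $w\in L^{p-1}_{\mathrm{loc}}(\mathbb{R}^N)$ with $\int_{\mathbb{R}^N}\frac{|w|^{p-1}}{(1+|x|)^{N+s_pp}}dx<\infty$, and $\mathrm{Tail}(u;x_0,R):=\left(R^{s_pp}\int_{\mathbb{R}^N\setminus B_R(x_0)}\frac{|u(x)|^{p-1}}{|x-x_0|^{N+s_pp}}dx\right)^{\frac1{p-1}}$. The set-valued sign is $\mathrm{sgn}(t)=\{1\}$ if $t>0$, $\{-1\}$ if $t<0$, $[-1,1]$ if $t=0$. Weak solution: a function $u\in W^{s_1,1}_{\mathrm{loc}}(\Omega)\cap W^{s_p,p}_{\mathrm{loc}}(\Omega)\cap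 L^{p-1}_{s_pp}(\mathbb{R}^N)$ is a weak solution of $(-\Delta_1)^{s_1}u+(-\Delta_p)^{s_p}u=0$ in $\Omega$ if there is $Z\in L^\infty(\mathbb{R}^N\times\mathbb{R}^N)$ with $Z(x,y)\in\mathrm{sgn}(u(x)-u(y))$ for a.e. $(x,y)$, such that for every $\varphi\in W^{s_1,1}_0(\Omega)\cap W^{s_p,p}_0(\Omega)$, $$0=\int_{\mathbb{R}^N}\int_{\mathbb{R}^N}Z\frac{\varphi(x)-\varphi(y)}{|x-y|^{N+s_1}}dxdy+\int_{\mathbb{R}^N}\int_{\mathbb{R}^N}\frac{|u(x)-u(y)|^{p-2}(u(x)-u(y))(\varphi(x)-\varphi(y))}{|x-y|^{N+s_pp}}dxdy.$$ A locally bounded weak solution is a weak solution with $u\in L^\infty_{\mathrm{loc}}(\Omega)$. *)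

(* Defs.v *)
(* All objects live on R^N, represented as
   N.-tuple R for an abstract R : realType (carrying the product Borel
   sigma-algebra provided by MathComp-Analysis). *)
From HB Require Import structures.
From mathcomp Require Import all_boot all_order all_algebra.
From mathcomp Require Import all_classical all_reals all_analysis.
Unset Printing Implicit Defensive.
Import Order.TTheory GRing.Theory Num.Theory.
Import numFieldNormedType.Exports.
Local Open Scope classical_set_scope.
Local Open Scope ring_scope.

Definition edist {R : realType} {N : nat} (x y : N.-tuple R) : R :=
  Num.sqrt (\sum_(i < N) (tnth x i - tnth y i) ^+ 2).

Definition origin {R : realType} (N : nat) : N.-tuple R := [tuple (0:R) | _ < N].

Definition eball {R : realType} {N : nat} (x0 : N.-tuple R) (rho : R) :
  set (N.-tuple R) := [set x | edist x x0 < rho].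

(* B_rho(x0) compactly contained in Om: the closure of the ball (the closed
   ball, rho > 0) is contained in Om (closed balls of R^N are compact). *)
Definition ball_cc {R : realType} {N : nat} (Om : set (N.-tuple R))
  (x0 : N.-tuple R) (rho : R) : Prop :=
  0 < rho /\ [set x | edist x x0 <= rho] `<=` Om.

Definition eopen {R : realType} {N : nat} (Om : set (N.-tuple R)) : Prop :=
  forall x, Om x -> exists2 e : R, 0 < e & eball x e `<=` Om.

Definition ebounded {R : realType} {N : nat} (Om : set (N.-tuple R)) : Prop :=
  exists M : R, Om `<=` eball (origin N) M.

Definition econnected {R : realType} {N : nat} (Om : set (N.-tuple R)) : Prop :=
  forall A B : set (N.-tuple R), eopen A -> eopen B ->
    Om `<=` A `|` B -> A `&` B `&` Om = set0 ->
    A `&` Om = set0 \/ B `&` Om = set0.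

Definition bounded_domain {R : realType} {N : nat} (Om : set (N.-tuple R)) :=
  Om !=set0 /\ eopen Om /\ econnected Om /\ ebounded Om.

(* Iterated (Tonelli) integral w.r.t. the 1-dimensional Lebesgue measure;
   it is used only on nonnegative measurable integrands, for which it is
   the Lebesgue integral on R^N. *)
Fixpoint iint {R : realType} (n : nat) : (n.-tuple R -> \bar R) -> \bar R :=
  match n return (n.-tuple R -> \bar R) -> \bar R with
  | 0 => fun f => f [tuple]
  | n'.+1 => fun f =>
      (\int[@lebesgue_measure R]_x @iint R n' (fun t => f (@cons_tuple _ R (x : R) t)))%E
  end.
Arguments iint {R} n f.

Definition iint2 {R : realType} (N : nat)
  (F : N.-tuple R * N.-tuple R -> \bar R) : \bar R :=
  iint N (fun x => iint N (fun y => F (x, y))).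

Definition integrableN {R : realType} {N : nat} (f : N.-tuple R -> R) : Prop :=
  measurable_fun setT f /\ (iint N (fun x => (`|f x|)%:E) < +oo)%E.

Definition integrable2N {R : realType} {N : nat}
  (F : N.-tuple R * N.-tuple R -> R) : Prop :=
  measurable_fun setT F /\ (iint2 N (fun z => (`|F z|)%:E) < +oo)%E.

Definition sintN {R : realType} {N : nat} (f : N.-tuple R -> R) : R :=
  fine (iint N (fun x => (Num.max (f x) 0)%:E)) -
  fine (iint N (fun x => (Num.max (- f x) 0)%:E)).

Definition sint2N {R : realType} {N : nat}
  (F : N.-tuple R * N.-tuple R -> R) : R :=
  fine (iint2 N (fun z => (Num.max (F z) 0)%:E)) -
  fine (iint2 N (fun z => (Num.max (- F z) 0)%:E)).

Definition aeN {R : realType} (N : nat) (P : N.-tuple R -> Prop) : Prop :=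
  exists E : set (N.-tuple R), measurable E /\
    iint N (fun x => (\1_E x : R)%:E) = 0%E /\ forall x, ~ E x -> P x.

Definition ae2N {R : realType} (N : nat)
  (P : N.-tuple R * N.-tuple R -> Prop) : Prop :=
  exists E : set (N.-tuple R * N.-tuple R), measurable E /\
    iint2 N (fun z => (\1_E z : R)%:E) = 0%E /\ forall z, ~ E z -> P z.

Definition LqpowN {R : realType} {N : nat} (q : R) (U : set (N.-tuple R))
  (w : N.-tuple R -> R) : \bar R :=
  iint N (fun x => (\1_U x * `|w x| `^ q)%:E).

Definition Lq {R : realType} {N : nat} (q : R) (U : set (N.-tuple R))
  (w : N.-tuple R -> R) : Prop :=
  measurable_fun setT w /\ (LqpowN q U w < +oo)%E.

Definition gagliardo_pow {R : realType} {N : nat} (gamma q : R)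
  (U : set (N.-tuple R)) (w : N.-tuple R -> R) : \bar R :=
  iint2 N (fun z => (\1_U z.1 * \1_U z.2 *
     (`|w z.1 - w z.2| `^ q / edist z.1 z.2 `^ (N%:R + gamma * q)))%:E).

Definition gagliardo {R : realType} {N : nat} (gamma q : R)
  (U : set (N.-tuple R)) (w : N.-tuple R -> R) : R :=
  fine (gagliardo_pow gamma q U w) `^ (q^-1).

Definition Wfrac {R : realType} {N : nat} (gamma q : R)
  (U : set (N.-tuple R)) (w : N.-tuple R -> R) : Prop :=
  Lq q U w /\ (gagliardo_pow gamma q U w < +oo)%E.

Definition Wfrac_loc {R : realType} {N : nat} (gamma q : R)
  (Om : set (N.-tuple R)) (w : N.-tuple R -> R) : Prop :=
  forall x0 rho, ball_cc Om x0 rho -> Wfrac gamma q (eball x0 rho) w.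

Definition Wfrac0 {R : realType} {N : nat} (gamma q : R)
  (Om : set (N.-tuple R)) (w : N.-tuple R -> R) : Prop :=
  Wfrac gamma q setT w /\ aeN N (fun x => ~ Om x -> w x = 0).

Definition Lq_loc {R : realType} {N : nat} (q : R)
  (Om : set (N.-tuple R)) (w : N.-tuple R -> R) : Prop :=
  forall x0 rho, ball_cc Om x0 rho -> Lq q (eball x0 rho) w.

Definition Linf_loc {R : realType} {N : nat}
  (Om : set (N.-tuple R)) (w : N.-tuple R -> R) : Prop :=
  measurable_fun setT w /\
  forall x0 rho, ball_cc Om x0 rho ->
    exists M : R, aeN N (fun x => eball x0 rho x -> `|w x| <= M).

Definition Linf_norm {R : realType} {N : nat} (U : set (N.-tuple R))
  (w : N.-tuple R -> R) : R :=
  inf [set M : R | 0 <= M /\ aeN N (fun x => U x -> `|w x| <= M)].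

Definition tail_space {R : realType} {N : nat} (p s : R)
  (w : N.-tuple R -> R) : Prop :=
  measurable_fun setT w /\
  (forall x0 rho, Lq (p - 1) (eball x0 rho) w) /\
  (iint N (fun x => (`|w x| `^ (p - 1) /
        (1 + edist x (origin N)) `^ (N%:R + s * p))%:E) < +oo)%E.

Definition Tail {R : realType} {N : nat} (p s : R) (u : N.-tuple R -> R)
  (x0 : N.-tuple R) (rho : R) : R :=
  (rho `^ (s * p) *
   fine (iint N (fun x => (\1_(~` eball x0 rho) x *
        (`|u x| `^ (p - 1) / edist x x0 `^ (N%:R + s * p)))%:E)))
  `^ ((p - 1)^-1).

Definition sgn_set {R : realType} (t : R) : set R :=
  if 0 < t then [set 1] else if t < 0 then [set -1] else `[-1, 1]%classic.

Definition weak_solution {R : realType} {N : nat} (s1 p sp : R)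
  (Om : set (N.-tuple R)) (u : N.-tuple R -> R) : Prop :=
  Wfrac_loc s1 1 Om u /\ Wfrac_loc sp p Om u /\ tail_space p sp u /\
  exists Z : N.-tuple R * N.-tuple R -> R,
    measurable_fun setT Z /\
    (exists M : R, ae2N N (fun z => `|Z z| <= M)) /\
    ae2N N (fun z => sgn_set (u z.1 - u z.2) (Z z)) /\
    forall phi : N.-tuple R -> R,
      Wfrac0 s1 1 Om phi -> Wfrac0 sp p Om phi ->
      let F1 := fun z : N.-tuple R * N.-tuple R =>
        Z z * (phi z.1 - phi z.2) / edist z.1 z.2 `^ (N%:R + s1) in
      let F2 := fun z : N.-tuple R * N.-tuple R =>
        `|u z.1 - u z.2| `^ (p - 2) * (u z.1 - u z.2) * (phi z.1 - phi z.2)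
          / edist z.1 z.2 `^ (N%:R + sp * p) in
      integrable2N F1 /\ integrable2N F2 /\ 0 = sint2N F1 + sint2N F2.

Definition locally_bounded_weak_solution {R : realType} {N : nat}
  (s1 p sp : R) (Om : set (N.-tuple R)) (u : N.-tuple R -> R) : Prop :=
  weak_solution s1 p sp Om u /\ Linf_loc Om u.

Definition shift {R : realType} {N : nat} (x : N.-tuple R) (i : 'I_N) (h : R)
  : N.-tuple R := [tuple tnth x j + (if j == i then h else 0) | j < N].

Definition pderiv {R : realType} {N : nat} (i : 'I_N)
  (f : N.-tuple R -> R) : N.-tuple R -> R :=
  fun x => derive1 (fun h : R => f (shift x i h)) 0.

Definition econtinuous {R : realType} {N : nat} (f : N.-tuple R -> R) : Prop :=
  forall x (e : R), 0 < e -> exists2 d : R, 0 < d &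
    forall y, edist y x < d -> `|f y - f x| < e.

Fixpoint Ck {R : realType} {N : nat} (k : nat) (f : N.-tuple R -> R) : Prop :=
  match k with
  | 0 => econtinuous f
  | k'.+1 => econtinuous f /\
      forall i : 'I_N, (forall x, derivable (fun h : R => f (shift x i h)) 0 1)
                       /\ Ck k' (pderiv i f)
  end.

(* C_c^infty(Om): smooth, with support a compact subset of Om *)
Definition test_fun {R : realType} {N : nat} (Om : set (N.-tuple R))
  (phi : N.-tuple R -> R) : Prop :=
  (forall k, Ck k phi) /\
  exists d M : R, 0 < d /\
    forall x, phi x <> 0 -> edist x (origin N) <= M /\ eball x d `<=` Om.

Definition weak_gradient {R : realType} {N : nat} (Om : set (N.-tuple R))
  (u : N.-tuple R -> R) (G : 'I_N -> N.-tuple R -> R) : Prop :=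
  forall (i : 'I_N) (phi : N.-tuple R -> R), test_fun Om phi ->
    integrableN (fun x => u x * pderiv i phi x) /\
    integrableN (fun x => G i x * phi x) /\
    sintN (fun x => u x * pderiv i phi x) = - sintN (fun x => G i x * phi x).

Definition vnorm {R : realType} {N : nat} (G : 'I_N -> N.-tuple R -> R)
  (x : N.-tuple R) : R := Num.sqrt (\sum_(i < N) G i x ^+ 2).

Definition W1q_loc_grad {R : realType} {N : nat} (q : R)
  (Om : set (N.-tuple R)) (u : N.-tuple R -> R)
  (G : 'I_N -> N.-tuple R -> R) : Prop :=
  Lq_loc q Om u /\ (forall i, Lq_loc q Om (G i)) /\ weak_gradient Om u G.

(* Main.v *)
(* After division by the datum A = T + [u] + 1 one works with a bounded solution v
   of an equation whose 1-part has a coefficient in [0, 1]. Subtracting the equation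
   from its translate by h and testing with |w|^(b-1) w eta^2, where w = v(.+h) - v
   and b = q - p + 2, gives a Caccioppoli inequality: the 1-part contributes only
   through the cutoff, since sgn is monotone, and the p-part controls the
   W^{s,p}-energy of a power of w. If the first differences of v are of order sg in
   L^q, this makes the second differences in L^(q+1) of order
   (q sg + s p - p + 2) / (q + 1) at least. Since s p - p + 2 > 1, finitely many
   steps lead to first differences of order 1 and second differences of order
   1 + gam > 1 in L^m, with m arbitrarily large. The dyadic difference quotients
   along a coordinate axis are then summably close to each other, so they converge
   in L^1_loc and almost everywhere, and the limit is the weak derivative. All
   constants are those of the normalized problem, so homogeneity yields the power q
   of the datum. *)
From Pilot Require Import Defs.
From HB Require Import structures.
From mathcomp Require Import all_boot all_order all_algebra.
From mathcomp Require Import all_classical all_reals all_analysis.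
From mathcomp Require Import measurable_realfun ring lra.
Import Order.TTheory GRing.Theory Num.Theory.
Import numFieldNormedType.Exports.
Import Pilot.Defs.
Local Open Scope classical_set_scope.
Local Open Scope ring_scope.

(** * Lebesgue measure on R^N *)

(** Every error term of the energy estimate contains at least the [b]-th power of [w], hence is of
    order [|h| ^ (sg b)]; comparing [w] with its translate by the same [h] gains [|h| ^ (s p)] more.
    With [b = q - p + 2] the sum [s p + sg b] is [q sg + s p - sg (p - 2)], and [sg <= 1] gives the
    stated order. The gain appears on second differences only. The way back to first differences
    costs a small part of it and cannot pass order 1, so the iteration saturates there; what makes
    the dyadic quotients summable is the surplus that the second differences keep. The obstacle is
    the region near the diagonal, where the coefficient [|v(x) - v(y)| ^ (p - 2)] must be controlled
    by the regularity already reached, for increments [y - x] in all directions and not just along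
    [h]; [s <= sg] makes the remaining kernel integrable. The limit of the quotients is one function
    on the whole space, so estimates on different balls bound the same gradient. The iterated
    integrals of the statement are identified with integrals for a product measure, to which Fubini,
    Fatou and dominated convergence apply. *)

Definition consP {R : realType} {n : nat} (z : measurableTypeR R * n.-tuple R) : n.+1.-tuple R :=
  cons_tuple z.1 z.2.

Lemma measurable_consP {R : realType} {n : nat} :
  measurable_fun setT (@consP R n).
Proof. exact: (@measurable_cons _ _ _ _ fst _ snd). Qed.

Section stepN.
Context {R : realType} {n : nat} (m : {sigma_finite_measure set (n.-tuple R) -> \bar R}).

(** The product of one-dimensional Lebesgue measure with [m], carried over by [consP]. It peels off
    the first coordinate in the same order as [iint], so facts about R^N follow by induction on the
    dimension. *)
Definition stepN : set (n.+1.-tuple R) -> \bar R :=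
  pushforward (@lebesgue_measure R \x m)%E (@consP R n).

Let L : {sigma_finite_measure set (measurableTypeR R) -> \bar R} :=
  @lebesgue_measure R.

Let M : {measure set (n.+1.-tuple R) -> \bar R} :=
  measure_function_pushforward__canonical__measure_function_Measure
    (L \x m)%E measurable_consP.

Let stepN0 : stepN set0 = 0%E.
Proof. exact: (measure0 M). Qed.

Let stepN_ge0 A : (0 <= stepN A)%E.
Proof. exact: (measure_ge0 M). Qed.

Let stepN_sigma_additive : semi_sigma_additive stepN.
Proof. exact: (@measure_semi_sigma_additive _ _ _ M). Qed.

HB.instance Definition _ := isMeasure.Build _ _ _ stepN
  stepN0 stepN_ge0 stepN_sigma_additive.

Let uncons (x : n.+1.-tuple R) : measurableTypeR R * n.-tuple R :=
  (thead x, [tuple of behead x]).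

Let measurable_uncons : measurable_fun setT uncons.
Proof.
apply/measurable_fun_pairP; split.
  exact: (@measurable_tnth _ _ _ ord0).
exact: measurable_behead.
Qed.

Let stepN_sigma_finite : sigma_finite setT stepN.
Proof.
have /sigma_finiteP[F [FT ndF Foo]] := sigma_finiteT L.
have /sigma_finiteP[G [GT ndG Goo]] := sigma_finiteT m.
exists (fun i => uncons @^-1` (F i `*` G i)).
  apply/esym/seteqP; split=> // x _.
  have [i _ Fi] : (\bigcup_i F i) (uncons x).1 by rewrite -FT.
  have [j _ Gj] : (\bigcup_i G i) (uncons x).2 by rewrite -GT.
  exists (maxn i j) => //; split.
    by move: Fi; exact/subsetPset/ndF/leq_maxl.
  by move: Gj; exact/subsetPset/ndG/leq_maxr.
move=> k; have [mF Fk] := Foo k; have [mG Gk] := Goo k.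
have mFG : measurable (F k `*` G k) by exact: measurableX.
split; first by rewrite -[X in measurable X]setTI; exact: measurable_uncons.
rewrite /stepN /pushforward -comp_preimage.
rewrite (_ : uncons \o _ = id); last first.
  by apply/funext => -[a b] /=; congr pair; exact/val_inj.
by rewrite preimage_id product_measure1E// lte_mul_pinfty// ge0_fin_numE.
Qed.

HB.instance Definition _ := Measure_isSigmaFinite.Build _ _ _ stepN
  stepN_sigma_finite.

Lemma integral_stepN (f : n.+1.-tuple R -> \bar R) :
  measurable_fun setT f -> (forall x, 0 <= f x)%E ->
  (\int[stepN]_x f x = \int[@lebesgue_measure R]_x \int[m]_y f (consP (x, y)))%E.
Proof.
move=> mf f0.
rewrite ge0_integral_pushforward//; last exact: measurable_consP.
rewrite preimage_setT fubini_tonelli1//.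
  exact: (measurableT_comp mf measurable_consP).
by move=> x; exact: f0.
Qed.

End stepN.

(** Lebesgue measure on R^n; the base case is the unit mass on the one-point space R^0.
    Sigma-finiteness is part of the type because Tonelli's theorem is used at every step. *)
Fixpoint muN (R : realType) (n : nat) : {sigma_finite_measure set (n.-tuple R) -> \bar R} :=
  match n return {sigma_finite_measure set (n.-tuple R) -> \bar R} with
  | 0 => @dirac _ (0.-tuple R) [tuple] R
  | n'.+1 => stepN (muN R n')
  end.

(** Links the iterated integrals of the statement with a genuine measure. *)
Lemma iintE (R : realType) (n : nat) (f : n.-tuple R -> \bar R) :
  measurable_fun setT f -> (forall x, 0 <= f x)%E ->
  iint n f = (\int[muN R n]_x f x)%E.
Proof.
elim: n f => [|n IH] f mf f0 /=.
  by rewrite integral_dirac// diracT mul1e.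
rewrite integral_stepN//; apply: eq_integral => x _; rewrite IH//.
exact: (measurableT_comp (measurableT_comp mf measurable_consP) (pair1_measurable x)).
Qed.

(** * Translations and the Euclidean distance *)

Section translation1.
Context {R : realType} (a : R).

Let tr (x : measurableTypeR R) : measurableTypeR R := x + a.

Let mtr : measurable_fun setT tr.
Proof. by apply: measurable_funD => //; exact: measurable_id. Qed.

Let M : {measure set (measurableTypeR R) -> \bar R} :=
  measure_function_pushforward__canonical__measure_function_Measure
    (@lebesgue_measure R) mtr.

(** Lebesgue measure is determined by its values on half-open intervals, and a translation changes
    neither their form nor their length. *)
Lemma integral_lebesgueD (f : R -> \bar R) :
  measurable_fun setT f -> (forall x, 0 <= f x)%E ->
  (\int[@lebesgue_measure R]_x f (x + a)%R = \int[@lebesgue_measure R]_x f x)%E.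
Proof.
move=> mf f0.
transitivity (\int[M]_x f x)%E.
  by rewrite ge0_integral_pushforward// preimage_setT.
apply: eq_measure_integral => A mA _ /=.
apply/esym; apply: (@lebesgue_measure_unique R M) => //.
move=> _ [[b c] _ <-] /=.
rewrite /pushforward /=.
rewrite (_ : tr @^-1` _ = `]b - a, c - a]%classic).
  rewrite !lebesgue_measure_itv/= !lte_fin ltrD2r.
  by case: ifPn => // _; rewrite -!EFinD; congr (_%:E); ring.
by apply/seteqP; split=> x /=; rewrite !in_itv/= /tr ltrBlDr lerBrDr.
Qed.

End translation1.

Definition tadd {R : realType} {N : nat} (x h : N.-tuple R) : N.-tuple R :=
  [tuple tnth x i + tnth h i | i < N].

Lemma measurable_tadd2 {R : realType} {N : nat} d (T : measurableType d)
    (f g : T -> N.-tuple R) :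
  measurable_fun setT f -> measurable_fun setT g ->
  measurable_fun setT (fun x => tadd (f x) (g x)).
Proof.
move=> mf mg; apply/measurable_fun_tnthP => i /=.
rewrite (_ : _ \o _ = fun x => tnth (f x) i + tnth (g x) i); last first.
  by apply/funext => x /=; rewrite tnth_mktuple.
apply: measurable_funD.
- exact: (measurableT_comp (@measurable_tnth _ _ _ i) mf).
- exact: (measurableT_comp (@measurable_tnth _ _ _ i) mg).
Qed.

Lemma measurable_taddr {R : realType} {N : nat} (h : N.-tuple R) :
  measurable_fun setT (fun x => tadd x h).
Proof. by apply: measurable_tadd2. Qed.

Lemma tadd_cons {R : realType} {N : nat} (h : N.+1.-tuple R) x (y : N.-tuple R) :
  tadd (consP (x, y)) h = consP (x + thead h, tadd y [tuple of behead h]).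
Proof.
apply: eq_from_tnth => i; rewrite tnth_mktuple.
case: (unliftP ord0 i) => [j ->|->]; last by rewrite !tnth0.
rewrite /consP /= !tnthS tnth_mktuple; congr (_ + _).
by rewrite [in LHS](tuple_eta h) tnthS.
Qed.

Lemma measurable_comp_taddr {R : realType} {N : nat} d (U : measurableType d)
    (f : N.-tuple R -> U) (h : N.-tuple R) :
  measurable_fun setT f -> measurable_fun setT (fun x => f (tadd x h)).
Proof. by move=> mf; apply: (measurableT_comp mf (measurable_taddr h)). Qed.

(** Induction on the dimension: Tonelli separates the first coordinate, where translation invariance
    on the line applies. *)
Lemma integral_tadd {R : realType} {N : nat} (f : N.-tuple R -> \bar R)
    (h : N.-tuple R) :
  measurable_fun setT f -> (forall x, 0 <= f x)%E ->
  (\int[muN R N]_x f (tadd x h) = \int[muN R N]_x f x)%E.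
Proof.
elim: N f h => [|N IH] f h mf f0.
  by apply: eq_integral => x _; congr f; rewrite [LHS]tuple0 [RHS]tuple0.
have mf2 x : measurable_fun setT (fun y => f (consP (x, y))).
  exact: (measurableT_comp (measurableT_comp mf measurable_consP) (pair1_measurable x)).
rewrite /= (integral_stepN _ f mf f0).
rewrite (integral_stepN _ _ (measurable_comp_taddr _ _ f h mf) (fun x => f0 _)).
under eq_integral do under eq_integral do rewrite tadd_cons.
under eq_integral do rewrite (IH (fun y => f (consP (_, y)))) //.
rewrite (@integral_lebesgueD _ _ (fun x => \int[muN R N]_y f (consP (x, y)))%E)//.
- exact: (@measurable_fun_fubini_tonelli_F _ _ _ _ _ (muN R N)
    (f \o consP) (measurableT_comp mf measurable_consP) (fun z => f0 _)).
- by move=> x; apply: integral_ge0.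
Qed.

Definition topp {R : realType} {N : nat} (h : N.-tuple R) : N.-tuple R :=
  [tuple - tnth h i | i < N].

Lemma taddA {R : realType} {N : nat} (x y z : N.-tuple R) :
  tadd x (tadd y z) = tadd (tadd x y) z.
Proof. by apply: eq_from_tnth => i; rewrite !tnth_mktuple addrA. Qed.

Lemma taddC {R : realType} {N : nat} (x y : N.-tuple R) : tadd x y = tadd y x.
Proof. by apply: eq_from_tnth => i; rewrite !tnth_mktuple addrC. Qed.

Lemma taddAC {R : realType} {N : nat} (x y z : N.-tuple R) :
  tadd (tadd x y) z = tadd (tadd x z) y.
Proof. by apply: eq_from_tnth => i; rewrite !tnth_mktuple addrAC. Qed.

Lemma tadd0 {R : realType} {N : nat} (x : N.-tuple R) : tadd x (origin N) = x.
Proof. by apply: eq_from_tnth => i; rewrite !tnth_mktuple addr0. Qed.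

Lemma taddK {R : realType} {N : nat} (x h : N.-tuple R) :
  tadd (tadd x h) (topp h) = x.
Proof. by apply: eq_from_tnth => i; rewrite !tnth_mktuple addrK. Qed.

Lemma edist_ge0 {R : realType} {N : nat} (x y : N.-tuple R) : 0 <= edist x y.
Proof. exact: sqrtr_ge0. Qed.

Lemma edistC {R : realType} {N : nat} (x y : N.-tuple R) : edist x y = edist y x.
Proof.
by rewrite /edist; congr Num.sqrt; apply: eq_bigr => i _; rewrite -sqrrN opprB.
Qed.

Lemma edistxx {R : realType} {N : nat} (x : N.-tuple R) : edist x x = 0.
Proof.
by rewrite /edist big1 ?sqrtr0// => i _; rewrite subrr expr0n.
Qed.

Lemma sum_sqr_triangle {R : realType} (I : finType) (a b : I -> R) :
  Num.sqrt (\sum_i (a i + b i) ^+ 2) <=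
  Num.sqrt (\sum_i a i ^+ 2) + Num.sqrt (\sum_i b i ^+ 2).
Proof.
set A := \sum_i a i ^+ 2; set B := \sum_i b i ^+ 2.
have A0 : 0 <= A by apply: sumr_ge0 => i _; exact: sqr_ge0.
have B0 : 0 <= B by apply: sumr_ge0 => i _; exact: sqr_ge0.
pose D := \sum_i a i * b i.
have CS : D ^+ 2 <= A * B.
  (* Lagrange's identity: the double sum is twice the defect in the Cauchy-Schwarz inequality. *)
  suff : 0 <= \sum_i \sum_j (a i * b j - a j * b i) ^+ 2.
    have -> : \sum_i \sum_j (a i * b j - a j * b i) ^+ 2 =
              A * B + B * A - 2 * D ^+ 2.
      rewrite expr2 /A /B /D !big_distrlr/= mulr_sumr -big_split/= -sumrB.
      apply: eq_bigr => i _; rewrite mulr_sumr -big_split/= -sumrB.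
      by apply: eq_bigr => j _; ring.
    by lra.
  by apply: sumr_ge0 => i _; apply: sumr_ge0 => j _; exact: sqr_ge0.
have DAB : D <= Num.sqrt A * Num.sqrt B.
  rewrite -sqrtrM// (le_trans (ler_norm _))// -sqrtr_sqr ler_sqrt//.
  exact: mulr_ge0.
rewrite -(@ler_pXn2r _ 2)// ?nnegrE ?addr_ge0 ?sqrtr_ge0//.
rewrite sqr_sqrtr; last by apply: sumr_ge0 => i _; exact: sqr_ge0.
rewrite sqrrD !sqr_sqrtr//.
rewrite (_ : \sum_i _ = A + D *+ 2 + B); first by rewrite lerD2r lerD2l lerMn2r.
rewrite /A /B /D -sumrMnl -!big_split/=.
by apply: eq_bigr => i _; rewrite sqrrD.
Qed.

Lemma edist_triangle {R : realType} {N : nat} (y x z : N.-tuple R) :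
  edist x z <= edist x y + edist y z.
Proof.
rewrite /edist.
rewrite (_ : \sum_(i < N) (tnth x i - tnth z i) ^+ 2 =
  \sum_(i < N) ((tnth x i - tnth y i) + (tnth y i - tnth z i)) ^+ 2).
  exact: sum_sqr_triangle.
by apply: eq_bigr => i _; rewrite subrKA.
Qed.

Lemma edist_tadd2r {R : realType} {N : nat} (x y h : N.-tuple R) :
  edist (tadd x h) (tadd y h) = edist x y.
Proof.
rewrite /edist; congr Num.sqrt; apply: eq_bigr => i _.
by rewrite !tnth_mktuple; congr (_ ^+ 2); ring.
Qed.

Notation enorm h := (edist h (origin _)).

Lemma edist_taddr {R : realType} {N : nat} (x h : N.-tuple R) :
  edist x (tadd x h) = enorm h.
Proof.
rewrite /edist; congr Num.sqrt; apply: eq_bigr => i _.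
by rewrite !tnth_mktuple -sqrrN; congr (_ ^+ 2); ring.
Qed.

Lemma enorm_topp {R : realType} {N : nat} (h : N.-tuple R) :
  enorm (topp h) = enorm h.
Proof.
rewrite /edist; congr Num.sqrt; apply: eq_bigr => i _.
by rewrite !tnth_mktuple -sqrrN; congr (_ ^+ 2); ring.
Qed.

Lemma edist_eq0 {R : realType} {N : nat} (x y : N.-tuple R) :
  edist x y = 0 -> x = y.
Proof.
move=> /eqP; rewrite sqrtr_eq0 => xy.
have : \sum_(i < N) (tnth x i - tnth y i) ^+ 2 == 0.
  by rewrite eq_le xy sumr_ge0// => i _; exact: sqr_ge0.
rewrite psumr_eq0; last by move=> i _; exact: sqr_ge0.
move=> /allP h; apply: eq_from_tnth => i.
have := h i; rewrite mem_index_enum => /(_ isT).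
by rewrite sqrf_eq0 subr_eq0 => /eqP.
Qed.

Lemma ler_coord_edist {R : realType} {N : nat} (x y : N.-tuple R) i :
  `|tnth x i - tnth y i| <= edist x y.
Proof.
rewrite /edist -sqrtr_sqr ler_sqrt.
  by rewrite (bigD1 i)//= lerDl sumr_ge0// => j _; exact: sqr_ge0.
by rewrite sumr_ge0// => j _; exact: sqr_ge0.
Qed.

Lemma edist_le_coord {R : realType} {N : nat} (x y : N.-tuple R) (e : R) :
  0 <= e -> (forall i, `|tnth x i - tnth y i| <= e) -> edist x y <= N%:R * e.
Proof.
move=> e0 xy; case: N x y xy => [x y _|N x y xy].
  by rewrite /edist big_ord0 sqrtr0 mul0r.
have Ne : 0 <= N.+1%:R * e :> R by rewrite mulr_ge0.
rewrite /edist -[leRHS]ger0_norm// -sqrtr_sqr.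
rewrite ler_sqrt ?sqr_ge0//.
apply: (@le_trans _ _ (\sum_(i < N.+1) e ^+ 2)).
  apply: ler_sum => i _; rewrite -real_normK ?num_real//.
  by rewrite ler_pXn2r ?nnegrE.
rewrite sumr_const card_ord -[leLHS]mulr_natl exprMn ler_wpM2r ?sqr_ge0//.
by rewrite expr2 ler_peMl// ler1n.
Qed.

Lemma measurable_edist {R : realType} {N : nat} d (T : measurableType d)
    (f g : T -> N.-tuple R) :
  measurable_fun setT f -> measurable_fun setT g ->
  measurable_fun setT (fun x => edist (f x) (g x)).
Proof.
move=> mf mg; rewrite /edist.
apply: (measurableT_comp (continuous_measurable_fun (@sqrt_continuous R))).
apply: measurable_sum => i.
apply: measurable_funX; apply: measurable_funB.
- exact: (measurableT_comp (@measurable_tnth _ _ _ i) mf).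
- exact: (measurableT_comp (@measurable_tnth _ _ _ i) mg).
Qed.

Lemma measurable_eball {R : realType} {N : nat} (x0 : N.-tuple R) r :
  measurable (eball x0 r).
Proof.
rewrite -[eball _ _]setTI.
rewrite (_ : eball _ _ = (fun x => edist x x0) @^-1` `]-oo, r[%classic).
  exact: measurable_edist.
by apply/seteqP; split => x; rewrite /= in_itv.
Qed.

(** * Volumes of balls and singular kernels *)

Section ge0_real_integrals.
Context d (T : measurableType d) {R : realType} (mu : {measure set T -> \bar R}).
Implicit Types f g : T -> R.

Lemma intR_le f g : measurable_fun setT f -> measurable_fun setT g ->
  (forall x, 0 <= f x) -> (forall x, f x <= g x) ->
  (\int[mu]_x (f x)%:E <= \int[mu]_x (g x)%:E)%E.
Proof.
move=> mf mg f0 fg; apply: ge0_le_integral => //=.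
- by move=> x _; rewrite lee_fin.
- exact/measurable_EFinP.
- exact/measurable_EFinP.
- by move=> x _; rewrite lee_fin.
Qed.

Lemma intRD f g : measurable_fun setT f -> measurable_fun setT g ->
  (forall x, 0 <= f x) -> (forall x, 0 <= g x) ->
  (\int[mu]_x (f x + g x)%:E = \int[mu]_x (f x)%:E + \int[mu]_x (g x)%:E)%E.
Proof.
move=> mf mg f0 g0; under eq_integral do rewrite EFinD.
rewrite ge0_integralD//.
- by move=> x _; rewrite lee_fin.
- exact/measurable_EFinP.
- by move=> x _; rewrite lee_fin.
- exact/measurable_EFinP.
Qed.

Lemma intRZ (c : R) f : measurable_fun setT f ->
  (forall x, 0 <= f x) -> 0 <= c ->
  (\int[mu]_x (c * f x)%:E = c%:E * \int[mu]_x (f x)%:E)%E.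
Proof.
move=> mf f0 c0; under eq_integral do rewrite EFinM.
rewrite ge0_integralZl_EFin//.
- by move=> x _; rewrite lee_fin.
- exact/measurable_EFinP.
Qed.

End ge0_real_integrals.

Section volumes.
Context {R : realType}.

Definition cube {N : nat} (x : N.-tuple R) (r : R) : set (N.-tuple R) :=
  [set y | forall i, `|tnth y i - tnth x i| < r].

Lemma cube_cons {N : nat} (x : N.+1.-tuple R) r :
  consP @^-1` cube x r =
  (`]thead x - r, thead x + r[%classic `*` cube [tuple of behead x] r).
Proof.
apply/seteqP; split => -[a y] /=.
  move=> h; split.
    by have := h ord0; rewrite /consP tnth0 in_itv/= ltr_distl.
  move=> i; have := h (lift ord0 i).
  by rewrite /consP tnthS/= [in X in X -> _](tuple_eta x) tnthS.
move=> [h0 h] i; case: (unliftP ord0 i) => [j ->|->].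
  by have := h j; rewrite /consP tnthS/= [in X in _ -> X](tuple_eta x) tnthS.
by rewrite /consP tnth0; move: h0; rewrite /= in_itv/= ltr_distl.
Qed.

Lemma measurable_cube {N : nat} (x : N.-tuple R) r : measurable (cube x r).
Proof.
rewrite (_ : cube x r = \bigcap_(i in [set: 'I_N])
  ((fun y => `|tnth y i - tnth x i|) @^-1` `]-oo, r[%classic)); last first.
  apply/seteqP; split => y /= h i; last by have := h i I; rewrite /= in_itv.
  by move=> _; rewrite /= in_itv/=.
apply: fin_bigcap_measurable; first exact: finite_finset.
move=> i _; rewrite -[X in measurable X]setTI.
suff mf : measurable_fun setT (fun y : N.-tuple R => `|tnth y i - tnth x i|).
  exact: mf.
apply: (measurableT_comp (@normr_measurable _ _)).
apply: measurable_funB => //; exact: measurable_tnth.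
Qed.

Lemma muN_cube {N : nat} (x : N.-tuple R) r : 0 <= r ->
  muN R N (cube x r) = ((2 * r) ^+ N)%:E.
Proof.
move=> r0; elim: N x => [|N IH] x.
  rewrite /= diracE mem_set ?expr0//.
  by case.
rewrite /= /stepN /pushforward cube_cons.
rewrite product_measure1E//; last exact: measurable_cube.
rewrite IH [X in (X * _)%E]lebesgue_measure_itv/= lte_fin ltrBlDr -addrA -mulr2n ltrDl.
case: ifPn => [_|].
  by rewrite -EFinD -EFinM exprS; congr (_ * _)%:E; ring.
rewrite -leNgt => r20; have -> : r = 0 by lra.
by rewrite mul0e mulr0 expr0n.
Qed.

Lemma muN_eball_le {N : nat} (x : N.-tuple R) r : 0 <= r ->
  (muN R N (eball x r) <= ((2 * r) ^+ N)%:E)%E.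
Proof.
move=> r0; rewrite -(muN_cube x) //; apply: le_measure; rewrite ?inE.
- exact: measurable_eball.
- exact: measurable_cube.
- by move=> y yx i; apply: le_lt_trans yx; exact: ler_coord_edist.
Qed.

(** The inscribed cube has half-side [r / (N + 1)], not [r / N]: this makes the comparison with the
    open ball strict and has a meaning in dimension 0. *)
Lemma muN_eball_ge {N : nat} (x : N.-tuple R) r : 0 < r ->
  (((2 * (r / N.+1%:R)) ^+ N)%:E <= muN R N (eball x r))%E.
Proof.
move=> r0; have r1 : 0 <= r / N.+1%:R by rewrite divr_ge0// ltW.
rewrite -(muN_cube x)//.
apply: le_measure; rewrite ?inE.
- exact: measurable_cube.
- exact: measurable_eball.
move=> y yx; apply: (@le_lt_trans _ _ (N%:R * (r / N.+1%:R))).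
  by apply: edist_le_coord => [|i]; [rewrite divr_ge0// ltW|exact/ltW/yx].
by rewrite mulrCA gtr_pMr// ltr_pdivrMr// mul1r ltr_nat.
Qed.

End volumes.

Lemma nneseries_geometric_le {R : realType} (C x : R) (f : nat -> \bar R) : 0 <= x < 1 -> 0 <= C ->
  (forall j, 0 <= f j <= (C * x ^+ j)%:E)%E -> (\sum_(j <oo) f j <= (C / (1 - x))%:E)%E.
Proof.
move=> /andP[x0 x1] C0 hf; apply: lime_le.
  by apply: is_cvg_nneseries => n _ _; case/andP: (hf n).
near=> n; apply: (@le_trans _ _ (\sum_(0 <= j < n) (C * x ^+ j)%:E)%E).
  by apply: lee_sum => j _; case/andP: (hf j).
rewrite sumEFin lee_fin -mulr_sumr; apply: ler_wpM2l => //.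
have -> : \sum_(0 <= j < n) x ^+ j = series (geometric 1 x) n.
  by rewrite /series /=; apply: eq_bigr => j _; rewrite mul1r.
rewrite geometric_seriesE ?lt_eqF//= mul1r ler_piMl ?invr_ge0 ?subr_ge0 ?(ltW x1)//.
by rewrite gerBl exprn_ge0.
Unshelve. all: by end_near. Qed.

Lemma half_pow_small {R : realType} (e : R) : 0 < e -> exists k0, forall k, (k0 <= k)%N -> (2^-1 : R) ^+ k < e.
Proof.
move=> e0; have : (2^-1 : R) ^+ n @[n --> \oo] --> (0 : R).
  by apply: cvg_expr; rewrite ger0_norm// invf_lt1// ltr1n.
move=> /cvgrPdist_lt /(_ e e0) [n _ hn]; exists n => k nk.
by have := hn k nk; rewrite /= sub0r normrN ger0_norm// exprn_ge0.
Qed.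

Lemma exprn_powR {R : realType} (x a : R) n : 0 <= x -> (x ^+ n) `^ a = (x `^ a) ^+ n.
Proof. by move=> x0; rewrite -powR_mulrn// powRAC powR_mulrn ?powR_ge0. Qed.

Lemma dyadic_bracket {R : realType} (t : R) : 0 < t < 1 ->
  exists j : nat, (2^-1 : R) ^+ j.+1 <= t < (2^-1 : R) ^+ j.
Proof.
move=> /andP[t0 t1].
have ex : exists n, (2^-1 : R) ^+ n <= t.
  by have [n hn] := half_pow_small t t0; exists n; exact: ltW (hn n (leqnn _)).
case: (ex_minnP ex) => -[|m] hm hmin.
  by move: hm; rewrite expr0 leNgt t1.
exists m; rewrite hm/= ltNge; apply/negP => /hmin; by rewrite ltnn.
Qed.

(* Behaves like |k|^(a-b-N) at the origin and like |k|^(-b-N) at infinity, hence is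
   integrable for [0 < b < a]. *)
Definition kern {R : realType} {N : nat} (a b : R) (k : N.-tuple R) : R :=
  Num.min 1 (enorm k `^ a) / enorm k `^ (N%:R + b).

Lemma kern_ge0 {R : realType} {N : nat} (a b : R) (k : N.-tuple R) :
  0 <= kern a b k.
Proof. by rewrite /kern divr_ge0 ?powR_ge0// le_min ler01 powR_ge0. Qed.

Lemma measurable_powRV {R : realType} (c : R) :
  measurable_fun setT (fun x : R => (x `^ c)^-1).
Proof.
rewrite (_ : (fun x => _) = (fun x : R => x `^ (- c))); first exact: measurable_powR.
by apply/funext => x; rewrite powRN.
Qed.

Lemma measurable_indic_comp {R : realType} {d d'} (T : measurableType d)
    (U : measurableType d') (A : set U) (f : T -> U) :
  measurable A -> measurable_fun setT f ->
  measurable_fun setT (fun x => \1_A (f x) : R).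
Proof. by move=> mA; apply: measurableT_comp; exact: measurable_indic. Qed.

Lemma measurable_EFin_comp {R : realType} {d} (T : measurableType d) (f : T -> R) :
  measurable_fun setT f -> measurable_fun setT (fun x => (f x)%:E).
Proof. by move=> mf; exact/measurable_EFinP. Qed.

Lemma measurable_pair_comp {d d1 d2} (T : measurableType d) (T1 : measurableType d1)
    (T2 : measurableType d2) (f : T -> T1) (g : T -> T2) :
  measurable_fun setT f -> measurable_fun setT g ->
  measurable_fun setT (fun x => (f x, g x)).
Proof. by move=> mf mg; apply/measurable_fun_pairP; split. Qed.

Ltac msr1 := lazymatch goal with
  | |- measurable_fun _ (fun=> ?c) => exact: measurable_cst
  | |- measurable_fun _ (fun x => @?f x - @?g x) => apply: (@measurable_funB _ _ _ _ f g)
  | |- measurable_fun _ (fun x => @?f x + @?g x) => apply: (@measurable_funD _ _ _ _ f g)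
  | |- measurable_fun _ (fun x => @?f x * @?g x) => apply: (@measurable_funM _ _ _ _ f g)
  | |- measurable_fun _ (fun x => - @?f x) => apply: (measurableT_comp (@oppr_measurable _ _))
  | |- measurable_fun _ (fun x => ((@?f x) `^ _)^-1) =>
      apply: (measurableT_comp (measurable_powRV _))
  | |- measurable_fun _ (fun x => `|@?f x|) =>
      apply: (measurableT_comp (@normr_measurable _ _))
  | |- measurable_fun _ (fun x => Num.min (@?f x) (@?g x)) => apply: (@measurable_minr _ _ _ _ f g)
  | |- measurable_fun _ (fun x => Num.max (@?f x) (@?g x)) => apply: (@measurable_maxr _ _ _ _ f g)
  | |- measurable_fun _ (fun x => (@?f x) ^+ _) => apply: (@measurable_funX _ _ _ _ f)
  | |- measurable_fun _ (fun x => (@?f x) `^ _) => apply: (measurableT_comp (measurable_powR _))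
  | |- measurable_fun _ (fun x => indic ?A (@?f x)) => apply: (measurable_indic_comp _ _ A f)
  | |- measurable_fun _ (fun x => edist (@?f x) (@?g x)) => apply: (measurable_edist _ _ f g)
  | |- measurable_fun _ (fun x => tadd (@?f x) (@?g x)) => apply: (measurable_tadd2 _ _ f g)
  | |- measurable_fun _ (fun x => EFin (@?f x)) => apply: (measurable_EFin_comp _ f)
  | |- measurable_fun _ (indic _) => apply: measurable_indic
  | |- measurable_fun _ (fun x => (@?f x, @?g x)) => apply: (measurable_pair_comp _ _ _ f g)
  | |- measurable_fun _ (fun x => (@?f x).1) => apply: (measurableT_comp measurable_fst)
  | |- measurable_fun _ (fun x => (@?f x).2) => apply: (measurableT_comp measurable_snd)
  | |- measurable_fun _ (fun x => x) => exact: measurable_id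
  | |- measurable_fun _ fst => exact: measurable_fst
  | |- measurable_fun _ snd => exact: measurable_snd
  | |- measurable_fun _ _ => idtac
  | |- measurable (eball _ _) => exact: measurable_eball
  | |- measurable (~` _) => apply: measurableC
  end.
Ltac msr := repeat first [
  match goal with
  | H : measurable_fun _ ?f |- measurable_fun _ ?f => exact: H
  | H : measurable ?A |- measurable ?A => exact: H
  end | progress msr1 |
  match goal with
  | H : measurable_fun _ ?u |- measurable_fun _ (fun x => ?u (@?f x)) =>
      apply: (measurableT_comp H)
  end].

Lemma measurable_kern {R : realType} {N : nat} (a b : R) :
  measurable_fun setT (@kern R N a b).
Proof.
rewrite /kern; msr.
Qed.

(** * Integrability of the singular kernel *)

Section kernel_integral.
Context {R : realType} {N : nat} (a b : R).
Hypotheses (b0 : 0 < b) (ba : b < a).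

Let h : R := 2^-1.

Let h0 : 0 < h. Proof. by rewrite /h; lra. Qed.

(** Upper bounds for [kern] on the dyadic annuli inside and outside the unit ball. Enlarging each
    annulus to the ball containing it still leaves geometric series, of ratio [h ^ (a - b)] inside
    and [h ^ b] outside, which is where [0 < b < a] enters. *)
Let cin (j : nat) : R := (h ^+ j) `^ a / (h ^+ j.+1) `^ (N%:R + b).
Let cout (j : nat) : R := ((2 ^+ j) `^ (N%:R + b))^-1.
Let rout (j : nat) : R := 2 ^+ j.+1.

Let cin0 j : 0 <= cin j. Proof. by rewrite /cin divr_ge0 ?powR_ge0. Qed.
Let cout0 j : 0 <= cout j. Proof. by rewrite /cout invr_ge0 powR_ge0. Qed.

Let powRNb (x : R) : 0 < x -> x `^ (N%:R + b) = x ^+ N * x `^ b.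
Proof.
move=> x0; rewrite powRD; last by rewrite (gt_eqF x0) implybT.
by rewrite powR_mulrn// ltW.
Qed.

(** A single term, that of the annulus containing [k], already bounds [kern]; at the origin the
    kernel is 0 because [a > 0]. *)
Let kern_le (k : N.-tuple R) :
  ((kern a b k)%:E <= \sum_(j <oo) (cin j * \1_(eball (origin N) (h ^+ j)) k)%:E
     + \sum_(j <oo) (cout j * \1_(eball (origin N) (rout j)) k)%:E)%E.
Proof.
have S0 : (0 <= \sum_(j <oo) (cin j * \1_(eball (origin N) (h ^+ j)) k)%:E)%E.
  by apply: nneseries_ge0 => j _ _; rewrite lee_fin mulr_ge0.
have S1 : (0 <= \sum_(j <oo) (cout j * \1_(eball (origin N) (rout j)) k)%:E)%E.
  by apply: nneseries_ge0 => j _ _; rewrite lee_fin mulr_ge0.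
have Nb : 0 <= N%:R + b :> R by rewrite addr_ge0// ltW.
have [k0|k0] := eqVneq (enorm k) 0.
  rewrite /kern k0 powR0 ?gt_eqF//; last by rewrite (lt_trans b0 ba).
  by rewrite min_r// mul0r adde_ge0.
have kp : 0 < enorm k by rewrite lt_neqAle eq_sym k0 edist_ge0.
have [k1|k1] := ltP (enorm k) 1.
  have [j /andP[j1 j2]] := @dyadic_bracket R (enorm k) (introT andP (conj kp k1)).
  rewrite -[leLHS]adde0; apply: leeD => //.
  apply: le_trans; last first.
    apply: (nneseries_lim_ge (P := xpredT) (m := 0) j.+1) => i _ _.
    by rewrite lee_fin mulr_ge0.
  rewrite big_nat_recr//= -[leLHS]add0e; apply: leeD.
    by apply: sume_ge0 => i _; rewrite lee_fin mulr_ge0.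
  rewrite lee_fin indicE mem_set ?mulr1//.
  rewrite /kern /cin; apply: ler_pM => //.
  - by rewrite le_min ler01 powR_ge0.
  - by rewrite invr_ge0 powR_ge0.
  - apply: (@le_trans _ _ (enorm k `^ a)); first by rewrite ge_min lexx orbT.
    rewrite ge0_ler_powR ?nnegrE ?exprn_ge0// ?ltW//.
    by rewrite (lt_trans b0 ba).
  - rewrite lef_pV2 ?posrE ?powR_gt0 ?exprn_gt0//.
    by rewrite ge0_ler_powR ?nnegrE ?exprn_ge0// ltW.
have [j /andP[j1 j2]] : exists j : nat, 2 ^+ j <= enorm k < 2 ^+ j.+1.
  have [->|k1'] := eqVneq (enorm k) 1.
    by exists 0%N; rewrite expr0 lexx expr1; lra.
  have kk : 1 < enorm k by rewrite lt_neqAle eq_sym k1'.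
  have : 0 < (enorm k)^-1 < 1 by rewrite invr_gt0 kp invf_lt1.
  move=> /dyadic_bracket[j]; rewrite !exprVn => /andP[j1 j2].
  have [e|e] := eqVneq (enorm k) (2 ^+ j.+1).
    exists j.+1; rewrite e lexx/=.
    by rewrite [ltRHS]exprS ltr_pMl ?exprn_gt0//; lra.
  exists j; apply/andP; split.
    by rewrite -lef_pV2 ?posrE ?exprn_gt0// ltW.
  rewrite lt_neqAle e/= -lef_pV2 ?posrE ?exprn_gt0//.
rewrite -[leLHS]add0e; apply: leeD => //.
apply: le_trans; last first.
  apply: (nneseries_lim_ge (P := xpredT) (m := 0) j.+1) => i _ _.
  by rewrite lee_fin mulr_ge0.
rewrite big_nat_recr//= -[leLHS]add0e; apply: leeD.
  by apply: sume_ge0 => i _; rewrite lee_fin mulr_ge0.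
rewrite lee_fin indicE mem_set ?mulr1//.
rewrite /kern /cout -[leRHS]mul1r; apply: ler_pM => //.
- by rewrite le_min ler01 powR_ge0.
- by rewrite invr_ge0 powR_ge0.
- rewrite lef_pV2 ?posrE ?powR_gt0 ?exprn_gt0//.
  by rewrite ge0_ler_powR ?nnegrE ?exprn_ge0// ltW.
Qed.

Lemma integral_kern_lty : (\int[muN R N]_k (kern a b k)%:E < +oo)%E.
Proof.
have hc (c : R) : 0 < c -> 0 <= h `^ c < 1.
  move=> c0; rewrite powR_ge0/=.
  have <- : 1 `^ c = 1 :> R by rewrite powR1.
  by rewrite gt0_ltr_powR ?nnegrE ?(ltW h0)//; rewrite /h; lra.
have mS (c : nat -> R) (r : nat -> R) : (forall j, 0 <= c j) ->
    measurable_fun setT (fun k : N.-tuple R =>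
      \sum_(j <oo) (c j * \1_(eball (origin N) (r j)) k)%:E)%E.
  move=> c0; apply: (ge0_emeasurable_sum (P := xpredT)) => j.
    by move=> x _ _; rewrite lee_fin mulr_ge0.
  by move=> _; msr.
have S0 (c : nat -> R) (r : nat -> R) k : (forall j, 0 <= c j) ->
    (0 <= \sum_(j <oo) (c j * \1_(eball (origin N) (r j)) k)%:E)%E.
  by move=> c0; apply: nneseries_ge0 => j _ _; rewrite lee_fin mulr_ge0.
have fin (c r : nat -> R) (C x : R) : (forall j, 0 <= c j) ->
    (forall j, 0 <= r j) -> 0 <= x < 1 -> 0 <= C ->
    (forall j, c j * (2 * r j) ^+ N <= C * x ^+ j) ->
    (\int[muN R N]_k \sum_(j <oo) (c j * \1_(eball (origin N) (r j)) k)%:E < +oo)%E.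
  move=> c0 r0 x01 C0 hC.
  rewrite integral_nneseries//; last 2 first.
    by move=> j; msr.
    by move=> j k _; rewrite lee_fin mulr_ge0.
  apply: le_lt_trans; last first.
    apply: (le_lt_trans (nneseries_geometric_le C x (fun j => (c j * (2 * r j) ^+ N)%:E) x01 C0 _) (ltry _)) => j.
    by rewrite !lee_fin hC andbT mulr_ge0// exprn_ge0// mulr_ge0.
  apply: lee_nneseries => [j _ _|j _].
    by apply: integral_ge0 => k _; rewrite lee_fin mulr_ge0.
  rewrite intRZ//; last by msr.
  rewrite integral_indic//; last exact: measurable_eball.
  by rewrite setIT EFinM lee_wpmul2l ?lee_fin// muN_eball_le.
apply: (@le_lt_trans _ _ (\int[muN R N]_k
   (\sum_(j <oo) (cin j * \1_(eball (origin N) (h ^+ j)) k)%:E +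
    \sum_(j <oo) (cout j * \1_(eball (origin N) (rout j)) k)%:E))%E).
  apply: ge0_le_integral => //.
  - by move=> k _; rewrite lee_fin kern_ge0.
  - by apply: measurable_EFin_comp; exact: measurable_kern.
  - by apply: emeasurable_funD; exact: mS.
rewrite ge0_integralD//; [|by move=> *; exact: S0|exact: mS|by move=> *; exact: S0|exact: mS].
apply: lte_add_pinfty.
  apply: (fin _ _ (2 ^+ N * (h `^ (N%:R + b))^-1) (h `^ (a - b))) => //.
  - by move=> j; rewrite exprn_ge0// ltW.
  - by apply: hc; rewrite subr_gt0.
  - by rewrite mulr_ge0 ?exprn_ge0 ?invr_ge0 ?powR_ge0.
  - move=> j; rewrite /cin exprS powRM ?exprn_ge0 ?(ltW h0)// (powRNb (h ^+ j)) ?exprn_gt0//.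
    rewrite -exprn_powR ?(ltW h0)// powRB ?(gt_eqF (exprn_gt0 _ h0)) ?implybT// exprMn.
    have H1 : h `^ (N%:R + b) != 0 by rewrite gt_eqF// powR_gt0.
    have H2 : (h ^+ j) `^ b != 0 by rewrite gt_eqF// powR_gt0// exprn_gt0.
    have H3 : (h ^+ j) ^+ N != 0 by rewrite gt_eqF// !exprn_gt0.
    rewrite le_eqVlt; apply/orP; left; apply/eqP; field.
    by rewrite H1 H2 H3.
apply: (fin _ _ (4 ^+ N) (h `^ b)) => //.
- by move=> j; rewrite exprn_ge0.
- exact: hc.
- move=> j; rewrite /cout /rout exprS powRNb ?exprn_gt0//.
  rewrite -(exprn_powR h b j (ltW h0)) /h exprVn.
  have -> : ((2 ^+ j)^-1) `^ b = ((2 ^+ j) `^ b)^-1 :> R.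
    by rewrite -powR_inv1 ?exprn_ge0// -powRrM mulN1r powRN.
  have H2 : (2 ^+ j : R) `^ b != 0 by rewrite gt_eqF// powR_gt0// exprn_gt0.
  have H3 : (2 ^+ j : R) ^+ N != 0 by rewrite gt_eqF// !exprn_gt0.
  rewrite mulrA exprMn (_ : 2 * 2 = 4); last by ring.
  rewrite le_eqVlt; apply/orP; left; apply/eqP; field.
  by rewrite H2 H3.
Qed.

End kernel_integral.

(** * Pointwise inequalities for powers *)

Section powers.
Context {R : realType}.
Implicit Types (a b r x y X Y : R).

(* [Jp (p - 2)] is the nonlinearity of the p-Laplacian. *)
Definition Jp r a : R := `|a| `^ r * a.

Lemma ler_powR2 r x y : 0 <= r -> 0 <= x -> x <= y -> x `^ r <= y `^ r.
Proof.
by move=> r0 x0 xy; rewrite ge0_ler_powR ?nnegrE// (le_trans x0 xy).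
Qed.

Lemma powRD_ge0 x r s : 0 <= x -> 0 <= r -> 0 <= s -> x `^ (r + s) = x `^ r * x `^ s.
Proof.
move=> x0 r0 s0; have [rs|rs] := eqVneq (r + s) 0.
  have r00 : r = 0 by lra.
  have s00 : s = 0 by lra.
  by rewrite r00 s00 addr0 powRr0 mulr1.
have [->|xn0] := eqVneq x 0; last by rewrite powRD// xn0 implybT.
rewrite powR0//; have [r00|r00] := eqVneq r 0; last by rewrite powR0 ?mul0r.
by rewrite r00 add0r in rs; rewrite (powR0 rs) mulr0.
Qed.

Lemma normJp r a : 0 <= r -> `|Jp r a| = `|a| `^ (r + 1).
Proof.
move=> r0; rewrite /Jp normrM (ger0_norm (powR_ge0 _ _)) powRD_ge0//.
by rewrite powRr1.
Qed.

Lemma powR_le_add x y z r : 0 <= r -> 0 <= z -> 0 <= x -> 0 <= y -> z <= x + y ->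
  z `^ r <= 2 `^ r * (x `^ r + y `^ r).
Proof.
move=> r0 z0; wlog xy : x y / y <= x.
  move=> H x0 y0 zxy; have [/H|/ltW /H] := leP y x; first exact.
  by rewrite addrC [X in _ * X]addrC; apply.
move=> x0 y0 zxy; apply: (@le_trans _ _ ((2 * x) `^ r)).
  by apply: ler_powR2 => //; lra.
by rewrite powRM// ler_wpM2l ?powR_ge0// lerDl powR_ge0.
Qed.

(** Young's inequality without weights: both bases are replaced by the larger one. *)
Lemma powR_young x y r s : 0 <= x -> 0 <= y -> 0 <= r -> 0 <= s ->
  x `^ r * y `^ s <= x `^ (r + s) + y `^ (r + s).
Proof.
move=> x0 y0 r0 s0; rewrite !powRD_ge0//; have [xy|/ltW yx] := leP x y.
  apply: (@le_trans _ _ (y `^ r * y `^ s)); last by rewrite lerDr mulr_ge0 ?powR_ge0.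
  by rewrite ler_wpM2r ?powR_ge0// ler_powR2.
apply: (@le_trans _ _ (x `^ r * x `^ s)); last by rewrite lerDl mulr_ge0 ?powR_ge0.
by rewrite ler_wpM2l ?powR_ge0// ler_powR2.
Qed.

Lemma powR_le1D x r s : 0 <= x -> 0 <= r <= s -> x `^ r <= 1 + x `^ s.
Proof.
move=> x0 /andP[r0 rs]; have := powR_young x 1 r (s - r) x0 ler01 r0.
by rewrite subr_ge0 !powR1 mulr1 subrKC => /(_ rs) h; lra.
Qed.

(** The two sides differ by half of [(|a| ^ r - |b| ^ r) (a ^ 2 - b ^ 2)], whose factors never have
    opposite signs. *)
Lemma Jp_monotone r a b : 0 <= r ->
  2^-1 * ((`|a| `^ r + `|b| `^ r) * (a - b) ^+ 2) <= (Jp r a - Jp r b) * (a - b).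
Proof.
move=> r0; rewrite /Jp; set A := `|a| `^ r; set B := `|b| `^ r.
have : 0 <= (A - B) * (`|a| ^+ 2 - `|b| ^+ 2).
  have [ab|/ltW ba] := leP `|a| `|b|.
    rewrite mulr_le0// subr_le0; first exact: ler_powR2.
    by rewrite ler_pXn2r ?nnegrE.
  rewrite mulr_ge0// subr_ge0; first exact: ler_powR2.
  by rewrite ler_pXn2r ?nnegrE.
rewrite !real_normK ?num_real// => h.
rewrite -subr_ge0 (_ : _ - _ = 2^-1 * ((A - B) * (a ^+ 2 - b ^+ 2))).
  by rewrite mulr_ge0.
by field.
Qed.

Lemma expr_bernoulli (n : nat) x : 0 <= x <= 1 -> 1 - x ^+ n <= n%:R * (1 - x).
Proof.
move=> /andP[x0 x1]; elim: n => [|n IH]; first by rewrite expr0 mul0r subrr.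
rewrite exprS -natr1 mulrDl mul1r.
have : x * (1 - x ^+ n) <= 1 - x ^+ n.
  by rewrite ler_piMl// subr_ge0 exprn_ile1.
lra.
Qed.

(* Bernoulli's inequality is available for natural exponents only, so the real
   exponent [r + 1] is rounded up. *)
Definition lipc r : R := (Num.bound (r + 1))%:R.

Lemma lipc_gt r : 0 <= r -> r + 1 <= lipc r.
Proof. by move=> r0; apply/ltW/archi_boundP; lra. Qed.

(** For opposite signs [|a - b|] is [|a| + |b|] and the triangle inequality is enough. For equal
    signs homogeneity reduces to [b = t a] with [0 < t <= 1], where Bernoulli's inequality bounds
    [1 - t ^ (r + 1)] by a multiple of [1 - t]. *)
Lemma Jp_lip r a b : 0 <= r ->
  `|Jp r a - Jp r b| <= lipc r * ((`|a| `^ r + `|b| `^ r) * `|a - b|).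
Proof.
move=> r0; have Lr := lipc_gt r r0.
wlog ab : a b / `|b| <= `|a|.
  move=> H; have [/H//|/ltW/H] := leP `|b| `|a|.
  by rewrite distrC (distrC b) (addrC (`|b| `^ r)).
have A0 := powR_ge0 `|a| r; have B0 := powR_ge0 `|b| r.
have d0 := normr_ge0 (a - b).
have [sg|sg] := leP (a * b) 0.
  have -> : `|a - b| = `|a| + `|b|.
    move: sg; rewrite le_eqVlt mulf_eq0 => /orP[/orP[]/eqP->|sg].
    - by rewrite sub0r normrN normr0 add0r.
    - by rewrite subr0 normr0 addr0.
    case: (lerP 0 a) => a0; case: (lerP 0 b) => b0.
    - by have := mulr_ge0 a0 b0; lra.
    - by rewrite (ger0_norm a0) (ltr0_norm b0) ger0_norm; lra.
    - by rewrite (ltr0_norm a0) (ger0_norm b0) ler0_norm; lra.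
    - by move: sg; rewrite nmulr_rlt0// ltNge (ltW b0).
  apply: (@le_trans _ _ ((`|a| `^ r + `|b| `^ r) * (`|a| + `|b|))).
    rewrite (le_trans (ler_normB _ _))// /Jp !normrM !(ger0_norm (powR_ge0 _ _)).
    by have := normr_ge0 a; have := normr_ge0 b; nra.
  by rewrite ler_peMl//; lra.
have a0 : a != 0 by apply/eqP => a0; rewrite a0 mul0r ltxx in sg.
pose t := b / a.
have bta : b = t * a by rewrite /t divfK.
have t0 : 0 < t.
  have -> : t = a * b / a ^+ 2 by rewrite /t; field.
  by rewrite divr_gt0// exprn_even_gt0.
have t1 : t <= 1.
  by move: ab; rewrite bta normrM gtr0_norm// ger_pMl// normr_gt0.
have -> : Jp r a - Jp r b = Jp r a * (1 - t `^ (r + 1)).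
  rewrite /Jp bta normrM gtr0_norm// powRM ?(ltW t0)// powRD_ge0 ?(ltW t0)// powRr1 ?(ltW t0)//.
  by ring.
rewrite normrM (_ : `|Jp r a| = `|a| `^ r * `|a|); last first.
  by rewrite /Jp normrM (ger0_norm A0).
have -> : `|a - b| = `|a| * (1 - t).
  rewrite bta (_ : a - t * a = a * (1 - t)); last by ring.
  by rewrite normrM (ger0_norm (x := 1 - t)) ?subr_ge0.
have tr1 : t `^ (r + 1) <= 1.
  rewrite -[leRHS](_ : 1 `^ (r + 1) = 1); last by rewrite powR1.
  by apply: ler_powR2 => //; [lra|exact: ltW].
rewrite (ger0_norm (x := 1 - _)) ?subr_ge0//.
have tb : 1 - t `^ (r + 1) <= lipc r * (1 - t).
  apply: (@le_trans _ _ (1 - t ^+ Num.bound (r + 1))).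
    rewrite lerD2l lerN2 -(powR_mulrn _ (ltW t0)).
    by apply: ger_powR => //; rewrite t0.
  by apply: expr_bernoulli; rewrite t1 ltW.
apply: (@le_trans _ _ (`|a| `^ r * `|a| * (lipc r * (1 - t)))).
  by rewrite ler_wpM2l// mulr_ge0.
have -> : lipc r * ((`|a| `^ r + `|b| `^ r) * (`|a| * (1 - t))) =
  `|a| `^ r * `|a| * (lipc r * (1 - t)) + `|b| `^ r * (`|a| * (lipc r * (1 - t))) by ring.
rewrite lerDl mulr_ge0// mulr_ge0// mulr_ge0 ?subr_ge0//; lra.
Qed.

(* [a] and [b] stand for the increments of [v] at the shifted and the unshifted
   pair of points, [wx] and [wy] for the values of the difference [diff v h], and
   [X], [Y] for those of the cutoff. *)
Lemma caccioppoli_pointwise r r' a b wx wy X Y :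
  0 <= r -> 0 <= r' -> 0 <= X <= 1 -> 0 <= Y <= 1 -> a - b = wx - wy ->
  (16 * 2 `^ (r + r'))^-1 * (`|wx - wy| `^ (r + r' + 2) * (X ^+ 2 + Y ^+ 2))
  - 16 * lipc r ^+ 2 * ((`|a| `^ r + `|b| `^ r) *
      (`|wx| `^ (r' + 2) + `|wy| `^ (r' + 2)) * (X - Y) ^+ 2)
  <= (Jp r a - Jp r b) * (Jp r' wx * X ^+ 2 - Jp r' wy * Y ^+ 2).
Proof.
move=> r0 r'0 /andP[X0 X1] /andP[Y0 Y1] abw.
set S := `|a| `^ r + `|b| `^ r.
set T := `|wx| `^ r' + `|wy| `^ r'.
set D := Jp r a - Jp r b.
set jx := Jp r' wx; set jy := Jp r' wy.
set L := lipc r.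
have L1 : 1 <= L by have := lipc_gt r r0; rewrite -/L; lra.
set dl := wx - wy.
have S0 : 0 <= S by rewrite addr_ge0 ?powR_ge0.
have T0 : 0 <= T by rewrite addr_ge0 ?powR_ge0.
have Dle : `|D| <= L * (S * `|dl|) by rewrite /dl -abw; exact: Jp_lip.
have Dm : 2^-1 * (S * dl ^+ 2) <= D * dl by rewrite /dl -abw; exact: Jp_monotone.
have Em : 2^-1 * (T * dl ^+ 2) <= (jx - jy) * dl by exact: Jp_monotone.
(* Both differences are monotone in [dl], so the two lower bounds multiply; dividing by [dl ^ 2]
   gives the good term. *)
have DE : 4^-1 * (S * T * dl ^+ 2) <= D * (jx - jy).
  have [d0|d0] := eqVneq dl 0.
    have -> : D = 0 by apply/eqP; rewrite -normr_le0 (le_trans Dle)// d0 normr0 !mulr0.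
    by rewrite d0 expr0n/= !mulr0 mul0r.
  have d2 : 0 < dl ^+ 2 by rewrite exprn_even_gt0.
  rewrite -(ler_pM2r d2).
  have := @ler_pM _ _ _ _ _ (_ : 0 <= 2^-1 * (S * dl ^+ 2)) (_ : 0 <= 2^-1 * (T * dl ^+ 2)) Dm Em.
  rewrite (_ : D * (jx - jy) * dl ^+ 2 = D * dl * ((jx - jy) * dl)); last by ring.
  rewrite (_ : 4^-1 * _ * _ = 2^-1 * (S * dl ^+ 2) * (2^-1 * (T * dl ^+ 2))); last by field.
  by apply; apply: mulr_ge0 => //; apply: mulr_ge0 => //; exact/ltW.
set W := `|wx| + `|wy|.
have W0 : 0 <= W by rewrite addr_ge0.
have jT : `|jx + jy| <= T * W.
  rewrite (le_trans (ler_normD _ _))// /jx /jy /Jp !normrM !(ger0_norm (powR_ge0 _ _)).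
  rewrite /T /W; have := powR_ge0 `|wx| r'; have := powR_ge0 `|wy| r'.
  by have := normr_ge0 wx; have := normr_ge0 wy; nra.
(* Young's inequality, from the square of [|dl| (X + Y) / 4 - 2 L W |X - Y|]. The resulting weight
   1/32 leaves at least half of the good term once [XY] is used. *)
have bad : - (S * T * (32^-1 * (dl ^+ 2 * (X + Y) ^+ 2) + 2 * L ^+ 2 * (W ^+ 2 * (X - Y) ^+ 2)))
    <= 2^-1 * (D * (jx + jy) * (X ^+ 2 - Y ^+ 2)).
  apply: (@le_trans _ _ (- (2^-1 * (L * (S * `|dl|) * (T * W) * (`|X - Y| * (X + Y)))))).
    rewrite lerN2.
    have : 0 <= (4^-1 * (`|dl| * (X + Y)) - 2 * L * (W * `|X - Y|)) ^+ 2 by exact: sqr_ge0.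
    have ST : 0 <= S * T by rewrite mulr_ge0.
    move=> /(mulr_ge0 ST).
    rewrite -(real_normK (num_real dl)) -(real_normK (num_real (X - Y))).
    lra.
  rewrite lerNl -mulrN ler_wpM2l ?invr_ge0// -normrN.
  rewrite (le_trans (ler_norm _))// !(normrN, normrM).
  rewrite subr_sqr normrM (ger0_norm (x := X + Y)) ?addr_ge0//.
  rewrite ler_wpM2r ?mulr_ge0 ?addr_ge0// ler_pM//.
have XY : (X + Y) ^+ 2 <= 2 * (X ^+ 2 + Y ^+ 2).
  by have := sqr_ge0 (X - Y); lra.
have main : 16^-1 * (S * T * dl ^+ 2 * (X ^+ 2 + Y ^+ 2)) -
    2 * L ^+ 2 * (S * (T * W ^+ 2) * (X - Y) ^+ 2) <=
    D * (jx * X ^+ 2 - jy * Y ^+ 2).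
  (* Symmetric and antisymmetric parts: the first carries the sign, the second has the factor
     [X ^ 2 - Y ^ 2], which is small where the cutoff varies little. *)
  rewrite (_ : D * (jx * X ^+ 2 - jy * Y ^+ 2) =
    2^-1 * (D * (jx - jy) * (X ^+ 2 + Y ^+ 2)) + 2^-1 * (D * (jx + jy) * (X ^+ 2 - Y ^+ 2))); last by field.
  have XY0 : 0 <= X ^+ 2 + Y ^+ 2 by rewrite addr_ge0 ?sqr_ge0.
  have STd : 0 <= S * T * dl ^+ 2 by rewrite mulr_ge0 ?sqr_ge0// mulr_ge0.
  have h1 := ler_wpM2r XY0 DE.
  have h2 := ler_wpM2l STd XY.
  lra.
apply: le_trans main; apply: lerB.
  rewrite invfM -[leLHS]mulrA; apply: ler_wpM2l; first by rewrite invr_ge0.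
  rewrite ler_pdivrMl ?powR_gt0//.
  rewrite mulrA ler_wpM2r ?addr_ge0 ?sqr_ge0//.
  rewrite powRD_ge0 ?addr_ge0// powR_mulrn// real_normK ?num_real//.
  rewrite [leRHS]mulrA ler_wpM2r ?sqr_ge0// powRD_ge0// powRD_ge0//.
  rewrite [leRHS](_ : _ = (2 `^ r * S) * (2 `^ r' * T)); last by ring.
  apply: ler_pM; rewrite ?powR_ge0//.
    rewrite /dl -abw; apply: powR_le_add => //; exact: ler_normB.
  by apply: powR_le_add => //; exact: ler_normB.
rewrite [leRHS](_ : _ = 2 * L ^+ 2 *
  (S * (8 * (`|wx| `^ (r' + 2) + `|wy| `^ (r' + 2))) * (X - Y) ^+ 2)); last by ring.
apply: ler_wpM2l; first by rewrite mulr_ge0 ?sqr_ge0.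
apply: ler_wpM2r; first exact: sqr_ge0.
apply: ler_wpM2l => //.
(* What remains is an inequality in [|wx|] and [|wy|] alone, symmetric in the two, so one may assume
   [|wy| <= |wx|]. *)
rewrite /T /W; move: r'0; clear => r'0.
have := normr_ge0 wy; have := normr_ge0 wx; move: `|wx| `|wy| => x y.
wlog xy : x y / y <= x.
  move=> H x0 y0; have [/H|/ltW /H] := leP y x; first exact.
  by rewrite (addrC y) (addrC (y `^ r')) (addrC (y `^ (r' + 2))); apply.
move=> x0 y0; apply: (@le_trans _ _ (8 * x `^ (r' + 2))); last first.
  by rewrite ler_pM2l// lerDl powR_ge0.
rewrite powRD_ge0// powR_mulrn//.
have h1 : y `^ r' <= x `^ r' by exact: ler_powR2.
have h2 : (x + y) ^+ 2 <= 4 * x ^+ 2.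
  by rewrite (_ : 4 * x ^+ 2 = (x + x) ^+ 2) ?ler_pXn2r ?nnegrE ?addr_ge0 ?lerD2l//; ring.
rewrite (_ : 8 * _ = 2 * x `^ r' * (4 * x ^+ 2)); last by ring.
apply: ler_pM => //; rewrite ?addr_ge0 ?powR_ge0 ?sqr_ge0//; lra.
Qed.

(** The splitting of [caccioppoli_pointwise] with a bounded [D]. The symmetric part is nonnegative
    because [D] and [Jp r' wx - Jp r' wy] do not have opposite signs; the antisymmetric part keeps
    one factor [|X - Y|], enough against a kernel of order [s1 < 1]. *)
Lemma sign_pointwise r' D wx wy X Y : 0 <= r' -> 0 <= X <= 1 -> 0 <= Y <= 1 ->
  `|D| <= 2 -> 0 <= D * (wx - wy) -> (wx = wy -> D * (Jp r' wx - Jp r' wy) = 0) ->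
  - (2 * ((`|wx| `^ (r' + 1) + `|wy| `^ (r' + 1)) * `|X - Y|))
  <= D * (Jp r' wx * X ^+ 2 - Jp r' wy * Y ^+ 2).
Proof.
move=> r'0 /andP[X0 X1] /andP[Y0 Y1] D2 Dd Dd0.
set jx := Jp r' wx in Dd0 *; set jy := Jp r' wy in Dd0 *.
have good : 0 <= D * (jx - jy).
  have [d0|d0] := eqVneq wx wy; first by rewrite Dd0.
  have d2 : 0 < (wx - wy) ^+ 2 by rewrite exprn_even_gt0//= subr_eq0.
  rewrite -(pmulr_lge0 _ d2).
  rewrite (_ : _ * _ = (D * (wx - wy)) * ((jx - jy) * (wx - wy))); last by ring.
  rewrite mulr_ge0// (le_trans _ (Jp_monotone _ _ _ r'0))// mulr_ge0 ?invr_ge0//.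
  by rewrite mulr_ge0 ?sqr_ge0// addr_ge0 ?powR_ge0.
rewrite (_ : D * (jx * X ^+ 2 - jy * Y ^+ 2) =
    2^-1 * (D * (jx - jy) * (X ^+ 2 + Y ^+ 2)) + 2^-1 * (D * (jx + jy) * (X ^+ 2 - Y ^+ 2))); last by field.
rewrite -[leLHS]add0r; apply: lerD.
  by rewrite mulr_ge0 ?invr_ge0// mulr_ge0// addr_ge0 ?sqr_ge0.
rewrite lerNl -mulrN; set V := _ `^ _ + _.
rewrite (_ : 2 * (V * `|X - Y|) = 2^-1 * (2 * V * (`|X - Y| * 2))); last by field.
rewrite ler_wpM2l ?invr_ge0// (le_trans (ler_norm _))// normrN !normrM.
apply: ler_pM => //; rewrite ?mulr_ge0//.
  by apply: ler_pM => //; rewrite /V -!normJp//; exact: ler_normD.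
rewrite subr_sqr normrM ler_wpM2l// ger0_norm ?addr_ge0//; lra.
Qed.

End powers.

(** * Double integrals and averaging *)

Section double_integrals.
Context {R : realType} {N : nat}.
Local Notation T := (N.-tuple R).
Local Notation mu := (muN R N).
Local Notation mu2 := (muN R N \x muN R N)%E.
Implicit Types (F : T * T -> R) (f g : T -> R).

Lemma int2E F : measurable_fun setT F -> (forall z, 0 <= F z) ->
  (\int[mu2]_z (F z)%:E = \int[mu]_x \int[mu]_y (F (x, y))%:E)%E.
Proof.
move=> mF F0; rewrite (fubini_tonelli1 (fun z => (F z)%:E))//.
by msr.
Qed.

Lemma measurable_int2_section F : measurable_fun setT F -> (forall z, 0 <= F z) ->
  measurable_fun setT (fun x => \int[mu]_y (F (x, y))%:E)%E.
Proof.
move=> mF F0; apply: (@measurable_fun_fubini_tonelli_F _ _ _ _ _ mu (fun z => (F z)%:E)).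
  by msr.
by move=> z; rewrite lee_fin.
Qed.

Lemma measurable_pair1 F x : measurable_fun setT F -> measurable_fun setT (fun y => F (x, y)).
Proof. by move=> mF; apply: (measurableT_comp mF (pair1_measurable x)). Qed.

Lemma measurable_swap F : measurable_fun setT F -> measurable_fun setT (fun z => F (z.2, z.1)).
Proof. by move=> mF; msr. Qed.

Lemma int2_swap F : measurable_fun setT F -> (forall z, 0 <= F z) ->
  (\int[mu2]_z (F (z.2, z.1))%:E = \int[mu2]_z (F z)%:E)%E.
Proof.
move=> mF F0; rewrite (fubini_tonelli1 (fun z => (F (z.2, z.1))%:E))//=; last 2 first.
  by apply: measurable_EFin_comp; exact: measurable_swap.
  by move=> z; rewrite lee_fin.
rewrite (fubini_tonelli2 (fun z => (F z)%:E))//; by msr.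
Qed.

Lemma measurable_shear F : measurable_fun setT F ->
  measurable_fun setT (fun z => F (z.1, tadd z.1 z.2)).
Proof. by move=> mF; msr. Qed.

(** The kernels depend on [y - x] only; in the variables [x] and [k = y - x] they separate from the
    functions they multiply. *)
Lemma int2_shear F : measurable_fun setT F -> (forall z, 0 <= F z) ->
  (\int[mu2]_z (F z)%:E = \int[mu2]_z (F (z.1, tadd z.1 z.2))%:E)%E.
Proof.
move=> mF F0; rewrite (int2E _ mF F0) (int2E _ (measurable_shear _ mF) (fun z => F0 _)).
apply: eq_integral => x _ /=.
rewrite -(@integral_tadd _ _ (fun y => (F (x, y))%:E) x)//.
- by apply: eq_integral => y _; rewrite taddC.
- by apply: measurable_EFin_comp; exact: measurable_pair1.
- by move=> y; rewrite lee_fin.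
Qed.

Lemma int2_tadd1 F h : measurable_fun setT F -> (forall z, 0 <= F z) ->
  (\int[mu2]_z (F (tadd z.1 h, z.2))%:E = \int[mu2]_z (F z)%:E)%E.
Proof.
move=> mF F0; rewrite (int2E _ mF F0).
have mFh : measurable_fun setT (fun z => F (tadd z.1 h, z.2)) by msr.
rewrite (int2E _ mFh (fun z => F0 _)) /=.
rewrite (@integral_tadd _ _ (fun x => \int[mu]_y (F (x, y))%:E)%E h)//.
  exact: measurable_int2_section.
by move=> x; apply: integral_ge0 => y _; rewrite lee_fin.
Qed.

Lemma int2_tadd2 F h : measurable_fun setT F -> (forall z, 0 <= F z) ->
  (\int[mu2]_z (F (z.1, tadd z.2 h))%:E = \int[mu2]_z (F z)%:E)%E.
Proof.
move=> mF F0; rewrite -int2_swap//=; last by msr.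
rewrite (int2_tadd1 (fun z => F (z.2, z.1)))//; first exact: int2_swap.
exact: measurable_swap.
Qed.

Lemma int2_prod f g : measurable_fun setT f -> measurable_fun setT g ->
  (forall x, 0 <= f x) -> (forall x, 0 <= g x) ->
  (\int[mu2]_z (f z.1 * g z.2)%:E = \int[mu]_x (f x)%:E * \int[mu]_x (g x)%:E)%E.
Proof.
move=> mf mg f0 g0; rewrite int2E//=; [|by msr|by move=> z; rewrite mulr_ge0].
under eq_integral do rewrite intRZ//.
rewrite ge0_integralZr//; first by msr.
  by move=> x _; rewrite lee_fin.
by apply: integral_ge0 => x _; rewrite lee_fin.
Qed.

Lemma int2_le_conv F f g : measurable_fun setT F -> (forall z, 0 <= F z) ->
  measurable_fun setT f -> measurable_fun setT g ->
  (forall x, 0 <= f x) -> (forall x, 0 <= g x) ->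
  (forall x k, F (x, tadd x k) <= f x * g k) ->
  (\int[mu2]_z (F z)%:E <= \int[mu]_x (f x)%:E * \int[mu]_x (g x)%:E)%E.
Proof.
move=> mF F0 mf mg f0 g0 h; rewrite int2_shear// -int2_prod//.
apply: intR_le => //; first exact: measurable_shear.
by msr.
Qed.

End double_integrals.

Section averaging.
Context {R : realType} {N : nat}.
Local Notation T := (N.-tuple R).
Local Notation mu := (muN R N).
Local Notation mu2 := (muN R N \x muN R N)%E.

Definition gag (m tau : R) (B : set T) (f : T -> R) (z : T * T) : R :=
  \1_B z.1 * \1_B z.2 * (`|f z.1 - f z.2| `^ m / edist z.1 z.2 `^ (N%:R + tau)).

Lemma gag_ge0 m tau B f z : 0 <= gag m tau B f z.
Proof. by rewrite /gag mulr_ge0// divr_ge0 ?powR_ge0. Qed.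

Lemma measurable_gag m tau B f : measurable B -> measurable_fun setT f ->
  measurable_fun setT (gag m tau B f).
Proof. by move=> mB mf; rewrite /gag; msr. Qed.

Lemma ler_gag m tau (B : set T) f x y (e : R) : 0 < m -> 0 <= tau ->
  B x -> B y -> edist x y <= e ->
  `|f x - f y| `^ m <= e `^ (N%:R + tau) * gag m tau B f (x, y).
Proof.
move=> m0 t0 Bx By xye; rewrite /gag /= !indicE !mem_set// !mul1r.
have [xy|xy] := eqVneq (edist x y) 0.
  rewrite (edist_eq0 _ _ xy) subrr normr0 powR0 ?gt_eqF//.
have e0 : 0 < edist x y by rewrite lt_neqAle eq_sym xy edist_ge0.
rewrite mulrCA ler_peMr ?powR_ge0// ler_pdivlMr ?powR_gt0// mul1r.
by apply: ler_powR2; rewrite ?addr_ge0// ltW.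
Qed.

(* Compare [f (x + h)] and [f x] with the values of [f] on a ball of radius
   comparable to [enorm h] near [x], and average. *)
Lemma averaging (m tau : R) : 0 < m -> 0 <= tau ->
  exists2 C : R, 0 < C & forall (f : T -> R) (x0 h : T) (rho d : R),
  measurable_fun setT f -> 0 < enorm h -> enorm h <= d ->
  (\int[mu]_x (\1_(eball x0 rho) x * `|f (tadd x h) - f x| `^ m)%:E <=
   (C * enorm h `^ tau)%:E *
     \int[mu2]_z (gag m tau (eball x0 (rho + 2 * d)) f z)%:E)%E.
Proof.
move=> m0 t0.
pose c : R := (2 / N.+1%:R) ^+ N.
have c0 : 0 < c by rewrite exprn_gt0// divr_gt0.
pose C : R := 2 `^ m * (2 `^ (N%:R + tau) + 1) / c.
have C0 : 0 < C by rewrite /C divr_gt0// mulr_gt0 ?powR_gt0// addr_gt0 ?powR_gt0.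
exists C => // f x0 h rho d mf h0 hd.
set e := enorm h in h0 hd *.
set B := eball x0 (rho + 2 * d); set G := gag m tau B f.
have mB : measurable B by exact: measurable_eball.
have mG : measurable_fun setT G by exact: measurable_gag.
have G0 z : 0 <= G z by exact: gag_ge0.
pose L x : R := \1_(eball x0 rho) x * `|f (tadd x h) - f x| `^ m.
have mL : measurable_fun setT L by rewrite /L; msr.
have L0 x : 0 <= L x by rewrite /L mulr_ge0// powR_ge0.
pose E := eball (origin N : T) e.
change (\int[mu]_x (L x)%:E <= (C * e `^ tau)%:E * \int[mu2]_z (G z)%:E)%E.
have mGs : measurable_fun setT (fun z => G (tadd z.1 h, z.2)).
  by msr.
(* The intermediate point [x + k], with [|k| < e], is at distance at most [2 e] from [x + h] and [e]
   from [x], whence the two weights. *)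
have key x k : L x * \1_E k <= 2 `^ m * ((2 * e) `^ (N%:R + tau) * G (tadd x h, tadd x k) +
    e `^ (N%:R + tau) * G (x, tadd x k)).
  have RHS0 : 0 <= 2 `^ m * ((2 * e) `^ (N%:R + tau) * G (tadd x h, tadd x k) +
    e `^ (N%:R + tau) * G (x, tadd x k)).
    by rewrite mulr_ge0 ?powR_ge0// addr_ge0// mulr_ge0 ?powR_ge0.
  rewrite /L !indicE; have [xB|xB] := boolP (x \in eball x0 rho); last first.
    by rewrite !mul0r.
  have [kE|kE] := boolP (k \in E); last by rewrite mulr0.
  rewrite mul1r mulr1; move: xB kE; rewrite !inE /E /eball/= => xB kE.
  have Bx : B x by rewrite /B /eball/=; move: xB h0 hd; clear; lra.
  have Bxh : B (tadd x h).
    rewrite /B /eball/=; have := edist_triangle x (tadd x h) x0.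
    by rewrite (edistC (tadd x h) x) edist_taddr -/e; move: xB h0 hd; clear; lra.
  have Bxk : B (tadd x k).
    rewrite /B /eball/=; have := edist_triangle x (tadd x k) x0.
    by rewrite (edistC (tadd x k) x) edist_taddr; move: xB h0 hd kE; clear; lra.
  apply: (@le_trans _ _ (2 `^ m * (`|f (tadd x h) - f (tadd x k)| `^ m + `|f x - f (tadd x k)| `^ m))).
    apply: powR_le_add => //; first exact: ltW.
    rewrite (distrC (f x)) -[X in `|X|](subrKA (f (tadd x k))).
    exact: ler_normD.
  rewrite ler_wpM2l ?powR_ge0// lerD//; apply: ler_gag => //.
    have := edist_triangle x (tadd x h) (tadd x k).
    by rewrite (edistC (tadd x h) x) !edist_taddr -/e; move: h0 hd kE; clear; lra.
  by rewrite edist_taddr ltW.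
clearbody L G.
have mE : measurable E by exact: measurable_eball.
(* Integration over [k] in [E] turns the left side into a product and the right side, after a shear
   and a translation, into the energy. *)
have I1 : (\int[mu]_x (L x)%:E * mu E <= (2 `^ m * (2 `^ (N%:R + tau) + 1) * e `^ (N%:R + tau))%:E * \int[mu2]_z (G z)%:E)%E.
  rewrite -[X in (_ * mu X)%E]setIT -integral_indic//.
  have mI : measurable_fun setT (\1_E : T -> R) by exact: measurable_indic.
  have I0 x : 0 <= (\1_E x : R) by [].
  rewrite -(int2_prod L (\1_E) mL mI L0 I0).
  apply: (@le_trans _ _ (\int[mu2]_z (2 `^ m * ((2 * e) `^ (N%:R + tau) * G (tadd z.1 h, tadd z.1 z.2) +
    e `^ (N%:R + tau) * G (z.1, tadd z.1 z.2)))%:E)%E).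
    apply: intR_le.
    - by msr.
    - by msr.
    - by move=> z; rewrite mulr_ge0.
    - by move=> z; exact: key.
  have mG1 := measurable_shear (fun z => G (tadd z.1 h, z.2)) mGs.
  have mG2 := measurable_shear _ mG.
  rewrite intRZ; last 3 first.
    - by msr.
    - by move=> z; rewrite addr_ge0// mulr_ge0 ?powR_ge0.
    - exact: powR_ge0.
  rewrite intRD; last 4 first.
    - by msr.
    - by msr.
    - by move=> z; rewrite mulr_ge0 ?powR_ge0.
    - by move=> z; rewrite mulr_ge0 ?powR_ge0.
  rewrite !intRZ ?powR_ge0//.
  rewrite -(int2_shear (fun z => G (tadd z.1 h, z.2)))// -(int2_shear G)// int2_tadd1//.
  rewrite -ge0_muleDl ?lee_fin ?powR_ge0// muleA -!EFinD -!EFinM.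
  rewrite powRM ?(ltW h0)//.
  rewrite [X in (X%:E * _ <= _)%E](_ : _ = 2 `^ m * (2 `^ (N%:R + tau) + 1) * e `^ (N%:R + tau)) //.
  by ring.
have mEge : ((c * e ^+ N)%:E <= mu E)%E.
  have := muN_eball_ge (origin N : T) e h0.
  by rewrite mulrCA mulrC exprMn mulrC [X in (X%:E <= _)%E]mulrC.
have I2 : (\int[mu]_x (L x)%:E * (c * e ^+ N)%:E <= (2 `^ m * (2 `^ (N%:R + tau) + 1) * e `^ (N%:R + tau))%:E * \int[mu2]_z (G z)%:E)%E.
  apply: le_trans I1; apply: lee_wpmul2l => //.
  by apply: integral_ge0 => x _; rewrite lee_fin.
have ceN : 0 < c * e ^+ N by rewrite mulr_gt0// exprn_gt0.
move: I2; rewrite muleC -lee_pdivlMl// muleA -EFinM.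
rewrite [X in (X%:E * _)%E](_ : _ = C * e `^ tau) //.
rewrite (powRD_ge0 e) ?(ltW h0)// (powR_mulrn _ (ltW h0)) /C.
have eN : e ^+ N != 0 by rewrite gt_eqF// exprn_gt0.
field; by rewrite eN gt_eqF.
Qed.

End averaging.

(* Stated with infinite error integrals allowed, so that no a priori finiteness of
   [E1] and [E2] is needed. *)
Lemma energy_inequality {d} {T : measurableType d} {R : realType}
    (mu : {measure set T -> \bar R}) (G1 G2 A E1 E2 : T -> R) (lam : R) :
  0 <= lam <= 1 ->
  mu.-integrable setT (EFin \o G1) -> mu.-integrable setT (EFin \o G2) ->
  (\int[mu]_x (G2 x)%:E + lam%:E * \int[mu]_x (G1 x)%:E = 0)%E ->
  measurable_fun setT A -> measurable_fun setT E1 -> measurable_fun setT E2 ->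
  (forall x, 0 <= A x) -> (forall x, 0 <= E1 x) -> (forall x, 0 <= E2 x) ->
  (forall x, A x - E2 x <= G2 x) -> (forall x, - E1 x <= G1 x) ->
  (\int[mu]_x (A x)%:E <= \int[mu]_x (E2 x)%:E + \int[mu]_x (E1 x)%:E)%E.
Proof.
move=> /andP[l0 l1] iG1 iG2 eq0 mA mE1 mE2 A0 E10 E20 hA hE.
have J1 : (0 <= \int[mu]_x (E1 x)%:E)%E by apply: integral_ge0 => x _; rewrite lee_fin.
have J2 : (0 <= \int[mu]_x (E2 x)%:E)%E by apply: integral_ge0 => x _; rewrite lee_fin.
have [->|f1] := eqVneq (\int[mu]_x (E1 x)%:E)%E +oo%E.
  by rewrite addey ?leey// gt_eqF// (lt_le_trans _ J2)// ltNyr.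
have [->|f2] := eqVneq (\int[mu]_x (E2 x)%:E)%E +oo%E.
  by rewrite addye ?leey// gt_eqF// (lt_le_trans _ J1)// ltNyr.
have iE1 : mu.-integrable setT (EFin \o E1).
  apply/integrableP; split; first by apply/measurable_EFinP.
  under eq_integral do rewrite /= ger0_norm//.
  by rewrite ltey.
have iE2 : mu.-integrable setT (EFin \o E2).
  apply/integrableP; split; first by apply/measurable_EFinP.
  under eq_integral do rewrite /= ger0_norm//.
  by rewrite ltey.
have iG1l : mu.-integrable setT (fun x => lam%:E * (G1 x)%:E)%E by exact: integrableZl.
have iG : mu.-integrable setT (fun x => (G2 x)%:E + lam%:E * (G1 x)%:E)%E by exact: integrableD.
have iE : mu.-integrable setT (fun x => (E2 x)%:E + (E1 x)%:E)%E by exact: integrableD.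
apply: (@le_trans _ _ (\int[mu]_x (((G2 x)%:E + lam%:E * (G1 x)%:E) + ((E2 x)%:E + (E1 x)%:E)))%E).
  apply: ge0_le_integral => //.
  - by move=> x _; rewrite lee_fin.
  - exact/measurable_EFinP.
  - apply: emeasurable_funD; [exact: measurable_int iG|exact: measurable_int iE].
  - move=> x _; rewrite -!EFinM -!EFinD lee_fin.
    have h1 := hA x; have h2 := hE x; have h3 := E10 x.
    have : - (lam * E1 x) <= lam * G1 x by rewrite -mulrN ler_wpM2l.
    have : lam * E1 x <= E1 x by rewrite ler_piMl.
    lra.
rewrite (integralD _ iG iE)// (integralD _ iE2 iE1)// (integralD _ iG2 iG1l)//.
rewrite [X in (_ + X + _)%E](_ : _ = lam%:E * \int[mu]_x (G1 x)%:E)%E; last exact: integralZl.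
by rewrite eq0 add0e.
Qed.

(** * The equation satisfied by finite differences *)

Section translations.
Context {R : realType} {N : nat}.
Local Notation T := (N.-tuple R).
Local Notation mu2 := (muN R N \x muN R N)%E.
Implicit Types (F : T * T -> R).

Lemma int2_tadd F h : measurable_fun setT F -> (forall z, 0 <= F z) ->
  (\int[mu2]_z (F (tadd z.1 h, tadd z.2 h))%:E = \int[mu2]_z (F z)%:E)%E.
Proof.
move=> mF F0; rewrite (int2_tadd1 (fun z => F (z.1, tadd z.2 h)))//; last by msr.
exact: int2_tadd2.
Qed.

Lemma int2_tadd_signed F h : measurable_fun setT F ->
  (\int[mu2]_z (F (tadd z.1 h, tadd z.2 h))%:E = \int[mu2]_z (F z)%:E)%E.
Proof.
move=> mF; rewrite integralE [RHS]integralE; congr (_ - _)%E.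
  rewrite (_ : (fun z => _)^\+%E = (fun z => (Num.max (F (tadd z.1 h, tadd z.2 h)) 0)%:E)); last first.
    by apply/funext => z; rewrite funeposE -EFin_max.
  rewrite (int2_tadd (fun z => Num.max (F z) 0))//.
  - by apply: eq_integral => z _; rewrite funeposE -EFin_max.
  - by msr.
  - by move=> z; rewrite le_max lexx orbT.
rewrite (_ : (fun z => _)^\-%E = (fun z => (Num.max (- F (tadd z.1 h, tadd z.2 h)) 0)%:E)); last first.
  by apply/funext => z; rewrite funenegE -EFin_max.
rewrite (int2_tadd (fun z => Num.max (- F z) 0))//.
- by apply: eq_integral => z _; rewrite funenegE -EFin_max.
- by msr.
- by move=> z; rewrite le_max lexx orbT.
Qed.

Lemma integrable2_tadd F h : mu2.-integrable setT (EFin \o F) ->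
  mu2.-integrable setT (EFin \o (fun z => F (tadd z.1 h, tadd z.2 h))).
Proof.
move=> /integrableP[/measurable_EFinP mF foo]; apply/integrableP; split.
  by apply/measurable_EFinP; msr.
by have := int2_tadd (fun z => `|F z|) h => /= ->//; msr.
Qed.

End translations.

Section normalized.
Context {R : realType} {N : nat}.
Local Notation T := (N.-tuple R).
Local Notation mu := (muN R N).
Local Notation mu2 := (muN R N \x muN R N)%E.

Definition diff (v : T -> R) (h x : T) : R := v (tadd x h) - v x.

(* Membership in W_0^{s1,1} and W_0^{s,p}, in the form in which it is verified for
   the test functions below. *)
Record admissible (s1 p s : R) (x0 : T) (Rr : R) (phi : T -> R) : Prop := Admissible {
  adm_meas : measurable_fun setT phi;
  adm_bd : exists M, forall x, `|phi x| <= M;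
  adm_supp : forall x, ~ eball x0 Rr x -> phi x = 0;
  adm_gag1 : (\int[mu2]_z (gag 1 s1 setT phi z)%:E < +oo)%E;
  adm_gagp : (\int[mu2]_z (gag p (s * p) setT phi z)%:E < +oo)%E }.

Definition form1 (s1 : R) (Z : T * T -> R) (phi : T -> R) (z : T * T) : R :=
  Z z * (phi z.1 - phi z.2) / edist z.1 z.2 `^ (N%:R + s1).

Definition formp (s p : R) (v phi : T -> R) (z : T * T) : R :=
  Jp (p - 2) (v z.1 - v z.2) * (phi z.1 - phi z.2) / edist z.1 z.2 `^ (N%:R + s * p).

(* The solution divided by [A := datum >= 1]; by homogeneity the 1-part then
   carries the factor [lam = A ^ (1 - p) <= 1], which is why the constants below do
   not depend on the solution. The pointwise bounds hold everywhere, not just almost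
   everywhere, after modification on a null set. *)
Record nsol (s1 p s lam : R) (x0 : T) (Rr : R) (v : T -> R) (Z : T * T -> R) : Prop := NSol {
  ns_mv : measurable_fun setT v;
  ns_mZ : measurable_fun setT Z;
  ns_bd : forall x, eball x0 Rr x -> `|v x| <= 1;
  ns_Z1 : forall z, `|Z z| <= 1;
  ns_Zp : forall z, v z.2 < v z.1 -> Z z = 1;
  ns_Zn : forall z, v z.1 < v z.2 -> Z z = -1;
  ns_lam : 0 <= lam <= 1;
  ns_tail : (\int[mu]_x (\1_(~` eball x0 Rr) x *
       (`|v x| `^ (p - 1) / edist x x0 `^ (N%:R + s * p)))%:E <= ((Rr `^ (s * p))^-1)%:E)%E;
  ns_gag : (\int[mu2]_z (gag p (s * p) (eball x0 Rr) v z)%:E <= 1)%E;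
  ns_gag1 : (\int[mu2]_z (gag 1 s1 (eball x0 Rr) v z)%:E < +oo)%E;
  ns_eq : forall phi, admissible s1 p s x0 Rr phi ->
    [/\ mu2.-integrable setT (EFin \o form1 s1 Z phi),
        mu2.-integrable setT (EFin \o formp s p v phi) &
        (\int[mu2]_z (formp s p v phi z)%:E + lam%:E * \int[mu2]_z (form1 s1 Z phi z)%:E = 0)%E] }.

Lemma measurable_Jp (r : R) : measurable_fun setT (Jp r).
Proof. by rewrite /Jp; msr. Qed.

(** The equation is tested with [phi] and with its translate by [-h]. Translating the second
    identity moves the shift onto [v] and [Z], because the kernels are translation invariant; the
    two identities are then subtracted. *)
Lemma difference_equation s1 p s lam x0 Rr v Z (phi : T -> R) (h : T) :
  nsol s1 p s lam x0 Rr v Z -> admissible s1 p s x0 Rr phi ->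
  admissible s1 p s x0 Rr (fun x => phi (tadd x (topp h))) ->
  let G1 := fun z => (Z (tadd z.1 h, tadd z.2 h) - Z z) * (phi z.1 - phi z.2)
              / edist z.1 z.2 `^ (N%:R + s1) in
  let G2 := fun z => (Jp (p - 2) (v (tadd z.1 h) - v (tadd z.2 h)) - Jp (p - 2) (v z.1 - v z.2))
              * (phi z.1 - phi z.2) / edist z.1 z.2 `^ (N%:R + s * p) in
  [/\ mu2.-integrable setT (EFin \o G1), mu2.-integrable setT (EFin \o G2) &
    (\int[mu2]_z (G2 z)%:E + lam%:E * \int[mu2]_z (G1 z)%:E = 0)%E].
Proof.
move=> sol ap aph G1 G2.
set psi := (fun x => _) in aph.
have [i1 i2 e] := ns_eq _ _ _ _ _ _ _ _ sol _ ap.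
have [j1 j2 e'] := ns_eq _ _ _ _ _ _ _ _ sol _ aph.
have mv := ns_mv _ _ _ _ _ _ _ _ sol; have mZ := ns_mZ _ _ _ _ _ _ _ _ sol.
have mp := adm_meas _ _ _ _ _ _ ap; have mps := adm_meas _ _ _ _ _ _ aph.
have mJ := measurable_Jp (p - 2).
have m1 : measurable_fun setT (form1 s1 Z psi) by rewrite /form1; msr.
have m2 : measurable_fun setT (formp s p v psi) by rewrite /formp; msr.
have k1 := integrable2_tadd _ h j1; have k2 := integrable2_tadd _ h j2.
have G1E : EFin \o G1 = ((EFin \o (fun z => form1 s1 Z psi (tadd z.1 h, tadd z.2 h))) \- (EFin \o form1 s1 Z phi))%E.
  apply/funext => z; rewrite /= /form1 /psi /= -EFinB /G1 !taddK edist_tadd2r.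
  by congr (_%:E); ring.
have G2E : EFin \o G2 = ((EFin \o (fun z => formp s p v psi (tadd z.1 h, tadd z.2 h))) \- (EFin \o formp s p v phi))%E.
  apply/funext => z; rewrite /= /formp /psi /= -EFinB /G2 !taddK edist_tadd2r.
  by congr (_%:E); ring.
have iG1 : mu2.-integrable setT (EFin \o G1) by rewrite G1E; exact: (integrableB measurableT k1 i1).
have iG2 : mu2.-integrable setT (EFin \o G2) by rewrite G2E; exact: (integrableB measurableT k2 i2).
split => //.
rewrite -[X in (X + _)%E]/(\int[mu2]_z ((EFin \o G2) z))%E -[X in (_ + _ * X)%E]/(\int[mu2]_z ((EFin \o G1) z))%E.
rewrite G1E G2E (integralB _ k1 i1)// (integralB _ k2 i2)//.
rewrite [X in (X - _ + _)%E](int2_tadd_signed (formp s p v psi) h m2).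
rewrite [X in (_ + _ * (X - _))%E](int2_tadd_signed (form1 s1 Z psi) h m1).
have fin (F : T * T -> R) : mu2.-integrable setT (EFin \o F) ->
    exists a : R, (\int[mu2]_z (F z)%:E = a%:E)%E.
  move=> iF; exists (fine (\int[mu2]_z (F z)%:E)%E).
  by rewrite fineK//; exact: (integrable_fin_num _ iF).
have [a1 e1] := fin _ i1; have [a2 e2] := fin _ i2.
have [a3 e3] := fin _ j1; have [a4 e4] := fin _ j2.
move: e e'; rewrite /= e1 e2 e3 e4 -!EFinB -!EFinM -!EFinD.
move=> [h1] [h2]; congr (_%:E); move: h1 h2; clear; rewrite mulrBr; lra.
Qed.

Definition cutoff (x0 : T) (rho d : R) (x : T) : R :=
  Num.max 0 (Num.min 1 ((rho + d - edist x x0) / d)).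

Lemma measurable_cutoff x0 rho d : measurable_fun setT (cutoff x0 rho d).
Proof. by rewrite /cutoff; msr. Qed.

Lemma cutoff01 x0 rho d x : 0 <= cutoff x0 rho d x <= 1.
Proof. by rewrite /cutoff le_max lexx/= ge_max ler01 ge_min lexx. Qed.

Lemma cutoff1 x0 rho d x : 0 < d -> edist x x0 <= rho -> cutoff x0 rho d x = 1.
Proof.
move=> d0 xr; rewrite /cutoff min_l; first by rewrite max_r.
by rewrite ler_pdivlMr// mul1r; lra.
Qed.

Lemma cutoff0 x0 rho d x : 0 < d -> rho + d <= edist x x0 -> cutoff x0 rho d x = 0.
Proof.
move=> d0 xr; rewrite /cutoff max_l// ge_min; apply/orP; right.
by rewrite ler_pdivrMr// mul0r; lra.
Qed.

Lemma clamp01_lip (a b : R) :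
  `|Num.max 0 (Num.min 1 a) - Num.max 0 (Num.min 1 b)| <= `|a - b|.
Proof.
rewrite ler_norml; have := ler_norm (a - b); have := ler_norm (b - a).
rewrite distrC; rewrite /Num.max /Num.min /Order.max /Order.min.
by case: (ltP 1 a) => h1; case: (ltP 1 b) => h2; case: ltP => h3; case: ltP => h4; lra.
Qed.

(** The minimum with 1 is the form in which the increment of the cutoff becomes the numerator of
    [kern2]; [d <= 1] lets both bounds share the factor [1 / d]. *)
Lemma cutoff_lip x0 rho d x y : 0 < d <= 1 ->
  `|cutoff x0 rho d x - cutoff x0 rho d y| <= Num.min 1 (edist x y) / d.
Proof.
move=> /andP[d0 d1].
have h1 : `|cutoff x0 rho d x - cutoff x0 rho d y| <= 1.
  have /andP[? ?] := cutoff01 x0 rho d x; have /andP[? ?] := cutoff01 x0 rho d y.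
  by rewrite ler_norml; apply/andP; split; lra.
have h2 : `|cutoff x0 rho d x - cutoff x0 rho d y| <= edist x y / d.
  apply: (le_trans (clamp01_lip _ _)).
  rewrite -mulrBl normrM (gtr0_norm (x := d^-1)) ?invr_gt0// ler_wpM2r ?invr_ge0 ?(ltW d0)//.
  have := edist_triangle x y x0; have := edist_triangle y x x0.
  rewrite (edistC y x) => t1 t2; rewrite ler_norml; apply/andP; split; lra.
rewrite /Num.min /Order.min; case: ifP => _ //.
by rewrite (le_trans h1)// ler_pdivlMr// mul1r.
Qed.

End normalized.

(** * Integrals against the singular kernel in two variables *)

Section kernels2.
Context {R : realType} {N : nat}.
Local Notation T := (N.-tuple R).
Local Notation mu := (muN R N).
Local Notation mu2 := (muN R N \x muN R N)%E.

Definition kern2 (a b : R) (z : T * T) : R :=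
  Num.min 1 (edist z.1 z.2 `^ a) / edist z.1 z.2 `^ (N%:R + b).

Lemma kern2_ge0 a b z : 0 <= kern2 a b z.
Proof. by rewrite /kern2 divr_ge0 ?powR_ge0// le_min ler01 powR_ge0. Qed.

Lemma measurable_kern2 a b : measurable_fun setT (kern2 a b).
Proof. by rewrite /kern2; msr. Qed.

Lemma kern2_tadd a b x k : kern2 a b (x, tadd x k) = kern a b k.
Proof. by rewrite /kern2 /kern /= edist_taddr. Qed.

Lemma kern2C a b x y : kern2 a b (x, y) = kern2 a b (y, x).
Proof. by rewrite /kern2 /= edistC. Qed.

(** A real number, so that it can enter the constants; it is the true integral, and not a default
    value, as soon as [0 < b < a]. *)
Definition kmass (a b : R) : R := fine (\int[mu]_k (kern a b k)%:E).

Lemma kmass_ge0 a b : 0 <= kmass a b.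
Proof. by rewrite fine_ge0// integral_ge0// => k _; rewrite lee_fin kern_ge0. Qed.

Lemma kmassE a b : 0 < b -> b < a -> (\int[mu]_k (kern a b k)%:E = (kmass a b)%:E)%E.
Proof.
move=> b0 ba; rewrite /kmass fineK// ge0_fin_numE; first exact: integral_kern_lty.
by apply: integral_ge0 => k _; rewrite lee_fin kern_ge0.
Qed.

Lemma int2_kern2 (a b : R) (g : T -> R) : 0 < b -> b < a ->
  measurable_fun setT g -> (forall x, 0 <= g x) ->
  (\int[mu2]_z (g z.1 * kern2 a b z)%:E <= (kmass a b)%:E * \int[mu]_x (g x)%:E)%E.
Proof.
move=> b0 ba mg g0; rewrite muleC -kmassE//.
have mk := measurable_kern2 a b.
have mk1 := @measurable_kern R N a b.
apply: int2_le_conv.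
- by msr.
- by move=> z; rewrite mulr_ge0// kern2_ge0.
- exact: mg.
- exact: mk1.
- exact: g0.
- by move=> x; exact: kern_ge0.
- by move=> x k; rewrite kern2_tadd.
Qed.

Lemma int2_kern2_sym (a b : R) (g : T -> R) : 0 < b -> b < a ->
  measurable_fun setT g -> (forall x, 0 <= g x) ->
  (\int[mu2]_z ((g z.1 + g z.2) * kern2 a b z)%:E <=
   (2 * kmass a b)%:E * \int[mu]_x (g x)%:E)%E.
Proof.
move=> b0 ba mg g0; have mk := measurable_kern2 a b.
have mF : measurable_fun setT (fun z : T * T => g z.1 * kern2 a b z) by msr.
have F0 (z : T * T) : 0 <= g z.1 * kern2 a b z by rewrite mulr_ge0// kern2_ge0.
have mF' : measurable_fun setT (fun z : T * T => g z.2 * kern2 a b z) by msr.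
have F0' (z : T * T) : 0 <= g z.2 * kern2 a b z by rewrite mulr_ge0// kern2_ge0.
under eq_integral do rewrite mulrDl.
rewrite intRD// EFinM -muleA (_ : 2%:E = 1%:E + 1%:E)%E; last by rewrite -EFinD.
rewrite ge0_muleDl ?lee_fin// mul1e; apply: leeD; first exact: int2_kern2.
rewrite -int2_swap//=; apply: le_trans (int2_kern2 a b g b0 ba mg g0).
rewrite le_eqVlt; apply/orP; left; apply/eqP; apply: eq_integral => -[x y] _ /=.
by rewrite kern2C.
Qed.

End kernels2.

(** * Test functions *)

Section real_tools.
Context {R : realType}.

Lemma powR_ge1 (r : R) : 0 <= r -> 1 <= 2 `^ r.
Proof.
by move=> r0; rewrite -[leLHS](powRr0 2); apply: ler_powR => //; lra.
Qed.

Lemma powR_le_add3 (x y t z r : R) : 0 <= r -> 0 <= z -> 0 <= x -> 0 <= y -> 0 <= t ->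
  z <= x + (y + t) -> z `^ r <= 4 `^ r * (x `^ r + y `^ r + t `^ r).
Proof.
move=> r0 z0 x0 y0 t0 h.
have h1 := @powR_le_add R x (y + t) z r r0 z0 x0 (addr_ge0 y0 t0) h.
have h2 := @powR_le_add R y t (y + t) r r0 (addr_ge0 y0 t0) y0 t0 (lexx _).
have g1 := powR_ge1 r r0.
have -> : 4 `^ r = 2 `^ r * 2 `^ r :> R.
  by rewrite -powRM//; congr (_ `^ _); ring.
apply: (le_trans h1); rewrite -mulrA; apply: ler_wpM2l; first exact: powR_ge0.
rewrite -addrA mulrDr; apply: lerD => //.
by rewrite ler_peMl// powR_ge0.
Qed.

Lemma min1_powR (t m : R) : 0 <= t -> 0 <= m ->
  (Num.min 1 t) `^ m <= Num.min 1 (t `^ m).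
Proof.
move=> t0 m0; have mn0 : 0 <= Num.min 1 t by rewrite le_min ler01.
rewrite le_min; apply/andP; split; last by apply: ler_powR2; rewrite ?ge_min ?lexx ?orbT.
rewrite -[leRHS](_ : 1 `^ m = 1); last by rewrite powR1.
by apply: ler_powR2; rewrite ?ge_min ?lexx.
Qed.

Definition testc (r : R) : R := lipc r * (2 * 2 `^ r) + 2 * 2 `^ (r + 1).

Lemma testc_ge0 r : 0 <= r -> 0 <= testc r.
Proof.
move=> r0; have := lipc_gt r r0 => h.
by rewrite addr_ge0 ?mulr_ge0 ?powR_ge0//; lra.
Qed.

(** The increments in [w] and in the cutoff are separated so that each can be compared with its own
    finite energy. *)
Lemma test_lip (r wx wy X Y : R) : 0 <= r -> `|wx| <= 2 -> `|wy| <= 2 ->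
  0 <= X <= 1 -> 0 <= Y <= 1 ->
  `|Jp r wx * X ^+ 2 - Jp r wy * Y ^+ 2| <= testc r * (`|wx - wy| + `|X - Y|).
Proof.
move=> r0 wx2 wy2 /andP[X0 X1] /andP[Y0 Y1]; have L1 := lipc_gt r r0.
have -> : Jp r wx * X ^+ 2 - Jp r wy * Y ^+ 2 =
  (Jp r wx - Jp r wy) * X ^+ 2 + Jp r wy * ((X + Y) * (X - Y)) by ring.
apply: (le_trans (ler_normD _ _)); rewrite [leRHS]mulrDr; apply: lerD.
  rewrite normrM (ger0_norm (sqr_ge0 X)).
  apply: (@le_trans _ _ (lipc r * (2 * 2 `^ r) * `|wx - wy| * 1)).
    apply: ler_pM => //; first exact: sqr_ge0.
      apply: (le_trans (Jp_lip r wx wy r0)); rewrite -!mulrA.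
      apply: ler_wpM2l; first lra.
      rewrite mulrA; apply: ler_wpM2r => //.
      have h1 := @ler_powR2 R r `|wx| 2 r0 (normr_ge0 _) wx2.
      have h2 := @ler_powR2 R r `|wy| 2 r0 (normr_ge0 _) wy2.
      lra.
    by rewrite expr2 mulr_ile1.
  rewrite mulr1 ler_wpM2r// /testc lerDl mulr_ge0 ?powR_ge0//; lra.
rewrite normrM (normJp r wy r0) normrM.
have h2 := @ler_powR2 R (r + 1) `|wy| 2 (addr_ge0 r0 ler01) (normr_ge0 _) wy2.
have XY : `|X + Y| <= 2 by rewrite ger0_norm ?addr_ge0//; lra.
rewrite mulrA ler_wpM2r//.
apply: (@le_trans _ _ (2 `^ (r + 1) * 2)); first by apply: ler_pM => //; exact: powR_ge0.
by rewrite /testc mulrC lerDr !mulr_ge0 ?powR_ge0//; lra.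
Qed.

End real_tools.

Section test_function.
Context {R : realType} {N : nat}.
Local Notation T := (N.-tuple R).
Local Notation mu2 := (muN R N \x muN R N)%E.
Variables (v : T -> R) (x0 h : T) (Rr rho d r : R).
Hypotheses (mv : measurable_fun setT v)
  (vbd : forall x, eball x0 Rr x -> `|v x| <= 1)
  (d01 : 0 < d <= 1) (hd : enorm h < d) (rho0 : 0 <= rho) (rR : rho + 6 * d <= Rr) (r0 : 0 <= r).

(** The radii are spaced by multiples of [d] because a shift by [h] moves points by less than [d].
    The cutoff is 1 up to [rho + 2 d], a margin consumed by [averaging], and vanishes from
    [rho + 3 d] on. The gap from there to [rho + 5 d] keeps the two points of a far interaction [d]
    apart even after the shift, and [rho + 6 d <= Rr] keeps the shift of [B] where [v] is
    bounded. *)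
Local Notation B := (eball x0 (rho + 5 * d)).
Local Notation w := (diff v h).

(* [|w| ^ r w eta ^ 2] with [w = diff v h]; the powers of [w] on the left-hand side
   of the energy estimate raise the integrability exponent. *)
Definition testf (x : T) : R := Jp r (diff v h x) * (cutoff x0 (rho + 2 * d) d x) ^+ 2.
Local Notation eta := (cutoff x0 (rho + 2 * d) d).

Let d0 : 0 < d. Proof. by case/andP: d01. Qed.

Lemma eball_shift x e : eball x0 e x -> eball x0 (e + d) (tadd x h).
Proof.
rewrite /eball/= => xe; have := edist_triangle x (tadd x h) x0.
by rewrite (edistC (tadd x h) x) edist_taddr; move: xe hd; lra.
Qed.

Lemma testB_sub x : B x -> eball x0 Rr x.
Proof. by rewrite /eball/=; move: rR d0; lra. Qed.

Lemma testB_sub_shift x : B x -> eball x0 Rr (tadd x h).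
Proof. by move=> /eball_shift; rewrite /eball/=; move: rR d0; lra. Qed.

Lemma test_diff_le2 x : B x -> `|w x| <= 2.
Proof.
move=> Bx; rewrite /diff (le_trans (ler_normB _ _))//.
have := vbd _ (testB_sub _ Bx); have := vbd _ (testB_sub_shift _ Bx); lra.
Qed.

Lemma cutoff_out x : ~ eball x0 (rho + 3 * d) x -> eta x = 0.
Proof.
rewrite /eball/= => /negP; rewrite -leNgt => xB; apply: cutoff0 => //.
by move: xB; lra.
Qed.

Lemma testf_out x : ~ eball x0 (rho + 3 * d) x -> testf x = 0.
Proof. by move=> /cutoff_out xB; rewrite /testf xB expr0n mulr0. Qed.

Lemma test_supp_sub x : eball x0 (rho + 3 * d) x -> B x.
Proof. by rewrite /eball/=; move: d0; lra. Qed.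

Lemma testf_outB x : ~ B x -> testf x = 0.
Proof. by move=> xB; apply: testf_out => /test_supp_sub. Qed.

Lemma cutoff_outB x : ~ B x -> eta x = 0.
Proof. by move=> xB; apply: cutoff_out => /test_supp_sub. Qed.

Lemma measurable_diff : measurable_fun setT w.
Proof. by rewrite /diff; msr. Qed.

Lemma measurable_testf : measurable_fun setT testf.
Proof.
have mJ := @measurable_Jp R r; have mw := measurable_diff.
have mc := @measurable_cutoff R N x0 (rho + 2 * d) d.
by rewrite /testf; msr.
Qed.

Lemma testf_bd x : `|testf x| <= 2 `^ (r + 1).
Proof.
have [Bx|Bx] := pselect (B x); last by rewrite testf_outB// normr0 powR_ge0.
rewrite /testf normrM normJp// -[leRHS]mulr1; apply: ler_pM => //.
  by apply: ler_powR2 => //; [rewrite addr_ge0|exact: test_diff_le2].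
have /andP[c0 c1] := cutoff01 x0 (rho + 2 * d) d x.
by rewrite ger0_norm ?sqr_ge0// expr2 mulr_ile1.
Qed.

(** The increments of the test function are bounded by those of [v] at the shifted and the unshifted
    points, of finite energy in the ball, and by those of the cutoff, whose energy is finite because
    [tau < m]. *)
Lemma testf_gag (m tau : R) : 1 <= m -> 0 < tau < m ->
  (\int[mu2]_z (gag m tau (eball x0 Rr) v z)%:E < +oo)%E ->
  (\int[mu2]_z (gag m tau setT testf z)%:E < +oo)%E.
Proof.
move=> m1 /andP[t0 tm] fin.
have mp : 0 < m by exact: lt_le_trans ltr01 m1.
have m0 := ltW mp.
have mB : measurable B by exact: measurable_eball.
have mBR : measurable (eball x0 Rr) by exact: measurable_eball.
pose c := (testc r * 2) `^ m * 4 `^ m : R.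
have c0 : 0 <= c by rewrite mulr_ge0 ?powR_ge0.
pose G := gag m tau (eball x0 Rr) v.
have mG : measurable_fun setT G by exact: measurable_gag.
have G0 z : 0 <= G z by exact: gag_ge0.
have mk := @measurable_kern2 R N m tau.
have mt := measurable_testf.
have mgt : measurable_fun setT (gag m tau setT testf).
  by apply: measurable_gag.
pose I (x : T) : R := \1_B x.
have mI : measurable_fun setT I by exact: measurable_indic.
have I0 x : 0 <= I x by rewrite /I.
have dm0 : 0 <= (d `^ m)^-1 by rewrite invr_ge0 powR_ge0.
have key x y : gag m tau setT testf (x, y) <=
    c * (G (tadd x h, tadd y h) + G (x, y) + (d `^ m)^-1 * ((I x + I y) * kern2 m tau (x, y))).
  have RHS0 : 0 <= c * (G (tadd x h, tadd y h) + G (x, y) + (d `^ m)^-1 * ((I x + I y) * kern2 m tau (x, y))).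
    rewrite mulr_ge0// addr_ge0 ?addr_ge0// mulr_ge0// mulr_ge0 ?kern2_ge0//.
    by rewrite addr_ge0.
  rewrite {1}/gag /= !indicE !in_setT !mul1r.
  set K := edist x y `^ _; have K0 : 0 <= K^-1 by rewrite invr_ge0 powR_ge0.
  have [BB|nBB] := pselect (B x \/ B y); last first.
    have [nx ny] : ~ B x /\ ~ B y by split => b; apply: nBB; [left|right].
    rewrite !testf_outB// subrr normr0 powR0 ?mul0r//.
    by rewrite gt_eqF.
  (* [J] is the indicator of both points lying in [B]. If one point is outside, the test function
     and the cutoff vanish there, and the increment of the cutoff alone is a bound. *)
  pose J : R := I x * I y.
  have hlip : `|testf x - testf y| <= testc r * 2 *
     (J * `|v (tadd x h) - v (tadd y h)| + (J * `|v x - v y| + `|eta x - eta y|)).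
    have cx := cutoff01 x0 (rho + 2 * d) d x; have cy := cutoff01 x0 (rho + 2 * d) d y.
    have tc := testc_ge0 r r0.
    have [Bx|nBx] := pselect (B x); have [By|nBy] := pselect (B y).
    - rewrite /J /I !indicE !mem_set// !mul1r.
      apply: (le_trans (test_lip r _ _ _ _ r0 (test_diff_le2 _ Bx) (test_diff_le2 _ By) cx cy)).
      rewrite -mulrA ler_wpM2l//.
      have : `|w x - w y| <= `|v (tadd x h) - v (tadd y h)| + `|v x - v y|.
        rewrite /diff (_ : _ - _ = (v (tadd x h) - v (tadd y h)) - (v x - v y)); last by ring.
        exact: ler_normB.
      have := normr_ge0 (eta x - eta y); have := normr_ge0 (v (tadd x h) - v (tadd y h)).
      have := normr_ge0 (v x - v y).
      by lra.
    - have J0 : J = 0 by rewrite /J /I [X in _ * X]indicE memNset// mulr0.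
      rewrite J0 !mul0r !add0r (testf_outB y)// (cutoff_outB y)//.
      have h1 : `|Jp r (w x)| <= 2 `^ (r + 1).
        rewrite normJp//; apply: ler_powR2 => //; [by rewrite addr_ge0|exact: test_diff_le2].
      rewrite !subr0 /testf normrM.
      move: cx => /andP[cx0 cx1]; rewrite (ger0_norm (sqr_ge0 _)) (ger0_norm cx0).
      apply: ler_pM => //; first exact: sqr_ge0; last by rewrite expr2 ler_piMr.
      apply: (le_trans h1); rewrite /testc.
      have := mulr_ge0 (le_trans (addr_ge0 r0 ler01) (lipc_gt r r0)) (mulr_ge0 (ler0n R 2) (powR_ge0 2 r)).
      have := powR_ge0 (2 : R) (r + 1); lra.
    - have J0 : J = 0 by rewrite /J /I [X in X * _]indicE memNset// mul0r.
      rewrite J0 !mul0r !add0r (testf_outB x)// (cutoff_outB x)// !sub0r !normrN.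
      have h1 : `|Jp r (w y)| <= 2 `^ (r + 1).
        rewrite normJp//; apply: ler_powR2 => //; [by rewrite addr_ge0|exact: test_diff_le2].
      rewrite /testf normrM.
      move: cy => /andP[cy0 cy1]; rewrite (ger0_norm (sqr_ge0 _)) (ger0_norm cy0).
      apply: ler_pM => //; first exact: sqr_ge0; last by rewrite expr2 ler_piMr.
      apply: (le_trans h1); rewrite /testc.
      have := mulr_ge0 (le_trans (addr_ge0 r0 ler01) (lipc_gt r r0)) (mulr_ge0 (ler0n R 2) (powR_ge0 2 r)).
      have := powR_ge0 (2 : R) (r + 1); lra.
    - by case: BB.
  have tc := testc_ge0 r r0.
  have J01 : J = 0 \/ J = 1.
    by rewrite /J /I !indicE; case: (x \in _); case: (y \in _); rewrite ?mulr1 ?mulr0; [right|left|left|left].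
  have J0 : 0 <= J by case: J01 => ->.
  have hpow : `|testf x - testf y| `^ m <= c *
     (J * `|v (tadd x h) - v (tadd y h)| `^ m + J * `|v x - v y| `^ m + (d `^ m)^-1 * Num.min 1 (edist x y `^ m)).
    apply: (@le_trans _ _ ((testc r * 2 * (J * `|v (tadd x h) - v (tadd y h)| + (J * `|v x - v y| + `|eta x - eta y|))) `^ m)).
      exact: ler_powR2.
    rewrite powRM ?mulr_ge0 ?addr_ge0 ?mulr_ge0// /c -mulrA.
    apply: ler_wpM2l; first exact: powR_ge0.
    apply: (le_trans (@powR_le_add3 R (J * `|v (tadd x h) - v (tadd y h)|) (J * `|v x - v y|) `|eta x - eta y| _ m m0 _ _ _ _ (lexx _))); rewrite ?addr_ge0 ?mulr_ge0//.
    apply: ler_wpM2l; first exact: powR_ge0.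
    have Jm : J `^ m = J by case: J01 => ->; rewrite ?powR1// powR0// gt_eqF.
    rewrite (@powRM _ J _ m J0 (normr_ge0 _)) (@powRM _ J _ m J0 (normr_ge0 _)) Jm lerD2l.
    apply: (@le_trans _ _ ((Num.min 1 (edist x y) / d) `^ m)).
      apply: ler_powR2 => //; exact: cutoff_lip.
    have mn0 : 0 <= Num.min 1 (edist x y) by rewrite le_min ler01 edist_ge0.
    rewrite powRM// ?invr_ge0 ?(ltW d0)// mulrC.
    rewrite -(powR_inv1 (ltW d0)) -powRrM mulN1r powRN ler_wpM2l//.
    by apply: min1_powR => //; exact: edist_ge0.
  apply: (@le_trans _ _ (c *
     (J * `|v (tadd x h) - v (tadd y h)| `^ m + J * `|v x - v y| `^ m + (d `^ m)^-1 * Num.min 1 (edist x y `^ m)) / K)).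
    exact: ler_wpM2r.
  rewrite -mulrA; apply: ler_wpM2l => //.
  rewrite !mulrDl; apply: lerD; first apply: lerD.
  - rewrite /G /gag /= edist_tadd2r -/K -mulrA.
    apply: ler_wpM2r; first by rewrite mulr_ge0 ?powR_ge0.
    rewrite /J /I !indicE.
    apply: ler_pM => //; case: (boolP (_ \in B)) => // /set_mem b; rewrite mem_set//; exact: testB_sub_shift.
  - rewrite /G /gag /= -/K -mulrA.
    apply: ler_wpM2r; first by rewrite mulr_ge0 ?powR_ge0.
    rewrite /J /I !indicE.
    apply: ler_pM => //; case: (boolP (_ \in B)) => // /set_mem b; rewrite mem_set//; exact: testB_sub.
  - rewrite -mulrDl /kern2 /= -/K -[leLHS]mulrA ler_wpM2l// ler_peMl//.
      by rewrite mulr_ge0// le_min ler01 powR_ge0.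
    by case: BB => b; rewrite /I !indicE ?(mem_set b) ?lerDl ?lerDr.
have mGh : measurable_fun setT (fun z => G (tadd z.1 h, tadd z.2 h)) by msr.
have eqG := int2_tadd G h mG G0.
have finG : (\int[mu2]_z (G z)%:E < +oo)%E := fin.
clearbody G.
have mK : measurable_fun setT (fun z : T * T => (I z.1 + I z.2) * kern2 m tau z) by msr.
have K0 (z : T * T) : 0 <= (I z.1 + I z.2) * kern2 m tau z.
  by rewrite mulr_ge0 ?kern2_ge0// addr_ge0.
apply: (@le_lt_trans _ _ (\int[mu2]_z (c * (G (tadd z.1 h, tadd z.2 h) + G z +
   (d `^ m)^-1 * ((I z.1 + I z.2) * kern2 m tau z)))%:E)%E).
  apply: intR_le.
  - exact: mgt.
  - by msr.
  - by move=> z; exact: gag_ge0.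
  - by move=> -[x y]; exact: key.
rewrite intRZ//; last 2 first.
  by msr.
  by move=> z; rewrite addr_ge0 ?addr_ge0// mulr_ge0.
rewrite lte_mul_pinfty//.
rewrite intRD; last 4 first.
- by msr.
- by msr.
- by move=> z; rewrite addr_ge0.
- by move=> z; rewrite mulr_ge0.
rewrite (intRD _ _ _ _ G mGh mG)//.
apply: lte_add_pinfty; first by apply: lte_add_pinfty; rewrite ?eqG.
rewrite intRZ//; apply: lte_mul_pinfty => //.
apply: (le_lt_trans (int2_kern2_sym m tau I t0 tm mI I0)).
rewrite lte_mul_pinfty ?lee_fin ?mulr_ge0 ?kmass_ge0//.
rewrite /I integral_indic// setIT.
by apply: (le_lt_trans (muN_eball_le _ _ _)); rewrite ?ltry// addr_ge0// mulr_ge0// (ltW d0).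
Qed.

End test_function.

(** * The energy estimate for finite differences *)

Section energy_pointwise.
Context {R : realType} {N : nat}.
Local Notation T := (N.-tuple R).
Local Notation mu2 := (muN R N \x muN R N)%E.

Lemma gag_tadd (m tau : R) (phi : T -> R) (k : T) z :
  gag m tau setT (fun x => phi (tadd x k)) z = gag m tau setT phi (tadd z.1 k, tadd z.2 k).
Proof. by rewrite /gag /= edist_tadd2r !indicE !in_setT. Qed.

Lemma admissible_testf (s1 p s lam : R) (x0 : T) (Rr : R) v Z (h : T) (rho d r : R) :
  0 < s1 < 1 -> 2 <= p -> 0 < s < 1 ->
  nsol s1 p s lam x0 Rr v Z -> 0 < d <= 1 -> enorm h < d -> 0 <= rho ->
  rho + 6 * d <= Rr -> 0 <= r ->
  admissible s1 p s x0 Rr (testf v x0 h rho d r) /\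
  admissible s1 p s x0 Rr (fun x => testf v x0 h rho d r (tadd x (topp h))).
Proof.
move=> /andP[s10 s11] p2 /andP[s0 s01] sol d01 hd rho0 rR r0.
have [mv bd] := (ns_mv _ _ _ _ _ _ _ _ sol, ns_bd _ _ _ _ _ _ _ _ sol).
have d0 : 0 < d by case/andP: d01.
set phi := testf v x0 h rho d r.
have mphi : measurable_fun setT phi by exact: measurable_testf.
have bphi x : `|phi x| <= 2 `^ (r + 1).
  by apply: (testf_bd v x0 h Rr).
have g1 : (\int[mu2]_z (gag 1 s1 setT phi z)%:E < +oo)%E.
  apply: (testf_gag v x0 h Rr rho d r mv bd d01 hd rho0 rR r0); [exact: lexx|by rewrite s10|].
  exact: ns_gag1 _ _ _ _ _ _ _ _ sol.
have gp : (\int[mu2]_z (gag p (s * p) setT phi z)%:E < +oo)%E.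
  have p0 : 0 < p by exact: lt_le_trans p2.
  apply: (testf_gag v x0 h Rr rho d r mv bd d01 hd rho0 rR r0).
  - by apply: le_trans p2; rewrite ler1n.
  - by rewrite mulr_gt0// gtr_pMl.
  - by apply: (le_lt_trans (ns_gag _ _ _ _ _ _ _ _ sol)); rewrite ltry.
have out x : ~ eball x0 (rho + 3 * d) x -> phi x = 0 by exact: testf_out.
split.
  split => //; first by exists (2 `^ (r + 1)).
  move=> x xR; apply: out; apply: contra_not xR; rewrite /eball/=.
  by move: rR d0; clear; lra.
have mG (m tau : R) : measurable_fun setT (gag m tau setT phi) by exact: measurable_gag.
split.
- by msr.
- by exists (2 `^ (r + 1)) => x; exact: bphi.
- move=> x xR; apply: out; apply: contra_not xR; rewrite /eball/=.
  have := edist_triangle (tadd x (topp h)) x x0.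
  by rewrite edist_taddr enorm_topp; move: rR d0 hd; clear; lra.
- under eq_integral do rewrite gag_tadd.
  by rewrite (int2_tadd (gag 1 s1 setT phi))// => z; exact: gag_ge0.
- under eq_integral do rewrite gag_tadd.
  by rewrite (int2_tadd (gag p (s * p) setT phi))// => z; exact: gag_ge0.
Qed.

(* The three error terms produced by the cutoff: both points near the centre, one
   point far away, and the 1-part of the operator, whose principal part has a sign
   because [Z] is a monotone selection. *)
Definition near_err (p s b : R) (B : set T) (v : T -> R) (h : T) (eta : T -> R) (z : T * T) : R :=
  \1_B z.1 * \1_B z.2 *
  ((`|v (tadd z.1 h) - v (tadd z.2 h)| `^ (p - 2) + `|v z.1 - v z.2| `^ (p - 2)) *
   (`|diff v h z.1| `^ (b + 1) + `|diff v h z.2| `^ (b + 1)) * (eta z.1 - eta z.2) ^+ 2)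
  / edist z.1 z.2 `^ (N%:R + s * p).

Definition far_err (p s b : R) (B3 B : set T) (v : T -> R) (h : T) (z : T * T) : R :=
  \1_B3 z.1 * `|diff v h z.1| `^ b *
  (\1_(~` B) z.2 * (2 + `|v (tadd z.2 h)| `^ (p - 1) + `|v z.2| `^ (p - 1)))
  / edist z.1 z.2 `^ (N%:R + s * p).

Definition sign_err (s1 b : R) (B : set T) (v : T -> R) (h : T) (eta : T -> R) (z : T * T) : R :=
  2 * ((\1_B z.1 * `|diff v h z.1| `^ b + \1_B z.2 * `|diff v h z.2| `^ b) *
  `|eta z.1 - eta z.2|) / edist z.1 z.2 `^ (N%:R + s1).

Lemma near_err_ge0 p s b B v h eta z : 0 <= near_err p s b B v h eta z.
Proof. by rewrite /near_err mulr_ge0 ?invr_ge0 ?powR_ge0// mulr_ge0// mulr_ge0 ?sqr_ge0. Qed.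

Lemma far_err_ge0 p s b B3 B v h z : 0 <= far_err p s b B3 B v h z.
Proof. by rewrite /far_err mulr_ge0 ?invr_ge0 ?powR_ge0// mulr_ge0. Qed.

Lemma sign_err_ge0 s1 b B v h eta z : 0 <= sign_err s1 b B v h eta z.
Proof.
by rewrite /sign_err mulr_ge0 ?invr_ge0 ?powR_ge0// mulr_ge0// mulr_ge0.
Qed.

Lemma far_pointwise (p a b vx vxh vy vyh : R) : 2 <= p -> `|vx| <= 1 -> `|vxh| <= 1 ->
  a = vxh - vyh -> b = vx - vy ->
  `|Jp (p - 2) a - Jp (p - 2) b| <= 2 `^ (p - 1) * (2 + `|vyh| `^ (p - 1) + `|vy| `^ (p - 1)).
Proof.
move=> p2 vx1 vxh1 -> ->.
have p20 : 0 <= p - 2 by lra.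
have p10 : 0 <= p - 1 by lra.
have E : p - 2 + 1 = p - 1 by ring.
rewrite (le_trans (ler_normB _ _))// !normJp// E.
have aux (x y : R) : `|x| <= 1 -> `|x - y| `^ (p - 1) <= 2 `^ (p - 1) * (1 + `|y| `^ (p - 1)).
  move=> x1; have := @powR_le_add R 1 `|y| `|x - y| (p - 1) p10 (normr_ge0 _) ler01 (normr_ge0 _).
  by rewrite powR1; apply; rewrite (le_trans (ler_normB _ _))// lerD2r.
have h1 := aux vx vy vx1; have h2 := aux vxh vyh vxh1.
rewrite (_ : 2 + _ + _ = (1 + `|vyh| `^ (p - 1)) + (1 + `|vy| `^ (p - 1))); last by ring.
by rewrite mulrDr lerD.
Qed.

(** Monotonicity of the sign graph, for any selection: of two unequal increments either the larger
    is positive, and its sign is 1, or the smaller is negative, and its sign is -1; [|Z| <= 1]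
    handles the other sign. *)
Lemma sgn_diff (Z : T * T -> R) (v : T -> R) z z' :
  (forall z, `|Z z| <= 1) -> (forall z, v z.2 < v z.1 -> Z z = 1) ->
  (forall z, v z.1 < v z.2 -> Z z = -1) ->
  0 <= (Z z' - Z z) * ((v z'.1 - v z'.2) - (v z.1 - v z.2)).
Proof.
move=> Z1 Zp Zn.
have := Z1 z; have := Z1 z'; rewrite !ler_norml => /andP[a1 a2] /andP[b1 b2].
have [ab|ab|->] := ltgtP (v z'.1 - v z'.2) (v z.1 - v z.2); last by rewrite subrr mulr0.
  apply: mulr_le0; last by lra.
  have [c|c] := ltP (v z.2) (v z.1); first by rewrite (Zp z)//; lra.
  by rewrite (Zn z'); lra.
apply: mulr_ge0; last by lra.
have [c|c] := ltP (v z'.2) (v z'.1); first by rewrite (Zp z')//; lra.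
by rewrite (Zn z); lra.
Qed.

(** * Pointwise lower bounds for the tested equation *)

Section pointwise.
Variables (s1 p s lam : R) (x0 : T) (Rr : R) (v : T -> R) (Z : T * T -> R) (h : T) (rho d b : R).
Hypotheses (p2 : 2 <= p) (sol : nsol s1 p s lam x0 Rr v Z) (d01 : 0 < d <= 1)
  (hd : enorm h < d) (rho0 : 0 <= rho) (rR : rho + 6 * d <= Rr) (b1 : 1 <= b).

Local Notation B := (eball x0 (rho + 5 * d)).
Local Notation B3 := (eball x0 (rho + 3 * d)).
Local Notation B2 := (eball x0 (rho + 2 * d)).
Local Notation w := (diff v h).
Local Notation eta := (cutoff x0 (rho + 2 * d) d).
Local Notation phi := (testf v x0 h rho d (b - 1)).

Let d0 : 0 < d. Proof. by case/andP: d01. Qed.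
Let bb : b - 1 + 1 = b. Proof. by rewrite subrK. Qed.
Let b10 : 0 <= b - 1. Proof. by rewrite subr_ge0. Qed.

Let phi_out x : ~ B3 x -> phi x = 0.
Proof. exact: testf_out. Qed.

Let phi_outB x : ~ B x -> phi x = 0.
Proof. exact: testf_outB. Qed.

Let phi_le x : `|phi x| <= `|w x| `^ b * eta x.
Proof.
rewrite /testf normrM normJp// bb ler_wpM2l ?powR_ge0//.
have /andP[c0 c1] := cutoff01 x0 (rho + 2 * d) d x.
by rewrite ger0_norm ?sqr_ge0// expr2 ler_piMr.
Qed.

Let eta_le1 x : eta x <= 1.
Proof. by case/andP: (cutoff01 x0 (rho + 2 * d) d x). Qed.

Let eta_ge0 x : 0 <= eta x.
Proof. by case/andP: (cutoff01 x0 (rho + 2 * d) d x). Qed.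

Let B2B x : B2 x -> B x.
Proof. by rewrite /eball/=; move: d0; lra. Qed.

(** Both points in [B]: [sign_pointwise], fed with the monotonicity of the sign. One point outside:
    the test function and the cutoff vanish there, and [|D| <= 2] is enough. Both outside: nothing
    remains. *)
Lemma sign_lower z : - sign_err s1 b B v h eta z <=
  (Z (tadd z.1 h, tadd z.2 h) - Z z) * (phi z.1 - phi z.2) / edist z.1 z.2 `^ (N%:R + s1).
Proof.
case: z => x y; rewrite /sign_err /= -mulNr; apply: ler_wpM2r; first by rewrite invr_ge0 powR_ge0.
set D := Z _ - Z _.
have D2 : `|D| <= 2.
  rewrite (le_trans (ler_normB _ _))// (_ : 2 = 1 + 1)// ; apply: lerD; exact: (ns_Z1 _ _ _ _ _ _ _ _ sol).
have side (wx e : R) : 0 <= e -> `|D * wx| <= 2 * e -> - (2 * e) <= D * wx.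
  by move=> _; rewrite ler_norml => /andP[].
(* [x'] is the point in [B]; the factor [sg], equal to 1 or -1, records in which order the points
   were given. *)
have one x' y' sg : B x' -> ~ B y' -> `|sg| = 1 ->
    - (2 * ((`|w x'| `^ b) * `|eta x' - eta y'|)) <= D * (sg * (phi x' - phi y')).
  move=> Bx By sg1.
  rewrite (phi_outB y' By) (cutoff_outB x0 rho d d01 y' By) !subr0 lerNl -mulrN.
  rewrite (le_trans (ler_norm _))// normrM normrN normrM sg1 mul1r.
  apply: ler_pM => //; rewrite (ger0_norm (eta_ge0 _)); exact: phi_le.
rewrite !indicE.
have [Bx|nBx] := pselect (B x); have [By|nBy] := pselect (B y).
- rewrite !mem_set// !mul1r.
  have := @sign_pointwise R (b - 1) D (w x) (w y) (eta x) (eta y) b10.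
  rewrite bb; apply => //; rewrite ?eta_ge0 ?eta_le1//.
  + have := @sgn_diff Z v (x, y) (tadd x h, tadd y h) (ns_Z1 _ _ _ _ _ _ _ _ sol)
      (ns_Zp _ _ _ _ _ _ _ _ sol) (ns_Zn _ _ _ _ _ _ _ _ sol).
    rewrite /= -/D; congr (0 <= D * _); rewrite /diff; ring.
  + by move=> ->; rewrite subrr mulr0.
- rewrite mem_set// memNset// mul1r mul0r addr0.
  by have := one x y 1 Bx nBy (normr1 _); rewrite mul1r.
- rewrite memNset// mem_set// mul1r mul0r add0r.
  have := one y x (-1) By nBx; rewrite normrN normr1 => /(_ erefl).
  by rewrite mulN1r opprB (distrC (eta y)).
- by rewrite !memNset// !mul0r addr0 mul0r mulr0 oppr0 !phi_outB// subrr mulr0.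
Qed.

(** Both points in [B]: [caccioppoli_pointwise]. Exactly one in [B]: the principal term vanishes, as
    [B2] is contained in [B], and the test function is nonzero only if the point in [B] is already
    in [B3]. The far error occurs in both orders because either point may be the distant one. *)
Lemma energy_lower z :
  (16 * 2 `^ (p - 2 + (b - 1)))^-1 * gag (p + b - 1) (s * p) B2 w z
  - (16 * lipc (p - 2) ^+ 2 * near_err p s b B v h eta z +
     2 `^ (p - 1) * (far_err p s b B3 B v h z + far_err p s b B3 B v h (z.2, z.1)))
  <= (Jp (p - 2) (v (tadd z.1 h) - v (tadd z.2 h)) - Jp (p - 2) (v z.1 - v z.2))
              * (phi z.1 - phi z.2) / edist z.1 z.2 `^ (N%:R + s * p).
Proof.
case: z => x y /=.
set D := Jp _ _ - Jp _ _.
set K := edist x y `^ (N%:R + s * p).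
have K0 : 0 <= K^-1 by rewrite invr_ge0 powR_ge0.
have p20 : 0 <= p - 2 by rewrite subr_ge0.
have c0 : 0 <= (16 * 2 `^ (p - 2 + (b - 1)))^-1 :> R by rewrite invr_ge0 mulr_ge0// powR_ge0.
have L0 : 0 <= 16 * lipc (p - 2) ^+ 2 :> R by rewrite mulr_ge0// sqr_ge0.
have t0 : 0 <= 2 `^ (p - 1) :> R by exact: powR_ge0.
have f1 := far_err_ge0 p s b B3 B v h (x, y).
have f2 := far_err_ge0 p s b B3 B v h (y, x).
have n1 := near_err_ge0 p s b B v h eta (x, y).
(* [D'] is the difference of fluxes written from the point in [B]; exchanging the points changes [D]
   only by a sign, so one argument covers both orders. *)
have one x' y' sg D' : B x' -> ~ B y' -> `|sg| = 1 -> D' = D \/ D' = - D ->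
    D' = Jp (p - 2) (v (tadd x' h) - v (tadd y' h)) - Jp (p - 2) (v x' - v y') ->
    edist x' y' = edist x y ->
    - (2 `^ (p - 1) * far_err p s b B3 B v h (x', y')) <= D * (sg * (phi x' - phi y')) / K.
  move=> Bx By sg1 DD D'E dE.
  rewrite (phi_outB y' By) subr0.
  have [B3x|nB3x] := pselect (B3 x'); last first.
    rewrite (phi_out x' nB3x) !mulr0 mul0r oppr_le0.
    by apply: mulr_ge0; [exact: t0|exact: far_err_ge0].
  rewrite lerNl; apply: (le_trans (ler_norm _)).
  rewrite normrN normrM (ger0_norm K0) normrM normrM sg1 mul1r.
  rewrite /far_err /= dE -/K !indicE !mem_set// !mul1r mulrA.
  apply: ler_wpM2r => //.
  have hD : `|D| <= 2 `^ (p - 1) * (2 + `|v (tadd y' h)| `^ (p - 1) + `|v y'| `^ (p - 1)).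
    have -> : `|D| = `|D'| by case: DD => ->; rewrite ?normrN.
    rewrite D'E; apply: (@far_pointwise _ _ _ (v x') (v (tadd x' h)) (v y') (v (tadd y' h))) => //.
      by apply: (ns_bd _ _ _ _ _ _ _ _ sol); apply: (testB_sub _ _ _ _ d01 rR).
    by apply: (ns_bd _ _ _ _ _ _ _ _ sol); apply: (testB_sub_shift _ _ _ _ _ d01 hd rR).
  have hphi : `|phi x'| <= `|w x'| `^ b.
    by rewrite (le_trans (phi_le x'))// ler_piMr// powR_ge0.
  rewrite [leRHS](_ : _ = 2 `^ (p - 1) * (2 + `|v (tadd y' h)| `^ (p - 1) + `|v y'| `^ (p - 1)) * `|w x'| `^ b); last by ring.
  exact: ler_pM.
have [Bx|nBx] := pselect (B x); have [By|nBy] := pselect (B y).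
- have cac := @caccioppoli_pointwise R (p - 2) (b - 1) (v (tadd x h) - v (tadd y h)) (v x - v y)
    (w x) (w y) (eta x) (eta y) p20 b10 (cutoff01 _ _ _ _) (cutoff01 _ _ _ _).
  have e1 : v (tadd x h) - v (tadd y h) - (v x - v y) = w x - w y by rewrite /diff; ring.
  move/(_ e1): cac; rewrite -/D => cac.
  have cac' := ler_wpM2r K0 cac.
  apply: le_trans cac'; rewrite mulrBl; apply: lerB.
    rewrite -mulrA; apply: ler_wpM2l; first exact: c0.
    rewrite /gag /= -/K mulrA; apply: ler_wpM2r => //.
    have -> : p - 2 + (b - 1) + 2 = p + b - 1 by ring.
    rewrite mulrC; apply: ler_wpM2l; first exact: powR_ge0.
    rewrite !indicE; have [B2x|nB2x] := pselect (B2 x); last first.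
      by rewrite memNset// mul0r addr_ge0// sqr_ge0.
    have [B2y|nB2y] := pselect (B2 y); last first.
      by rewrite (memNset nB2y) mulr0 addr_ge0// sqr_ge0.
    have hx : edist x x0 <= rho + 2 * d by exact: ltW.
    have hy : edist y x0 <= rho + 2 * d by exact: ltW.
    by rewrite !mem_set// (cutoff1 _ _ _ _ d0 hx) (cutoff1 _ _ _ _ d0 hy) mulr1 expr1n lerDl.
  rewrite -[leLHS]mulrA -[leLHS]addr0; apply: lerD; last first.
    exact: (mulr_ge0 t0 (addr_ge0 f1 f2)).
  apply: ler_wpM2l; first exact: L0.
  rewrite /near_err /= -/K !indicE (mem_set Bx) (mem_set By) !mul1r.
  by rewrite (_ : b - 1 + 2 = b + 1); [exact: lexx|ring].
- have gz : gag (p + b - 1) (s * p) B2 w (x, y) = 0.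
    have nB2 : ~ B2 y by move=> /B2B.
    by rewrite /gag /= !indicE (memNset nB2) mulr0 mul0r.
  rewrite gz mulr0 sub0r.
  have := one x y 1 D Bx nBy (normr1 _) (or_introl erefl) erefl erefl; rewrite mul1r.
  apply: le_trans; rewrite lerN2 -[leLHS]add0r; apply: lerD; first exact: (mulr_ge0 L0 n1).
  apply: (ler_wpM2l t0); rewrite lerDl; exact: f2.
- have gz : gag (p + b - 1) (s * p) B2 w (x, y) = 0.
    have nB2 : ~ B2 x by move=> /B2B.
    by rewrite /gag /= !indicE (memNset nB2) !mul0r.
  rewrite gz mulr0 sub0r.
  have DN : Jp (p - 2) (v (tadd y h) - v (tadd x h)) - Jp (p - 2) (v y - v x) = - D.
    rewrite /D /Jp (distrC (v (tadd y h))) (distrC (v y)); ring.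
  have := one y x (-1) (- D) By nBx _ (or_intror erefl) (esym DN) (edistC _ _).
  rewrite normrN normr1 mulN1r opprB => /(_ erefl).
  apply: le_trans; rewrite lerN2 -[leLHS]add0r; apply: lerD; first exact: (mulr_ge0 L0 n1).
  apply: (ler_wpM2l t0); rewrite lerDr; exact: f1.
- have gz : gag (p + b - 1) (s * p) B2 w (x, y) = 0.
    have nB2 : ~ B2 x by move=> /B2B.
    by rewrite /gag /= !indicE (memNset nB2) !mul0r.
  rewrite (phi_outB x nBx) (phi_outB y nBy) subrr mulr0 mul0r gz mulr0 sub0r oppr_le0.
  exact: (addr_ge0 (mulr_ge0 L0 n1) (mulr_ge0 t0 (addr_ge0 f1 f2))).
Qed.

End pointwise.
End energy_pointwise.

Section real_tools2.
Context {R : realType}.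

Lemma powRN_le (d a b : R) : 0 < d <= 1 -> a <= b -> d `^ (- a) <= d `^ (- b).
Proof. by move=> d01 ab; apply: ger_powR => //; rewrite lerN2. Qed.

Lemma powRN_ge1 (d a : R) : 0 < d <= 1 -> 0 <= a -> 1 <= d `^ (- a).
Proof. by move=> d01 a0; rewrite -(powRr0 d) -[X in d `^ X]oppr0; exact: powRN_le. Qed.

Lemma powR_dvd (x t q : R) : 0 <= x -> 0 <= t -> (x / t) `^ q = x `^ q / t `^ q.
Proof.
move=> x0 t0; rewrite powRM// ?invr_ge0//; congr (_ * _).
by rewrite -powR_inv1// -powRrM mulN1r powRN.
Qed.

(** Young's inequality after dividing [A] and [W] by their expected sizes [t] and [u]: the product
    keeps the order [t ^ r u ^ b], and both quotients are bounded in mean. *)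
Lemma young_scaled (A W t u r b : R) : 0 <= A -> 0 <= W -> 0 < t -> 0 < u -> 0 <= r -> 0 <= b ->
  A `^ r * W `^ b <= t `^ r * u `^ b * (A `^ (r + b) / t `^ (r + b) + W `^ (r + b) / u `^ (r + b)).
Proof.
move=> A0 W0 t0 u0 r0 b0.
have h := @powR_young R (A / t) (W / u) r b (divr_ge0 A0 (ltW t0)) (divr_ge0 W0 (ltW u0)) r0 b0.
rewrite -!powR_dvd ?(ltW t0) ?(ltW u0)//.
have -> : A `^ r * W `^ b = t `^ r * u `^ b * ((A / t) `^ r * (W / u) `^ b).
  rewrite !powR_dvd ?(ltW t0) ?(ltW u0)//.
  have tn : t `^ r != 0 by rewrite gt_eqF// powR_gt0.
  have un : u `^ b != 0 by rewrite gt_eqF// powR_gt0.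
  by field; rewrite tn un.
by apply: ler_wpM2l => //; rewrite mulr_ge0 ?powR_ge0.
Qed.

Lemma powR_le1 (x r : R) : 0 <= x <= 1 -> 0 <= r -> x `^ r <= 1.
Proof.
move=> /andP[x0 x1] r0; rewrite -[leRHS](_ : 1 `^ r = 1); last by rewrite powR1.
exact: ler_powR2.
Qed.

Lemma powR_ge1x (x r : R) : 1 <= x -> 0 <= r -> 1 <= x `^ r.
Proof.
move=> x1 r0; rewrite -[leLHS](_ : 1 `^ r = 1); last by rewrite powR1.
exact: ler_powR2.
Qed.

(** Bookkeeping for the far error: [V4] is the bare kernel between [x] and [y], [V1] and [V2] are
    this kernel times the powers of [|v|] at [y] and [y + h], and [V3] is [V2] with the distance to
    [y + h] instead. [A1], [A2] are integrable kernels, [A3], [A4] tails. *)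
Lemma far_algebra (P D1 D2 A1 A2 A3 A4 V1 V2 V3 V4 : R) : 1 <= P -> 0 <= D1 -> 0 <= D2 ->
  0 <= A1 -> 0 <= A2 -> 0 <= A3 -> 0 <= A4 ->
  V4 <= D1 * A1 -> V1 <= D1 * A1 + D2 * A3 -> V2 <= P * V3 -> V3 <= D1 * A2 + D2 * A4 ->
  2 * V4 + V2 + V1 <= 3 * P * D1 * A1 + 3 * P * D1 * A2 + (3 * P * D2 * A3 + 3 * P * D2 * A4).
Proof.
move=> g1 D10 D20 a1 a2 a3 a4 H1 H2 H3 H4.
have P0 : 0 <= P by exact: le_trans g1.
have m1 : 0 <= D1 * A1 by exact: mulr_ge0.
have m2 : 0 <= D1 * A2 by exact: mulr_ge0.
have m3 : 0 <= D2 * A3 by exact: mulr_ge0.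
have m4 : 0 <= D2 * A4 by exact: mulr_ge0.
have n2 := mulr_ge0 P0 m2; have n4 := mulr_ge0 P0 m4.
have q1 : D1 * A1 <= P * (D1 * A1) by exact: ler_peMl.
have q3 : D2 * A3 <= P * (D2 * A3) by exact: ler_peMl.
have n3 := mulr_ge0 P0 m3.
have q4 := ler_wpM2l P0 H4.
lra.
Qed.

Lemma far_algebra2 (c km t1 t2 t3 t4 t5 : R) :
  c * km * t1 <= c * km * t2 -> c * (t4 * t3) <= c * (t5 * t2) ->
  c * t1 * km + c * t1 * km + (c * t4 * t3 + c * t4 * t3) <= c * (2 * km + 2 * t5) * t2.
Proof. lra. Qed.

Lemma far_factor (wx c1 a1 a2 c2 a3 a4 : R) :
  c1 * (wx * a1) + c1 * (wx * a2) + (c2 * (wx * a3) + c2 * (wx * a4)) =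
  wx * (c1 * a1 + c1 * a2 + (c2 * a3 + c2 * a4)).
Proof. by ring. Qed.

Lemma far_split (x y z : R) : (2 + x + y) / z = 2 * z^-1 + x / z + y / z.
Proof. by ring. Qed.

Lemma far_geom1 (e a d : R) : 0 < d -> a < d -> 2 * d <= e -> e + a <= 2 * e.
Proof. lra. Qed.

Lemma far_geom2 (rho d a b e : R) : a < rho + 3 * d -> rho + 5 * d <= b -> b <= e + a ->
  2 * d <= e.
Proof. lra. Qed.

Lemma far_geom3 (d e e' : R) : 0 < d -> 2 * d <= e -> e <= e' + d -> d <= e /\ d <= e'.
Proof. by move=> *; split; lra. Qed.

(** Three powers compete: [e ^ (sg (p - 2))] from the regularity reached by [v], [e ^ 2] from the
    squared increment of the cutoff, and the singular kernel. The condition [s <= sg] leaves an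
    excess of at least [3 - 2 s] over the exponent [n + 1], and [3 - 2 s > 1] makes
    [kern (3 - 2 s) 1] integrable. The constant is needed for [1 < e <= 2] only. *)
Lemma near_kernel_le (n e s p sg : R) : 0 < e -> e <= 2 -> 2 <= p -> 0 < s < 1 -> s <= sg <= 1 ->
  (e `^ sg) `^ (p - 2) * e ^+ 2 / e `^ (n + s * p) <=
  2 `^ (p + 1) * (Num.min 1 (e `^ (3 - 2 * s)) / e `^ (n + 1)).
Proof.
move=> e0 e2 p2 /andP[s0 s1] /andP[ssg sg1].
have en : (e == 0) = false by rewrite gt_eqF.
rewrite -powRrM -powR_mulrn ?(ltW e0)//.
have D (a b : R) : e `^ a * e `^ b = e `^ (a + b) by rewrite powRD// en implybT.
rewrite D -powRN D -powRN [leRHS]mulrA.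
set X := sg * (p - 2) + (2 - s * p + 1).
have -> : sg * (p - 2) + 2 - (n + s * p) = X + - (n + 1) by rewrite /X; ring.
rewrite -D; apply: ler_wpM2r; first exact: powR_ge0.
have X0 : 3 - 2 * s <= X.
  have : s * (p - 2) <= sg * (p - 2) by rewrite ler_wpM2r// subr_ge0.
  by rewrite /X; lra.
have X1 : X <= p + 1.
  have : sg * (p - 2) <= 1 * (p - 2) by rewrite ler_wpM2r// subr_ge0.
  have : 0 <= s * p by rewrite mulr_ge0// ltW// (lt_le_trans _ p2).
  by rewrite /X; lra.
have X00 : 0 <= X by lra.
have g1 : 1 <= 2 `^ (p + 1) :> R by apply: powR_ge1; lra.
have [el1|el1] := leP e 1.
  have h : e `^ X <= e `^ (3 - 2 * s) by apply: ger_powR => //; rewrite e0.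
  have hm : Num.min 1 (e `^ (3 - 2 * s)) = e `^ (3 - 2 * s).
    by rewrite min_r//; apply: powR_le1; [rewrite (ltW e0)|lra].
  rewrite hm (le_trans h)// ler_peMl ?powR_ge0//.
have hm : Num.min 1 (e `^ (3 - 2 * s)) = 1.
  by rewrite min_l//; apply: powR_ge1x; [exact: ltW|lra].
rewrite hm mulr1; apply: (@le_trans _ _ (2 `^ X)).
  by apply: ler_powR2 => //; exact: ltW.
by apply: ler_powR => //; rewrite ler1n.
Qed.

End real_tools2.

Section shear_bound.
Context {R : realType} {N : nat}.
Local Notation T := (N.-tuple R).
Local Notation mu := (muN R N).
Local Notation mu2 := (muN R N \x muN R N)%E.

(** Tonelli with the increment [k] outermost. The bound on [G k] is asked only where [a k] is
    nonzero, since in the application [G k] contains quotients by a power of [|k|]. *)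
Lemma int2_le_shear (F : T * T -> R) (a : T -> R) (G : T -> T -> R) (M : R) :
  measurable_fun setT F -> (forall z, 0 <= F z) -> measurable_fun setT a ->
  (forall k, 0 <= a k) -> (forall k, measurable_fun setT (G k)) -> (forall k x, 0 <= G k x) ->
  0 <= M ->
  (forall x k, F (x, tadd x k) <= a k * G k x) ->
  (forall k, a k != 0 -> (\int[mu]_x (G k x)%:E <= M%:E)%E) ->
  (\int[mu2]_z (F z)%:E <= M%:E * \int[mu]_k (a k)%:E)%E.
Proof.
move=> mF F0 ma a0 mG G0 M0 FG GM.
rewrite int2_shear//.
have mF' : measurable_fun setT (fun z => (F (z.1, tadd z.1 z.2))%:E).
  by apply: measurable_EFin_comp; exact: measurable_shear.
rewrite (fubini_tonelli2 (fun z => (F (z.1, tadd z.1 z.2))%:E) mF')//=; last first.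
  by move=> z; rewrite lee_fin.
rewrite -intRZ//; apply: ge0_le_integral => //.
- by move=> k _; apply: integral_ge0 => x _; rewrite lee_fin.
- exact: (@measurable_fun_fubini_tonelli_G _ _ _ _ _ mu _ mF' (fun z => F0 _)).
- by msr.
move=> k _; apply: (@le_trans _ _ (\int[mu]_x (a k * G k x)%:E)%E).
  apply: intR_le => //.
  - apply: (measurableT_comp mF).
    by apply: measurable_pair_comp; [exact: measurable_id|exact: measurable_taddr].
  - by have mGk := mG k; msr.
rewrite intRZ//; have [->|ak] := eqVneq (a k) 0; first by rewrite mul0e mulr0.
by rewrite mulrC EFinM lee_wpmul2l ?lee_fin//; exact: GM.
Qed.

End shear_bound.

(** * Integrals of the sign error and of the far error *)

Section energy_integrals.
Context {R : realType} {N : nat}.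
Local Notation T := (N.-tuple R).
Local Notation mu := (muN R N).
Local Notation mu2 := (muN R N \x muN R N)%E.

Lemma measurable_mul_fst (f : T -> R) (k : T * T -> R) : measurable_fun setT f ->
  measurable_fun setT k -> measurable_fun setT (fun z : T * T => f z.1 * k z).
Proof. by move=> mf mk; msr. Qed.

Lemma measurable_mul_fst_snd (f g : T -> R) : measurable_fun setT f ->
  measurable_fun setT g -> measurable_fun setT (fun z : T * T => f z.1 * g z.2).
Proof. by move=> mf mg; msr. Qed.

Lemma measurable_tadd_snd (k : T * T -> R) (h : T) : measurable_fun setT k ->
  measurable_fun setT (fun z : T * T => k (z.1, tadd z.2 h)).
Proof. by move=> mk; msr. Qed.

Lemma measurable_taddl (f : T -> R) (h : T) : measurable_fun setT f ->
  measurable_fun setT (fun y : T => f (tadd y h)).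
Proof. by move=> mf; msr. Qed.

Lemma integral_taddr (f : T -> R) (h : T) : measurable_fun setT f -> (forall x, 0 <= f x) ->
  (\int[mu]_x (f (tadd x h))%:E = \int[mu]_x (f x)%:E)%E.
Proof.
move=> mf f0; rewrite (@integral_tadd _ _ (fun y => (f y)%:E) h)//.
exact: measurable_EFin_comp.
Qed.

(* Nikol'skii regularity: [v] has [sg] derivatives in [L^q] on the ball. *)
Definition Hreg (v : T -> R) (x0 : T) (q sg rho K : R) : Prop := forall k : T,
  (\int[mu]_x (\1_(eball x0 rho) x * \1_(eball x0 rho) (tadd x k) * `|diff v k x| `^ q)%:E
   <= (K * (enorm k `^ sg) `^ q)%:E)%E.

Definition tailf (p s : R) (x0 : T) (Rr : R) (v : T -> R) (y : T) : R :=
  \1_(~` eball x0 Rr) y * (`|v y| `^ (p - 1) / edist y x0 `^ (N%:R + s * p)).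

Lemma tailf_ge0 p s x0 Rr v y : 0 <= tailf p s x0 Rr v y.
Proof. by rewrite /tailf mulr_ge0// divr_ge0 ?powR_ge0. Qed.

(** Away from the diagonal the bare kernel is dominated by the integrable [kern2], at the price of a
    power of [d]. *)
Lemma kern2_far (a b d : R) (x y : T) : 0 < d <= 1 -> 0 <= a -> d <= edist x y ->
  (edist x y `^ (N%:R + b))^-1 <= d `^ (- a) * kern2 a b (x, y).
Proof.
move=> /andP[d0 d1] a0 dxy; rewrite /kern2 /= mulrA ler_peMl ?invr_ge0 ?powR_ge0//.
rewrite powRN ler_pdivlMl ?powR_gt0// mulr1 le_min; apply/andP; split.
  by apply: powR_le1; rewrite ?(ltW d0).
by apply: ler_powR2 => //; exact: ltW.
Qed.

(** Inside the ball [|v| <= 1] and the kernel is enough. Outside, [|x - x0| <= 1 <= |x - y| / d]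
    gives [|y - x0| <= (2 / d) |x - y|], which moves the centre of the tail from [x] to [x0]. *)
Lemma tail_pointwise (p s d Rr : R) (x0 x y : T) (v : T -> R) :
  2 <= p -> 0 < s -> 0 < d <= 1 -> 0 < Rr ->
  (forall x, eball x0 Rr x -> `|v x| <= 1) -> edist x x0 <= 1 -> d <= edist x y ->
  `|v y| `^ (p - 1) / edist x y `^ (N%:R + s * p) <=
  d `^ (- (s * p + 1)) * kern2 (s * p + 1) (s * p) (x, y) +
  (2 / d) `^ (N%:R + s * p) * tailf p s x0 Rr v y.
Proof.
move=> p2 s0 d01 R0 bd x1 dxy; have /andP[d0 d1] := d01.
have sp0 : 0 <= s * p by rewrite mulr_ge0 ?(ltW s0)// (le_trans _ p2).
have sp1 : 0 <= s * p + 1 by rewrite addr_ge0.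
have k0 := kern2_ge0 (s * p + 1) (s * p) (x, y).
have t0 := tailf_ge0 p s x0 Rr v y.
have c1 : 0 <= d `^ (- (s * p + 1)) by exact: powR_ge0.
have c2 : 0 <= (2 / d) `^ (N%:R + s * p) by exact: powR_ge0.
have Np : 0 <= N%:R + s * p by rewrite addr_ge0.
have [yB|yB] := pselect (eball x0 Rr y).
  rewrite -[leLHS]addr0; apply: lerD; last exact: mulr_ge0.
  apply: le_trans (kern2_far _ _ _ _ _ d01 sp1 dxy).
  rewrite ler_piMl ?invr_ge0 ?powR_ge0//.
  by apply: powR_le1; [rewrite normr_ge0/=; exact: bd|rewrite subr_ge0 (le_trans _ p2)// ler1n].
rewrite -[leLHS]add0r; apply: lerD; first exact: mulr_ge0.
rewrite /tailf indicE mem_set// mul1r mulrCA; apply: ler_wpM2l; first exact: powR_ge0.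
have yR : Rr <= edist y x0 by rewrite leNgt; apply/negP.
have y0 : 0 < edist y x0 by exact: lt_le_trans yR.
have e0 : 0 < edist x y by exact: lt_le_trans dxy.
rewrite ler_pdivlMr ?powR_gt0// ler_pdivrMl ?powR_gt0// [leRHS]mulrC -powRM ?divr_ge0 ?(ltW d0) ?(ltW e0)//.
apply: ler_powR2 => //; first exact: ltW.
apply: (le_trans (edist_triangle x _ _)); rewrite (edistC y).
have h1 : 1 <= edist x y / d by rewrite ler_pdivlMr// mul1r.
have h2 : edist x y <= edist x y / d by rewrite ler_pdivlMr// ler_piMr// ltW.
have -> : 2 / d * edist x y = edist x y / d + edist x y / d by ring.
exact: (lerD h2 (le_trans x1 h1)).
Qed.

Section bounds.
Variables (s1 p s lam : R) (x0 : T) (Rr : R) (v : T -> R) (Z : T * T -> R) (h : T) (rho d b : R).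
Hypotheses (p2 : 2 <= p) (s10 : 0 < s1 < 1) (s01 : 0 < s < 1)
  (sol : nsol s1 p s lam x0 Rr v Z) (d01 : 0 < d <= 1) (R1 : Rr < 1)
  (hd : enorm h < d) (rho0 : 0 <= rho) (rR : rho + 6 * d <= Rr) (b1 : 1 <= b).

Local Notation B := (eball x0 (rho + 5 * d)).
Local Notation B3 := (eball x0 (rho + 3 * d)).
Local Notation w := (diff v h).
Local Notation eta := (cutoff x0 (rho + 2 * d) d).

Let d0 : 0 < d. Proof. by case/andP: d01. Qed.
Let mv := ns_mv _ _ _ _ _ _ _ _ sol.
Let mw : measurable_fun setT w. Proof. exact: measurable_diff. Qed.
Let meta : measurable_fun setT eta. Proof. exact: measurable_cutoff. Qed.
Let mB : measurable B. Proof. exact: measurable_eball. Qed.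

Definition wb (x : T) : R := \1_B x * `|w x| `^ b.

Let mwb : measurable_fun setT wb. Proof. by rewrite /wb; msr. Qed.
Let wb0 x : 0 <= wb x. Proof. by rewrite /wb mulr_ge0// powR_ge0. Qed.

Lemma measurable_sign_err : measurable_fun setT (sign_err s1 b B v h eta).
Proof. by rewrite /sign_err; msr. Qed.

Lemma measurable_far_err : measurable_fun setT (far_err p s b B3 B v h).
Proof. by rewrite /far_err; msr. Qed.

Lemma measurable_near_err : measurable_fun setT (near_err p s b B v h eta).
Proof. by rewrite /near_err; msr. Qed.

(** The increment of the cutoff contributes [min (1, |x - y|) / d], which makes the kernel of order
    [s1 < 1] integrable. *)
Lemma int_sign_err : (\int[mu2]_z (sign_err s1 b B v h eta z)%:E <=
  (2 * d `^ (- 1) * (2 * kmass (N := N) 1 s1))%:E * \int[mu]_x (wb x)%:E)%E.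
Proof.
have /andP[s1p s1l] := s10.
have mk := @measurable_kern2 R N 1 s1.
have c0 : 0 <= 2 * d `^ (- 1) by rewrite mulr_ge0 ?powR_ge0.
rewrite EFinM -muleA; apply: le_trans; last first.
  apply: lee_wpmul2l; first by rewrite lee_fin.
  exact: (int2_kern2_sym 1 s1 wb s1p s1l mwb wb0).
rewrite -intRZ; last 3 first.
- by msr.
- by move=> z; rewrite mulr_ge0 ?kern2_ge0// addr_ge0.
- exact: c0.
apply: intR_le.
- exact: measurable_sign_err.
- by msr.
- by move=> z; exact: sign_err_ge0.
move=> -[x y]; rewrite /sign_err /kern2 /= -/(wb x) -/(wb y).
have h1 := cutoff_lip x0 (rho + 2 * d) d x y d01.
rewrite powR_inv1 ?(ltW d0)// powRr1 ?edist_ge0//.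
rewrite -!mulrA; apply: ler_wpM2l => //.
rewrite [leRHS](_ : _ = (wb x + wb y) * (Num.min 1 (edist x y) / d * (edist x y `^ (N%:R + s1))^-1)); last by ring.
apply: ler_wpM2l; first exact: addr_ge0.
by apply: ler_wpM2r => //; rewrite invr_ge0 powR_ge0.
Qed.

Definition farC : R := 3 * 2 `^ (N%:R + s * p) *
  (2 * kmass (N := N) (s * p + 1) (s * p) + 2 * 2 `^ (N%:R + s * p)).

(** The point [z.2] stays at distance at least [d] from [z.1], also after the shift by [h], so each
    factor in [z.2] is dominated by an integrable kernel and a tail. Integrating it out leaves the
    integral of [wb] times a power of [d]. *)
Lemma int_far_err : (\int[mu2]_z (far_err p s b B3 B v h z)%:E <=
  (farC * d `^ (- (N%:R + 2 * (s * p) + 1)))%:E * \int[mu]_x (wb x)%:E)%E.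
Proof.
have /andP[sp s1l] := s01.
have bd := ns_bd _ _ _ _ _ _ _ _ sol.
have sp0 : 0 < s * p by rewrite mulr_gt0// (lt_le_trans _ p2).
have spa : s * p < s * p + 1 by rewrite ltrDl.
have Np : 0 <= N%:R + s * p by rewrite addr_ge0// ltW.
have R0 : 0 < Rr by rewrite (lt_le_trans _ rR)//; rewrite ltr_wpDl// mulr_gt0.
set a := s * p + 1; set tau := s * p.
set k2 := kern2 (N := N) a tau; set tf := tailf p s x0 Rr v.
set c := 3 * 2 `^ (N%:R + tau).
have mk : measurable_fun setT k2 by exact: measurable_kern2.
have k20 z : 0 <= k2 z by exact: kern2_ge0.
have mtf : measurable_fun setT tf by rewrite /tf /tailf; msr; exact: measurable_eball.
have tf0 y : 0 <= tf y by exact: tailf_ge0.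
have g1 : 1 <= 2 `^ (N%:R + tau) :> R by exact: powR_ge1.
pose c1 := c * d `^ (- a); pose c2 := c * (2 / d) `^ (N%:R + tau).
have cc : 0 <= c by rewrite /c mulr_ge0 ?powR_ge0.
have c10 : 0 <= c1 by rewrite /c1 mulr_ge0 ?powR_ge0.
have c20 : 0 <= c2 by rewrite /c2 mulr_ge0 ?powR_ge0.
have pt x y : far_err p s b B3 B v h (x, y) <=
    c1 * (wb x * k2 (x, y)) + c1 * (wb x * k2 (x, tadd y h)) +
    (c2 * (wb x * tf y) + c2 * (wb x * tf (tadd y h))).
  have rhs : 0 <= c1 * (wb x * k2 (x, y)) + c1 * (wb x * k2 (x, tadd y h)) +
    (c2 * (wb x * tf y) + c2 * (wb x * tf (tadd y h))).
    by apply: addr_ge0; apply: addr_ge0; apply: mulr_ge0 => //; apply: mulr_ge0.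
  have [xB|nxB] := pselect (B3 x); last first.
    by rewrite /far_err /= indicE (memNset nxB) !mul0r.
  have [yB|nyB] := pselect (B y).
    by rewrite /far_err /= [\1_(~` _) _]indicE memNset ?mul0r ?mulr0 ?mul0r//; apply.
  have Bx : B x by exact: (test_supp_sub x0 rho d d01).
  have x1 : edist x x0 <= 1.
    have := testB_sub x0 Rr rho d d01 rR x Bx; rewrite /eball/= => xr.
    by rewrite ltW// (lt_trans xr).
  have dxy : 2 * d <= edist x y.
    move: xB nyB; rewrite /eball/= => xr /negP; rewrite -leNgt => yr.
    have := edist_triangle x y x0; rewrite (edistC y x) => tr.
    exact: (far_geom2 _ _ _ _ _ xr yr tr).
  have dxyh : edist x y <= edist x (tadd y h) + d.
    apply: (le_trans (edist_triangle (tadd y h) _ _)); rewrite lerD2l.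
    by rewrite edistC edist_taddr ltW.
  have dxyh' : edist x (tadd y h) <= 2 * edist x y.
    apply: (le_trans (edist_triangle y _ _)); rewrite edist_taddr.
    exact: (far_geom1 _ _ _ d0 hd dxy).
  have [e1 e2] := far_geom3 _ _ _ d0 dxy dxyh.
  have a0 : 0 <= a by rewrite /a addr_ge0// ltW.
  have K1 := kern2_far a tau d x y d01 a0 e1.
  have T1 := tail_pointwise p s d Rr x0 x y v p2 sp d01 R0 bd x1 e1.
  have T2 := tail_pointwise p s d Rr x0 x (tadd y h) v p2 sp d01 R0 bd x1 e2.
  rewrite -/a -/tau -/k2 -/tf in K1 T1 T2.
  have e0 : 0 < edist x y by exact: lt_le_trans e1.
  have e0' : 0 < edist x (tadd y h) by exact: lt_le_trans e2.
  have T3 : `|v (tadd y h)| `^ (p - 1) / edist x y `^ (N%:R + tau) <= 2 `^ (N%:R + tau) *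
    (`|v (tadd y h)| `^ (p - 1) / edist x (tadd y h) `^ (N%:R + tau)).
    rewrite mulrCA; apply: ler_wpM2l; first exact: powR_ge0.
    rewrite ler_pdivlMr ?powR_gt0// ler_pdivrMl ?powR_gt0// mulrC -powRM ?(ltW e0)//.
    by apply: ler_powR2 => //; exact: ltW.
  rewrite /far_err /= !indicE mem_set// mul1r mem_set// mul1r -/tau.
  rewrite -mulrA (_ : `|w x| `^ b = wb x); last by rewrite /wb indicE mem_set// mul1r.
  rewrite far_factor; apply: ler_wpM2l => //; rewrite far_split.
  exact: (far_algebra _ _ _ _ _ _ _ _ _ _ _ g1 (powR_ge0 _ _) (powR_ge0 _ _)
    (k20 _) (k20 _) (tf0 _) (tf0 _) K1 T1 T3 T2).
have mk' : measurable_fun setT (fun z : T * T => k2 (z.1, tadd z.2 h)) by exact: (measurable_tadd_snd k2 h mk).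
have I1 : (\int[mu2]_z (wb z.1 * k2 z)%:E <= (kmass (N := N) a tau)%:E * \int[mu]_x (wb x)%:E)%E.
  exact: int2_kern2.
have I2 : (\int[mu2]_z (wb z.1 * k2 (z.1, tadd z.2 h))%:E <= (kmass (N := N) a tau)%:E * \int[mu]_x (wb x)%:E)%E.
  apply: le_trans I1.
  have mF : measurable_fun setT (fun z : T * T => wb z.1 * k2 z) by exact: (measurable_mul_fst wb k2 mwb mk).
  have := int2_tadd2 (fun z => wb z.1 * k2 z) h mF.
  by move=> /= -> // z; exact: (mulr_ge0 (wb0 _) (k20 _)).
(* The tail is normalized; [d <= Rr] turns the power of [Rr] into one of [d]. *)
have It : (\int[mu]_y (tf y)%:E <= (d `^ (- tau))%:E)%E.
  apply: (le_trans (ns_tail _ _ _ _ _ _ _ _ sol)); rewrite lee_fin powRN lef_pV2 ?posrE ?powR_gt0//.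
  apply: ler_powR2; [exact: ltW|exact: ltW|].
  by apply: le_trans rR; move: rho0 d0; lra.
have It0 : (0 <= \int[mu]_x (wb x)%:E)%E by apply: integral_ge0 => x _; rewrite lee_fin.
have I3 : (\int[mu2]_z (wb z.1 * tf z.2)%:E <= (d `^ (- tau))%:E * \int[mu]_x (wb x)%:E)%E.
  by rewrite (int2_prod wb tf mwb mtf wb0 tf0) muleC; apply: lee_wpmul2r.
have I4 : (\int[mu2]_z (wb z.1 * tf (tadd z.2 h))%:E <= (d `^ (- tau))%:E * \int[mu]_x (wb x)%:E)%E.
  have mtfh : measurable_fun setT (fun y => tf (tadd y h)) by exact: (measurable_taddl tf h mtf).
  rewrite (int2_prod wb (fun y => tf (tadd y h)) mwb mtfh wb0 (fun y => tf0 _)).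
  by rewrite (integral_taddr tf h mtf tf0) muleC; apply: lee_wpmul2r.
have Jint (c' : R) (F : T * T -> R) : 0 <= c' -> measurable_fun setT F -> (forall z, 0 <= F z) ->
    (\int[mu2]_z (c' * F z)%:E = c'%:E * \int[mu2]_z (F z)%:E)%E.
  by move=> c'0 mF F0; rewrite intRZ.
pose F1 (z : T * T) := wb z.1 * k2 z.
pose F2 (z : T * T) := wb z.1 * k2 (z.1, tadd z.2 h).
pose F3 (z : T * T) := wb z.1 * tf z.2.
pose F4 (z : T * T) := wb z.1 * tf (tadd z.2 h).
have mF1 : measurable_fun setT F1 by exact: (measurable_mul_fst wb k2 mwb mk).
have mF2 : measurable_fun setT F2 by exact: (measurable_mul_fst wb _ mwb mk').
have mF3 : measurable_fun setT F3 by exact: (measurable_mul_fst_snd wb tf mwb mtf).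
have mF4 : measurable_fun setT F4 by exact: (measurable_mul_fst_snd wb _ mwb (measurable_taddl tf h mtf)).
have F10 z : 0 <= F1 z by exact: mulr_ge0.
have F20 z : 0 <= F2 z by exact: mulr_ge0.
have F30 z : 0 <= F3 z by exact: mulr_ge0.
have F40 z : 0 <= F4 z by exact: mulr_ge0.
apply: (@le_trans _ _ (\int[mu2]_z (c1 * F1 z + c1 * F2 z + (c2 * F3 z + c2 * F4 z))%:E)%E).
  apply: intR_le.
  - exact: measurable_far_err.
  - by clearbody F1 F2 F3 F4; msr.
  - by move=> z; exact: far_err_ge0.
  - by move=> -[x y]; exact: pt.
move: I1 I2 I3 I4; rewrite -/(F1 _) -/(F2 _) -/(F3 _) -/(F4 _).
change (((\int[mu2]_z (F1 z)%:E <= (kmass (N := N) a tau)%:E * \int[mu]_x (wb x)%:E)%E ->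
 (\int[mu2]_z (F2 z)%:E <= (kmass (N := N) a tau)%:E * \int[mu]_x (wb x)%:E)%E ->
 (\int[mu2]_z (F3 z)%:E <= (d `^ (- tau))%:E * \int[mu]_x (wb x)%:E)%E ->
 (\int[mu2]_z (F4 z)%:E <= (d `^ (- tau))%:E * \int[mu]_x (wb x)%:E)%E -> 
 (\int[mu2]_z (c1 * F1 z + c1 * F2 z + (c2 * F3 z + c2 * F4 z))%:E <= 
   (farC * d `^ (- (N%:R + 2 * tau + 1)))%:E * \int[mu]_x (wb x)%:E)%E)).
clearbody F1 F2 F3 F4 => I1 I2 I3 I4.
have p1 : (\int[mu2]_z (c1 * F1 z)%:E = c1%:E * \int[mu2]_z (F1 z)%:E)%E by exact: Jint.
have p2' : (\int[mu2]_z (c1 * F2 z)%:E = c1%:E * \int[mu2]_z (F2 z)%:E)%E by exact: Jint.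
have p3 : (\int[mu2]_z (c2 * F3 z)%:E = c2%:E * \int[mu2]_z (F3 z)%:E)%E by exact: Jint.
have p4 : (\int[mu2]_z (c2 * F4 z)%:E = c2%:E * \int[mu2]_z (F4 z)%:E)%E by exact: Jint.
rewrite intRD; last 4 first.
- by msr.
- by msr.
- by move=> z; rewrite addr_ge0// mulr_ge0.
- by move=> z; rewrite addr_ge0// mulr_ge0.
rewrite intRD; last 4 first.
- by msr.
- by msr.
- by move=> z; rewrite mulr_ge0.
- by move=> z; rewrite mulr_ge0.
rewrite intRD; last 4 first.
- by msr.
- by msr.
- by move=> z; rewrite mulr_ge0.
- by move=> z; rewrite mulr_ge0.
rewrite p1 p2' p3 p4.
set W := (\int[mu]_x (wb x)%:E)%E in I1 I2 I3 I4 It0 *.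
apply: (@le_trans _ _ ((c1 * kmass (N := N) a tau)%:E * W + (c1 * kmass (N := N) a tau)%:E * W +
   ((c2 * d `^ (- tau))%:E * W + (c2 * d `^ (- tau))%:E * W))%E).
  rewrite (EFinM c1) (EFinM c2) -!muleA.
  by apply: leeD; apply: leeD; apply: lee_wpmul2l => //; rewrite lee_fin.
have km := @kmass_ge0 R N a tau.
rewrite -!ge0_muleDl ?lee_fin ?addr_ge0 ?mulr_ge0 ?powR_ge0// -!EFinD.
apply: lee_wpmul2r => //; rewrite lee_fin.
set kap := N%:R + 2 * tau + 1.
have D1 : d `^ (- a) <= d `^ (- kap).
  apply: powRN_le => //; rewrite /kap /a; have := ler0n R N; rewrite -/tau.
  by move: (ltW sp0); rewrite -/tau; lra.
have D2 : (2 / d) `^ (N%:R + tau) * d `^ (- tau) <= 2 `^ (N%:R + tau) * d `^ (- kap).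
  rewrite powR_dvd ?(ltW d0)// -mulrA; apply: ler_wpM2l; first exact: powR_ge0.
  rewrite -powRN -powRD; last by rewrite (gt_eqF d0) implybT.
  rewrite -opprD; apply: powRN_le => //; rewrite /kap; lra.
rewrite /c1 /c2 /farC -/a -/tau -/c.
have E1 := ler_wpM2l (mulr_ge0 cc km) D1.
have E2 := ler_wpM2l cc D2.
exact: (far_algebra2 _ _ _ _ _ _ _ E1 E2).
Qed.

End bounds.
End energy_integrals.

Section near_reals.
Context {R : realType}.

Lemma near_split (I S X Y E K : R) : 0 <= I -> 0 <= S -> 0 <= X -> 0 <= Y -> 0 <= E -> 0 <= K ->
  forall X' Y', 0 <= X' -> 0 <= Y' -> (I != 0 -> X' <= 2 * X) -> (I != 0 -> Y' <= 2 * Y) ->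
  I * (S * (X' + Y') * E) * K <= 2 * (I * (S * X * E) * K + I * (S * Y * E) * K).
Proof.
move=> I0 S0 X0 Y0 E0 K0 X' Y' X'0 Y'0 hX hY.
have [->|In] := eqVneq I 0; first by rewrite !mul0r addr0 mulr0.
have -> : 2 * (I * (S * X * E) * K + I * (S * Y * E) * K) = I * (S * (2 * X + 2 * Y) * E) * K by ring.
apply: ler_wpM2r => //; apply: ler_wpM2l => //; apply: ler_wpM2r => //; apply: ler_wpM2l => //.
by apply: lerD; [exact: hX|exact: hY].
Qed.

Lemma near_combine (A1 A2 W D dd e2 K tp ub q1 q2 q3 k3 : R) :
  0 <= D -> D <= e2 * dd -> 0 <= K -> 0 <= ub -> 0 <= q1 -> 0 <= q2 -> 0 <= q3 -> 0 <= tp -> 0 <= dd ->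
  0 <= A1 -> 0 <= A2 -> 0 <= W ->
  A1 * W <= tp * ub * (q1 + q3) -> A2 * W <= tp * ub * (q2 + q3) ->
  tp * e2 * K <= k3 ->
  (A1 + A2) * W * D * K <= dd * ub * k3 * (q1 + q2 + 2 * q3).
Proof.
move=> D0 De K0 ub0 q10 q20 q30 tp0 dd0 A10 A20 W0 h1 h2 hk.
have Q0 : 0 <= q1 + q2 + 2 * q3 by rewrite !addr_ge0// mulr_ge0.
apply: (@le_trans _ _ ((A1 + A2) * W * (e2 * dd) * K)).
  by apply: ler_wpM2r => //; apply: ler_wpM2l => //; rewrite mulr_ge0// addr_ge0.
apply: (@le_trans _ _ (tp * ub * (q1 + q2 + 2 * q3) * (e2 * dd) * K)).
  apply: ler_wpM2r => //; apply: ler_wpM2r; first exact: le_trans De.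
  rewrite mulrDl (_ : tp * ub * _ = tp * ub * (q1 + q3) + tp * ub * (q2 + q3)); last by ring.
  exact: lerD.
have -> : tp * ub * (q1 + q2 + 2 * q3) * (e2 * dd) * K = (dd * ub * (q1 + q2 + 2 * q3)) * (tp * e2 * K) by ring.
have -> : dd * ub * k3 * (q1 + q2 + 2 * q3) = (dd * ub * (q1 + q2 + 2 * q3)) * k3 by ring.
by apply: ler_wpM2l => //; rewrite mulr_ge0// mulr_ge0.
Qed.

Lemma near_geom (a c rho d Rr : R) : a < rho + 5 * d -> c < rho + 5 * d -> rho + 6 * d <= Rr ->
  Rr < 1 -> 0 < d -> a + c <= 2.
Proof. lra. Qed.

Lemma nearG_algebra (i1 i2 A1 A2 W ti ui : R) : 0 <= i1 -> i2 <= 1 -> 0 <= W -> 0 <= ui ->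
  i1 * i2 * (A1 * ti + A2 * ti + 2 * (W * ui)) <=
  ti * (i1 * i2 * A1) + ti * (i1 * i2 * A2) + 2 * ui * (i1 * W).
Proof.
move=> i10 i21 W0 u0.
have -> : i1 * i2 * (A1 * ti + A2 * ti + 2 * (W * ui)) =
  ti * (i1 * i2 * A1) + ti * (i1 * i2 * A2) + i2 * (2 * ui * (i1 * W)) by ring.
by rewrite lerD2l ler_piMl// !mulr_ge0.
Qed.

Lemma lee_scale (c : R) (x y : \bar R) : 0 <= c -> (x <= y)%E -> (c%:E * x <= c%:E * y)%E.
Proof. by move=> c0 xy; apply: lee_wpmul2l => //; rewrite lee_fin. Qed.

Lemma near_total (t U K : R) : 0 < t -> 0 < U ->
  t^-1 * (K * t) + t^-1 * (K * t) + 2 / U * (K * U) = 4 * K.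
Proof. by move=> t0 U0; field; rewrite !gt_eqF. Qed.

End near_reals.

(** * Integral of the near error *)

Section near_integral.
Context {R : realType} {N : nat}.
Local Notation T := (N.-tuple R).
Local Notation mu := (muN R N).
Local Notation mu2 := (muN R N \x muN R N)%E.

Variables (s1 p s lam : R) (x0 : T) (Rr : R) (v : T -> R) (Z : T * T -> R) (h : T) (rho d b sg K : R).
Hypotheses (p2 : 2 <= p) (s10 : 0 < s1 < 1) (s01 : 0 < s < 1)
  (sol : nsol s1 p s lam x0 Rr v Z) (d01 : 0 < d <= 1) (R1 : Rr < 1)
  (h0 : 0 < enorm h) (hd : enorm h < d) (rho0 : 0 <= rho) (rR : rho + 6 * d <= Rr) (b1 : 1 <= b)
  (ssg : s <= sg <= 1) (K0 : 0 <= K) (HK : Hreg v x0 (p - 2 + b) sg (rho + 6 * d) K).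

Local Notation B := (eball x0 (rho + 5 * d)).
Local Notation B6 := (eball x0 (rho + 6 * d)).
Local Notation w := (diff v h).
Local Notation eta := (cutoff x0 (rho + 2 * d) d).
Local Notation u := (enorm h `^ sg).
Local Notation q := (p - 2 + b).

Let d0 : 0 < d. Proof. by case/andP: d01. Qed.
Let mv := ns_mv _ _ _ _ _ _ _ _ sol.
Let mw : measurable_fun setT w. Proof. exact: measurable_diff. Qed.
Let meta : measurable_fun setT eta. Proof. exact: measurable_cutoff. Qed.
Let mB : measurable B. Proof. exact: measurable_eball. Qed.
Let mB6 : measurable B6. Proof. exact: measurable_eball. Qed.
Let u0 : 0 < u. Proof. by rewrite powR_gt0. Qed.
Let b0 : 0 <= b. Proof. exact: le_trans b1. Qed.
Let p20 : 0 <= p - 2. Proof. by rewrite subr_ge0. Qed.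
Let q0 : 0 <= q. Proof. exact: addr_ge0. Qed.
Let bq : 0 <= b <= q. Proof. by rewrite b0/= lerDr. Qed.
Let uq0 : 0 < u `^ q. Proof. by rewrite powR_gt0. Qed.

Let BB6 x : B x -> B6 x.
Proof. by rewrite /eball/=; move: d0; lra. Qed.

Let BB6h x : B x -> B6 (tadd x h).
Proof.
rewrite /eball/= => xB; apply: (le_lt_trans (edist_triangle x _ _)).
by rewrite edistC edist_taddr; move: d0 hd xB; lra.
Qed.

Lemma int_diff_q : (\int[mu]_x (\1_B x * `|w x| `^ q)%:E <= (K * u `^ q)%:E)%E.
Proof.
apply: le_trans (HK h); apply: intR_le.
- by msr.
- have mI := measurable_taddl (\1_B6) h (measurable_indic mB6).
  by msr.
- by move=> x; rewrite mulr_ge0// powR_ge0.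
- move=> x; apply: ler_wpM2r; first exact: powR_ge0.
  rewrite !indicE; have [xB|xB] := pselect (B x); last by rewrite (memNset xB) mulr_ge0.
  by rewrite (mem_set xB) (mem_set (BB6 x xB)) (mem_set (BB6h x xB)) mulr1.
Qed.

(** Since [b <= q], the power is raised after dividing by [u]: [(|w| / u) ^ b <= 1 + (|w| / u) ^ q].
    The 1 contributes the volume of [B], at most [2 ^ N] because the radius is below 1. *)
Lemma int_wb : (\int[mu]_x (wb x0 v h rho d b x)%:E <= (u `^ b * (2 ^+ N + K))%:E)%E.
Proof.
apply: (@le_trans _ _ (\int[mu]_x (u `^ b * (\1_B x + (u `^ q)^-1 * (\1_B x * `|w x| `^ q)))%:E)%E).
  apply: intR_le.
  - by rewrite /wb; msr.
  - by msr.
  - by move=> x; rewrite /wb mulr_ge0// powR_ge0.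
  - move=> x; rewrite /wb.
    have := powR_le1D (`|w x| / u) b q (divr_ge0 (normr_ge0 _) (ltW u0)) bq.
    rewrite !powR_dvd ?(ltW u0)// => hh.
    have -> : u `^ b * (\1_B x + (u `^ q)^-1 * (\1_B x * `|w x| `^ q)) = \1_B x * (u `^ b * (1 + `|w x| `^ q / u `^ q)).
      by ring.
    apply: ler_wpM2l => //; rewrite -ler_pdivrMl ?powR_gt0//; apply: le_trans hh.
    by rewrite mulrC.
rewrite intRZ; last 3 first.
- by msr.
- by move=> x; rewrite addr_ge0// mulr_ge0 ?invr_ge0 ?powR_ge0// mulr_ge0// powR_ge0.
- exact: powR_ge0.
rewrite EFinM; apply: lee_wpmul2l; first by rewrite lee_fin powR_ge0.
rewrite intRD; last 4 first.
- by msr.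
- by msr.
- by move=> x.
- by move=> x; rewrite mulr_ge0 ?invr_ge0 ?powR_ge0// mulr_ge0// powR_ge0.
rewrite EFinD; apply: leeD.
  rewrite integral_indic// setIT.
  have r0 : 0 <= rho + 5 * d by rewrite addr_ge0// mulr_ge0// ltW.
  apply: (le_trans (muN_eball_le x0 _ r0)).
  rewrite lee_fin lerXn2r ?nnegrE ?mulr_ge0//.
  by rewrite ler_piMr//; move: rR R1 d0; lra.
rewrite intRZ; last 3 first.
- by msr.
- by move=> x; rewrite mulr_ge0// powR_ge0.
- by rewrite invr_ge0 powR_ge0.
apply: (le_trans (lee_wpmul2l _ int_diff_q)); first by rewrite lee_fin invr_ge0 powR_ge0.
by rewrite -EFinM lee_fin mulrCA mulVf ?mulr1// gt_eqF.
Qed.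

(** On [B] one of the [b + 1] powers of [w] is bounded by 2, and by symmetry in the two points it is
    enough to keep the power of [w] at [z.1]. *)
Definition near1 (z : T * T) : R :=
  \1_B z.1 * \1_B z.2 *
  ((`|v (tadd z.1 h) - v (tadd z.2 h)| `^ (p - 2) + `|v z.1 - v z.2| `^ (p - 2)) *
   `|w z.1| `^ b * (eta z.1 - eta z.2) ^+ 2)
  / edist z.1 z.2 `^ (N%:R + s * p).

Lemma near1_ge0 z : 0 <= near1 z.
Proof. by rewrite /near1 mulr_ge0 ?invr_ge0 ?powR_ge0// mulr_ge0// mulr_ge0 ?sqr_ge0// mulr_ge0 ?addr_ge0 ?powR_ge0. Qed.

Lemma measurable_near1 : measurable_fun setT near1.
Proof. by rewrite /near1; msr. Qed.

Lemma near_err_le z : near_err p s b B v h eta z <= 2 * (near1 z + near1 (z.2, z.1)).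
Proof.
case: z => x y; rewrite /near_err /near1 /= (edistC y x).
rewrite (mulrC (\1_B y)) (distrC (v (tadd y h)) (v (tadd x h))) (distrC (v y) (v x)) -(sqrrN (eta y - eta x)) opprB.
have aux z : B z -> `|w z| `^ (b + 1) <= 2 * `|w z| `^ b.
  move=> Bz; rewrite powRD_ge0// mulrC powRr1//; apply: ler_wpM2r; first exact: powR_ge0.
  by apply: (test_diff_le2 v x0 h Rr rho d) => //; exact: (ns_bd _ _ _ _ _ _ _ _ sol).
have cB y' : \1_B y' != 0 :> R -> B y'.
  by rewrite indicE; have [//|yB] := pselect (B y'); rewrite (memNset yB) eqxx.
apply: near_split.
- exact: mulr_ge0.
- by apply: addr_ge0; exact: powR_ge0.
- exact: powR_ge0.
- exact: powR_ge0.
- exact: sqr_ge0.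
- by rewrite invr_ge0; exact: powR_ge0.
- exact: powR_ge0.
- exact: powR_ge0.
- by rewrite mulf_eq0 negb_or => /andP[/cB xB _]; exact: aux.
- by rewrite mulf_eq0 negb_or => /andP[_ /cB yB]; exact: aux.
Qed.

(** In the variables [x] and [k] the near error is at most [neara k] times [nearG k x]. The
    increments in [nearG] are divided by the size that [Hreg] predicts for them, so its integral in
    [x] is bounded uniformly in [k]; the orders in [k] and [h] are left to [neara]. *)
Definition nearG (k x : T) : R := \1_B x * \1_B (tadd x k) *
  (`|diff v k (tadd x h)| `^ q / (enorm k `^ sg) `^ q + `|diff v k x| `^ q / (enorm k `^ sg) `^ q +
   2 * (`|w x| `^ q / u `^ q)).

Let g0 (a c : R) : 0 <= `|a| `^ q / c `^ q.
Proof. by rewrite divr_ge0 ?powR_ge0. Qed.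

Lemma nearG_ge0 k x : 0 <= nearG k x.
Proof.
have i0 : 0 <= \1_B x * \1_B (tadd x k) :> R by exact: mulr_ge0.
apply: (mulr_ge0 i0); apply: addr_ge0; first exact: addr_ge0 (g0 _ _) (g0 _ _).
exact: mulr_ge0 (g0 _ _).
Qed.

Definition neara (k : T) : R := d^-2 * u `^ b * (2 `^ (p + 1) * kern (3 - 2 * s) 1 k).

Lemma near1_shear x k : near1 (x, tadd x k) <= neara k * nearG k x.
Proof.
rewrite /near1 /nearG /neara /= edist_taddr.
have k3 : 0 <= 2 `^ (p + 1) * kern (3 - 2 * s) 1 k :> R by rewrite mulr_ge0 ?powR_ge0 ?kern_ge0.
have dd0 : 0 <= d^-2 by rewrite invr_ge0 sqr_ge0.
have tu := powR_ge0 (enorm h `^ sg) b.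
have [xB|xB] := pselect (B x); last by rewrite !indicE (memNset xB) !mul0r mulr0.
have [yB|yB] := pselect (B (tadd x k)); last first.
  by rewrite !indicE (memNset yB) !mulr0 !mul0r mulr0.
rewrite !indicE (mem_set xB) (mem_set yB) !mul1r.
have [k00|kn] := eqVneq (enorm k) 0.
  have -> : tadd x k = x by apply: edist_eq0; rewrite edistC edist_taddr.
  rewrite (subrr (eta x)) expr0n/= mulr0 mul0r; apply: mulr_ge0; first exact: mulr_ge0 (mulr_ge0 dd0 tu) k3.
  apply: addr_ge0; first exact: addr_ge0 (g0 _ _) (g0 _ _).
  exact: mulr_ge0 (g0 _ _).
have kp : 0 < enorm k by rewrite lt_def kn edist_ge0.
have tp : 0 < enorm k `^ sg by rewrite powR_gt0.
have e2 : enorm k <= 2.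
  rewrite -(edist_taddr x k); apply: (le_trans (edist_triangle x0 _ _)).
  move: xB yB; rewrite /eball/= (edistC x0 (tadd x k)) => xB yB.
  exact: near_geom xB yB rR R1 d0.
have cl := cutoff_lip x0 (rho + 2 * d) d x (tadd x k) d01.
have De : (eta x - eta (tadd x k)) ^+ 2 <= enorm k ^+ 2 * d^-2.
  rewrite -real_normK ?num_real// -exprVn -exprMn lerXn2r ?nnegrE ?mulr_ge0 ?edist_ge0 ?invr_ge0 ?(ltW d0)//.
  apply: (le_trans cl); apply: ler_wpM2r; first by rewrite invr_ge0 ltW.
  by rewrite edist_taddr ge_min lexx orbT.
have Y (a c : R) := @young_scaled R `|a| `|c| (enorm k `^ sg) u (p - 2) b (normr_ge0 _) (normr_ge0 _) tp u0 p20 b0.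
have nk := near_kernel_le N%:R (enorm k) s p sg kp e2 p2 s01 ssg.
have E1 : `|v (tadd x h) - v (tadd (tadd x k) h)| = `|diff v k (tadd x h)|.
  by rewrite distrC /diff taddAC.
have E2 : `|v x - v (tadd x k)| = `|diff v k x| by rewrite distrC.
rewrite E1 E2.
apply: (near_combine _ _ _ _ _ _ _ _ _ _ _ _ _ _ De _ _ _ _ _ _ _ _ _ _ (Y _ _) (Y _ _) nk).
- exact: sqr_ge0.
- by rewrite invr_ge0; exact: powR_ge0.
- exact: tu.
- exact: g0.
- exact: g0.
- exact: g0.
- exact: powR_ge0.
- exact: dd0.
- exact: powR_ge0.
- exact: powR_ge0.
- exact: powR_ge0.
Qed.

(** The first two terms have integral at most [K] by [Hreg] in the direction [k], on the larger ball
    because of the shift by [h]; the third is [Hreg] in the direction [h] and counts twice. *)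
Lemma int_nearG k : neara k != 0 -> (\int[mu]_x (nearG k x)%:E <= (4 * K)%:E)%E.
Proof.
move=> ak; have kn : enorm k != 0.
  apply: contraNneq ak => k00; rewrite /neara /kern k00 powR0 ?min_r ?mul0r ?mulr0//.
  by case/andP: s01 => *; apply: lt0r_neq0; lra.
have kp : 0 < enorm k by rewrite lt_def kn edist_ge0.
have tp : 0 < (enorm k `^ sg) `^ q by rewrite !powR_gt0.
set t := (enorm k `^ sg) `^ q in tp *.
have m1 : measurable_fun setT (diff v k) by exact: measurable_diff.
have mh1 : measurable_fun setT (fun x => diff v k (tadd x h)) by exact: (measurable_taddl (diff v k) h m1).
have mI : measurable_fun setT (fun x => \1_B (tadd x k) : R).
  by apply: (measurable_taddl (\1_B) k); exact: measurable_indic.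
have mI6 : measurable_fun setT (fun x => \1_B6 (tadd x k) : R).
  by apply: (measurable_taddl (\1_B6) k); exact: measurable_indic.
pose F1 x := \1_B x * \1_B (tadd x k) * `|diff v k (tadd x h)| `^ q.
pose F2 x := \1_B x * \1_B (tadd x k) * `|diff v k x| `^ q.
pose F3 x := \1_B x * `|w x| `^ q.
pose F6 x := \1_B6 x * \1_B6 (tadd x k) * `|diff v k x| `^ q.
have mF1 : measurable_fun setT F1 by rewrite /F1; msr.
have mF2 : measurable_fun setT F2 by rewrite /F2; msr.
have mF3 : measurable_fun setT F3 by rewrite /F3; msr.
have mF6 : measurable_fun setT F6 by rewrite /F6; msr.
have F10 x : 0 <= F1 x by rewrite mulr_ge0 ?powR_ge0// mulr_ge0.
have F20 x : 0 <= F2 x by rewrite mulr_ge0 ?powR_ge0// mulr_ge0.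
have F30 x : 0 <= F3 x by rewrite mulr_ge0 ?powR_ge0.
have F60 x : 0 <= F6 x by rewrite mulr_ge0 ?powR_ge0// mulr_ge0.
have I6 : (\int[mu]_x (F6 x)%:E <= (K * t)%:E)%E by exact: HK.
have I2 : (\int[mu]_x (F2 x)%:E <= (K * t)%:E)%E.
  apply: le_trans I6; apply: intR_le => // x; apply: ler_wpM2r; first exact: powR_ge0.
  rewrite !indicE; have [xB|xB] := pselect (B x); last by rewrite (memNset xB) mul0r mulr_ge0.
  have [yB|yB] := pselect (B (tadd x k)); last by rewrite (memNset yB) mulr0 mulr_ge0.
  by rewrite !mem_set//; exact: BB6.
have I1 : (\int[mu]_x (F1 x)%:E <= (K * t)%:E)%E.
  apply: le_trans I6; rewrite -(integral_taddr F6 h mF6 F60).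
  apply: intR_le => //; first exact: (measurable_taddl F6 h mF6).
  move=> x; apply: ler_wpM2r; first exact: powR_ge0.
  rewrite !indicE; have [xB|xB] := pselect (B x); last by rewrite (memNset xB) mul0r mulr_ge0.
  have [yB|yB] := pselect (B (tadd x k)); last by rewrite (memNset yB) mulr0 mulr_ge0.
  rewrite (mem_set xB) (mem_set yB) (mem_set (BB6h x xB)) mem_set//.
  by rewrite taddAC; exact: BB6h.
have I3 : (\int[mu]_x (F3 x)%:E <= (K * u `^ q)%:E)%E by exact: int_diff_q.
have D0 : 0 <= t^-1 by rewrite invr_ge0 ltW.
have D1 : 0 <= 2 * (u `^ q)^-1 by rewrite mulr_ge0 ?invr_ge0 ?powR_ge0.
apply: (@le_trans _ _ (\int[mu]_x (t^-1 * F1 x + t^-1 * F2 x + 2 * (u `^ q)^-1 * F3 x)%:E)%E).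
  apply: intR_le.
  - by rewrite /nearG; msr.
  - by clearbody F1 F2 F3; msr.
  - exact: nearG_ge0.
  - move=> x.
    have i10 : 0 <= \1_B x :> R by [].
    have i21 : \1_B (tadd x k) <= 1 :> R by rewrite indicE; case: (_ \in _).
    have ui : 0 <= (u `^ q)^-1 by rewrite invr_ge0; exact: powR_ge0.
    exact: (nearG_algebra _ _ _ _ _ t^-1 _ i10 i21 (powR_ge0 _ q) ui).
clearbody F1 F2 F3.
rewrite intRD; last 4 first.
- by msr.
- by msr.
- by move=> x; rewrite addr_ge0 ?mulr_ge0.
- by move=> x; rewrite mulr_ge0.
rewrite intRD; last 4 first.
- by msr.
- by msr.
- by move=> x; rewrite mulr_ge0.
- by move=> x; rewrite mulr_ge0.
rewrite (intRZ _ _ _ _ _ mF1 F10 D0) (intRZ _ _ _ _ _ mF2 F20 D0) (intRZ _ _ _ _ _ mF3 F30 D1).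
apply: (@le_trans _ _ (t^-1%:E * (K * t)%:E + t^-1%:E * (K * t)%:E + (2 * (u `^ q)^-1)%:E * (K * u `^ q)%:E)%E).
  exact: (leeD (leeD (lee_scale _ _ _ D0 I1) (lee_scale _ _ _ D0 I2)) (lee_scale _ _ _ D1 I3)).
rewrite -!EFinM -!EFinD lee_fin.
by rewrite (near_total _ _ _ tp uq0).
Qed.

(** The factor 16 collects the 2 of [near_err_le], the two orders of the points, and the bound [4 K]
    for [nearG]. *)
Lemma int_near_err : (\int[mu2]_z (near_err p s b B v h eta z)%:E <=
  (16 * 2 `^ (p + 1) * kmass (N := N) (3 - 2 * s) 1 * (d^-2 * u `^ b * K))%:E)%E.
Proof.
have m1 := measurable_near1; have mk := @measurable_kern R N (3 - 2 * s) 1.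
have ms : measurable_fun setT (fun z : T * T => near1 (z.2, z.1)) by exact: measurable_swap.
have ma : measurable_fun setT neara by rewrite /neara; msr.
have dd0 : 0 <= d^-2 by rewrite invr_ge0 sqr_ge0.
have c0 : 0 <= d^-2 * u `^ b * 2 `^ (p + 1) by rewrite mulr_ge0 ?powR_ge0// mulr_ge0 ?powR_ge0.
have a0 k : 0 <= neara k by rewrite /neara mulrA mulr_ge0 ?kern_ge0.
have K4 : 0 <= 4 * K by rewrite mulr_ge0.
apply: (@le_trans _ _ (\int[mu2]_z (2 * (near1 z + near1 (z.2, z.1)))%:E)%E).
  apply: intR_le.
  - exact: (measurable_near_err s1 p s lam x0 Rr v Z h rho d b).
  - by clear -m1 ms; msr.
  - by move=> z; exact: near_err_ge0.
  - exact: near_err_le.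
rewrite intRZ; last 3 first.
- by clear -m1 ms; msr.
- by move=> z; rewrite addr_ge0// near1_ge0.
- by [].
rewrite (intRD _ _ _ _ _ m1 ms (near1_ge0) (fun z => near1_ge0 _)).
rewrite (int2_swap near1 m1 near1_ge0).
have mG k : measurable_fun setT (nearG k).
  rewrite /nearG.
  have mI : measurable_fun setT (fun x => \1_B (tadd x k) : R).
    by apply: (measurable_taddl (\1_B) k); exact: measurable_indic.
  have mk1 : measurable_fun setT (diff v k) by exact: measurable_diff.
  have mh1 : measurable_fun setT (fun x => diff v k (tadd x h)) by exact: (measurable_taddl (diff v k) h mk1).
  by msr.
have I := int2_le_shear near1 neara nearG (4 * K) m1 near1_ge0 ma a0 mG nearG_ge0 K4 near1_shear int_nearG.
have Ia : (\int[mu]_k (neara k)%:E = (d^-2 * u `^ b * 2 `^ (p + 1) * kmass (N := N) (3 - 2 * s) 1)%:E)%E.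
  rewrite /neara; under eq_integral do rewrite mulrA.
  rewrite (intRZ _ _ _ _ _ mk (kern_ge0 _ _) c0) kmassE//.
  by case/andP: s01 => *; lra.
rewrite Ia -EFinM in I.
apply: (le_trans (lee_wpmul2l _ (leeD I I))); first by rewrite lee_fin.
rewrite -EFinD -EFinM lee_fin le_eqVlt; apply/orP; left; apply/eqP; ring.
Qed.

End near_integral.

(** * Assembly of the energy estimate *)

Section energy_step.
Context {R : realType} {N : nat}.
Local Notation T := (N.-tuple R).
Local Notation mu := (muN R N).
Local Notation mu2 := (muN R N \x muN R N)%E.

(** The last two alternatives stand for sign conditions on [q2] and [q3], and the caller refutes
    them. The inequality [V + K <= V (K + 1)] brings the three errors to a common form. *)
Lemma energy_collect (cM L2 q1 q2 q3 A B D dn df ds ub K V : R) : 0 <= L2 -> 0 <= A -> 0 <= B -> 0 <= D ->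
  0 <= ub -> 0 <= K -> 1 <= V -> dn <= q1 -> df <= q1 -> ds <= q1 -> 0 <= q1 -> 0 <= cM -> 0 <= dn -> 0 <= df -> 0 <= ds ->
  cM * (L2 * (A * (dn * ub * K)) + q2 * (B * df * (ub * (V + K)) + B * df * (ub * (V + K))) + D * ds * q3 * (ub * (V + K)))
  <= cM * (L2 * A + q2 * B * V * 2 + D * q3 * V + 1) * q1 * (K + 1) * ub \/ q2 < 0 \/ q3 < 0.
Proof.
move=> L20 A0 B0 D0 u0 K0 V1 h1 h2 h3 q0 cM0 dn0 df0 ds0.
have [q20|] := leP 0 q2; last by right; left.
have [q30|] := leP 0 q3; last by right; right.
left.
rewrite -!(mulrA cM); apply: ler_wpM2l => //.
have V0 : 0 <= V by exact: le_trans V1.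
have K1 : 0 <= K + 1 by rewrite addr_ge0.
have VK : V + K <= V * (K + 1) by rewrite mulrDr mulr1 addrC lerD2r ler_peMl.
have uq : 0 <= ub * (K + 1) by rewrite mulr_ge0.
have e1 : L2 * (A * (dn * ub * K)) <= L2 * A * q1 * (K + 1) * ub.
  have -> : L2 * (A * (dn * ub * K)) = L2 * A * (dn * (ub * K)) by ring.
  have -> : L2 * A * q1 * (K + 1) * ub = L2 * A * (q1 * (ub * (K + 1))) by ring.
  apply: ler_wpM2l; first exact: mulr_ge0.
  apply: ler_pM => //; first exact: mulr_ge0.
  by apply: ler_wpM2l => //; rewrite lerDl.
have uV : 0 <= ub * (V + K) by rewrite mulr_ge0// addr_ge0.
have uVK : ub * (V + K) <= ub * (V * (K + 1)) by exact: ler_wpM2l.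
have e2 : B * df * (ub * (V + K)) <= B * V * q1 * (K + 1) * ub.
  have -> : B * V * q1 * (K + 1) * ub = B * q1 * (ub * (V * (K + 1))) by ring.
  by apply: ler_pM => //; [exact: mulr_ge0|exact: ler_wpM2l].
have e3 : D * ds * q3 * (ub * (V + K)) <= D * q3 * V * q1 * (K + 1) * ub.
  have -> : D * q3 * V * q1 * (K + 1) * ub = D * q1 * q3 * (ub * (V * (K + 1))) by ring.
  apply: ler_pM => //; first by rewrite mulr_ge0// mulr_ge0.
  by apply: ler_wpM2r => //; exact: ler_wpM2l.
have e2' := ler_wpM2l q20 (lerD e2 e2).
apply: (le_trans (lerD (lerD e1 e2') e3)).
have n : 0 <= q1 * (K + 1) * ub by rewrite mulr_ge0// mulr_ge0.
move: n; clear; lra.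
Qed.

(** [energy_inequality] with the pointwise bounds [energy_lower] and [sign_lower]; the exponent of
    [d] is one that dominates those of all three errors. *)
Lemma energy_step (s1 p s b : R) : 2 <= p -> 0 < s1 < 1 -> 0 < s < 1 -> 1 <= b ->
  exists2 C : R, 0 < C & forall lam x0 Rr v Z (h : T) rho d sg K,
    nsol s1 p s lam x0 Rr v Z -> 0 < d <= 1 -> Rr < 1 -> 0 < enorm h -> enorm h < d ->
    0 <= rho -> rho + 6 * d <= Rr -> s <= sg <= 1 -> 0 <= K ->
    Hreg v x0 (p - 2 + b) sg (rho + 6 * d) K ->
    (\int[mu2]_z (gag (p + b - 1) (s * p) (eball x0 (rho + 2 * d)) (diff v h) z)%:E <=
     (C * d `^ (- (N%:R + 2 * (s * p) + 2)) * (K + 1) * (enorm h `^ sg) `^ b)%:E)%E.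
Proof.
move=> p2 s10 s01 b1.
pose cM : R := 16 * 2 `^ (p - 2 + (b - 1)).
have cM0 : 0 < cM by rewrite /cM mulr_gt0// powR_gt0.
pose L2 : R := 16 * lipc (p - 2) ^+ 2.
have L20 : 0 <= L2 by rewrite /L2 mulr_ge0// sqr_ge0.
pose A : R := 16 * 2 `^ (p + 1) * kmass (N := N) (3 - 2 * s) 1.
have A0 : 0 <= A by rewrite /A mulr_ge0 ?kmass_ge0// mulr_ge0 ?powR_ge0.
have km0 := @kmass_ge0 R N (s * p + 1) (s * p).
pose Bc : R := @farC R N p s.
have B0 : 0 <= Bc by rewrite /Bc /farC !mulr_ge0 ?powR_ge0// addr_ge0 ?mulr_ge0 ?powR_ge0.
pose q2 : R := 2 `^ (p - 1); have q20 : 0 <= q2 by exact: powR_ge0.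
pose q3 : R := 2 * kmass (N := N) 1 s1; have q30 : 0 <= q3 by exact: mulr_ge0 (ler0n R 2) (kmass_ge0 _ _).
pose V : R := 2 ^+ N; have V1 : 1 <= V by rewrite exprn_ege1// ler1n.
have V0 : 0 <= V by exact: le_trans V1.
exists (cM * (L2 * A + q2 * Bc * V * 2 + 2 * q3 * V + 1)).
  rewrite mulr_gt0// ltr_wpDl//; apply: addr_ge0; last exact: mulr_ge0 (mulr_ge0 (ler0n R 2) q30) V0.
  apply: addr_ge0; first exact: mulr_ge0.
  exact: mulr_ge0 (mulr_ge0 (mulr_ge0 q20 B0) V0) (ler0n R 2).
move=> lam x0 Rr v Z h rho d sg K sol d01 R1 h0 hd rho0 rR ssg K0 HK.
have d0 : 0 < d by case/andP: d01.
have b10 : 0 <= b - 1 by rewrite subr_ge0.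
have mv := ns_mv _ _ _ _ _ _ _ _ sol.
have mw : measurable_fun setT (diff v h) by exact: measurable_diff.
set B2 := eball x0 (rho + 2 * d).
have [ap ap'] := admissible_testf _ _ _ _ _ _ _ _ _ _ _ _ s10 p2 s01 sol d01 hd rho0 rR b10.
have [i1 i2 eq0] := difference_equation _ _ _ _ _ _ _ _ _ _ sol ap ap'.
have mg : measurable_fun setT (gag (p + b - 1) (s * p) B2 (diff v h)).
  by apply: measurable_gag => //; exact: measurable_eball.
have mn := measurable_near_err s1 p s lam x0 Rr v Z h rho d b sol.
have mf := measurable_far_err s1 p s lam x0 Rr v Z h rho d b sol.
have ms := measurable_sign_err s1 p s lam x0 Rr v Z h rho d b sol.
set ne := near_err _ _ _ _ _ _ _ in mn.
set fe := far_err _ _ _ _ _ _ _ in mf.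
set se := sign_err _ _ _ _ _ _ in ms.
have n0 z : 0 <= ne z by exact: near_err_ge0.
have f0 z : 0 <= fe z by exact: far_err_ge0.
have e0 z : 0 <= se z by exact: sign_err_ge0.
have lowr := energy_lower s1 p s lam x0 Rr v Z h rho d b p2 sol d01 hd rR b1.
have lows := sign_lower s1 p s lam x0 Rr v Z h rho d b sol d01 b1.
have In := int_near_err s1 p s lam x0 Rr v Z h rho d b sg K p2 s01 sol d01 R1 h0 hd rR b1 ssg K0 HK.
have If := int_far_err s1 p s lam x0 Rr v Z h rho d b p2 s01 sol d01 R1 hd rho0 rR.
have Is := int_sign_err s1 p s lam x0 Rr v Z h rho d b s10 sol d01.
have Iw := int_wb s1 p s lam x0 Rr v Z h rho d b sg K p2 sol d01 R1 h0 hd rho0 rR b1 HK.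
rewrite -/ne in In lowr; rewrite -/fe in If lowr; rewrite -/se in Is lows.
rewrite -/B2 -/cM -/L2 -/q2 in lowr.
rewrite -/A in In; rewrite -/Bc in If; rewrite -/q3 in Is; rewrite -/V in Iw.
set W := (\int[mu]_x _)%E in If Is Iw.
set ub := (enorm h `^ sg) `^ b in In Iw *.
have ub0 : 0 <= ub by exact: powR_ge0.
clearbody ne fe se A Bc q3 V cM L2 q2 ub.
pose g := gag (p + b - 1) (s * p) B2 (diff v h).
have g0 z : 0 <= g z by exact: gag_ge0.
rewrite -/g in mg lowr *.
have mg' : measurable_fun setT (fun z => cM^-1 * g z) by clearbody g; clear -mg; msr.
have mfs : measurable_fun setT (fun z : T * T => fe (z.2, z.1)) by exact: measurable_swap.
have mE2 : measurable_fun setT (fun z => L2 * ne z + q2 * (fe z + fe (z.2, z.1))).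
  by clearbody g; clear -mn mf mfs; msr.
have ic : 0 <= cM^-1 by rewrite invr_ge0 ltW.
have gg0 z : 0 <= cM^-1 * g z by exact: mulr_ge0.
have ff0 z : 0 <= fe z + fe (z.2, z.1) by exact: addr_ge0.
have E20 z : 0 <= L2 * ne z + q2 * (fe z + fe (z.2, z.1)).
  exact: addr_ge0 (mulr_ge0 L20 (n0 z)) (mulr_ge0 q20 (ff0 z)).
have EN := energy_inequality _ _ _ _ _ _ lam (ns_lam _ _ _ _ _ _ _ _ sol) i1 i2 eq0 mg' ms mE2 gg0 e0 E20 lowr lows.
clearbody g.
have mff : measurable_fun setT (fun z => fe z + fe (z.2, z.1)) by clear -mf mfs; msr.
have m1 : measurable_fun setT (fun z => L2 * ne z) by clear -mn; msr.
have m2 : measurable_fun setT (fun z => q2 * (fe z + fe (z.2, z.1))) by clear -mff; msr.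
rewrite (intRZ _ _ _ _ _ mg g0 ic) in EN.
rewrite (intRD _ _ _ _ _ m1 m2 (fun z => mulr_ge0 L20 (n0 z)) (fun z => mulr_ge0 q20 (ff0 z))) in EN.
rewrite (intRZ _ _ _ _ _ mn n0 L20) (intRZ _ _ _ _ _ mff ff0 q20) in EN.
rewrite (intRD _ _ _ _ _ mf mfs f0 (fun z => f0 _)) (int2_swap fe mf f0) in EN.
have kf0 : 0 <= Bc * d `^ (- (N%:R + 2 * (s * p) + 1)) by exact: mulr_ge0 B0 (powR_ge0 _ _).
have ks0 : 0 <= 2 * d `^ (- 1) * q3 by exact: mulr_ge0 (mulr_ge0 (ler0n R 2) (powR_ge0 _ _)) q30.
have If' := le_trans If (lee_scale _ _ _ kf0 Iw).
have Is' := le_trans Is (lee_scale _ _ _ ks0 Iw).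
have EN' := le_trans EN (leeD (leeD (lee_scale _ _ _ L20 In) (lee_scale _ _ _ q20 (leeD If' If'))) Is').
have {EN'} := lee_scale cM _ _ (ltW cM0) EN'.
rewrite muleA -EFinM mulfV ?gt_eqF// mul1e => EN'.
apply: (le_trans EN').
rewrite -[X in (X <= _)%E]fineK//=.
rewrite lee_fin.
have kap (a : R) : a <= N%:R + 2 * (s * p) + 2 -> d `^ (- a) <= d `^ (- (N%:R + 2 * (s * p) + 2)).
  by move=> ak; exact: powRN_le.
have sp0 : 0 <= s * p.
  by case/andP: s01 => *; apply: mulr_ge0; [exact: ltW|exact: le_trans p2].
have N0 := ler0n R N.
have dn : d ^- 2 <= d `^ (- (N%:R + 2 * (s * p) + 2)).
  rewrite -(powR_mulrn 2 (ltW d0)) -powRN; apply: kap; move: sp0 N0; clear; lra.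
have df : d `^ (- (N%:R + 2 * (s * p) + 1)) <= d `^ (- (N%:R + 2 * (s * p) + 2)).
  by apply: kap; clear; lra.
have ds : d `^ (- 1) <= d `^ (- (N%:R + 2 * (s * p) + 2)).
  by apply: kap; move: sp0 N0; clear; lra.
have dn0 : 0 <= d ^- 2 by rewrite invr_ge0 exprn_ge0// ltW.
have [//|[]] := energy_collect cM L2 _ q2 q3 A Bc 2 _ _ _ ub K V L20 A0 B0 (ler0n R 2) ub0 K0 V1 dn df ds
  (powR_ge0 _ _) (ltW cM0) dn0 (powR_ge0 _ _) (powR_ge0 _ _).
- by rewrite ltNge q20.
- by rewrite ltNge q30.
Qed.

End energy_step.

(** * From second to first differences *)

Section minkowski_set.
Context {R : realType}.

Lemma convex_pow2 (m l a b : R) : 1 <= m -> 0 <= l <= 1 -> 0 <= a -> 0 <= b ->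
  (l * a + (1 - l) * b) `^ m <= l * a `^ m + (1 - l) * b `^ m.
Proof.
move=> m1 l01 a0 b0; have /andP[l0 l1] := l01.
have := @convex_powR R m m1 (Itv01 l0 l1) a b.
rewrite !inE/= !in_itv/= !andbT => /(_ a0 b0).
by rewrite !convRE.
Qed.

(** Convexity of [t ^ m] at the weights [X / (X + Y)] and [Y / (X + Y)]. When [X] and [Y] bound the
    two norms this is Minkowski's inequality before integration. *)
Lemma convex_scaled (m X Y a b z : R) : 1 <= m -> 0 < X -> 0 < Y -> 0 <= a -> 0 <= b ->
  0 <= z -> z <= a + b ->
  z `^ m <= (X + Y) `^ m * (X / (X + Y)) / X `^ m * a `^ m +
            (X + Y) `^ m * (Y / (X + Y)) / Y `^ m * b `^ m.
Proof.
move=> m1 X0 Y0 a0 b0 z0 zab.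
have S0 : 0 < X + Y by exact: addr_gt0.
have l01 : 0 <= X / (X + Y) <= 1.
  by rewrite divr_ge0 ?(ltW X0) ?(ltW S0)//= ler_pdivrMr// mul1r lerDl ltW.
have := convex_pow2 m (X / (X + Y)) (a / X) (b / Y) m1 l01 (divr_ge0 a0 (ltW X0)) (divr_ge0 b0 (ltW Y0)).
have nX := lt0r_neq0 X0; have nY := lt0r_neq0 Y0; have nS := lt0r_neq0 S0.
have -> : X / (X + Y) * (a / X) + (1 - X / (X + Y)) * (b / Y) = (a + b) / (X + Y).
  by field; rewrite nX nY nS.
have -> : 1 - X / (X + Y) = Y / (X + Y) by field; rewrite nS.
rewrite !powR_dvd ?addr_ge0 ?(ltW X0) ?(ltW Y0) ?(ltW S0)// => h.
have zz : z `^ m <= (a + b) `^ m.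
  by apply: ler_powR2 => //; exact: le_trans m1.
apply: (le_trans zz); have Sm : 0 < (X + Y) `^ m by exact: powR_gt0.
move: h; rewrite ler_pdivrMr// => h; apply: (le_trans h).
by rewrite le_eqVlt; apply/orP; left; apply/eqP; ring.
Qed.

(** Induction step of [doubling], with [tau = 2 ^ sg], [w = 2 ^ eps] and [z = |h| ^ eps]. The
    inherited factor [1 - w z / 2] is smaller than the required [1 - z / 2], and the difference
    [(w - 1) z / 2] pays for the second difference. *)
Lemma doubling_real (A K1 t z tau w : R) : 0 <= A -> 0 <= t -> 0 <= z -> tau <= 2 -> w * z <= 1 ->
  K1 <= A * (w - 1) ->
  A * (tau * t) * (1 - w * z / 2) / 2 + K1 * (t * z) / 2 <= A * t * (1 - z / 2).
Proof.
move=> A0 t0 z0 t2 wz KA.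
have f0 : 0 <= 1 - w * z / 2 by lra.
have At : 0 <= A * t by exact: mulr_ge0.
have h1 : A * t * (1 - w * z / 2) * tau <= A * t * (1 - w * z / 2) * 2.
  by apply: ler_wpM2l => //; exact: mulr_ge0.
have h2 : K1 * (t * z) <= A * (w - 1) * (t * z) by apply: ler_wpM2r => //; exact: mulr_ge0.
lra.
Qed.

(** Base of the induction, for [d / 2 <= |h|]: there [A t (1 - z / 2)] is at least [A d / 4], which
    explains the 4. *)
Lemma doubling_base (A c d e t z : R) : 0 <= A -> 4 * c <= A * d -> d <= 2 * e -> e <= t -> z <= 1 -> 0 <= e ->
  c <= A * t * (1 - z / 2).
Proof.
move=> A0 cA de et z1 e0.
have h1 : A * d <= A * (2 * t) by apply: ler_wpM2l => //; lra.
have h2 : 0 <= A * t * (1 - z) by rewrite mulr_ge0 ?subr_ge0// mulr_ge0//; lra.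
lra.
Qed.

End minkowski_set.

Section doubling.
Context {R : realType} {N : nat}.
Local Notation T := (N.-tuple R).
Local Notation mu := (muN R N).

Lemma minkowski_set (B : set T) (f g z : T -> R) (m X Y : R) : measurable B ->
  measurable_fun setT f -> measurable_fun setT g -> measurable_fun setT z ->
  1 <= m -> 0 < X -> 0 < Y -> (forall x, `|z x| <= `|f x| + `|g x|) ->
  (\int[mu]_x (\1_B x * `|f x| `^ m)%:E <= (X `^ m)%:E)%E ->
  (\int[mu]_x (\1_B x * `|g x| `^ m)%:E <= (Y `^ m)%:E)%E ->
  (\int[mu]_x (\1_B x * `|z x| `^ m)%:E <= ((X + Y) `^ m)%:E)%E.
Proof.
move=> mB mf mg mz m1 X0 Y0 zfg If Ig.
have S0 : 0 < X + Y by exact: addr_gt0.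
set c1 := (X + Y) `^ m * (X / (X + Y)) / X `^ m.
set c2 := (X + Y) `^ m * (Y / (X + Y)) / Y `^ m.
have c10 : 0 <= c1 by rewrite /c1 !mulr_ge0 ?invr_ge0 ?powR_ge0// ltW.
have c20 : 0 <= c2 by rewrite /c2 !mulr_ge0 ?invr_ge0 ?powR_ge0// ltW.
pose F x := \1_B x * `|f x| `^ m; pose G x := \1_B x * `|g x| `^ m.
have mF : measurable_fun setT F by rewrite /F; msr.
have mG : measurable_fun setT G by rewrite /G; msr.
have F0 x : 0 <= F x by rewrite mulr_ge0 ?powR_ge0.
have G0 x : 0 <= G x by rewrite mulr_ge0 ?powR_ge0.
apply: (@le_trans _ _ (\int[mu]_x (c1 * F x + c2 * G x)%:E)%E).
  apply: intR_le.
  - by msr.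
  - by clearbody F G c1 c2; msr.
  - by move=> x; rewrite mulr_ge0 ?powR_ge0.
  - move=> x; have := convex_scaled m X Y `|f x| `|g x| `|z x| m1 X0 Y0 (normr_ge0 _) (normr_ge0 _) (normr_ge0 _) (zfg x).
    rewrite -/c1 -/c2 => h.
    have i0 : 0 <= \1_B x :> R by [].
    by apply: (le_trans (ler_wpM2l i0 h)); rewrite /F /G mulrDr !(mulrCA (\1_B x)).
have J1 : (\int[mu]_x (F x)%:E <= (X `^ m)%:E)%E by [].
have J2 : (\int[mu]_x (G x)%:E <= (Y `^ m)%:E)%E by [].
clearbody F G.
have m1' : measurable_fun setT (fun x => c1 * F x) by msr.
have m2' : measurable_fun setT (fun x => c2 * G x) by msr.
rewrite (intRD _ _ _ _ _ m1' m2' (fun x => mulr_ge0 c10 (F0 x)) (fun x => mulr_ge0 c20 (G0 x))).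
rewrite (intRZ _ _ _ _ _ mF F0 c10) (intRZ _ _ _ _ _ mG G0 c20).
apply: (le_trans (leeD (lee_scale _ _ _ c10 J1) (lee_scale _ _ _ c20 J2))).
rewrite -!EFinM -EFinD lee_fin /c1 /c2 !mulfVK ?gt_eqF ?powR_gt0//.
by rewrite -mulrDr -mulrDl divff ?mulr1// gt_eqF.
Qed.

Lemma enorm_double (h : T) : enorm (tadd h h) = 2 * enorm h.
Proof.
rewrite /edist -[X in X * _](@ger0_norm R 2)// -sqrtr_sqr -sqrtrM ?sqr_ge0//; congr Num.sqrt.
rewrite mulr_sumr; apply: eq_bigr => i _; rewrite !tnth_mktuple; ring.
Qed.

Lemma diff2E (v : T -> R) (h x : T) :
  diff v h x = 2^-1 * diff v (tadd h h) x - 2^-1 * diff (diff v h) h x.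
Proof. by rewrite /diff taddA; field. Qed.

(* [diff v h] is half of [diff v (2 h)] up to second differences. The factor
   [1 - |h| ^ eps / 2] is the gain that absorbs them in the induction on the number
   [J] of doublings, so that the exponent [sg <= 1] is attained even for [sg = 1]. *)
Lemma doubling (v : T -> R) (B : set T) (m sg eps d c K1 A : R) : measurable B ->
  measurable_fun setT v -> 1 <= m -> 0 <= sg <= 1 -> 0 <= eps -> 0 < d <= 1 ->
  0 < K1 -> 0 < A -> K1 <= A * (2 `^ eps - 1) -> 4 * c <= A * d -> 0 <= c ->
  (forall h, 0 < enorm h -> enorm h < d ->
    (\int[mu]_x (\1_B x * `|diff (diff v h) h x| `^ m)%:E <= ((K1 * enorm h `^ (sg + eps)) `^ m)%:E)%E) ->
  (forall h, 0 < enorm h -> enorm h < d ->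
    (\int[mu]_x (\1_B x * `|diff v h x| `^ m)%:E <= (c `^ m)%:E)%E) ->
  forall (J : nat) h, 0 < enorm h -> enorm h < d -> d <= 2 ^+ J * enorm h ->
    (\int[mu]_x (\1_B x * `|diff v h x| `^ m)%:E <=
      ((A * enorm h `^ sg * (1 - enorm h `^ eps / 2)) `^ m)%:E)%E.
Proof.
move=> mB mv m1 sg01 eps0 /andP[d0 d1] K10 A0 KA cA c0 H2 H1.
have /andP[sg0 sg1] := sg01.
have m0 : 0 <= m by exact: le_trans m1.
have eps_le1 e : 0 < e -> e < d -> e `^ eps <= 1.
  by move=> e0 ed; apply: powR_le1 => //; rewrite (ltW e0)/= (le_trans (ltW ed)).
elim=> [|J IH] h h0 hd; first by rewrite expr0 mul1r leNgt hd.
(* If [2 h] is no longer a small increment, the bound [c] of order zero takes the place of the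
   induction hypothesis. *)
move=> dJ; have [hd2|hd2] := ltP (2 * enorm h) d; last first.
  apply: (le_trans (H1 h h0 hd)); rewrite lee_fin; apply: ler_powR2 => //.
  apply: (doubling_base A c d (enorm h)) => //; [exact: ltW| |exact: eps_le1|exact: ltW].
  have h1 : enorm h <= 1 by exact: le_trans (ltW hd) d1.
  by rewrite -[leLHS](powRr1 (ltW h0)); apply: ger_powR => //; rewrite h0.
have h20 : 0 < enorm (tadd h h) by rewrite enorm_double mulr_gt0.
have h2d : enorm (tadd h h) < d by rewrite enorm_double.
have dJ2 : d <= 2 ^+ J * enorm (tadd h h) by rewrite enorm_double mulrA -exprSr.
have I := IH _ h20 h2d dJ2; have I2 := H2 h h0 hd.
have z1 := eps_le1 _ h20 h2d.
move: I z1; rewrite enorm_double !(@powRM R 2 (enorm h) _ _ (ltW h0))// => I z1.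
set e := enorm h in h0 hd hd2 dJ I I2 z1 *.
have t0 : 0 < e `^ sg by rewrite powR_gt0.
have zz : 0 < e `^ eps by rewrite powR_gt0.
have m1' : measurable_fun setT (diff v (tadd h h)) by exact: measurable_diff.
have m2' : measurable_fun setT (diff v h) by exact: measurable_diff.
have m3' : measurable_fun setT (diff (diff v h) h) by exact: measurable_diff.
have De : e `^ (sg + eps) = e `^ sg * e `^ eps by exact: powRD_ge0 (ltW h0) sg0 eps0.
rewrite De in I2.
have f0 : 0 < 1 - 2 `^ eps * e `^ eps / 2 by move: z1; clear; lra.
have X0 : 0 < A * (2 `^ sg * e `^ sg) * (1 - 2 `^ eps * e `^ eps / 2) / 2.
  by rewrite divr_gt0// mulr_gt0// mulr_gt0// mulr_gt0// powR_gt0.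
have Y0 : 0 < K1 * (e `^ sg * e `^ eps) / 2 by rewrite divr_gt0// mulr_gt0// mulr_gt0.
have scale (f : T -> R) (X : R) : measurable_fun setT f -> 0 <= X ->
   (\int[mu]_x (\1_B x * `|f x| `^ m)%:E <= (X `^ m)%:E)%E ->
   (\int[mu]_x (\1_B x * `|2^-1 * f x| `^ m)%:E <= ((X / 2) `^ m)%:E)%E.
  move=> mf X0' If.
  rewrite (_ : (fun x => (\1_B x * `|2^-1 * f x| `^ m)%:E) = (fun x => (2^-1 `^ m * (\1_B x * `|f x| `^ m))%:E)); last first.
    by apply/funext => x; rewrite normrM ger0_norm ?invr_ge0// powRM ?invr_ge0// mulrCA.
  have c20 : 0 <= 2^-1 `^ m :> R by exact: powR_ge0.
  have mF : measurable_fun setT (fun x => \1_B x * `|f x| `^ m) by msr.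
  rewrite (intRZ _ _ _ _ _ mF _ c20); last by move=> x; rewrite mulr_ge0 ?powR_ge0.
  by rewrite (mulrC X) powRM ?invr_ge0// EFinM; exact: lee_scale.
have w1 : A * e `^ sg * (1 - e `^ eps / 2) >= A * (2 `^ sg * e `^ sg) * (1 - 2 `^ eps * e `^ eps / 2) / 2 + K1 * (e `^ sg * e `^ eps) / 2.
  apply: doubling_real => //; try exact: ltW.
  by rewrite -[leRHS](@powRr1 R 2)//; apply: ler_powR => //; rewrite ler1n.
apply: (@le_trans _ _ ((A * (2 `^ sg * e `^ sg) * (1 - 2 `^ eps * e `^ eps / 2) / 2 + K1 * (e `^ sg * e `^ eps) / 2) `^ m)%:E); last first.
  rewrite lee_fin; apply: ler_powR2 => //.
  by rewrite addr_ge0// ltW.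
apply: (minkowski_set B (fun x => 2^-1 * diff v (tadd h h) x) (fun x => 2^-1 * diff (diff v h) h x)) => //.
- by clear -m1'; msr.
- by clear -m3'; msr.
- by move=> x; rewrite {1}diff2E ler_normB.
- apply: scale => //; rewrite ltW// mulr_gt0//mulr_gt0//mulr_gt0// powR_gt0//.
- by apply: scale => //; rewrite ltW// mulr_gt0// mulr_gt0.
Qed.

(** [averaging] applied to [diff v h] with the increment [h] itself: it turns the energy into a
    second difference and contributes [|h| ^ (s p)]. *)
Lemma second_diff_bound (s1 p s b : R) : 2 <= p -> 0 < s1 < 1 -> 0 < s < 1 -> 1 <= b ->
  exists2 C : R, 0 < C & forall lam x0 Rr v Z (h : T) rho d sg K,
    nsol s1 p s lam x0 Rr v Z -> 0 < d <= 1 -> Rr < 1 -> 0 < enorm h -> enorm h < d ->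
    0 <= rho -> rho + 6 * d <= Rr -> s <= sg <= 1 -> 0 <= K ->
    Hreg v x0 (p - 2 + b) sg (rho + 6 * d) K ->
    (\int[mu]_x (\1_(eball x0 rho) x * `|diff (diff v h) h x| `^ (p + b - 1))%:E <=
     (C * d `^ (- (N%:R + 2 * (s * p) + 2)) * (K + 1) *
      enorm h `^ (s * p + sg * b))%:E)%E.
Proof.
move=> p2 s10 s01 b1; have /andP[s0 s1'] := s01.
have [C1 C10 H1] := @energy_step R N s1 p s b p2 s10 s01 b1.
have sp0 : 0 <= s * p by apply: mulr_ge0; [exact: ltW|exact: le_trans p2].
have m0 : 0 < p + b - 1 by move: p2 b1; clear; lra.
have [C2 C20 H2] := @averaging R N (p + b - 1) (s * p) m0 sp0.
exists (C2 * C1); first exact: mulr_gt0.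
move=> lam x0 Rr v Z h rho d sg K sol d01 R1 h0 hd rho0 rR ssg K0 HK.
have mw : measurable_fun setT (diff v h) by apply: measurable_diff; exact: ns_mv _ _ _ _ _ _ _ _ sol.
have I1 := H1 _ _ _ _ _ _ _ _ _ _ sol d01 R1 h0 hd rho0 rR ssg K0 HK.
have I2 := H2 (diff v h) x0 h rho d mw h0 (ltW hd).
have c0 : 0 <= C2 * enorm h `^ (s * p) by exact: mulr_ge0 (ltW C20) (powR_ge0 _ _).
apply: (le_trans (le_trans I2 (lee_scale _ _ _ c0 I1))).
have b0 : 0 <= b by exact: le_trans b1.
have sb0 : 0 <= sg * b.
  by apply: mulr_ge0 => //; case/andP: ssg => + _; apply: le_trans; exact: ltW.
rewrite (powRD_ge0 _ _ _ (ltW h0) sp0 sb0) (powRrM _ sg b) -EFinM lee_fin.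
set x := enorm h `^ (s * p); set y := _ `^ b; set z := d `^ _.
by rewrite le_eqVlt; apply/orP; left; apply/eqP; ring.
Qed.

Lemma int_diff_trivial (v : T -> R) (B : set T) (m rho : R) (x0 h : T) : 0 <= rho -> rho < 1 -> 1 <= m ->
  measurable_fun setT v -> measurable B -> B `<=` eball x0 rho ->
  (forall x, B x -> `|diff v h x| <= 2) ->
  (\int[mu]_x (\1_B x * `|diff v h x| `^ m)%:E <= ((2 * 2 ^+ N) `^ m)%:E)%E.
Proof.
move=> rho0 rho1 m1 mv mB Bs bd; have m0 : 0 <= m by exact: le_trans m1.
have mw : measurable_fun setT (diff v h) by exact: measurable_diff.
have V1 : 1 <= 2 ^+ N :> R by rewrite exprn_ege1// ler1n.
apply: (@le_trans _ _ (\int[mu]_x (2 `^ m * \1_B x)%:E)%E).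
  apply: intR_le.
  - by msr.
  - by msr.
  - by move=> x; rewrite mulr_ge0 ?powR_ge0.
  - move=> x; rewrite mulrC indicE; have [xB|xB] := pselect (B x); last by rewrite (memNset xB) !mulr0.
    by rewrite (mem_set xB) !mulr1; apply: ler_powR2 => //; exact: bd.
have mI : measurable_fun setT (\1_B : T -> R) by exact: measurable_indic.
rewrite (intRZ _ _ _ _ _ mI _ (powR_ge0 _ _)); last by [].
rewrite integral_indic// setIT.
have hB : (mu B <= (2 ^+ N)%:E)%E.
  apply: (@le_trans _ _ (mu (eball x0 rho))).
    by apply: le_measure; rewrite ?inE//; exact: measurable_eball.
  apply: (le_trans (muN_eball_le x0 _ rho0)); rewrite lee_fin lerXn2r ?nnegrE ?mulr_ge0//.
  by move: rho1; clear; lra.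
apply: (le_trans (lee_scale _ _ _ (powR_ge0 _ _) hB)); rewrite -EFinM lee_fin powRM//.
apply: ler_wpM2l; first exact: powR_ge0.
rewrite -[leLHS]powRr1//.
exact: ler_powR.
Qed.

Lemma int_diff_far (v : T -> R) (x0 k : T) (m rho : R) : 0 <= rho -> rho < 1 -> 1 <= m ->
  measurable_fun setT v -> (forall x, eball x0 rho x -> `|v x| <= 1) ->
  (\int[mu]_x (\1_(eball x0 rho) x * \1_(eball x0 rho) (tadd x k) * `|diff v k x| `^ m)%:E
    <= ((2 * 2 ^+ N) `^ m)%:E)%E.
Proof.
move=> rho0 rho1 m1 mv bd; set B := eball x0 rho.
have mB : measurable B by exact: measurable_eball.
have mw : measurable_fun setT (diff v k) by exact: measurable_diff.
have mI : measurable_fun setT (fun x => \1_B (tadd x k) : R).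
  by apply: (measurable_taddl (\1_B) k); exact: measurable_indic.
pose B' := B `&` [set x | B (tadd x k)].
have mB' : measurable B'.
  apply: measurableI => //; rewrite -[X in measurable X]setTI.
  by have := measurable_taddr k : measurable_fun setT (fun x => tadd x k); apply.
apply: (@le_trans _ _ (\int[mu]_x (\1_B' x * `|diff v k x| `^ m)%:E)%E).
  apply: intR_le.
  - by msr.
  - by msr.
  - by move=> x; rewrite !mulr_ge0 ?powR_ge0.
  - by move=> x; rewrite /B' indicI /= !indicE.
apply: (int_diff_trivial v B' m rho x0 k rho0 rho1 m1 mv mB').
- by move=> x [].
- move=> x [xB xkB]; rewrite /diff (le_trans (ler_normB _ _))// (_ : 2 = 1 + 1 :> R)//.
  by apply: lerD; exact: bd.
Qed.

(** [A] is the sum of the two quantities that [doubling] requires it to dominate, [K1 / w] and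
    [4 c / d]. Its [m]-th power is bounded linearly in [K + 1] with a power of [d] in front, a form
    that can be iterated. *)
Lemma reg_const (C w m kap d K c : R) : 0 < C -> 0 < w -> 1 <= m -> 0 <= kap -> 0 < d <= 1 -> 0 <= K -> 0 < c ->
  let K1 := (C * d `^ (- kap) * (K + 1)) `^ m^-1 in
  let A := K1 / w + 4 * c / d in
  [/\ 0 < K1, 0 < A, K1 <= A * w, 4 * c <= A * d & K1 `^ m = C * d `^ (- kap) * (K + 1) /\
    A `^ m <= 2 `^ m * (C / w `^ m + (4 * c) `^ m) * d `^ (- (kap + m)) * (K + 1)].
Proof.
move=> C0 w0 m1 kap0 d01 K0 c0 K1 A; have /andP[d0 d1] := d01.
have m0 : 0 < m by exact: lt_le_trans m1.
have K10 : 0 < K + 1 by move: K0; clear; lra.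
have X0 : 0 < C * d `^ (- kap) * (K + 1) by rewrite !mulr_gt0// powR_gt0.
have K1p : 0 < K1 by exact: powR_gt0.
have c4 : 0 < 4 * c / d by rewrite divr_gt0// mulr_gt0.
have Kw : 0 < K1 / w by rewrite divr_gt0.
have A0 : 0 < A by exact: addr_gt0.
have K1m : K1 `^ m = C * d `^ (- kap) * (K + 1).
  by rewrite /K1 -powRrM mulVf ?powRr1 ?(ltW X0)// gt_eqF.
split => //; last split => //.
- by rewrite /A mulrDl divfK ?gt_eqF// lerDl mulr_ge0// ltW.
- by rewrite /A (mulrDl (K1 / w)) (divfK (lt0r_neq0 d0)) lerDr mulr_ge0// ltW.
- apply: (le_trans (powR_le_add _ _ A m (ltW m0) (ltW A0) (ltW Kw) (ltW c4) (lexx _))).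
  rewrite -!mulrA; apply: ler_wpM2l; first exact: powR_ge0.
  rewrite (powR_dvd _ _ _ (ltW K1p) (ltW w0)) K1m mulrA (powR_dvd (4 * c) d m); last 2 first.
  - by rewrite mulr_ge0// ltW.
  - exact: ltW.
  have D0 : 0 <= d `^ (- (kap + m)) * (K + 1) by rewrite mulr_ge0 ?powR_ge0// ltW.
  rewrite (mulrDl (C / w `^ m)); apply: lerD.
    have -> : C * d `^ (- kap) * (K + 1) / w `^ m = C / w `^ m * (d `^ (- kap) * (K + 1)) by ring.
    apply: ler_wpM2l; first by rewrite divr_ge0 ?powR_ge0// ltW.
    apply: ler_wpM2r; first exact: ltW.
    by apply: powRN_le => //; rewrite lerDl ltW.
  apply: ler_wpM2l; first exact: powR_ge0.
  rewrite -powRN -[leLHS]mulr1; apply: ler_pM; rewrite ?powR_ge0//.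
    by apply: powRN_le => //; rewrite lerDr.
  by move: K0; clear; lra.
Qed.

(** The condition on the exponents says that second differences are of order [sg' + eps] in [L^m],
    where [m = p + b - 1]. For [|k| < d] they yield first differences by [doubling]; for [|k| >= d]
    the bound of order zero suffices, since [A |k| ^ sg'] is then at least [4 c]. *)
Lemma reg_step (s1 p s b sg sg' eps : R) : 2 <= p -> 0 < s1 < 1 -> 0 < s < 1 -> 1 <= b ->
  s <= sg <= 1 -> 0 <= sg' <= 1 -> 0 < eps ->
  (p + b - 1) * (sg' + eps) <= s * p + sg * b ->
  exists C kap : R, [/\ 0 < C, 0 < kap & forall lam (x0 : T) Rr v Z rho d K,
    nsol s1 p s lam x0 Rr v Z -> 0 < d <= 1 -> Rr < 1 ->
    0 <= rho -> rho + 6 * d <= Rr -> 0 <= K ->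
    Hreg v x0 (p - 2 + b) sg (rho + 6 * d) K ->
    Hreg v x0 (p + b - 1) sg' rho (C * d `^ (- kap) * (K + 1))].
Proof.
move=> p2 s10 s01 b1 ssg sg01' eps0 hexp.
have [C1 C10 H] := second_diff_bound s1 p s b p2 s10 s01 b1.
set m := p + b - 1 in hexp H *.
have m1 : 1 <= m by rewrite /m; move: p2 b1; clear; lra.
have m0 : 0 <= m by exact: le_trans m1.
pose w : R := 2 `^ eps - 1.
have w0 : 0 < w.
  have one : 1 `^ eps = 1 :> R by rewrite powR1.
  rewrite /w subr_gt0 -[ltLHS]one; apply: gt0_ltr_powR => //; rewrite ?nnegrE//.
  by rewrite ltr1n.
pose c : R := 2 * 2 ^+ N.
have c0 : 0 < c by rewrite mulr_gt0// exprn_gt0.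
set kap := N%:R + 2 * (s * p) + 2 in H *.
have kap0 : 0 <= kap.
  rewrite /kap; have := ler0n R N; have : 0 <= s * p; last by clear; lra.
  by case/andP: s01 => *; apply: mulr_ge0; [exact: ltW|exact: le_trans p2].
exists (2 `^ m * (C1 / w `^ m + (4 * c) `^ m)), (kap + m).
split.
- apply: mulr_gt0; first exact: powR_gt0.
  apply: addr_gt0; first exact: divr_gt0 C10 (powR_gt0 _ w0).
  by apply: powR_gt0; exact: mulr_gt0.
- by move: m1 kap0; clear; lra.
move=> lam x0 Rr v Z rho d K sol d01 R1 rho0 rR K0 HK k.
have /andP[d0 d1] := d01.
have [K1p A0 KA cA [K1m Am]] := reg_const C1 w m kap d K c C10 w0 m1 kap0 d01 K0 c0.
set K1 := (C1 * _ * _) `^ _ in K1p KA cA K1m Am A0; set A := K1 / w + 4 * c / d in KA cA Am A0.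
have mv := ns_mv _ _ _ _ _ _ _ _ sol; have bd := ns_bd _ _ _ _ _ _ _ _ sol.
set B := eball x0 rho.
have mB : measurable B by exact: measurable_eball.
have mw : measurable_fun setT (diff v k) by exact: measurable_diff.
have rho1 : rho < 1 by move: rR R1 d0; clear; lra.
have BR x : B x -> eball x0 Rr x by rewrite /B /eball/=; move: rR d0; clear; lra.
have clear_t0 : 0 <= enorm k `^ sg' by exact: powR_ge0.
have mI : measurable_fun setT (fun x => \1_B (tadd x k) : R).
  by apply: (measurable_taddl (\1_B) k); exact: measurable_indic.
apply: (@le_trans _ _ ((A * enorm k `^ sg') `^ m)%:E); last first.
  by rewrite lee_fin powRM ?(ltW A0)//; apply: ler_wpM2r; first exact: powR_ge0.
have sg0' : 0 <= sg' by case/andP: sg01'.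
have [k0|kn] := eqVneq (enorm k) 0.
  have kk : k = origin _ by apply: edist_eq0.
  rewrite (_ : (fun x => _) = (fun=> 0%E)); last first.
    apply/funext => x; have -> : diff v k x = 0 by rewrite /diff kk tadd0 subrr.
    by rewrite normr0 powR0 ?mulr0// gt_eqF// (lt_le_trans _ m1).
  by rewrite integral0 lee_fin powR_ge0.
have kp : 0 < enorm k by rewrite lt_def kn edist_ge0.
have [kd|kd] := ltP (enorm k) d.
  have H1 h : 0 < enorm h -> enorm h < d ->
      (\int[mu]_x (\1_B x * `|diff (diff v h) h x| `^ m)%:E <= ((K1 * enorm h `^ (sg' + eps)) `^ m)%:E)%E.
    move=> h0 hd; apply: (le_trans (H _ _ _ _ _ _ _ _ _ _ sol d01 R1 h0 hd rho0 rR ssg K0 HK)).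
    rewrite lee_fin (powRM _ (ltW K1p) (powR_ge0 _ _)) K1m; apply: ler_wpM2l.
      by rewrite -K1m powR_ge0.
    rewrite -powRrM (mulrC _ m); apply: ger_powR => //; rewrite h0/=.
    exact: (le_trans (ltW hd)).
  have H2 h : 0 < enorm h -> enorm h < d ->
      (\int[mu]_x (\1_B x * `|diff v h x| `^ m)%:E <= (c `^ m)%:E)%E.
    move=> h0 hd; apply: (int_diff_trivial v B m rho x0) => // x xB.
    rewrite /diff (le_trans (ler_normB _ _))// (_ : 2 = 1 + 1 :> R)//; apply: lerD; apply: bd; last exact: BR.
    rewrite /eball/=; apply: (le_lt_trans (edist_triangle x _ _)); rewrite edistC edist_taddr.
    by move: xB; rewrite /B /eball/=; move: rR d0 hd; clear; lra.
  (* Any number of doublings that brings [k] up to size [d] will do; the bound in [doubling] does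
     not depend on it. *)
  have [J hJ] : exists J : nat, d <= 2 ^+ J * enorm k.
    exists (Num.bound (d / enorm k)); rewrite -ler_pdivrMr//.
    have := archi_boundP (divr_ge0 (ltW d0) (ltW kp)) => /ltW/le_trans; apply.
    by rewrite -natrX ler_nat ltnW// ltn_expl.
  have D := doubling v B m sg' eps d c K1 A mB mv m1 sg01' (ltW eps0) d01 K1p A0 KA cA (ltW c0) H1 H2 J k kp kd hJ.
  apply: le_trans (le_trans D _).
    apply: intR_le.
    - by msr.
    - by msr.
    - by move=> x; rewrite !mulr_ge0 ?powR_ge0.
    - move=> x; apply: ler_wpM2r; first exact: powR_ge0.
      by rewrite ler_piMr// indicE; case: (_ \in _).
  rewrite lee_fin; have z0 := powR_ge0 (enorm k) eps.
  have z1 : enorm k `^ eps <= 1.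
    by apply: powR_le1; rewrite ?(ltW kp) ?(ltW eps0)//= (le_trans (ltW kd)).
  have At : 0 <= A * enorm k `^ sg' by rewrite mulr_ge0// ltW.
  apply: ler_powR2 => //; first by rewrite mulr_ge0//; move: z1; clear; lra.
  by rewrite ler_piMr//; move: z0; clear; lra.
apply: (le_trans (int_diff_far v x0 k m rho rho0 rho1 m1 mv _)); first by move=> x /BR; exact: bd.
rewrite lee_fin -/c; apply: ler_powR2 => //; first exact: ltW.
have h1 : d <= enorm k `^ sg'.
  apply: (@le_trans _ _ (d `^ sg')); last by apply: ler_powR2 => //; exact: ltW.
  rewrite -[leLHS](powRr1 (ltW d0)); apply: ger_powR => //; first by case/andP: sg01'.
have h2 : A * d <= A * enorm k `^ sg' by apply: ler_wpM2l => //; exact: ltW.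
by move: cA h2 c0; clear; lra.
Qed.

End doubling.

(** * Iteration of the integrability exponent *)

Section iteration.
Context {R : realType} {N : nat}.
Local Notation T := (N.-tuple R).
Local Notation mu := (muN R N).
Local Notation mu2 := (muN R N \x muN R N)%E.

Lemma gag_subset (m tau : R) (A B : set T) (f : T -> R) : A `<=` B ->
  forall z, gag m tau A f z <= gag m tau B f z.
Proof.
move=> AB z; rewrite /gag; apply: ler_wpM2r; first by rewrite divr_ge0 ?powR_ge0.
have h x : \1_A x <= \1_B x :> R.
  rewrite !indicE; have [xA|xA] := pselect (A x); last by rewrite (memNset xA).
  by rewrite !mem_set//; exact: AB.
exact: ler_pM.
Qed.

(** Start of the iteration: [averaging] applied to [v] itself, whose energy in the ball is at most 1
    by normalization. *)
Lemma reg_base (s1 p s : R) : 2 <= p -> 0 < s < 1 ->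
  exists2 C : R, 0 < C & forall lam (x0 : T) Rr v Z rho d,
    nsol s1 p s lam x0 Rr v Z -> 0 < d <= 1 -> Rr < 1 -> 0 <= rho -> rho + 2 * d <= Rr ->
    Hreg v x0 p s rho (C * d `^ (- (s * p))).
Proof.
move=> p2 /andP[s0 s1'].
have p0 : 0 < p by exact: lt_le_trans p2.
have sp0 : 0 <= s * p by rewrite mulr_ge0// ltW.
have [C1 C10 H] := @averaging R N p (s * p) p0 sp0.
pose c : R := (2 * 2 ^+ N) `^ p.
have c0 : 0 < c by rewrite powR_gt0// mulr_gt0// exprn_gt0.
exists (C1 + c); first exact: addr_gt0.
move=> lam x0 Rr v Z rho d sol d01 R1 rho0 rR k; have /andP[d0 d1] := d01.
have mv := ns_mv _ _ _ _ _ _ _ _ sol; have bd := ns_bd _ _ _ _ _ _ _ _ sol.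
have mB : measurable (eball x0 rho) by exact: measurable_eball.
have mw : measurable_fun setT (diff v k) by exact: measurable_diff.
have mI : measurable_fun setT (fun x => \1_(eball x0 rho) (tadd x k) : R).
  by apply: (measurable_taddl (\1_(eball x0 rho)) k); exact: measurable_indic.
have rho1 : rho < 1 by move: rR R1 d0; clear; lra.
rewrite -powRrM.
have ds1 : 1 <= d `^ (- (s * p)) by exact: powRN_ge1.
have [k0|kn] := eqVneq (enorm k) 0.
  have kk : k = origin _ by apply: edist_eq0.
  rewrite (_ : (fun x => _) = (fun=> 0%E)); last first.
    apply/funext => x; have -> : diff v k x = 0 by rewrite /diff kk tadd0 subrr.
    by rewrite normr0 powR0 ?mulr0// gt_eqF.
  by rewrite integral0 lee_fin !mulr_ge0 ?powR_ge0// addr_ge0// ltW.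
have kp : 0 < enorm k by rewrite lt_def kn edist_ge0.
have [kd|kd] := ltP (enorm k) d; last first.
  have BR x : eball x0 rho x -> `|v x| <= 1.
    by move=> xB; apply: bd; move: xB; rewrite /eball/=; move: rR d0; clear; lra.
  have p1 : 1 <= p by apply: le_trans p2; rewrite ler1n.
  apply: (le_trans (int_diff_far v x0 k p rho rho0 rho1 p1 mv BR)).
  rewrite lee_fin -/c powRN -mulrA.
  have h : 1 <= (d `^ (s * p))^-1 * enorm k `^ (s * p).
    by rewrite ler_pdivlMl ?powR_gt0// mulr1; apply: ler_powR2 => //; exact: ltW.
  apply: (@le_trans _ _ ((C1 + c) * 1)); first by rewrite mulr1 lerDr ltW.
  by apply: ler_wpM2l => //; rewrite addr_ge0// ltW.
have I := H v x0 k rho d mv kp (ltW kd).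
have G : (\int[mu2]_z (gag p (s * p) (eball x0 (rho + 2 * d)) v z)%:E <= 1)%E.
  apply: le_trans (ns_gag _ _ _ _ _ _ _ _ sol).
  apply: intR_le.
  - by apply: measurable_gag => //; exact: measurable_eball.
  - by apply: measurable_gag => //; exact: measurable_eball.
  - by move=> z; exact: gag_ge0.
  - by apply: gag_subset => x; rewrite /eball/=; move: rR; clear; lra.
have cc : 0 <= C1 * enorm k `^ (s * p) by rewrite mulr_ge0 ?powR_ge0// ltW.
apply: le_trans (le_trans I (le_trans (lee_scale _ _ _ cc G) _)).
  apply: intR_le.
  - by msr.
  - by msr.
  - by move=> x; rewrite !mulr_ge0 ?powR_ge0.
  - move=> x; apply: ler_wpM2r; first exact: powR_ge0.
    by rewrite ler_piMr// indicE; case: (_ \in _).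
rewrite mule1 lee_fin; apply: ler_wpM2r; first exact: powR_ge0.
rewrite -[leLHS]mulr1; apply: ler_pM => //; first exact: ltW.
by rewrite lerDl ltW.
Qed.

(* One step of the iteration turns [q sg] into at least [q sg + gexp], and
   [gexp > 1] is the hypothesis [s > (p - 1) / p]. Half of the surplus [gexp - 1] is
   given up at each step to absorb the second differences; [sigma n] is the
   resulting number of derivatives in [L^(p + n)]. *)
Definition gexp (p s : R) : R := s * p - p + 2.
Definition gexp' (p s : R) : R := (1 + gexp p s) / 2.
Definition sigma (p s : R) (n : nat) : R :=
  Num.min 1 ((s * p + n%:R * gexp' p s) / (p + n%:R)).

Lemma gexp_bounds (p s : R) : 2 <= p -> (p - 1) / p < s < 1 -> 1 < gexp p s < 2.
Proof.
move=> p2 /andP[]; have p0 : 0 < p by exact: lt_le_trans p2.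
rewrite ltr_pdivrMr// => h1 h2; have h3 : s * p < 1 * p by rewrite ltr_pM2r.
rewrite /gexp; apply/andP; split; lra.
Qed.

Lemma sigma_ge (p s : R) n : 2 <= p -> (p - 1) / p < s < 1 -> s <= sigma p s n <= 1.
Proof.
move=> p2 hs; have /andP[g1 g2] := gexp_bounds p s p2 hs; have /andP[_ s1] := hs.
rewrite /sigma le_min (ltW s1)/= ge_min lexx/= andbT.
have pn : 0 < p + n%:R by rewrite ltr_pwDl//; exact: lt_le_trans p2.
rewrite ler_pdivlMr// mulrDr lerD2l mulrC ler_wpM2l// (le_trans (ltW s1))//.
by rewrite /gexp'; move: g1; clear; lra.
Qed.

(** As [sigma p s n <= 1], the right side is at least [sigma p s n (p + n) + gexp p s]. Of the gain
    [gexp], the part [gexp'] goes into [sigma p s n.+1], and the rest, [(gexp - 1) / 2], is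
    [(p + n + 1) eps]. *)
Lemma sigma_step (p s : R) n : 2 <= p -> (p - 1) / p < s < 1 ->
  let eps := (gexp p s - 1) / 2 / (p + n%:R + 1) in
  0 < eps /\ (p + (n%:R + 2) - 1) * (sigma p s n.+1 + eps) <= s * p + sigma p s n * (n%:R + 2).
Proof.
move=> p2 hs eps; have /andP[g1 g2] := gexp_bounds p s p2 hs.
have N0 : 0 <= n%:R :> R by exact: ler0n.
have /andP[_ sl] := sigma_ge p s n p2 hs.
have pn1 : 0 < p + n%:R + 1 by move: p2 N0; clear; lra.
have pn : 0 < p + n%:R by move: p2 N0; clear; lra.
have e0 : 0 < eps by rewrite /eps !divr_gt0// subr_gt0.
split=> //.
have -> : p + (n%:R + 2) - 1 = p + n%:R + 1 by ring.
rewrite mulrDr.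
have -> : (p + n%:R + 1) * eps = (gexp p s - 1) / 2 by rewrite /eps mulrCA mulfV ?mulr1// gt_eqF.
have h1 : sigma p s n * (p - 2) <= 1 * (p - 2) by apply: ler_wpM2r => //; rewrite subr_ge0.
have h2 : (p + n%:R + 1) * sigma p s n.+1 <= sigma p s n * (p + n%:R) + gexp' p s.
  rewrite {2}/sigma; have [c|c] := leP 1 ((s * p + n%:R * gexp' p s) / (p + n%:R)).
    rewrite mul1r; apply: (@le_trans _ _ ((p + n%:R + 1) * 1)).
      by apply: ler_wpM2l; [exact: ltW|rewrite /sigma ge_min lexx].
    by rewrite mulr1 lerD2l /gexp'; move: g1; clear; lra.
  rewrite divfK ?gt_eqF//.
  have -> : s * p + n%:R * gexp' p s + gexp' p s = (p + n%:R + 1) * ((s * p + n.+1%:R * gexp' p s) / (p + n.+1%:R)).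
    by rewrite -natr1 addrA; field; rewrite gt_eqF.
  by apply: ler_wpM2l; [exact: ltW|rewrite /sigma ge_min lexx orbT].
have E : gexp' p s = (1 + gexp p s) / 2 by [].
have F : gexp p s = s * p - p + 2 by [].
move: h1 h2 E F; set a := sigma _ _ _; set b := sigma _ _ _; clear; lra.
Qed.

(** Each step costs [6 d] of the radius and the base case [2 d], whence [6 n + 2]. *)
Lemma reg_iter (s1 p s : R) n : 2 <= p -> 0 < s1 < 1 -> (p - 1) / p < s < 1 ->
  exists C kap : R, [/\ 0 < C, 0 < kap & forall lam (x0 : T) Rr v Z rho d,
    nsol s1 p s lam x0 Rr v Z -> 0 < d <= 1 -> Rr < 1 -> 0 <= rho ->
    rho + (6 * n%:R + 2) * d <= Rr ->
    Hreg v x0 (p + n%:R) (sigma p s n) rho (C * d `^ (- kap))].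
Proof.
move=> p2 s10 hs.
have p0 : 0 < p by exact: lt_le_trans p2.
have s01 : 0 < s < 1.
  case/andP: hs => h ->; rewrite andbT; apply: le_lt_trans h.
  by rewrite divr_ge0 ?(ltW p0)// subr_ge0 (le_trans _ p2)// ler1n.
have /andP[s0 sl1] := s01.
elim: n => [|n [C [kap [C0 kap0 IH]]]].
  have [C C0 H] := reg_base s1 p s p2 s01.
  exists C, (s * p); split => //; first exact: mulr_gt0.
  move=> lam x0 Rr v Z rho d sol d01 R1 rho0 rR.
  have -> : p + 0%:R = p by rewrite addr0.
  have -> : sigma p s 0 = s.
    by rewrite /sigma mul0r !addr0 mulfK ?gt_eqF// min_r// ltW.
  apply: (H _ _ _ _ _ _ _ sol) => //.
  by move: rR; rewrite mulr0 add0r.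
have [e0 he] := sigma_step p s n p2 hs; set eps := _ / _ in e0 he.
have b1 : 1 <= n%:R + 2 :> R by have := ler0n R n; clear; lra.
have /andP[sg1 sg2] := sigma_ge p s n.+1 p2 hs.
have sg01 : 0 <= sigma p s n.+1 <= 1 by rewrite sg2 andbT (le_trans (ltW s0)).
have [C2 [k2 [C20 k20 H]]] := @reg_step R N s1 p s (n%:R + 2) (sigma p s n) (sigma p s n.+1) eps
  p2 s10 s01 b1 (sigma_ge p s n p2 hs) sg01 e0 he.
exists (C2 * (C + 1)), (k2 + kap); split; [by rewrite mulr_gt0// addr_gt0|exact: addr_gt0|].
move=> lam x0 Rr v Z rho d sol d01 R1 rho0 rR; have /andP[d0 d1] := d01.
have K0 : 0 <= C * d `^ (- kap) by rewrite mulr_ge0 ?powR_ge0// ltW.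
have r6 : 0 <= rho + 6 * d by rewrite addr_ge0// mulr_ge0// ltW.
have rR' : rho + 6 * d + (6 * n%:R + 2) * d <= Rr.
  by apply: le_trans rR; rewrite -natr1; move: d0; clear; lra.
have rR6 : rho + 6 * d <= Rr.
  apply: le_trans rR'; rewrite lerDl mulr_ge0 ?(ltW d0)// addr_ge0// mulr_ge0//.
have := IH _ _ _ _ _ _ _ sol d01 R1 r6 rR'.
have -> : p + n%:R = p - 2 + (n%:R + 2) by ring.
move=> /(H _ _ _ _ _ _ _ _ sol d01 R1 rho0 rR6 K0).
have -> : p + (n%:R + 2) - 1 = p + n.+1%:R by rewrite -natr1; ring.
move=> HH k; apply: (le_trans (HH k)); rewrite lee_fin; apply: ler_wpM2r; first exact: powR_ge0.
rewrite -!mulrA; apply: ler_wpM2l; first exact: ltW.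
rewrite opprD powRD; last by rewrite (gt_eqF d0) implybT.
rewrite mulrCA; apply: ler_wpM2l; first exact: powR_ge0.
by rewrite mulrDl mul1r lerD2l; apply: powRN_ge1 => //; exact: ltW.
Qed.

(** Level [n] is chosen with [sigma p s n = 1]. First differences are taken from level [n + 1],
    second ones from [second_diff_bound] at level [n] with [sg = 1]. Both live in [L^(p + n + 1)],
    and the exponent [s p + n + 2] of the second exceeds [p + n + 1] by [gexp - 1]. *)
Lemma difference_estimates (s1 p s q : R) : 2 <= p -> 0 < s1 < 1 -> (p - 1) / p < s < 1 ->
  exists m gam C kap : R, [/\ q <= m, 1 <= m, 0 < gam, 0 < C & 0 < kap /\
  forall lam (x0 : T) Rr v Z r, nsol s1 p s lam x0 Rr v Z -> 0 < r -> r < Rr -> Rr < 1 ->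
    exists2 d : R, 0 < d & forall h, 0 < enorm h -> enorm h < d ->
    (\int[mu]_x (\1_(eball x0 r) x * `|diff v h x| `^ m)%:E <=
      (C * (Rr - r) `^ (- kap) * enorm h `^ m)%:E)%E /\
    (\int[mu]_x (\1_(eball x0 r) x * `|diff (diff v h) h x| `^ m)%:E <=
      (C * (Rr - r) `^ (- kap) * enorm h `^ (m + gam))%:E)%E].
Proof.
move=> p2 s10 hs; have /andP[g1 g2] := gexp_bounds p s p2 hs.
have p0 : 0 < p by exact: lt_le_trans p2.
have s01 : 0 < s < 1.
  case/andP: hs => h ->; rewrite andbT; apply: le_lt_trans h.
  by rewrite divr_ge0 ?(ltW p0)// subr_ge0 (le_trans _ p2)// ler1n.
have /andP[s0 sl1] := s01.
have g1' : 0 < gexp' p s - 1 by rewrite /gexp'; move: g1; clear; lra.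
(* From [n >= p / (gexp' - 1)] on, [s p + n gexp'] is at least [p + n] and the minimum in [sigma] is
   1; [n >= q] makes the final exponent large enough. *)
pose n := maxn (Num.bound q) (Num.bound (p / (gexp' p s - 1))).
have nq : q <= n%:R.
  have [q0|q0] := ltP q 0; first by rewrite (le_trans (ltW q0)).
  apply: (le_trans (ltW (archi_boundP q0))); rewrite ler_nat leq_maxl//.
have np : p / (gexp' p s - 1) <= n%:R.
  apply: (le_trans (ltW (archi_boundP (divr_ge0 (ltW p0) (ltW g1'))))).
  by rewrite ler_nat leq_maxr.
have sn (k : nat) : (n <= k)%N -> sigma p s k = 1.
  move=> nk; rewrite /sigma min_l// ler_pdivlMr; last by rewrite ltr_pwDl.
  rewrite mul1r; have : p <= k%:R * (gexp' p s - 1).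
    rewrite -ler_pdivrMr//; apply: (le_trans np); by rewrite ler_nat.
  have : 0 <= s * p by rewrite mulr_ge0// ltW.
  by clear; lra.
have [C1 [k1 [C10 k10 H1]]] := reg_iter s1 p s n p2 s10 hs.
have [C2 [k2 [C20 k20 H2]]] := reg_iter s1 p s n.+1 p2 s10 hs.
rewrite sn// in H1; rewrite sn// in H2.
have N0 : 0 <= n%:R :> R by exact: ler0n.
have b1 : 1 <= n%:R + 2 :> R by move: N0; clear; lra.
have [C3 C30 H3] := @second_diff_bound R N s1 p s (n%:R + 2) p2 s10 s01 b1.
set k3 := N%:R + _ + 2 in H3.
have k30 : 0 <= k3.
  rewrite /k3; have := ler0n R N; have : 0 <= s * p by rewrite mulr_ge0// ltW.
  by clear; lra.
(* The gap [Rr - r] is divided into [6 n + 9] parts: [6 (n + 1) + 2] for level [n + 1], and one for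
   the shift by [h]. *)
pose M : R := 6 * n%:R + 9.
have M1 : 1 <= M by rewrite /M; move: N0; clear; lra.
have M0 : 0 < M by exact: lt_le_trans M1.
pose k := k1 + k2 + k3.
have kk0 : 0 < k by rewrite /k; move: k10 k20 k30; clear; lra.
pose C := (C2 + C3 * (C1 + 1)) * M `^ k.
exists (p + n.+1%:R), (gexp p s - 1), C, k; split.
- by apply: (le_trans nq); rewrite -natr1; move: p2; clear; lra.
- by rewrite -natr1; move: p2 N0; clear; lra.
- by rewrite subr_gt0.
- by rewrite mulr_gt0 ?powR_gt0// addr_gt0// mulr_gt0// addr_gt0.
split=> // lam x0 Rr v Z r sol r0 rR R1.
pose D := Rr - r; have D0 : 0 < D by rewrite subr_gt0.
have D1 : D <= 1 by rewrite /D; move: R1 r0; clear; lra.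
pose d := D / M; have d0 : 0 < d by rewrite divr_gt0.
have d1 : d <= 1 by rewrite ler_pdivrMr// mul1r (le_trans D1).
have d01 : 0 < d <= 1 by rewrite d0.
have Md : M * d = D by rewrite mulrC divfK// gt_eqF.
have dk : d `^ (- k) = M `^ k * D `^ (- k).
  by rewrite !powRN powR_dvd ?(ltW D0) ?(ltW M0)// invf_div.
exists d => // h h0 hd.
have mv := ns_mv _ _ _ _ _ _ _ _ sol.
have mw : measurable_fun setT (diff v h) by exact: measurable_diff.
have mB : measurable (eball x0 r) by exact: measurable_eball.
have dk1 (a : R) : a <= k -> d `^ (- a) <= d `^ (- k) by exact: powRN_le.
have h1 : enorm h <= 1 by exact: le_trans (ltW hd) d1.
split.
  have rr : 0 <= r + d by rewrite addr_ge0// ltW.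
  have rR2 : r + d + (6 * n.+1%:R + 2) * d <= Rr.
    by move: Md; rewrite /M /D -natr1; clear; lra.
  have I := H2 _ _ _ _ _ _ _ sol d01 R1 rr rR2 h.
  have mB' : measurable (eball x0 (r + d)) by exact: measurable_eball.
  have mI : measurable_fun setT (fun x => \1_(eball x0 (r + d)) (tadd x h) : R).
    by apply: (measurable_taddl (\1_(eball x0 (r + d))) h); exact: measurable_indic.
  apply: le_trans (le_trans I _).
    apply: intR_le.
    - by msr.
    - by msr.
    - by move=> x; rewrite mulr_ge0 ?powR_ge0.
    - move=> x; apply: ler_wpM2r; first exact: powR_ge0.
      rewrite !indicE; have [xB|xB] := pselect (eball x0 r x); last by rewrite (memNset xB) mulr_ge0.
      have b1' : eball x0 (r + d) x by move: xB; rewrite /eball/=; move: d0; clear; lra.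
      have b2' : eball x0 (r + d) (tadd x h).
        rewrite /eball/=; apply: (le_lt_trans (edist_triangle x _ _)); rewrite edistC edist_taddr.
        by move: xB; rewrite /eball/=; move: hd; clear; lra.
      by rewrite (mem_set xB) (mem_set b1') (mem_set b2') mulr1.
  rewrite lee_fin powRr1 ?edist_ge0//; apply: ler_wpM2r; first exact: powR_ge0.
  rewrite /C -[leRHS]mulrA -dk; apply: ler_pM; rewrite ?powR_ge0 ?(ltW C20)//.
    by rewrite lerDl mulr_ge0 ?(ltW C30)// addr_ge0// ltW.
  by apply: dk1; rewrite /k; move: k10 k30; clear; lra.
have r6 : 0 <= r + 6 * d by rewrite addr_ge0 ?(ltW r0)// mulr_ge0// ltW.
have rR1 : r + 6 * d + (6 * n%:R + 2) * d <= Rr.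
  by move: Md d0; rewrite /M /D; clear; lra.
have I := H1 _ _ _ _ _ _ _ sol d01 R1 r6 rR1.
have rR3 : r + 6 * d <= Rr.
  apply: le_trans rR1; rewrite lerDl mulr_ge0 ?(ltW d0)// addr_ge0// mulr_ge0//.
have K0 : 0 <= C1 * d `^ (- k1) by rewrite mulr_ge0 ?powR_ge0// ltW.
have e : p + n%:R = p - 2 + (n%:R + 2) by ring.
rewrite e in I.
have ssg : s <= 1 <= (1 : R) by apply/andP; split; [exact: ltW|exact: lexx].
have J := H3 _ _ _ _ _ _ _ _ _ _ sol d01 R1 h0 hd (ltW r0) rR3 ssg K0 I.
have e' : p + (n%:R + 2) - 1 = p + n.+1%:R by rewrite -natr1; ring.
rewrite e' in J; apply: (le_trans J); rewrite lee_fin.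
have -> : s * p + 1 * (n%:R + 2) = p + n.+1%:R + (gexp p s - 1) by rewrite /gexp -natr1; ring.
apply: ler_wpM2r; first exact: powR_ge0.
rewrite /C -[leRHS]mulrA -dk.
apply: (@le_trans _ _ (C3 * (C1 + 1) * d `^ (- k))); last first.
  by apply: ler_wpM2r; [exact: powR_ge0|rewrite lerDr ltW].
rewrite -!mulrA; apply: ler_wpM2l; first exact: ltW.
apply: (@le_trans _ _ (d `^ (- k3) * ((C1 + 1) * d `^ (- k1)))).
  apply: ler_wpM2l; first exact: powR_ge0.
  by rewrite mulrDl mul1r lerD2l; apply: powRN_ge1 => //; exact: ltW.
rewrite mulrCA; apply: ler_wpM2l; first by rewrite addr_ge0// ltW.
rewrite -powRD; last by rewrite (gt_eqF d0) implybT.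
by rewrite -opprD; apply: dk1; rewrite /k; move: k20; clear; lra.
Qed.

End iteration.

(** * Compactness and smooth functions *)

Section euclidean_topology.
Context {R : realType} {N : nat}.
Local Notation T := (N.-tuple R).

(** Makes a local radius uniform on a closed cube. The property is inherited by smaller [e], so the
    covering form of compactness applies to the filter of small positive [e]; the cube is read as a
    product of segments of row vectors. *)
Lemma cube_compact (M : R) (P : R -> T -> Prop) :
  (forall e e' x, 0 < e' -> e' <= e -> P e x -> P e' x) ->
  (forall x, (forall i, `|tnth x i| <= M) ->
     exists2 e, 0 < e & forall y, edist y x < e -> P e y) ->
  exists2 e, 0 < e & forall x, (forall i, `|tnth x i| <= M) -> P e x.
Proof.
move=> Pmono Ploc.
pose K := [set v : 'rV[R]_N | forall i, `[- M, M]%classic (v ord0 i)].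
have cK : near_covering K.
  apply/compact_near_coveringP; apply: (@rV_compact R N (fun=> `[- M, M]%classic)) => i.
  exact: segment_compact.
pose tup (v : 'rV[R]_N) : T := [tuple v ord0 i | i < N].
have Ktup v : K v -> forall i, `|tnth (tup v) i| <= M.
  by move=> Kv i; rewrite tnth_mktuple ler_norml; have := Kv i; rewrite /= in_itv.
have FK : \forall e \near (0:R)^'+, K `<=` (fun v => P e (tup v)).
  apply: cK => v /Ktup /Ploc[e e0 He].
  have e1 : 0 < e / N.+1%:R by rewrite divr_gt0.
  exists ([set v' | ball v (e / N.+1%:R) v'], [set t | 0 < t /\ t < e]).
    split; first exact: nbhsx_ballx.
    by near=> t; split; near: t; [exact: nbhs_right_gt|exact: nbhs_right_lt].
  move=> [v' t] /= [[_ vv'] [t0 te]]; apply: (Pmono e) => //; first exact: ltW.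
  apply: He; apply: (@le_lt_trans _ _ (N%:R * (e / N.+1%:R))).
    apply: edist_le_coord; first exact: ltW.
    by move=> i; rewrite !tnth_mktuple distrC; apply: ltW; exact: (vv' ord0 i).
  by rewrite mulrA ltr_pdivrMr// mulrC ltr_pM2l// ltr_nat.
have [e [e0 Pe]] : exists e : R, 0 < e /\ K `<=` (fun v => P e (tup v)).
  exact: (filter_ex (filterI (nbhs_right_gt (0:R)) FK)).
exists e => // x xM.
have -> : x = tup (\row_i tnth x i).
  by apply: eq_from_tnth => i; rewrite tnth_mktuple mxE.
by apply: Pe => i /=; rewrite mxE in_itv /= -ler_norml.
Unshelve. all: by end_near. Qed.

Lemma ler_coord_enorm (x : T) i : `|tnth x i| <= enorm x.
Proof. by have := ler_coord_edist x (origin N) i; rewrite tnth_mktuple subr0. Qed.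

Lemma ball_cc_margin (Om : set T) (x0 : T) (rho : R) : eopen Om -> ball_cc Om x0 rho ->
  exists2 e : R, 0 < e & forall x, edist x x0 <= rho -> eball x e `<=` Om.
Proof.
move=> oOm [rho0 sOm].
have [||e e0 He] := @cube_compact (rho + enorm x0) (fun e x => edist x x0 <= rho -> eball x e `<=` Om).
- by move=> e e' x e'0 ee' H xr y yx; apply: (H xr); exact: lt_le_trans ee'.
- move=> x xM; have [xr|xr] := leP (edist x x0) rho; last first.
    exists (edist x x0 - rho); first by rewrite subr_gt0.
    move=> y yx yr; exfalso; have := edist_triangle y x x0.
    by rewrite (edistC x y); move: yx yr; clear; lra.
  have [e e0 He] := oOm x (sOm x xr).
  exists (e / 2); first by rewrite divr_gt0.
  move=> y yx _ z zy; apply: He; rewrite /eball/=.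
  apply: (le_lt_trans (edist_triangle y _ _)).
  by move: zy; rewrite /eball/=; move: yx; clear; lra.
exists e => // x xr; apply: He => // i; apply: (le_trans (ler_coord_enorm x i)).
by apply: (le_trans (edist_triangle x0 _ _)); rewrite lerD2r.
Qed.

(** The bound is written [e^-1] in order to be a property inherited by smaller [e], as
    [cube_compact] requires. *)
Lemma econtinuous_bounded (f : T -> R) (M : R) : econtinuous f ->
  exists2 L : R, 0 < L & forall x, enorm x <= M -> `|f x| <= L.
Proof.
move=> cf.
have [||e e0 He] := @cube_compact M (fun e x => `|f x| <= e^-1).
- by move=> e e' x e'0 ee' H; apply: (le_trans H); rewrite lef_pV2 ?posrE// (lt_le_trans e'0).
- move=> x xM; have [d d0 Hd] := cf x 1 ltr01.
  have p : 0 < `|f x| + 1 by rewrite ltr_wpDl.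
  exists (Num.min d (`|f x| + 1)^-1); first by rewrite lt_min d0 invr_gt0.
  move=> y; rewrite lt_min => /andP[yd _]; apply: (@le_trans _ _ (`|f x| + 1)).
    rewrite -lerBlDl; apply: (le_trans _ (ltW (Hd y yd))).
    exact: lerB_dist.
  by rewrite -[leLHS]invrK lef_pV2 ?posrE ?invr_gt0 ?lt_min ?d0 ?invr_gt0// ge_min lexx orbT.
exists e^-1; first by rewrite invr_gt0.
by move=> x xM; apply: He => i; exact: le_trans (ler_coord_enorm x i) xM.
Qed.

Lemma rat_dense (x : T) (e : R) : 0 < e -> exists c : N.-tuple rat,
  edist [tuple ratr (tnth c i) | i < N] x < e.
Proof.
move=> e0; have e1 : 0 < e / N.+1%:R by rewrite divr_gt0.
have h i : exists c : rat, `|ratr c - tnth x i| < e / N.+1%:R.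
  have lt1 : tnth x i - e / N.+1%:R < tnth x i + e / N.+1%:R.
    by rewrite ltrBlDr -addrA ltrDl addr_gt0.
  by have [c] := rat_in_itvoo lt1; rewrite in_itv/= => ce; exists c; rewrite ltr_distl.
have [c hc] := choice h.
exists [tuple c i | i < N]; apply: (@le_lt_trans _ _ (N%:R * (e / N.+1%:R))).
  apply: edist_le_coord; first exact: ltW.
  by move=> i; rewrite !tnth_mktuple; exact: ltW.
by rewrite mulrA ltr_pdivrMr// mulrC ltr_pM2l// ltr_nat.
Qed.

(** Every point of [A] lies in a ball with rational centre and radius that is contained in [A], and
    there are countably many such balls. *)
Lemma eopen_measurable (A : set T) : eopen A -> measurable A.
Proof.
move=> oA.
pose I : Type := (N.-tuple rat * rat)%type.
pose ctr (k : I) : T := [tuple ratr (tnth k.1 i) | i < N].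
pose D := [set k : I | eball (ctr k) (ratr k.2) `<=` A].
have -> : A = \bigcup_(k in D) eball (ctr k) (ratr k.2).
  apply/seteqP; split=> [x Ax|x [k Dk]]; last exact: Dk.
  have [e e0 He] := oA x Ax.
  have e4 : 0 < e / 4 by rewrite divr_gt0.
  have lt1 : e / 4 < e / 2 by move: e0; clear; lra.
  have [q] := rat_in_itvoo lt1; rewrite in_itv/= => /andP[q1 q2].
  have [c hc] := rat_dense x (e / 4) e4.
  exists (c, q).
    move=> y; rewrite /eball/= => yc; apply: He; rewrite /eball/=.
    apply: (le_lt_trans (edist_triangle _ _ _)); apply: lt_trans (ltrD yc hc) _.
    by move: q2 e0; clear; lra.
  by rewrite /eball/= edistC; exact: lt_trans hc q1.
rewrite bigcup_mkcond; apply: (@countable_bigcupT_measurable _ _ I); first exact: countableP.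
by move=> k; case: ifP => // _; exact: measurable_eball.
Qed.

Lemma econtinuous_measurable (f : T -> R) : econtinuous f -> measurable_fun setT f.
Proof.
move=> cf; apply: (measurability _ (RGenOInfty.measurableE R)) => _ [_ [c ->] <-].
apply: measurableI => //; apply: eopen_measurable => x /=; rewrite in_itv/= andbT => fc.
have fc0 : 0 < f x - c by rewrite subr_gt0.
have [d d0 Hd] := cf x (f x - c) fc0.
exists d => // y yx; rewrite /= in_itv/= andbT.
by have := Hd y yx; rewrite ltr_norml => /andP[+ _]; clear; lra.
Qed.

(** One representative is chosen in each nonempty cell of a grid of mesh [r / (N + 1)]. The centres
    thus lie in [K] itself, which later keeps the balls around them inside the domain. *)
Lemma totally_bounded (K : set T) (M r : R) : 0 < r -> (forall x, K x -> enorm x <= M) ->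
  exists s : seq T, (forall y, y \in s -> K y) /\ forall x, K x -> exists2 y, y \in s & eball y r x.
Proof.
move=> r0 KM; pose d := r / N.+1%:R; have d0 : 0 < d by rewrite divr_gt0.
pose L := (Num.bound (2 * M / d)).+1.
pose cellof (x : T) : {ffun 'I_N -> 'I_L.+1} := [ffun i => inord (Num.truncn ((tnth x i + M) / d))].
have h (c : {ffun 'I_N -> 'I_L.+1}) : exists y : option T, if y is Some y' then K y' /\ cellof y' = c
    else forall x, K x -> cellof x <> c.
  have [[y [Ky yc]]|n] := pselect (exists y, K y /\ cellof y = c); first by exists (Some y).
  by exists None => x Kx xc; apply: n; exists x.
have [rep hrep] := choice h.
exists (pmap rep (enum {ffun 'I_N -> 'I_L.+1})); split.
  move=> y; rewrite mem_pmap => /mapP[c _ E]; have := hrep c.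
  by rewrite -E => -[].
move=> x Kx; case E : (rep (cellof x)) (hrep (cellof x)) => [y|]; last by move=> /(_ x Kx).
move=> [Ky yc]; exists y.
  by rewrite mem_pmap -E; apply/mapP; exists (cellof x) => //; rewrite mem_enum.
rewrite /eball/=; apply: (@le_lt_trans _ _ (N%:R * d)); last first.
  by rewrite /d mulrA ltr_pdivrMr// mulrC ltr_pM2l// ltr_nat.
apply: edist_le_coord; first exact: ltW.
move=> i; have pos z : K z -> 0 <= (tnth z i + M) / d.
  move=> Kz; rewrite divr_ge0 ?(ltW d0)//.
  have := le_trans (ler_coord_enorm z i) (KM z Kz); rewrite ler_norml => /andP[+ _].
  by clear; lra.
have bnd z : K z -> (Num.truncn ((tnth z i + M) / d) < L.+1)%N.
  move=> Kz; rewrite ltnS -(@ler_nat R); apply: (le_trans (_ : _ <= (tnth z i + M) / d)).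
    by have /andP[] := truncn_itv (pos z Kz).
  have zM : (tnth z i + M) / d <= 2 * M / d.
    rewrite ler_pM2r ?invr_gt0//.
    have := le_trans (ler_coord_enorm z i) (KM z Kz); rewrite ler_norml => /andP[_].
    by clear; lra.
  apply: (le_trans zM); apply: (le_trans (ltW (archi_boundP (le_trans (pos z Kz) zM)))).
  by rewrite ler_nat.
have : Num.truncn ((tnth x i + M) / d) = Num.truncn ((tnth y i + M) / d).
  have /(congr1 (fun c : {ffun 'I_N -> 'I_L.+1} => nat_of_ord (c i))) := yc.
  by rewrite !ffunE !inordK ?bnd.
have /andP[x1 x2] := truncn_itv (pos x Kx); have /andP[y1 y2] := truncn_itv (pos y Ky).
move=> E'; rewrite E' in x1 x2; move: x1 x2 y1 y2.
clear -d0; rewrite -natr1; set n := _%:R; move: (tnth x i) (tnth y i) n => a b n; clearbody d.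
rewrite !ler_pdivlMr// !ltr_pdivrMr// => x1 x2 y1 y2.
by rewrite ler_norml; apply/andP; move: x1 x2 y1 y2; clear; split; lra.
Qed.

End euclidean_topology.

(** * Difference quotients of test functions *)

Section test_functions.
Context {R : realType} {N : nat}.
Local Notation T := (N.-tuple R).

Definition unitv (i : 'I_N) (h : R) : T := [tuple if j == i then h else 0 | j < N].

Lemma shiftE (x : T) i h : shift x i h = tadd x (unitv i h).
Proof. by apply: eq_from_tnth => j; rewrite !tnth_mktuple. Qed.

Lemma unitvD i (a b : R) : tadd (unitv i a) (unitv i b) = unitv i (a + b).
Proof. by apply: eq_from_tnth => j; rewrite !tnth_mktuple; case: ifP => // _; rewrite addr0. Qed.

Lemma unitvN i (a : R) : topp (unitv i a) = unitv i (- a).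
Proof. by apply: eq_from_tnth => j; rewrite !tnth_mktuple; case: ifP => // _; rewrite oppr0. Qed.

Lemma enorm_unitv i (h : R) : enorm (unitv i h) = `|h|.
Proof.
rewrite /edist (bigD1 i)//= big1 => [|j ji].
  by rewrite !tnth_mktuple eqxx subr0 addr0 sqrtr_sqr.
by rewrite !tnth_mktuple (negbTE ji) subrr expr0n.
Qed.

Lemma shift0 (x : T) i : shift x i 0 = x.
Proof. by apply: eq_from_tnth => j; rewrite !tnth_mktuple; case: ifP; rewrite addr0. Qed.

Lemma shiftD (x : T) i a b : shift (shift x i a) i b = shift x i (a + b).
Proof. by rewrite !shiftE -taddA unitvD. Qed.

(** Derivability at 0 along every shifted line amounts to derivability at every point of one line,
    the form that the mean value theorem asks for. *)
Lemma is_derive_line (f : T -> R) (i : 'I_N) (x : T) (t : R) :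
  (forall y, derivable (fun h : R => f (shift y i h)) 0 1) ->
  is_derive t 1 (fun h => f (shift x i h)) (pderiv i f (shift x i t)).
Proof.
move=> df; have := df (shift x i t).
have -> : (fun h => f (shift (shift x i t) i h)) = (fun h => f (shift x i h)) \o (fun h => t + h).
  by apply/funext => h /=; rewrite shiftD.
rewrite /pderiv derive1E.
have -> : (fun h => f (shift (shift x i t) i h)) = (fun h => f (shift x i h)) \o (fun h => t + h).
  by apply/funext => h /=; rewrite shiftD.
set g := fun h => f (shift x i h).
have E : (fun h => h^-1 *: ((g \o (fun h => t + h)) (h *: (1:R) + 0) - (g \o (fun h => t + h)) 0)) =
         (fun h => h^-1 *: (g (h *: (1:R) + t) - g t)).
  by apply/funext => h /=; rewrite !addr0 (addrC t).
rewrite /derivable /derive /= E => dg.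
exact: DeriveDef.
Qed.

Lemma pderiv_lip (f : T -> R) (i : 'I_N) (L : R) :
  (forall y, derivable (fun h : R => f (shift y i h)) 0 1) ->
  (forall y, `|pderiv i f y| <= L) ->
  forall x h, `|f (shift x i h) - f x| <= L * `|h|.
Proof.
move=> df fL.
have main x h : 0 <= h -> `|f (shift x i h) - f x| <= L * `|h|.
  move=> h0; rewrite -[X in _ - f X](shift0 x i).
  have [||c _ ->] := @MVT_segment R (fun t => f (shift x i t)) (fun t => pderiv i f (shift x i t)) 0 h h0.
  - by move=> t _; exact: is_derive_line.
  - apply: continuous_subspaceT => t; apply: differentiable_continuous.
    by apply/derivable1_diffP; have [] := is_derive_line f i x t df.
  by rewrite subr0 normrM ler_wpM2r.
move=> x h; have [h0|h0] := leP 0 h; first exact: main.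
have := main (shift x i h) (- h); rewrite shiftD subrr shift0 distrC normrN; apply.
by rewrite oppr_ge0 ltW.
Qed.

Lemma pderiv_cvg (f : T -> R) (i : 'I_N) (x : T) (h : nat -> R) :
  (forall y, derivable (fun h : R => f (shift y i h)) 0 1) ->
  (forall k, h k != 0) -> h @ \oo --> (0 : R) ->
  (fun k => (h k)^-1 * (f (shift x i (h k)) - f x)) @ \oo --> pderiv i f x.
Proof.
move=> df h0 hc.
have dx := df x; rewrite /derivable in dx.
have /cvgr_dnbhsP/(_ h (conj h0 hc)) := dx.
rewrite /pderiv derive1E /derive; apply: cvg_trans; apply: near_eq_cvg.
by near=> k => /=; rewrite shift0 addr0 /GRing.scale/= mulr1.
Unshelve. all: by end_near. Qed.

Lemma pderiv_support (f : T -> R) (i : 'I_N) (x : T) (e : R) : 0 < e ->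
  (forall y, edist y x < e -> f y = 0) -> pderiv i f x = 0.
Proof.
move=> e0 f0; rewrite /pderiv derive1E.
rewrite (@near_eq_derive _ _ _ _ (cst 0)) ?derive_cst//.
near=> t; rewrite f0// edistC shiftE edist_taddr enorm_unitv.
near: t; have := nbhsx_ballx (0:R) e e0; apply: filterS => t.
by rewrite /ball/= sub0r normrN.
Unshelve. all: by end_near. Qed.

End test_functions.

(** * The limit of the difference quotients *)

Section summable_limits.
Context {R : realType}.

Lemma summable_limit (u : nat -> R) (k : nat) (S : R) :
  (forall n, \sum_(0 <= j < n) `|u (k + j)%N - u (k + j).+1| <= S) ->
  exists2 l : R, u @ \oo --> l & `|u k - l| <= S.
Proof.
move=> hS; pose w j := u (k + j).+1 - u (k + j)%N.
have cw : cvgn (series w).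
  apply: normed_cvg; apply: nondecreasing_is_cvgn.
    by apply: nondecreasing_series => n _ _; exact: normr_ge0.
  exists S => _ [n _ <-]; apply: le_trans (hS n).
  by rewrite /series /=; apply: ler_sum => j _; rewrite distrC.
have wE n : series w n = u (k + n)%N - u k.
  rewrite /series/= (eq_bigr (fun j => (fun j => u (k + j)%N) j.+1 - (fun j => u (k + j)%N) j)).
    by rewrite telescope_sumr// addn0.
  by move=> j _ /=; rewrite addnS.
have cu : (fun n => u (k + n)%N) @ \oo --> limn (series w) + u k.
  have -> : (fun n => u (k + n)%N) = (fun n => series w n + u k).
    by apply/funext => n; rewrite wE subrK.
  by apply: cvgD => //; exact: cvg_cst.
exists (limn (series w) + u k).
  by rewrite -(cvg_shiftn k); under eq_fun do rewrite addnC.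
have cn : (fun n => `|u k - u (k + n)%N|) @ \oo --> `|u k - (limn (series w) + u k)|.
  by apply: cvg_norm; apply: cvgB => //; exact: cvg_cst.
rewrite -(cvg_lim _ cn)//; apply: limr_le; first by apply/cvg_ex; eexists; exact: cn.
near=> n; apply: le_trans (hS n); rewrite distrC -wE /series /=.
apply: (le_trans (ler_norm_sum _ _ _)).
by apply: ler_sum => j _; rewrite distrC.
Unshelve. all: by end_near. Qed.

Lemma limn_esup_EFin (u : nat -> R) (l : R) : u @ \oo --> l ->
  fine (limn_esup (fun k => (u k)%:E)) = l.
Proof.
move=> ul; have ul' : (fun k => (u k)%:E) @ \oo --> l%:E by apply/fine_cvgP; split; [near=> n|].
rewrite is_cvg_limn_esupE; last by apply/cvg_ex; eexists; exact: ul'.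
by rewrite (cvg_lim _ ul').
Unshelve. all: by end_near. Qed.

(** Below the threshold [c] the first term is a bound; above it [(z / c) ^ (m - 1) >= 1]. On sets of
    finite measure this plays the role of Hoelder's inequality. *)
Lemma powR_L1 (m c z : R) : 1 <= m -> 0 < c -> 0 <= z -> z <= c + c `^ (1 - m) * z `^ m.
Proof.
move=> m1 c0 z0; have m0 : 0 <= m by exact: le_trans m1.
have [zc|cz] := leP z c; first by apply: (le_trans zc); rewrite lerDl mulr_ge0 ?powR_ge0.
rewrite -[leLHS]add0r; apply: lerD; first exact: ltW.
have h : 1 <= (z / c) `^ (m - 1).
  by apply: powR_ge1x; [rewrite ler_pdivlMr// mul1r ltW|rewrite subr_ge0].
have zp : 0 < z by exact: lt_trans cz.
have -> : c `^ (1 - m) * z `^ m = z * (z / c) `^ (m - 1).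
  rewrite powR_dvd ?(ltW c0)//.
  have -> : 1 - m = - (m - 1) by ring.
  rewrite powRN mulrC mulrA; congr (_ / _).
  rewrite -{2}(powRr1 z0) -powRD; last by rewrite (gt_eqF zp) implybT.
  by congr (_ `^ _); ring.
by rewrite ler_peMr.
Qed.

Lemma powR_L1_geometric (m a : R) k (z : R) : 1 <= m -> 0 < a < 1 -> 0 <= z ->
  z <= a ^+ k + (a ^+ k * (a ^+ k) `^ m) * (z `^ m / (a ^+ k) `^ (2 * m)).
Proof.
move=> m1 /andP[a0 a1] z0; have c0 : 0 < a ^+ k by exact: exprn_gt0.
apply: (le_trans (powR_L1 m (a ^+ k) z m1 c0 z0)).
rewrite lerD2l (mulrC (z `^ m)) mulrA; apply: ler_wpM2r; first exact: powR_ge0.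
rewrite le_eqVlt; apply/orP; left; apply/eqP.
rewrite -[X in _ = X * _ / _](powRr1 (ltW c0)) -powRD; last by rewrite (gt_eqF c0) implybT.
rewrite -powRN -powRD; last by rewrite (gt_eqF c0) implybT.
by congr (_ `^ _); ring.
Qed.

End summable_limits.

(** * Sequences of functions with summable increments *)

Section sequence_limit.
Context {d : measure_display} {T : measurableType d} {R : realType}.
Variables (mu : {measure set T -> \bar R}) (D : nat -> T -> R) (B : set T) (m a K V : R) (k0 : nat).
Hypotheses (mD : forall k, measurable_fun setT (D k)) (mB : measurable B) (m1 : 1 <= m)
  (a01 : 0 < a < 1) (K0 : 0 <= K) (V0 : 0 <= V) (BV : (mu B <= V%:E)%E)
  (hD : forall k, (k0 <= k)%N -> (\int[mu]_x (\1_B x * `|D k x| `^ m)%:E <= K%:E)%E)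
  (hDD : forall k, (k0 <= k)%N ->
    (\int[mu]_x (\1_B x * `|D k x - D k.+1 x| `^ m)%:E <= (K * (a ^+ k) `^ (2 * m))%:E)%E).

(* Junk value where the sequence diverges; under the hypotheses below this only
   happens on a null set of [B]. *)
Definition seqlim (x : T) : R := fine (limn_esup (fun k => (D k x)%:E)).

Lemma measurable_seqlim : measurable_fun setT seqlim.
Proof.
apply: (measurableT_comp (@fine_measurable R setT measurableT)).
by apply: measurable_fun_limn_esup => n; exact: measurable_EFin_comp.
Qed.

Let m0 : 0 <= m. Proof. exact: le_trans m1. Qed.
Let a0 : 0 < a. Proof. by case/andP: a01. Qed.

Let gD j (x : T) := \1_B x * `|D j x - D j.+1 x|.

Let mgD j : measurable_fun setT (gD j).
Proof. by rewrite /gD; have m1' := mD j; have m2' := mD j.+1; msr. Qed.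

Let gD0 j x : 0 <= gD j x.
Proof. by rewrite mulr_ge0. Qed.

(** [powR_L1_geometric] with the threshold [a ^ k]: the bound [K (a ^ k) ^ (2 m)] outweighs the
    factor [(a ^ k) ^ (1 - m)], and the product is at most [K a ^ k]. *)
Lemma int_seq_step k : (k0 <= k)%N -> (\int[mu]_x (gD k x)%:E <= ((V + K) * a ^+ k)%:E)%E.
Proof.
move=> kk; have c0 : 0 < a ^+ k by exact: exprn_gt0.
have c1 : a ^+ k <= 1 by rewrite exprn_ile1 ?(ltW a0)//; case/andP: a01 => _ /ltW.
pose F x := \1_B x * `|D k x - D k.+1 x| `^ m.
have mF : measurable_fun setT F.
  by rewrite /F; have m1' := mD k; have m2' := mD k.+1; msr.
have F0 x : 0 <= F x by rewrite mulr_ge0 ?powR_ge0.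
set c := a ^+ k in c0 c1 *.
have cc : 0 <= c * c `^ m / c `^ (2 * m) by rewrite divr_ge0 ?powR_ge0// mulr_ge0 ?powR_ge0// ltW.
have mI : measurable_fun setT (\1_B : T -> R) by exact: measurable_indic.
apply: (@le_trans _ _ (\int[mu]_x (c * \1_B x + c * c `^ m / c `^ (2 * m) * F x)%:E)%E).
  apply: intR_le.
  - exact: mgD.
  - by clearbody F c; msr.
  - exact: gD0.
  - move=> x; rewrite /gD /F.
    have h := powR_L1_geometric m a k _ m1 a01 (normr_ge0 (D k x - D k.+1 x)).
    have i0 : 0 <= \1_B x :> R by [].
    apply: (le_trans (ler_wpM2l i0 h)); rewrite -/c le_eqVlt; apply/orP; left; apply/eqP; ring.
have IF : (\int[mu]_x (F x)%:E <= (K * c `^ (2 * m))%:E)%E by exact: hDD.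
clearbody F.
have m1' : measurable_fun setT (fun x => c * \1_B x) by msr.
have m2' : measurable_fun setT (fun x => c * c `^ m / c `^ (2 * m) * F x) by msr.
rewrite (intRD _ _ _ _ _ m1' m2' (fun x => mulr_ge0 (ltW c0) _) (fun x => mulr_ge0 cc (F0 x)))//.
rewrite (intRZ _ _ _ _ _ mI _ (ltW c0))// (intRZ _ _ _ _ _ mF F0 cc).
rewrite integral_indic// setIT.
apply: (le_trans (leeD (lee_scale _ _ _ (ltW c0) BV) (lee_scale _ _ _ cc IF))).
rewrite -EFinM -EFinM -EFinD lee_fin [leRHS](_ : _ = c * V + K * c); last by ring.
rewrite lerD2l.
have cm : 0 < c `^ (2 * m) by exact: powR_gt0.
have -> : c * c `^ m / c `^ (2 * m) * (K * c `^ (2 * m)) = K * (c * c `^ m).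
  by field; rewrite gt_eqF.
apply: ler_wpM2l => //; rewrite ler_piMr ?(ltW c0)//.
by apply: powR_le1 => //; rewrite (ltW c0).
Qed.

Let E k (x : T) : \bar R := (\sum_(j <oo) (gD (k + j) x)%:E)%E.

Let mE k : measurable_fun setT (E k).
Proof.
apply: ge0_emeasurable_sum => [j x _ _|j _]; first by rewrite lee_fin.
exact: measurable_EFin_comp.
Qed.

Lemma int_seq_tail k : (k0 <= k)%N -> (\int[mu]_x E k x <= ((V + K) / (1 - a) * a ^+ k)%:E)%E.
Proof.
move=> kk; rewrite /E integral_nneseries//; last 2 first.
- by move=> j; exact: measurable_EFin_comp.
- by move=> j x _; rewrite lee_fin.
have -> : (V + K) / (1 - a) * a ^+ k = (V + K) * a ^+ k / (1 - a) by rewrite mulrAC.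
apply: nneseries_geometric_le.
- by case/andP: a01 => h1 h2; rewrite ltW.
- by rewrite mulr_ge0 ?addr_ge0// exprn_ge0// ltW.
- move=> j; apply/andP; split; first by apply: integral_ge0 => x _; rewrite lee_fin.
  by rewrite -mulrA -exprD; apply: int_seq_step; exact: leq_trans (leq_addr _ _).
Qed.

Lemma seq_tail_cvg k x : B x -> (E k x < +oo)%E ->
  (fun j => D j x) @ \oo --> seqlim x /\ (`|D k x - seqlim x|%:E <= E k x)%E.
Proof.
move=> Bx Ek; have E0 : (0 <= E k x)%E by apply: nneseries_ge0 => j _ _; rewrite lee_fin.
have Ef : E k x \is a fin_num by rewrite ge0_fin_numE.
have [|l ul kl] := summable_limit (fun j => D j x) k (fine (E k x)).
  move=> n; rewrite -lee_fin fineK//; apply: le_trans (nneseries_lim_ge n _); last first.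
    by move=> j _ _; rewrite lee_fin.
  rewrite sumEFin lee_fin; apply: ler_sum => j _.
  by rewrite /gD indicE mem_set// mul1r.
have L : seqlim x = l by exact: limn_esup_EFin.
by rewrite L; split => //; rewrite -(fineK Ef) lee_fin.
Qed.

Lemma seqlim_L1 k : (k0 <= k)%N ->
  (\int[mu]_x (\1_B x * `|D k x - seqlim x|)%:E <= ((V + K) / (1 - a) * a ^+ k)%:E)%E.
Proof.
move=> kk; apply: le_trans (int_seq_tail k kk).
have ms := measurable_seqlim; have mk := mD k.
have mF : measurable_fun setT (fun x => (\1_B x * `|D k x - seqlim x|)%:E).
  by apply: measurable_EFin_comp; msr.
have F0 x : [set: T] x -> (0 <= (\1_B x * `|D k x - seqlim x|)%:E)%E.
  by move=> _; rewrite lee_fin mulr_ge0.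
have EE0 x : [set: T] x -> (0 <= E k x)%E.
  by move=> _; apply: nneseries_ge0 => j _ _; rewrite lee_fin.
apply: ge0_le_integral => // x _; have E0 : (0 <= E k x)%E by apply: nneseries_ge0 => j _ _; rewrite lee_fin.
have [Bx|nBx] := pselect (B x); last by rewrite indicE memNset// mul0r.
rewrite indicE mem_set// mul1r; have [->|Ef] := eqVneq (E k x) +oo%E; first by rewrite leey.
by have [] := seq_tail_cvg k x Bx; rewrite ?ltey.
Qed.

(** Fatou's lemma along the sequence; it converges almost everywhere on [B] because the sum of its
    increments has finite integral. *)
Lemma seqlim_Lm : (\int[mu]_x (\1_B x * `|seqlim x| `^ m)%:E <= K%:E)%E.
Proof.
have ms := measurable_seqlim.
pose F n x := (\1_B x * `|D (n + k0)%N x| `^ m)%:E.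
have mF n : measurable_fun setT (F n).
  by have mk := mD (n + k0)%N; apply: measurable_EFin_comp; msr.
have F0 n x : (0 <= F n x)%E by rewrite lee_fin mulr_ge0 ?powR_ge0.
have linf0 x : (0 <= limn_einf (F^~ x))%E.
  rewrite limn_einf_lim; apply: lime_ge; first exact: is_cvg_einfs.
  by near=> n; apply: le_ereal_inf_tmp => _ [j _ <-].
have aeE : {ae mu, forall x, (E k0 x < +oo)%E}.
  have iE : mu.-integrable setT (E k0).
    apply/integrableP; split => //.
    rewrite (eq_integral (E k0)); last first.
      by move=> x _; rewrite gee0_abs//; apply: nneseries_ge0 => j _ _; rewrite lee_fin.
    by apply: (le_lt_trans (int_seq_tail k0 (leqnn _))); rewrite ltry.
  have := integrable_ae measurableT iE; apply: filterS => x /(_ I).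
  by rewrite fin_numElt => /andP[].
apply: (@le_trans _ _ (\int[mu]_x limn_einf (F^~ x))%E).
  have mS : measurable_fun setT (fun x => (\1_B x * `|seqlim x| `^ m)%:E).
    by apply: measurable_EFin_comp; msr.
  have S0 x : [set: T] x -> (0 <= (\1_B x * `|seqlim x| `^ m)%:E)%E.
    by move=> _; rewrite lee_fin mulr_ge0 ?powR_ge0.
  have L0 x : [set: T] x -> (0 <= limn_einf (F^~ x))%E by move=> _; exact: linf0.
  have mL : measurable_fun setT (fun x => limn_einf (F^~ x)).
    rewrite /limn_einf; apply: measurableT_comp; first exact: oppe_measurable.
    by apply: measurable_fun_limn_esup => n; apply: measurableT_comp.
  apply: ae_ge0_le_integral => //.
  apply: filterS aeE => x Ex _.
  have [Bx|nBx] := pselect (B x); last first.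
    by rewrite indicE memNset// mul0r.
  (* Continuity of [t ^ m] is obtained from its differentiability at [t > 0]; at 0 the left side
     vanishes. *)
  have [S00|Sn] := eqVneq (seqlim x) 0.
    by rewrite S00 normr0 powR0 ?mulr0// gt_eqF// (lt_le_trans _ m1).
  have [cD _] := seq_tail_cvg k0 x Bx Ex.
  have cF : (F^~ x) @ \oo --> (\1_B x * `|seqlim x| `^ m)%:E.
    have c1 : (fun n => D (n + k0)%N x) @ \oo --> seqlim x.
      by move: cD; rewrite -(cvg_shiftn k0).
    have c2 : (fun n => `|D (n + k0)%N x| `^ m) @ \oo --> `|seqlim x| `^ m.
      have cn : (fun n => `|D (n + k0)%N x|) @ \oo --> `|seqlim x| by exact: cvg_norm.
      have dp : derivable (fun t : R => t `^ m) `|seqlim x| 1.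
        by apply: derivable_powR; rewrite in_itv/= andbT normr_gt0.
      apply: (@continuous_cvg _ _ _ _ _ _ (fun t : R => t `^ m)) cn.
      by apply: differentiable_continuous; apply/derivable1_diffP.
    have c3 : (fun n => \1_B x * `|D (n + k0)%N x| `^ m) @ \oo --> \1_B x * `|seqlim x| `^ m.
      by apply: cvgM => //; exact: cvg_cst.
    by apply/fine_cvgP; split; [near=> n|].
  by rewrite is_cvg_limn_einfE ?(cvg_lim _ cF)//; apply/cvg_ex; eexists; exact: cF.
apply: (le_trans (fatou _ measurableT mF (fun n x _ => F0 n x))).
rewrite limn_einf_lim; apply: lime_le; first exact: is_cvg_einfs.
near=> n; apply: (@le_trans _ _ (\int[mu]_x F n x)%E).
  by apply: ereal_inf_lbound; exists n => //=.
by apply: hD; exact: leq_addl.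
Unshelve. all: by end_near. Qed.

End sequence_limit.

(** * Discrete integration by parts *)

Section weak_gradient_limit.
Context {R : realType} {N : nat}.
Local Notation T := (N.-tuple R).
Local Notation mu := (muN R N).

Lemma integral_tadd_signed (f : T -> R) (h : T) : measurable_fun setT f ->
  (\int[mu]_x (f (tadd x h))%:E = \int[mu]_x (f x)%:E)%E.
Proof.
move=> mf; rewrite integralE [RHS]integralE; congr (_ - _)%E.
  rewrite (_ : (fun z => _)^\+%E = (fun z => (Num.max (f (tadd z h)) 0)%:E)); last first.
    by apply/funext => z; rewrite funeposE -EFin_max.
  rewrite (integral_taddr (fun z => Num.max (f z) 0))//.
  - by apply: eq_integral => z _; rewrite funeposE -EFin_max.
  - by msr.
  - by move=> z; rewrite le_max lexx orbT.
rewrite (_ : (fun z => _)^\-%E = (fun z => (Num.max (- f (tadd z h)) 0)%:E)); last first.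
  by apply/funext => z; rewrite funenegE -EFin_max.
rewrite (integral_taddr (fun z => Num.max (- f z) 0))//.
- by apply: eq_integral => z _; rewrite funenegE -EFin_max.
- by msr.
- by move=> z; rewrite le_max lexx orbT.
Qed.

Lemma integrable_dom (f g : T -> R) : measurable_fun setT f -> measurable_fun setT g ->
  (forall x, `|f x| <= g x) -> (\int[mu]_x (g x)%:E < +oo)%E -> mu.-integrable setT (EFin \o f).
Proof.
move=> mf mg fg gfin; apply/integrableP; split; first exact: measurable_EFin_comp.
apply: le_lt_trans gfin; rewrite (eq_integral (fun x => (`|f x|)%:E))//.
by apply: intR_le => //; msr.
Qed.

(** The sum of the indicators, not the indicator of the union: it is at least 1 on the union, and
    integrals against it split over the balls. *)
Definition cov (s : seq T) (r : R) (x : T) : R := \sum_(y <- s) \1_(eball y r) x.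

Lemma cov_ge0 s r x : 0 <= cov s r x.
Proof. by apply: sumr_ge0 => y _. Qed.

Lemma measurable_cov s r : measurable_fun setT (cov s r).
Proof.
rewrite /cov; apply: measurable_sum => y.
by apply: measurable_indic; exact: measurable_eball.
Qed.

Lemma cov_ge1 s r x y : y \in s -> eball y r x -> 1 <= cov s r x.
Proof.
move=> ys yx; rewrite /cov (big_rem y ys)/= indicE mem_set// lerDl.
by apply: sumr_ge0 => z _.
Qed.

Lemma int_cov_cons (F : T -> R) (y : T) s r : measurable_fun setT F -> (forall x, 0 <= F x) ->
  (\int[mu]_x (cov (y :: s) r x * F x)%:E =
   \int[mu]_x (\1_(eball y r) x * F x)%:E + \int[mu]_x (cov s r x * F x)%:E)%E.
Proof.
move=> mF F0; have mc := measurable_cov s r; have mb := measurable_eball y r.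
rewrite -intRD; last 4 first.
- by msr.
- by msr.
- by move=> x; rewrite mulr_ge0.
- by move=> x; rewrite mulr_ge0// cov_ge0.
by apply: eq_integral => x _; rewrite /cov big_cons mulrDl.
Qed.

Lemma int_cov_lty (F : T -> R) s r : measurable_fun setT F -> (forall x, 0 <= F x) ->
  (forall y, y \in s -> \int[mu]_x (\1_(eball y r) x * F x)%:E < +oo)%E ->
  (\int[mu]_x (cov s r x * F x)%:E < +oo)%E.
Proof.
move=> mF F0; elim: s => [|y s IH] hs.
  rewrite (eq_integral (fun=> 0%E)) ?integral0//.
  by move=> x _; rewrite /cov big_nil mul0r.
rewrite int_cov_cons// lte_add_pinfty//; first by apply: hs; rewrite mem_head.
by apply: IH => z zs; apply: hs; rewrite inE zs orbT.
Qed.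

(** The rates may differ from ball to ball, so a null sequence [c] is kept instead of a single
    geometric one. *)
Lemma int_cov_cvg (F : nat -> T -> R) s r : (forall k, measurable_fun setT (F k)) ->
  (forall k x, 0 <= F k x) ->
  (forall y, y \in s -> exists (C a : R) (k0 : nat), 0 <= a < 1 /\ forall k, (k0 <= k)%N ->
     (\int[mu]_x (\1_(eball y r) x * F k x)%:E <= (C * a ^+ k)%:E)%E) ->
  exists2 c : nat -> R, c @ \oo --> (0 : R) & exists k0, forall k, (k0 <= k)%N ->
    (\int[mu]_x (cov s r x * F k x)%:E <= (c k)%:E)%E.
Proof.
move=> mF F0; elim: s => [|y s IH] hs.
  exists (fun=> 0); first exact: cvg_cst.
  exists 0%N => k _; rewrite (eq_integral (fun=> 0%E)) ?integral0//.
  by move=> x _; rewrite /cov big_nil mul0r.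
have [|c c0 [k1 hc]] := IH.
  by move=> z zs; apply: hs; rewrite inE zs orbT.
have [C [a [k2 [/andP[a0 a1] hC]]]] := hs y (mem_head _ _).
exists (fun k => C * a ^+ k + c k).
  have -> : (0 : R) = C * 0 + 0 by rewrite mulr0 addr0.
  apply: cvgD => //; apply: cvgM; first exact: cvg_cst.
  by apply: cvg_expr; rewrite ger0_norm.
exists (maxn k1 k2) => k; rewrite geq_max => /andP[kk1 kk2].
by rewrite int_cov_cons// EFinD leeD//; [exact: hC|exact: hc].
Qed.

Definition dquot (u : T -> R) (i : 'I_N) (k : nat) (x : T) : R :=
  2 ^+ k * diff u (unitv i (2^-1 ^+ k)) x.

Lemma measurable_dquot u i k : measurable_fun setT u -> measurable_fun setT (dquot u i k).
Proof.
move=> mu_; have m := @measurable_diff R N u (unitv i (2^-1 ^+ k)) mu_.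
by rewrite /dquot; msr.
Qed.

(** Translation invariance moves the difference quotient from [u] to [phi]. On the side of [phi] the
    quotients converge pointwise under a dominating function; on the side of [u] they converge to
    [G] in [L^1] on the balls covering the support. The identity equates the two limits of
    [alpha]. *)
Lemma weak_gradient_limit (u G phi : T -> R) (i : 'I_N) (s : seq T) (r e L0 L : R) :
  measurable_fun setT u -> measurable_fun setT G -> measurable_fun setT phi ->
  measurable_fun setT (pderiv i phi) -> 0 < e ->
  (forall x, `|phi x| <= L0) -> (forall x, `|pderiv i phi x| <= L) ->
  (forall y, derivable (fun h : R => phi (shift y i h)) 0 1) ->
  (forall x h, phi x != 0 -> enorm h < e -> 1 <= cov s r (tadd x h)) ->
  (forall y, y \in s -> \int[mu]_x (\1_(eball y r) x * `|u x|)%:E < +oo)%E ->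
  (forall y, y \in s -> exists (C a : R) (k0 : nat), 0 <= a < 1 /\ forall k, (k0 <= k)%N ->
     (\int[mu]_x (\1_(eball y r) x * `|dquot u i k x - G x|)%:E <= (C * a ^+ k)%:E)%E) ->
  [/\ mu.-integrable setT (EFin \o (fun x => u x * pderiv i phi x)),
      mu.-integrable setT (EFin \o (fun x => G x * phi x)) &
      (\int[mu]_x (u x * pderiv i phi x)%:E = - \int[mu]_x (G x * phi x)%:E)%E].
Proof.
move=> mu_ mG mphi mpd e0 phiL pdL dphi hcov hU hG.
have L00 : 0 <= L0 by apply: le_trans (phiL (origin N)).
have Lp0 : 0 <= L by apply: le_trans (pdL (origin N)).
have mc := measurable_cov s r.
(* Multiples of [W] dominate the integrands, because the functions multiplying [u] vanish where
   [cov < 1] and are bounded elsewhere. *)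
pose W x := cov s r x * `|u x|.
have mW : measurable_fun setT W by rewrite /W; msr.
have W0 x : 0 <= W x by rewrite mulr_ge0// cov_ge0.
have Wfin : (\int[mu]_x (W x)%:E < +oo)%E.
  by apply: int_cov_lty => //; msr.
have WZ c : 0 <= c -> (\int[mu]_x (c * W x)%:E < +oo)%E.
  move=> c0; rewrite (intRZ _ _ _ _ _ mW W0 c0); apply: lte_mul_pinfty => //; by rewrite lee_fin.
have mZ c : measurable_fun setT (fun x => c * W x) by msr.
have phi0 x h : enorm h < e -> cov s r x < 1 -> phi (tadd x h) = 0.
  move=> he cx; apply/eqP; apply: contraTT cx => hphi; rewrite -leNgt.
  by have := hcov _ (topp h) hphi; rewrite enorm_topp taddK; apply.
have phi00 x : cov s r x < 1 -> phi x = 0.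
  by move=> cx; rewrite -(tadd0 x); apply: phi0 => //; rewrite edistxx.
have pd0 x : cov s r x < 1 -> pderiv i phi x = 0.
  move=> cx; apply: (pderiv_support _ _ _ e e0) => y yx.
  have -> : y = tadd x (tadd y (topp x)) by rewrite taddC -taddA (taddC (topp x)) taddA taddK.
  apply: phi0 => //.
  by rewrite -(edist_taddr x) edistC taddC -taddA (taddC (topp x)) taddA taddK.
have domW (g : T -> R) c : 0 <= c -> (forall x, `|g x| <= c) ->
    (forall x, cov s r x < 1 -> g x = 0) -> forall x, `|u x * g x| <= c * W x.
  move=> c0 gc g0 x; rewrite normrM /W; have [cx|cx] := ltP (cov s r x) 1.
    by rewrite g0// normr0 mulr0 mulr_ge0// W0.
  rewrite mulrC mulrA; apply: ler_pM => //.
  by rewrite -[leLHS]mulr1; apply: ler_pM.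
have iupd : mu.-integrable setT (EFin \o (fun x => u x * pderiv i phi x)).
  by apply: (integrable_dom _ (fun x => L * W x)); [msr|exact: mZ|exact: domW|exact: WZ].
have iuphi : mu.-integrable setT (EFin \o (fun x => u x * phi x)).
  by apply: (integrable_dom _ (fun x => L0 * W x)); [msr|exact: mZ|exact: domW|exact: WZ].
have [k1 hk1] := half_pow_small e e0.
pose hh k : T := unitv i (2^-1 ^+ k).
have h2 k : 0 < (2^-1 : R) ^+ k by rewrite exprn_gt0.
have hhn k : enorm (hh k) = 2^-1 ^+ k by rewrite enorm_unitv ger0_norm// ltW.
(* The step is [- 2 ^ (- k)] while the factor in front is [+ 2 ^ k]: the limit is
   [- pderiv i phi]. *)
pose q k x := 2 ^+ k * (phi (shift x i (- 2^-1 ^+ k)) - phi x).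
have p22 k : 2 ^+ k * 2^-1 ^+ k = 1 :> R by rewrite -exprMn mulfV// expr1n.
have shq k x : shift x i (- 2^-1 ^+ k) = tadd x (topp (hh k)) by rewrite shiftE unitvN.
have mphis h : measurable_fun setT (fun x => phi (tadd x h)) by exact: (measurable_taddl phi h mphi).
have mq k : measurable_fun setT (q k).
  have -> : q k = (fun x => 2 ^+ k * (phi (tadd x (topp (hh k))) - phi x)).
    by apply/funext => x; rewrite /q shq.
  by have mp := mphis (topp (hh k)); msr.
have qL k x : `|q k x| <= L.
  rewrite /q normrM ger0_norm ?exprn_ge0//.
  have := pderiv_lip phi i L dphi pdL x (- 2^-1 ^+ k).
  rewrite normrN (ger0_norm (ltW (h2 k))) => h; apply: (le_trans (ler_wpM2l _ h)); first by rewrite exprn_ge0.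
  by rewrite mulrCA p22 mulr1.
have q0 k x : (k1 <= k)%N -> cov s r x < 1 -> q k x = 0.
  move=> kk cx; rewrite /q shq (phi00 x cx) phi0 ?subrr ?mulr0//.
  by rewrite enorm_topp hhn; exact: hk1.
have iD k : (k1 <= k)%N -> mu.-integrable setT (EFin \o (fun x => dquot u i k x * phi x)) /\
    (\int[mu]_x (dquot u i k x * phi x)%:E = \int[mu]_x (u x * q k x)%:E)%E.
  move=> kk; pose f x := u x * phi (tadd x (topp (hh k))).
  have mf : measurable_fun setT f by have mp := mphis (topp (hh k)); rewrite /f; msr.
  have if_ : mu.-integrable setT (EFin \o f).
    apply: (integrable_dom _ (fun x => L0 * W x) mf (mZ _)); last exact: WZ.
    apply: domW => // x cx; apply: phi0 => //.
    by rewrite enorm_topp hhn; exact: hk1.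
  have ifh : mu.-integrable setT (EFin \o (fun x => f (tadd x (hh k)))).
    have mfh : measurable_fun setT (fun x => f (tadd x (hh k))) by exact: (measurable_taddl f _ mf).
    apply/integrableP; split; first exact: measurable_EFin_comp.
    have := integral_taddr (fun x => `|f x|) (hh k).
    have mnf : measurable_fun setT (fun x => `|f x|) by msr.
    move=> /(_ mnf (fun x => normr_ge0 _)) /= ->.
    by have /integrableP[] := if_.
  pose up x := u x * phi x; pose fh x := f (tadd x (hh k)).
  have E1 : EFin \o (fun x => dquot u i k x * phi x) =
      (fun x => ((2 ^+ k)%:E * ((EFin \o fh) \- (EFin \o up)) x)%E).
    apply/funext => x /=; rewrite -EFinD -EFinM; congr (_%:E).
    by rewrite /dquot /fh /up /f taddK /diff -/(hh k); ring.
  have E2 : EFin \o (fun x => u x * q k x) =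
      (fun x => ((2 ^+ k)%:E * ((EFin \o f) \- (EFin \o up)) x)%E).
    apply/funext => x /=; rewrite -EFinD -EFinM; congr (_%:E).
    by rewrite /q /f /up shq; ring.
  have i1 := integrableB measurableT ifh iuphi.
  have i2 := integrableB measurableT if_ iuphi.
  split; first by rewrite E1; exact: integrableZl.
  rewrite -[LHS]/(\int[mu]_x (EFin \o (fun x => (dquot u i k x * phi x)%R)) x)%E.
  rewrite -[RHS]/(\int[mu]_x (EFin \o (fun x => (u x * q k x)%R)) x)%E.
  rewrite E1 E2 (integralZl measurableT i1) (integralZl measurableT i2).
  rewrite (integralB measurableT ifh iuphi) (integralB measurableT if_ iuphi).
  by rewrite (integral_tadd_signed f (hh k) mf).
have mDG k : measurable_fun setT (fun x => `|dquot u i k x - G x|).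
  by have md := measurable_dquot u i k mu_; msr.
have [c c0 [k2 hc]] := int_cov_cvg _ s r mDG (fun k x => normr_ge0 _) hG.
have mDGphi k : measurable_fun setT (fun x => (dquot u i k x - G x) * phi x).
  by have md := measurable_dquot u i k mu_; msr.
have bDG k : (k2 <= k)%N -> (\int[mu]_x (`|(dquot u i k x - G x) * phi x|)%:E <= (L0 * c k)%:E)%E.
  move=> kk; have ck := hc k kk.
  have mcd : measurable_fun setT (fun x => cov s r x * `|dquot u i k x - G x|).
    by have md := mDG k; msr.
  have cd0 x : 0 <= cov s r x * `|dquot u i k x - G x| by rewrite mulr_ge0// cov_ge0.
  apply: (@le_trans _ _ (\int[mu]_x (L0 * (cov s r x * `|dquot u i k x - G x|))%:E)%E).
    apply: intR_le; [by have md := mDGphi k; msr|by msr|by []|move=> x].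
    rewrite normrM; have [cx|cx] := ltP (cov s r x) 1.
      by rewrite (phi00 x cx) normr0 mulr0 mulr_ge0.
    rewrite mulrC; apply: ler_pM => //.
    by rewrite -[leLHS]mul1r; apply: ler_wpM2r.
  rewrite (intRZ _ _ _ _ _ mcd cd0 L00) EFinM; exact: lee_scale.
have iDG k : (k2 <= k)%N -> mu.-integrable setT (EFin \o (fun x => (dquot u i k x - G x) * phi x)).
  move=> kk; apply/integrableP; split; first exact: measurable_EFin_comp.
  by apply: (le_lt_trans (bDG k kk)); rewrite ltry.
have iG : mu.-integrable setT (EFin \o (fun x => G x * phi x)).
  have kk1 := leq_maxl k1 k2; have kk2 := leq_maxr k1 k2.
  have [i1 _] := iD _ kk1; have i2 := iDG _ kk2.
  have := integrableB measurableT i1 i2; apply: eq_integrable => // x _ /=.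
  by rewrite -EFinD; congr (_%:E); ring.
split => //.
have fG := integrable_fin_num measurableT iG.
have fu := integrable_fin_num measurableT iupd.
(* Shifted by [maxn k1 k2], so that the support condition and the [L^1] bound hold for every
   term. *)
pose alpha k := fine (\int[mu]_x (u x * q (k + maxn k1 k2)%N x)%:E)%E.
have lim1 : alpha @ \oo --> - fine (\int[mu]_x (u x * pderiv i phi x)%:E)%E.
  have mlim : measurable_fun setT (fun x => (- (u x * pderiv i phi x))%:E).
    by apply: measurable_EFin_comp; msr.
  have mseq n : measurable_fun setT (fun x => (u x * q (n + maxn k1 k2)%N x)%:E).
    by have mqn := mq (n + maxn k1 k2)%N; apply: measurable_EFin_comp; clearbody q; msr.
  have iW : mu.-integrable setT (fun x => (L * W x)%:E).
    apply: (integrable_dom (fun x => L * W x) (fun x => L * W x)); [exact: mZ|exact: mZ| |exact: WZ].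
    by move=> x; rewrite ger0_norm// mulr_ge0.
  have ptw : {ae mu, forall x, [set: T] x ->
      (fun n => (u x * q (n + maxn k1 k2)%N x)%:E) @ \oo --> (- (u x * pderiv i phi x))%:E}.
    apply: aeW => x _; apply/fine_cvgP; split; first by near=> n.
    rewrite -mulrN; apply: cvgM; first exact: cvg_cst.
    rewrite (cvg_shiftn (maxn k1 k2) (fun n => q n x)).
    have hn0 k : - (2^-1 : R) ^+ k != 0 by rewrite oppr_eq0 gt_eqF.
    have hc0 : (fun k => - (2^-1 : R) ^+ k) @ \oo --> (0 : R).
      by rewrite -oppr0; apply: cvgN; apply: cvg_expr; rewrite ger0_norm// invf_lt1// ltr1n.
    have := pderiv_cvg phi i x _ dphi hn0 hc0 => /cvgN.
    apply: cvg_trans; apply: near_eq_cvg; near=> k => /=.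
    rewrite /q -[LHS]/(- ((- 2^-1 ^+ k)^-1 * (phi (shift x i (- 2^-1 ^+ k)) - phi x))).
    by rewrite -mulNr invrN opprK exprVn invrK.
  have bnd : {ae mu, forall x n, [set: T] x -> (`|(u x * q (n + maxn k1 k2)%N x)%:E| <= (L * W x)%:E)%E}.
    apply: aeW => x n _; rewrite /= lee_fin; apply: domW => // z cz.
    by apply: q0 => //; rewrite (leq_trans (leq_maxl _ _) (leq_addl _ _)).
  have [_ _ hl] := dominated_convergence measurableT mseq mlim ptw iW bnd.
  have El : (\int[mu]_x (- (u x * pderiv i phi x))%:E = - \int[mu]_x (u x * pderiv i phi x)%:E)%E.
    rewrite -integralN//=; exact: integrable_add_def.
  by rewrite -fineN -El; apply: fine_cvg; rewrite fineK// El fin_numN.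
have lim2 : alpha @ \oo --> fine (\int[mu]_x (G x * phi x)%:E)%E.
  have cL : (fun n => L0 * c (n + maxn k1 k2)%N) @ \oo --> (0 : R).
    rewrite -(mulr0 L0); apply: cvgM; first exact: cvg_cst.
    by rewrite (cvg_shiftn (maxn k1 k2)).
  apply/cvgrPdist_le => eps eps0.
  move/cvgrPdist_le : cL => /(_ eps eps0) [n0 _ hn0].
  exists n0 => // n nn; have := hn0 n nn; rewrite /= sub0r normrN => hcn.
  have kk1 : (k1 <= n + maxn k1 k2)%N by rewrite (leq_trans (leq_maxl _ _) (leq_addl _ _)).
  have kk2 : (k2 <= n + maxn k1 k2)%N by rewrite (leq_trans (leq_maxr k1 _) (leq_addl _ _)).
  set k := (n + maxn k1 k2)%N in kk1 kk2 hcn *.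
  apply: le_trans (le_trans (ler_norm _) hcn).
  have [i1 e1] := iD k kk1; rewrite /alpha -/k -e1.
  have f1 := integrable_fin_num measurableT i1.
  rewrite -lee_fin; apply: le_trans (bDG k kk2).
  have := @le_abse_integral _ _ _ mu setT (fun x => ((dquot u i k x - G x) * phi x)%:E) measurableT.
  have mm : measurable_fun setT (fun x => ((dquot u i k x - G x) * phi x)%:E).
    by apply: measurable_EFin_comp.
  move=> /(_ mm); apply: le_trans.
  have -> : (\int[mu]_x ((dquot u i k x - G x) * phi x)%:E =
     \int[mu]_x (dquot u i k x * phi x)%:E - \int[mu]_x (G x * phi x)%:E)%E.
    rewrite -(integralB_EFin measurableT i1 iG); apply: eq_integral => x _.
    by rewrite -EFinD; congr (_%:E); ring.
  rewrite -(fineK f1) -(fineK fG) -EFinD abse_EFin lee_fin distrC //.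
have E := cvg_unique (@norm_hausdorff _ _) lim1 lim2.
by rewrite -(fineK fu) -(fineK fG) -EFinN -E opprK.
Unshelve. all: by end_near. Qed.

End weak_gradient_limit.

(** * Normalization of a weak solution *)

Lemma fine_pos_neg {R : realType} {d} {S : measurableType d} (m : {measure set S -> \bar R})
    (f : S -> R) : m.-integrable setT (EFin \o f) ->
  fine (\int[m]_x (Num.max (f x) 0)%:E)%E - fine (\int[m]_x (Num.max (- f x) 0)%:E)%E =
  fine (\int[m]_x (f x)%:E)%E.
Proof.
move=> iF; rewrite [in RHS]integralE.
have E1 : (\int[m]_x (EFin \o f)^\+ x = \int[m]_x (Num.max (f x) 0)%:E)%E.
  by apply: eq_integral => x _; rewrite funeposE -EFin_max.
have E2 : (\int[m]_x (EFin \o f)^\- x = \int[m]_x (Num.max (- f x) 0)%:E)%E.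
  by apply: eq_integral => x _; rewrite funenegE -EFin_max.
have f1 := integrable_pos_fin_num measurableT iF.
have f2 := integrable_neg_fin_num measurableT iF.
by rewrite -E1 -E2 -fineB.
Qed.

Section iterated_integrals.
Context {R : realType} {N : nat}.
Local Notation T := (N.-tuple R).
Local Notation mu := (muN R N).
Local Notation mu2 := (muN R N \x muN R N)%E.

Lemma iintR (f : T -> R) : measurable_fun setT f -> (forall x, 0 <= f x) ->
  iint N (fun x => (f x)%:E) = (\int[mu]_x (f x)%:E)%E.
Proof. by move=> mf f0; apply: iintE => [|x]; [exact: measurable_EFin_comp|rewrite lee_fin]. Qed.

Lemma iint2R (F : T * T -> R) : measurable_fun setT F -> (forall z, 0 <= F z) ->
  iint2 N (fun z => (F z)%:E) = (\int[mu2]_z (F z)%:E)%E.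
Proof.
move=> mF F0; rewrite (int2E _ mF F0) /iint2.
have mF' : measurable_fun setT (fun z => (F z)%:E) by exact: measurable_EFin_comp.
rewrite (_ : (fun x => iint N _) = (fun x => \int[mu]_y (F (x, y))%:E)%E); last first.
  apply/funext => x; rewrite (iintR (fun y => F (x, y)))//.
  exact: (measurableT_comp mF (pair1_measurable x)).
apply: iintE; last by move=> x; apply: integral_ge0 => z _; rewrite lee_fin.
exact: (@measurable_fun_fubini_tonelli_F _ _ _ _ _ mu _ mF' (fun z => F0 _)).
Qed.

Lemma aeN_null (P : T -> Prop) : aeN N P ->
  exists E, [/\ measurable E, mu E = 0%E & forall x, ~ E x -> P x].
Proof.
move=> [E [mE [E0 EP]]]; exists E; split => //.
rewrite iintR in E0 => //.
by rewrite -E0 integral_indic// setIT.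
Qed.

Lemma ae2N_null (P : T * T -> Prop) : ae2N N P ->
  exists E, [/\ measurable E, mu2 E = 0%E & forall x, ~ E x -> P x].
Proof.
move=> [E [mE [E0 EP]]]; exists E; split => //.
rewrite iint2R in E0 => //.
by rewrite -E0 integral_indic// setIT.
Qed.

Lemma sintN_E (f : T -> R) : measurable_fun setT f -> (\int[mu]_x (`|f x|)%:E < +oo)%E ->
  sintN f = fine (\int[mu]_x (f x)%:E)%E.
Proof.
move=> mf ff; have iF : mu.-integrable setT (EFin \o f).
  by apply/integrableP; split; [exact: measurable_EFin_comp|].
rewrite /sintN !iintR; last 4 first.
- by msr.
- by move=> x; rewrite le_max lexx orbT.
- by msr.
- by move=> x; rewrite le_max lexx orbT.
by rewrite fine_pos_neg.
Qed.

Lemma sint2N_E (f : T * T -> R) : measurable_fun setT f -> (\int[mu2]_x (`|f x|)%:E < +oo)%E ->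
  sint2N f = fine (\int[mu2]_x (f x)%:E)%E.
Proof.
move=> mf ff; have iF : mu2.-integrable setT (EFin \o f).
  by apply/integrableP; split; [exact: measurable_EFin_comp|].
rewrite /sint2N !iint2R; last 4 first.
- by msr.
- by move=> x; rewrite le_max lexx orbT.
- by msr.
- by move=> x; rewrite le_max lexx orbT.
by rewrite fine_pos_neg.
Qed.

End iterated_integrals.

(** * Null sets *)

Section null_sets.
Context {R : realType} {N : nat}.
Local Notation T := (N.-tuple R).
Local Notation mu := (muN R N).
Local Notation mu2 := (muN R N \x muN R N)%E.

(** Turns an exceptional set of points into one of pairs, so that a function can be changed on it
    inside double integrals. *)
Lemma null_cylinder (E : set T) : measurable E -> mu E = 0%E ->
  let E2 := (E `*` setT) `|` (setT `*` E) in measurable E2 /\ mu2 E2 = 0%E.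
Proof.
move=> mE E0 E2.
have m1 : measurable (E `*` [set: T]) by exact: measurableX.
have m2 : measurable ([set: T] `*` E) by exact: measurableX.
have mE2 : measurable E2 by exact: measurableU.
split => //; apply/eqP; rewrite eq_le measure_ge0 andbT.
apply: (le_trans (measureU2 _ m1 m2)).
have e1 : mu2 (E `*` [set: T]) = 0%E.
  apply: etrans (product_measure1E mu mu mE measurableT) _.
  by rewrite [X in (X * _)%E](_ : _ = 0%E) ?mul0e//; exact: E0.
have e2 : mu2 ([set: T] `*` E) = 0%E.
  apply: etrans (product_measure1E mu mu measurableT mE) _.
  by rewrite [X in (_ * X)%E](_ : _ = 0%E) ?mule0//; exact: E0.
rewrite -[leRHS]adde0; apply: leeD.
- by rewrite le_eqVlt; apply/orP; left; apply/eqP; exact: e1.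
- by rewrite le_eqVlt; apply/orP; left; apply/eqP; exact: e2.
Qed.

Lemma null_tadd (E : set T) (h : T) : measurable E -> mu E = 0%E ->
  let E' := [set x | E (tadd x h)] in measurable E' /\ mu E' = 0%E.
Proof.
move=> mE E0 E'; have mE' : measurable E'.
  rewrite -[X in measurable X]setTI.
  by have := measurable_taddr h : measurable_fun setT (fun x => tadd x h); apply.
split => //.
have h1 (A : set T) : measurable A -> (\int[mu]_x (\1_A x)%:E = mu A)%E.
  by move=> mA; rewrite integral_indic// setIT.
rewrite -(h1 E' mE') -E0 -(h1 E mE).
exact: (integral_taddr (\1_E) h (measurable_indic mE) (fun x => ler0n _ _)).
Qed.

Lemma integral_null {d} {S : measurableType d} (m : {measure set S -> \bar R}) (E : set S) (f g : S -> R) :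
  measurable E -> m E = 0%E -> measurable_fun setT f -> measurable_fun setT g ->
  (forall x, ~ E x -> f x = g x) ->
  (\int[m]_x (f x)%:E = \int[m]_x (g x)%:E)%E /\
  (m.-integrable setT (EFin \o g) -> m.-integrable setT (EFin \o f)).
Proof.
move=> mE E0 mf mg fg.
have ae (F G : S -> R) : (forall x, ~ E x -> F x = G x) ->
    ae_eq m setT (fun x => (F x)%:E) (fun x => (G x)%:E).
  move=> FG; exists E; split => // x /=; apply: contra_notP => /FG -> //.
have mf' := measurable_EFin_comp _ _ mf; have mg' := measurable_EFin_comp _ _ mg.
split; first by apply: ae_eq_integral => //; exact: ae.
move=> /integrableP[_ gf]; apply/integrableP; split => //.
rewrite (_ : (\int[m]_x `|(EFin \o f) x|)%E = \int[m]_x `|(EFin \o g) x|)%E//.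
apply: ae_eq_integral => //.
- by apply: measurableT_comp.
- by apply: measurableT_comp.
- by have := ae (fun x => `|f x|) (fun x => `|g x|); apply => x /fg ->.
Qed.

End null_sets.

Section normalization.
Context {R : realType} {N : nat}.
Local Notation T := (N.-tuple R).
Local Notation mu := (muN R N).

Definition clamp (t : R) : R := Num.max (-1) (Num.min 1 t).

Lemma clamp_norm t : `|clamp t| <= 1.
Proof.
rewrite /clamp ler_norml le_max lexx/= ge_max ge_min lexx andbT.
by rewrite (le_trans (_ : -1 <= 0 :> R))// lerN10.
Qed.

Lemma clamp_id t : `|t| <= 1 -> clamp t = t.
Proof. by rewrite ler_norml /clamp => /andP[t1 t2]; rewrite min_r// max_r. Qed.

Lemma clamp_cases t : [\/ t <= -1 /\ clamp t = -1, 1 <= t /\ clamp t = 1 | -1 <= t <= 1 /\ clamp t = t].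
Proof.
have [t1|t1] := leP 1 t.
  by apply: Or32; split => //; rewrite /clamp min_l// max_r.
have [t2|t2] := leP t (-1).
  by apply: Or31; split => //; rewrite /clamp min_r ?(ltW t1)// max_l.
apply: Or33; split; first by rewrite (ltW t1) (ltW t2).
by apply: clamp_id; rewrite ler_norml (ltW t1) (ltW t2).
Qed.

Lemma clamp_dist a b : `|clamp a - clamp b| <= `|a - b|.
Proof.
wlog ab : a b / a <= b.
  by move=> H; have [/H//|/ltW/H] := leP a b; rewrite distrC (distrC b).
rewrite distrC (distrC a) (ger0_norm (_ : 0 <= b - a)) ?subr_ge0// /clamp.
rewrite -!/(clamp _) ler_norml.
have [[a1 ->]|[a1 ->]|[a1 ->]] := clamp_cases a;
  have [[b1 ->]|[b1 ->]|[b1 ->]] := clamp_cases b; apply/andP; split; lra.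
Qed.

(* On [B] the quotient is bounded by 1 almost everywhere, and clamping makes it so
   everywhere. *)
Definition normv (A : R) (u : T -> R) (B : set T) (x : T) : R :=
  \1_B x * clamp (u x / A) + \1_(~` B) x * (u x / A).

Lemma normv_in A u B x : B x -> normv A u B x = clamp (u x / A).
Proof. by move=> Bx; rewrite /normv !indicE mem_set// memNset ?mul1r ?mul0r ?addr0//; apply. Qed.

Lemma normv_out A u B x : ~ B x -> normv A u B x = u x / A.
Proof. by move=> Bx; rewrite /normv !indicE memNset// mem_set// mul1r mul0r add0r. Qed.

Lemma measurable_clamp (d : measure_display) (S : measurableType d) (f : S -> R) :
  measurable_fun setT f -> measurable_fun setT (fun x => clamp (f x)).
Proof. by move=> mf; rewrite /clamp; msr. Qed.

Lemma measurable_normv A u B : measurable B -> measurable_fun setT u -> measurable_fun setT (normv A u B).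
Proof.
move=> mB mu_; have m1 : measurable_fun setT (fun x => u x / A) by msr.
have m2 := measurable_clamp _ _ _ m1; have mC : measurable (~` B) by exact: measurableC.
rewrite /normv; msr.
Qed.

(** The sign is imposed where the increment of [v] is nonzero and [Z] is clamped where it vanishes,
    so that the conditions on a selection hold at every pair. For a weak solution this changes [Z]
    on a null set only. *)
Definition normZ (v : T -> R) (Z : T * T -> R) (z : T * T) : R :=
  if v z.2 < v z.1 then 1 else if v z.1 < v z.2 then -1 else clamp (Z z).

Lemma measurable_normZ v Z : measurable_fun setT v -> measurable_fun setT Z ->
  measurable_fun setT (normZ v Z).
Proof.
move=> mv mZ; have mc := measurable_clamp _ _ _ mZ.
have m1 : measurable_fun setT (fun z : T * T => v z.1) by msr.
have m2 : measurable_fun setT (fun z : T * T => v z.2) by msr.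
apply: measurable_fun_ifT; first exact: measurable_fun_ltr.
- exact: measurable_cst.
- by apply: measurable_fun_ifT => //; exact: measurable_fun_ltr.
Qed.

Lemma Linf_norm_ge0 (U : set T) (w : T -> R) : 0 <= Linf_norm U w.
Proof.
rewrite /Linf_norm; have [h|h] := pselect ([set M : R | 0 <= M /\ aeN N (fun x => U x -> `|w x| <= M)] !=set0).
  by apply: lb_le_inf => // M [].
by rewrite inf_out// => -[].
Qed.

(** The first hypothesis makes the set under the infimum nonempty, the infimum of the empty set
    being 0 by convention; any number strictly above the infimum is then an essential bound. *)
Lemma Linf_norm_lt (U : set T) (w : T -> R) (A M : R) :
  aeN N (fun x => U x -> `|w x| <= M) -> Linf_norm U w < A ->
  exists E, [/\ measurable E, mu E = 0%E & forall x, ~ E x -> U x -> `|w x| <= A].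
Proof.
move=> aM LA.
have hi : [set M : R | 0 <= M /\ aeN N (fun x => U x -> `|w x| <= M)] !=set0.
  exists `|M|; split => //; case: aM => E [mE [E0 EP]]; exists E; split => //; split => // x Ex Ux.
  by apply: (le_trans (EP x Ex Ux)); exact: ler_norm.
have [M' [M'0 aM'] M'A] := inf_lt hi LA.
have [E [mE E0 EP]] := aeN_null _ aM'.
by exists E; split => // x Ex Ux; apply: (le_trans (EP x Ex Ux)); exact: ltW.
Qed.

End normalization.

(** * Division by the datum *)

Section normalized_solution.
Context {R : realType} {N : nat}.
Local Notation T := (N.-tuple R).
Local Notation mu := (muN R N).
Local Notation mu2 := (muN R N \x muN R N)%E.

(** The summand 1 makes the datum strictly larger than the essential supremum, which is how it is
    seen to be an essential bound. *)
Definition datum (s p : R) (u : T -> R) (y : T) (Rr : R) : R :=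
  Linf_norm (eball y Rr) u + Tail p s u y Rr + gagliardo s p (eball y Rr) u + 1.

Lemma datum_ge1 s p u y Rr : 1 <= datum s p u y Rr.
Proof.
rewrite /datum lerDr; apply: addr_ge0; last exact: powR_ge0.
by apply: addr_ge0; [exact: Linf_norm_ge0|exact: powR_ge0].
Qed.

Lemma Linf_lt_datum s p u y Rr : Linf_norm (eball y Rr) u < datum s p u y Rr.
Proof.
rewrite /datum -addrA -addrA ltrDl; apply: ltr_wpDl; first exact: powR_ge0.
by apply: ltr_wpDl; [exact: powR_ge0|].
Qed.

Lemma Tail_le_datum s p u y Rr : Tail p s u y Rr <= datum s p u y Rr.
Proof.
have h1 := Linf_norm_ge0 (eball y Rr) u.
have h2 : 0 <= gagliardo s p (eball y Rr) u by exact: powR_ge0.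
by rewrite /datum; move: h1 h2; clear; lra.
Qed.

Lemma gagliardo_le_datum s p u y Rr : gagliardo s p (eball y Rr) u <= datum s p u y Rr.
Proof.
have h1 := Linf_norm_ge0 (eball y Rr) u.
have h2 : 0 <= Tail p s u y Rr by exact: powR_ge0.
by rewrite /datum; move: h1 h2; clear; lra.
Qed.

(** Outside the ball [1 + |x|] is at most a multiple of [|x - y|]. Finiteness matters because [fine]
    in [Tail] would send an infinite integral to 0. *)
Lemma tail_lty (s p : R) (u : T -> R) (y : T) (Rr : R) : 2 <= p -> 0 < s -> 0 < Rr ->
  tail_space p s u -> (\int[mu]_x (tailf p s y Rr u x)%:E < +oo)%E.
Proof.
move=> p2 s0 R0 [mu_ [_ tf]].
have sp0 : 0 <= s * p by rewrite mulr_ge0// ltW// (lt_le_trans _ p2).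
have Np : 0 <= N%:R + s * p by rewrite addr_ge0.
pose c := (1 + enorm y) / Rr + 1.
have y1 : 0 <= 1 + enorm y by exact: addr_ge0 ler01 (edist_ge0 _ _).
have c0 : 0 < c by apply: ltr_wpDl => //; exact: divr_ge0 y1 (ltW R0).
pose F (x : T) := `|u x| `^ (p - 1) / (1 + enorm x) `^ (N%:R + s * p).
have mF : measurable_fun setT F by rewrite /F; msr.
have F0 x : 0 <= F x by rewrite divr_ge0 ?powR_ge0.
rewrite (iintR F mF F0) in tf.
have mC : measurable (~` eball y Rr) by apply: measurableC; exact: measurable_eball.
apply: (@le_lt_trans _ _ (\int[mu]_x (c `^ (N%:R + s * p) * F x)%:E)%E); last first.
  rewrite (intRZ _ _ _ _ _ mF F0 (powR_ge0 _ _)).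
  by apply: lte_mul_pinfty => //; rewrite lee_fin powR_ge0.
apply: intR_le.
- by rewrite /tailf; msr.
- by msr.
- by move=> x; exact: tailf_ge0.
move=> x; rewrite /tailf indicE; have [xB|xB] := pselect (eball y Rr x).
  rewrite memNset; last by move=> h; exact: h.
  by rewrite mul0r mulr_ge0 ?powR_ge0.
rewrite mem_set// mul1r /F mulrCA; apply: ler_wpM2l; first exact: powR_ge0.
have xR : Rr <= edist x y by rewrite leNgt; apply/negP.
have x0 : 0 < edist x y by exact: lt_le_trans xR.
have e0 : 0 < 1 + enorm x by rewrite ltr_wpDr// edist_ge0.
rewrite ler_pdivlMr ?powR_gt0// ler_pdivrMl ?powR_gt0// -powRM ?(ltW c0) ?(ltW x0)//.
apply: ler_powR2 => //; first exact: ltW.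
have h : 1 + enorm y <= (1 + enorm y) / Rr * edist x y.
  rewrite -mulrA ler_peMr ?addr_ge0 ?edist_ge0// mulrC ler_pdivlMr// mul1r//.
have t := edist_triangle y x (origin N).
by rewrite /c mulrDr mulr1 (mulrC (edist x y)); move: h t; clear; lra.
Qed.

Lemma Wfrac0_admissible (s1 p s : R) (y : T) (Rr : R) (Om : set T) (phi : T -> R) (q tau : R) :
  1 <= q -> 0 <= Rr -> eball y Rr `<=` Om -> admissible s1 p s y Rr phi ->
  (\int[mu2]_z (gag q (tau * q) setT phi z)%:E < +oo)%E -> Wfrac0 tau q Om phi.
Proof.
move=> q1 R0 BO ad gf; have [mphi [M bphi] sphi _ _] := ad.
have q0 : 0 <= q by exact: le_trans q1.
have M0 : 0 <= M by exact: le_trans (bphi y).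
split; last first.
  exists set0; split => //; split.
    rewrite (_ : (fun x => _) = (fun=> (0 : R)%:E)); last by apply/funext => x; rewrite indic0.
    by rewrite iintR// integral0.
  by move=> x _ xO; apply: sphi => xB; apply: xO; exact: BO.
split.
  split => //; rewrite /LqpowN iintR; last 2 first.
  - by msr.
  - by move=> x; rewrite mulr_ge0 ?powR_ge0.
  have mB := measurable_eball y Rr.
  apply: (@le_lt_trans _ _ (\int[mu]_x (M `^ q * \1_(eball y Rr) x)%:E)%E).
    apply: intR_le.
    - by msr.
    - by msr.
    - by move=> x; rewrite mulr_ge0 ?powR_ge0.
    - move=> x; rewrite indicE in_setT mul1r indicE; have [xB|xB] := pselect (eball y Rr x).
        by rewrite mem_set// mulr1; apply: ler_powR2.
      by rewrite (sphi x xB) normr0 powR0 ?memNset// ?mulr0// gt_eqF// (lt_le_trans _ q1).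
  rewrite (intRZ _ _ _ _ _ (measurable_indic mB) (fun x => ler0n _ _) (powR_ge0 _ _)).
  apply: lte_mul_pinfty; [by rewrite lee_fin powR_ge0|by []|].
  rewrite integral_indic// setIT; apply: (le_lt_trans (muN_eball_le y _ R0)); exact: ltry.
rewrite /gagliardo_pow iint2R//; first by apply: measurable_gag.
by move=> z; exact: gag_ge0.
Qed.

Lemma normalized_solution (s1 p s : R) (Om : set T) (u : T -> R) (y : T) (Rr : R) :
  0 < s1 < 1 -> 2 <= p -> 0 < s < 1 -> locally_bounded_weak_solution s1 p s Om u ->
  ball_cc Om y Rr ->
  exists lam v Z E, [/\ nsol s1 p s lam y Rr v Z, measurable E, mu E = 0%E &
    forall x, ~ E x -> eball y Rr x -> u x = datum s p u y Rr * v x].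
Proof.
move=> s10 p2 /andP[s0 sl1] [[W1 [Wp [tl [Z [mZ [[M bZ] [sZ eqZ]]]]]]] [mu_ Li]] bc.
have [R0 BOm] := bc.
set B := eball y Rr; set A := datum s p u y Rr.
have A1 : 1 <= A by exact: datum_ge1.
have A0 : 0 < A by exact: lt_le_trans A1.
have An : A != 0 by rewrite gt_eqF.
have p0 : 0 < p by exact: lt_le_trans p2.
have p10 : 0 < p - 1 by move: p2; clear; lra.
have sp0 : 0 <= s * p by rewrite mulr_ge0// ltW.
have mB : measurable B by exact: measurable_eball.
have [M' hM'] := Li y Rr bc.
have [E1 [mE1 E10 uA]] := Linf_norm_lt B u A M' hM' (Linf_lt_datum s p u y Rr).
pose v := normv A u B; pose Zt := normZ v Z.
have mv : measurable_fun setT v by exact: measurable_normv.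
have mZt : measurable_fun setT Zt by exact: measurable_normZ.
have vu x : ~ E1 x -> v x = u x / A.
  move=> Ex; have [xB|xB] := pselect (B x); last exact: normv_out.
  rewrite /v normv_in// clamp_id// normrM normfV (ger0_norm (ltW A0)).
  by rewrite ler_pdivrMr// mul1r; exact: uA.
have [E2 [mE2 E20 sgnE]] := ae2N_null _ sZ.
have [mC C0] := null_cylinder E1 mE1 E10; set C := _ `|` _ in mC C0.
(* Off [F] neither clamping [v] nor rewriting [Z] changes anything; the equation is transferred
   across this null set of pairs. *)
pose F := C `|` E2.
have mF : measurable F by exact: measurableU.
have F0 : mu2 F = 0%E.
  apply/eqP; rewrite eq_le measure_ge0 andbT; apply: (le_trans (measureU2 _ mC mE2)).
  rewrite -[leRHS]adde0; apply: leeD.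
  - by rewrite le_eqVlt; apply/orP; left; apply/eqP; exact: C0.
  - by rewrite le_eqVlt; apply/orP; left; apply/eqP; exact: E20.
have vuF z : ~ F z -> v z.1 = u z.1 / A /\ v z.2 = u z.2 / A.
  move=> Fz; split; apply: vu => Ez; apply: Fz; left; [left|right] => //.
have ZF z : ~ F z -> Zt z = Z z.
  move=> Fz; have [v1 v2] := vuF z Fz.
  have /sgnE : ~ E2 z by move=> Ez; apply: Fz; right.
  rewrite /Zt /normZ /sgn_set v1 v2 !ltr_pM2r ?invr_gt0// subr_gt0 subr_lt0.
  case: ifP => _; first by move=> /= ->.
  case: ifP => _; first by move=> /= ->.
  by rewrite /= in_itv/= => zz; rewrite clamp_id// ler_norml.
have Ap : 0 < A `^ (p - 1) by exact: powR_gt0.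
have mgu (q tau : R) : measurable_fun setT (gag q tau B u) by apply: measurable_gag.
have gle (q tau : R) z : 0 <= q -> gag q tau B v z <= (A `^ q)^-1 * gag q tau B u z.
  move=> q0; rewrite /gag; have [Bx|nB] := pselect (B z.1); last first.
    by rewrite !indicE (memNset nB) !mul0r mulr0.
  have [By|nB] := pselect (B z.2); last by rewrite !indicE (memNset nB) !mulr0 !mul0r mulr0.
  rewrite [leRHS]mulrCA; apply: ler_wpM2l; first exact: mulr_ge0.
  rewrite mulrA; apply: ler_wpM2r; first by rewrite invr_ge0 powR_ge0.
  (* Clamping is 1-Lipschitz, hence does not increase the energy. *)
  rewrite /v !normv_in// [leRHS]mulrC -powR_dvd ?(ltW A0)//; apply: ler_powR2 => //.
  apply: (le_trans (clamp_dist _ _)).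
  by rewrite -mulrBl normrM normfV (ger0_norm (ltW A0)).
have gz (q tau : R) : 0 <= q -> (\int[mu2]_z (gag q tau B v z)%:E <=
    ((A `^ q)^-1)%:E * \int[mu2]_z (gag q tau B u z)%:E)%E.
  move=> q0; have ic : 0 <= (A `^ q)^-1 by rewrite invr_ge0 powR_ge0.
  rewrite -(intRZ _ _ _ _ _ (mgu q tau) (gag_ge0 _ _ _ _) ic).
  have mgq := mgu q tau; apply: intR_le; [exact: (measurable_gag q tau B v mB mv)|by clear -mgq; msr|exact: gag_ge0|].
  by move=> z; exact: gle.
have gfin (q tau : R) : 1 <= q -> Wfrac_loc tau q Om u ->
    (\int[mu2]_z (gag q (tau * q) B u z)%:E < +oo)%E.
  move=> q1 /(_ y Rr bc) [_]; rewrite /gagliardo_pow iint2R//; first exact: mgu.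
  exact: gag_ge0.
have gp := gfin p s (_ : 1 <= p) Wp.
exists (A `^ (p - 1))^-1, v, Zt, E1; split => //; last first.
  by move=> x Ex _; rewrite (vu x Ex) mulrCA mulfV ?mulr1.
split => //.
- by move=> x xB; rewrite /v normv_in//; exact: clamp_norm.
- move=> z; rewrite /Zt /normZ; case: ifP => _; first by rewrite normr1.
  by case: ifP => _; [rewrite normrN1|exact: clamp_norm].
- by move=> z vz; rewrite /Zt /normZ vz.
- by move=> z vz; rewrite /Zt /normZ vz ltNge (ltW vz).
- by rewrite invr_ge0 powR_ge0/= invf_le1//; apply: powR_ge1x => //; exact: ltW.
- pose Ft x := tailf p s y Rr u x.
  have tfin := tail_lty s p u y Rr p2 s0 R0 tl.
  have mFt : measurable_fun setT Ft.
    have mCB : measurable (~` eball y Rr) by exact: measurableC.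
    by rewrite /Ft /tailf; msr.
  have Ft0 x : 0 <= Ft x by exact: tailf_ge0.
  have ic : 0 <= (A `^ (p - 1))^-1 by rewrite invr_ge0 powR_ge0.
  rewrite (eq_integral (fun x => ((A `^ (p - 1))^-1 * Ft x)%:E)); last first.
    move=> x _; congr (_%:E); rewrite /Ft /tailf [RHS]mulrCA.
    have [xB|xB] := pselect (eball y Rr x).
      by rewrite indicE memNset ?mul0r// => h; exact: h.
    rewrite /v normv_out// normrM normfV (ger0_norm (ltW A0)) powR_dvd ?(ltW A0)//.
    by congr (_ * _); rewrite mulrA (mulrC _^-1).
  rewrite (intRZ _ _ _ _ _ mFt Ft0 ic).
  have tge : (0 <= \int[mu]_x (Ft x)%:E)%E by apply: integral_ge0 => x _; rewrite lee_fin.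
  have tf : (\int[mu]_x (Ft x)%:E)%E \is a fin_num by rewrite ge0_fin_numE.
  rewrite -(fineK tf) -EFinM lee_fin ler_pdivrMl//.
  rewrite ler_pdivlMr ?powR_gt0//.
  have TA := Tail_le_datum s p u y Rr.
  have : Tail p s u y Rr `^ (p - 1) <= A `^ (p - 1).
    by apply: ler_powR2 => //; [exact: ltW|exact: powR_ge0].
  rewrite /Tail -powRrM mulVf ?gt_eqF// powRr1; last first.
    rewrite mulr_ge0 ?powR_ge0// iintR// fine_ge0//.
  by rewrite iintR// mulrC.
- apply: (le_trans (gz p (s * p) (ltW p0))).
  have g0 : (0 <= \int[mu2]_z (gag p (s * p) B u z)%:E)%E.
    by apply: integral_ge0 => z _; rewrite lee_fin gag_ge0.
  have gf : (\int[mu2]_z (gag p (s * p) B u z)%:E)%E \is a fin_num.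
    by rewrite ge0_fin_numE//; apply: gp; rewrite (le_trans _ p2)// ler1n.
  rewrite -(fineK gf) -EFinM lee_fin ler_pdivrMl ?powR_gt0// mulr1.
  have GA := gagliardo_le_datum s p u y Rr.
  have : gagliardo s p (eball y Rr) u `^ p <= A `^ p.
    by apply: ler_powR2 => //; [exact: ltW|exact: powR_ge0].
  rewrite /gagliardo -powRrM mulVf ?gt_eqF// powRr1; last by rewrite /gagliardo_pow iint2R//; [exact: fine_ge0|exact: mgu|exact: gag_ge0].
  by rewrite /gagliardo_pow iint2R//; [exact: mgu|exact: gag_ge0].
- apply: (le_lt_trans (gz 1 s1 ler01)); apply: lte_mul_pinfty.
  + by rewrite lee_fin invr_ge0 powR_ge0.
  + by [].
  + by have := gfin 1 s1 (lexx _) W1; rewrite mulr1.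
move=> phi ad; have mphi := adm_meas _ _ _ _ _ _ ad.
have BO : eball y Rr `<=` Om by move=> x xB; apply: BOm; exact: ltW.
have p1 : 1 <= p by rewrite (le_trans _ p2)// ler1n.
have w1 : Wfrac0 s1 1 Om phi.
  by apply: (Wfrac0_admissible _ _ _ _ _ _ _ _ _ _ _ BO ad) => //; [exact: ltW|rewrite mulr1; exact: adm_gag1 _ _ _ _ _ _ ad].
have w2 : Wfrac0 s p Om phi.
  by apply: (Wfrac0_admissible _ _ _ _ _ _ _ _ _ _ _ BO ad) => //; [exact: ltW|exact: adm_gagp _ _ _ _ _ _ ad].
have [[mF1 f1] [[mF2 f2] e12]] := eqZ phi w1 w2.
set F1 := (fun z : T * T => Z z * _ / _) in mF1 f1 e12.
set F2 := (fun z : T * T => `|u z.1 - u z.2| `^ _ * _ * _ / _) in mF2 f2 e12.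
rewrite iint2R in f1; [|by msr|by []].
rewrite iint2R in f2; [|by msr|by []].
rewrite sint2N_E// sint2N_E// in e12.
have i1 : mu2.-integrable setT (EFin \o F1) by apply/integrableP; split; [exact: measurable_EFin_comp|].
have i2 : mu2.-integrable setT (EFin \o F2) by apply/integrableP; split; [exact: measurable_EFin_comp|].
set lam := (A `^ (p - 1))^-1.
have mf1 : measurable_fun setT (form1 s1 Zt phi) by rewrite /form1; msr.
have mJ := @measurable_Jp R (p - 2).
have mfp : measurable_fun setT (formp s p v phi).
  rewrite /formp; have mJv : measurable_fun setT (fun z : T * T => Jp (p - 2) (v z.1 - v z.2)).
    by apply: (measurableT_comp mJ); msr.
  by msr.
have mF2' : measurable_fun setT (fun z => lam * F2 z) by msr.
have eq1 z : ~ F z -> form1 s1 Zt phi z = F1 z by move=> Fz; rewrite /form1 ZF.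
(* The p-part is homogeneous of degree [p - 1], which produces the factor [lam]. *)
have eq2 z : ~ F z -> formp s p v phi z = lam * F2 z.
  move=> Fz; have [v1 v2] := vuF z Fz.
  rewrite /formp /F2 /Jp v1 v2 -mulrBl normrM normfV (ger0_norm (ltW A0)) (powR_dvd _ _ _ (normr_ge0 _) (ltW A0)).
  have El : lam = (A `^ (p - 2))^-1 / A.
    rewrite /lam (_ : p - 1 = p - 2 + 1); last by ring.
    by rewrite powRD ?(gt_eqF A0) ?implybT// powRr1 ?(ltW A0)// invfM.
  by rewrite El; ring.
have [I1 J1] := integral_null mu2 F (form1 s1 Zt phi) F1 mF F0 mf1 mF1 eq1.
have [I2 J2] := integral_null mu2 F (formp s p v phi) (fun z => lam * F2 z) mF F0 mfp mF2' eq2.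
have il : mu2.-integrable setT (EFin \o (fun z => lam * F2 z)).
  exact: (integrableZl measurableT lam i2).
have El : (\int[mu2]_z (lam * F2 z)%:E = lam%:E * \int[mu2]_z (F2 z)%:E)%E.
  exact: (integralZl measurableT i2).
split; [exact: J1|exact: J2|].
rewrite I1 I2 El.
have g1 := integrable_fin_num measurableT i1; have g2 := integrable_fin_num measurableT i2.
rewrite -(fineK g1) -(fineK g2) -!EFinM -EFinD -mulrDr; congr (_%:E).
by rewrite [X in lam * X](_ : _ = 0) ?mulr0// addrC; exact/esym.
Qed.

End normalized_solution.

(** * The gradient of a weak solution *)

Section local_gradient.
Context {R : realType} {N : nat}.
Local Notation T := (N.-tuple R).
Local Notation mu := (muN R N).

(** The second difference is taken at the finer step; being of order greater than 1 in that step, it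
    outweighs the factor [2 ^ k]. *)
Lemma dquot_step (u : T -> R) i k x :
  dquot u i k x - dquot u i k.+1 x =
  2 ^+ k * diff (diff u (unitv i (2^-1 ^+ k.+1))) (unitv i (2^-1 ^+ k.+1)) x.
Proof.
rewrite /dquot /diff -!taddA unitvD.
have -> : 2^-1 ^+ k.+1 + 2^-1 ^+ k.+1 = 2^-1 ^+ k :> R by rewrite exprSr; field.
rewrite exprS; ring.
Qed.

(** The relation [u = A v] has to hold at [x], [x + h] and [x + 2 h], hence the three translates of
    the null set and the margin [2 |h|]. *)
Lemma diff_transfer (u v : T -> R) (E : set T) (A m Rr r : R) (y h : T) :
  measurable E -> mu E = 0%E -> measurable_fun setT u -> measurable_fun setT v ->
  (forall x, ~ E x -> eball y Rr x -> u x = A * v x) -> 0 <= A ->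
  r + 2 * enorm h <= Rr ->
  (\int[mu]_x (\1_(eball y r) x * `|diff u h x| `^ m)%:E =
     (A `^ m)%:E * \int[mu]_x (\1_(eball y r) x * `|diff v h x| `^ m)%:E)%E /\
  (\int[mu]_x (\1_(eball y r) x * `|diff (diff u h) h x| `^ m)%:E =
     (A `^ m)%:E * \int[mu]_x (\1_(eball y r) x * `|diff (diff v h) h x| `^ m)%:E)%E.
Proof.
move=> mE E0 mu_ mv uv A0 rh.
have [mE1 E10] := null_tadd E h mE E0; set E1 := [set x | _] in mE1 E10.
have [mE2 E20] := null_tadd E1 h mE1 E10; set E2 := [set x | E1 _] in mE2 E20.
have mF : measurable (E `|` E1 `|` E2) by apply: measurableU => //; exact: measurableU.
have F0 : mu (E `|` E1 `|` E2) = 0%E.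
  apply/eqP; rewrite eq_le measure_ge0 andbT.
  apply: (le_trans (measureU2 _ (measurableU _ _ mE mE1) mE2)).
  apply: (@le_trans _ _ (mu E + mu E1 + mu E2)%E).
    by apply: leeD => //; exact: (measureU2 _ mE mE1).
  by rewrite E0 E10 E20 !adde0.
have m1 := @measurable_diff R N u h mu_; have m2 := @measurable_diff R N v h mv.
have m3 := @measurable_diff R N _ h m1; have m4 := @measurable_diff R N _ h m2.
have mB := measurable_eball y r.
have h0 : 0 <= enorm h by exact: edist_ge0.
have inB x : eball y r x -> [/\ eball y Rr x, eball y Rr (tadd x h) & eball y Rr (tadd (tadd x h) h)].
  rewrite /eball/= => xr.
  have t1 := edist_triangle x (tadd x h) y; rewrite (edistC (tadd x h) x) edist_taddr in t1.
  have t2 := edist_triangle (tadd x h) (tadd (tadd x h) h) y.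
  rewrite (edistC (tadd (tadd x h) h) (tadd x h)) edist_taddr in t2.
  by split; move: xr t1 t2 rh h0; clear; lra.
have d1 x : ~ (E `|` E1 `|` E2) x -> eball y r x -> diff u h x = A * diff v h x.
  move=> nF xr; have [b1 b2 b3] := inB x xr; rewrite /diff uv ?(uv x)//; first by ring.
  - by move=> Ex; apply: nF; left; left.
  - by move=> Ex; apply: nF; left; right.
have d2 x : ~ (E `|` E1 `|` E2) x -> eball y r x -> diff (diff u h) h x = A * diff (diff v h) h x.
  move=> nF xr; have [b1 b2 b3] := inB x xr; rewrite /diff uv ?(uv x) ?(uv (tadd x h))//; first by ring.
  - by move=> Ex; apply: nF; left; right.
  - by move=> Ex; apply: nF; left; left.
  - by move=> Ex; apply: nF; right.
have tr (f g : T -> R) : measurable_fun setT f -> measurable_fun setT g ->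
    (forall x, ~ (E `|` E1 `|` E2) x -> eball y r x -> f x = A * g x) ->
    (\int[mu]_x (\1_(eball y r) x * `|f x| `^ m)%:E =
     (A `^ m)%:E * \int[mu]_x (\1_(eball y r) x * `|g x| `^ m)%:E)%E.
  move=> mf mg fg; have mG : measurable_fun setT (fun x => \1_(eball y r) x * `|g x| `^ m) by msr.
  have mH : measurable_fun setT (fun x => \1_(eball y r) x * `|f x| `^ m) by msr.
  have G0 x : 0 <= \1_(eball y r) x * `|g x| `^ m by rewrite mulr_ge0 ?powR_ge0.
  rewrite -(intRZ _ _ _ _ _ mG G0 (powR_ge0 _ _)).
  have mK : measurable_fun setT (fun x => A `^ m * (\1_(eball y r) x * `|g x| `^ m)) by msr.
  suff fgE x : ~ (E `|` E1 `|` E2) x ->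
      \1_(eball y r) x * `|f x| `^ m = A `^ m * (\1_(eball y r) x * `|g x| `^ m).
    by have [] := integral_null mu _ _ _ mF F0 mH mK fgE.
  move=> nF; rewrite mulrCA; have [xr|xr] := pselect (eball y r x); last by rewrite indicE memNset// !mul0r.
  by rewrite (fg x nF xr) normrM (ger0_norm A0) powRM.
by split; apply: tr.
Qed.

(** The limit [seqlim (dquot u i)] does not depend on the ball, so the estimates on all balls
    concern the same function and nothing has to be glued. *)
Lemma local_gradient (s1 p s q : R) : 2 <= p -> 0 < s1 < 1 -> (p - 1) / p < s < 1 ->
  exists m C kap : R, [/\ q <= m, 1 <= m, 0 < C, 0 < kap &
  forall (Om : set T) (u : T -> R), locally_bounded_weak_solution s1 p s Om u ->
  forall (y : T) (Rr r : R), ball_cc Om y Rr -> Rr < 1 -> 0 < r -> r < Rr -> forall i : 'I_N,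
  (\int[mu]_x (\1_(eball y r) x * `|seqlim (dquot u i) x| `^ m)%:E <=
    (datum s p u y Rr `^ m * (C * (Rr - r) `^ (- kap)))%:E)%E /\
  exists (C' a : R) (k0 : nat), 0 <= a < 1 /\ forall k, (k0 <= k)%N ->
    (\int[mu]_x (\1_(eball y r) x * `|dquot u i k x - seqlim (dquot u i) x|)%:E <=
       (C' * a ^+ k)%:E)%E].
Proof.
move=> p2 s10 hs; have s01 : 0 < s < 1.
  case/andP: hs => h ->; rewrite andbT; apply: le_lt_trans h.
  have p0 : 0 < p by exact: lt_le_trans p2.
  by rewrite divr_ge0 ?(ltW p0)// subr_ge0 (le_trans _ p2)// ler1n.
have [m [gam [C [kap [qm m1 gam0 C0 [kap0 H]]]]]] := @difference_estimates R N s1 p s q p2 s10 hs.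
exists m, C, kap; split => // Om u sol y Rr r bc R1 r0 rR i.
have [lam [v [Z [E [nv mE E0 uv]]]]] := normalized_solution s1 p s Om u y Rr s10 p2 s01 sol bc.
set A := datum s p u y Rr in uv *.
have A1 : 1 <= A by exact: datum_ge1.
have A0 : 0 <= A by exact: le_trans A1.
have mu_ : measurable_fun setT u by have [_ []] := sol.
have mv := ns_mv _ _ _ _ _ _ _ _ nv.
have m0 : 0 < m by exact: lt_le_trans m1.
have [d d0 Hd] := H _ _ _ _ _ _ nv r0 rR R1.
set Kv := C * (Rr - r) `^ (- kap) in Hd *.
have Kv0 : 0 <= Kv by rewrite mulr_ge0 ?powR_ge0// ltW.
(* The second bound keeps [x + 2 h] in the larger ball. *)
have dp : 0 < Num.min d ((Rr - r) / 2) by rewrite lt_min d0 divr_gt0// subr_gt0.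
have [k0 hk0] := half_pow_small _ dp.
pose K := A `^ m * Kv.
have K0 : 0 <= K by rewrite mulr_ge0 ?powR_ge0.
(* [a ^ (2 m) = 2 ^ (- gam)] is the decay of the second differences beyond first order; the factor 2
   in the exponent is that of [powR_L1_geometric]. *)
pose a : R := 2 `^ (- (gam / (2 * m))).
have a0 : 0 < a by rewrite powR_gt0.
have a1 : a < 1.
  rewrite /a powRN invf_lt1 ?powR_gt0//; have one : 1 `^ (gam / (2 * m)) = 1 :> R by rewrite powR1.
  by rewrite -[ltLHS]one; apply: gt0_ltr_powR; rewrite ?nnegrE// ?ltr1n// divr_gt0// mulr_gt0.
have a01 : 0 < a < 1 by rewrite a0.
have hpos k : 0 < (2^-1 : R) ^+ k by rewrite exprn_gt0.
have est k : (k0 <= k)%N -> let h := unitv i (2^-1 ^+ k) in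
    (\int[mu]_x (\1_(eball y r) x * `|diff u h x| `^ m)%:E <= (K * (2^-1 ^+ k) `^ m)%:E)%E /\
    (\int[mu]_x (\1_(eball y r) x * `|diff (diff u h) h x| `^ m)%:E <= (K * (2^-1 ^+ k) `^ (m + gam))%:E)%E.
  move=> kk h; have hn : enorm h = 2^-1 ^+ k by rewrite enorm_unitv ger0_norm// ltW.
  have := hk0 k kk; rewrite -hn lt_min => /andP[hd hr].
  have rh : r + 2 * enorm h <= Rr by move: hr; clear; lra.
  have h0 : 0 < enorm h by rewrite hn.
  have [e1 e2] := diff_transfer u v E A m Rr r y h mE E0 mu_ mv uv A0 rh.
  have [i1 i2] := Hd h h0 hd.
  have Am := powR_ge0 A m.
  by rewrite e1 e2 /K -!(mulrA (A `^ m)) !(EFinM (A `^ m)); split;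
    [exact: (lee_scale _ _ _ Am i1)|exact: (lee_scale _ _ _ Am i2)].
have mD k : measurable_fun setT (dquot u i k) by exact: measurable_dquot.
have mB := measurable_eball y r.
have p2k k : (2 ^+ k : R) `^ m * (2^-1 ^+ k) `^ m = 1.
  by rewrite -powRM ?exprn_ge0// -exprMn mulfV// expr1n powR1.
have scale (f : T -> R) (k : nat) (X : R) : measurable_fun setT f ->
    (\int[mu]_x (\1_(eball y r) x * `|f x| `^ m)%:E <= X%:E)%E ->
    (\int[mu]_x (\1_(eball y r) x * `|2 ^+ k * f x| `^ m)%:E <= ((2 ^+ k) `^ m * X)%:E)%E.
  move=> mf fX; have mF : measurable_fun setT (fun x => \1_(eball y r) x * `|f x| `^ m) by msr.
  have F0 x : 0 <= \1_(eball y r) x * `|f x| `^ m by rewrite mulr_ge0 ?powR_ge0.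
  rewrite (eq_integral (fun x => ((2 ^+ k) `^ m * (\1_(eball y r) x * `|f x| `^ m))%:E)); last first.
    by move=> x _; rewrite normrM (ger0_norm (exprn_ge0 _ _))// powRM ?exprn_ge0// mulrCA.
  by rewrite (intRZ _ _ _ _ _ mF F0 (powR_ge0 _ _)) EFinM; apply: lee_scale => //; exact: powR_ge0.
have hD k : (k0 <= k)%N -> (\int[mu]_x (\1_(eball y r) x * `|dquot u i k x| `^ m)%:E <= K%:E)%E.
  move=> kk; have [e1 _] := est k kk.
  have := scale _ k _ (@measurable_diff R N u _ mu_) e1.
  by rewrite mulrCA p2k mulr1.
have hDD k : (k0 <= k)%N ->
    (\int[mu]_x (\1_(eball y r) x * `|dquot u i k x - dquot u i k.+1 x| `^ m)%:E <=
      (K * (a ^+ k) `^ (2 * m))%:E)%E.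
  move=> kk; have [_ e2] := est k.+1 (leqW kk).
  have mdd := @measurable_diff R N _ (unitv i (2^-1 ^+ k.+1)) (@measurable_diff R N u (unitv i (2^-1 ^+ k.+1)) mu_).
  rewrite (eq_integral (fun x => (\1_(eball y r) x * `|2 ^+ k * diff (diff u (unitv i (2^-1 ^+ k.+1))) (unitv i (2^-1 ^+ k.+1)) x| `^ m)%:E)); last first.
    by move=> x _; rewrite dquot_step.
  apply: (le_trans (scale _ k _ mdd e2)); rewrite lee_fin mulrCA; apply: ler_wpM2l => //.
  have hk : (2^-1 : R) ^+ k.+1 <= 2^-1 ^+ k by rewrite exprS ler_piMl ?exprn_ge0// invf_le1// ler1n.
  apply: (@le_trans _ _ ((2 ^+ k) `^ m * (2^-1 ^+ k) `^ (m + gam))).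
    by apply: ler_wpM2l; [exact: powR_ge0|apply: ler_powR2 => //; rewrite ?exprn_ge0// addr_ge0// ltW].
  rewrite powRD; last by rewrite (gt_eqF (hpos k)) implybT.
  rewrite mulrA p2k mul1r !exprn_powR ?(ltW a0) ?invr_ge0//.
  rewrite /a -powRrM mulNr divfK; last by rewrite mulf_neq0// gt_eqF.
  have -> : (2^-1 : R) `^ gam = 2 `^ (- gam); last by [].
  by rewrite -[X in X `^ gam = _](powR_inv1 (ler0n R 2)) -powRrM mulN1r.
have V0 : 0 <= 2 ^+ N :> R by rewrite exprn_ge0.
have BV : (mu (eball y r) <= (2 ^+ N)%:E)%E.
  apply: (le_trans (muN_eball_le y _ (ltW r0))); rewrite lee_fin lerXn2r ?nnegrE ?mulr_ge0 ?(ltW r0)//.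
  by move: rR R1; clear; lra.
split; first exact: (seqlim_Lm mu (dquot u i) (eball y r) m a K (2 ^+ N) k0 mD mB m1 a01 K0 V0 BV hD hDD).
exists ((2 ^+ N + K) / (1 - a)), a, k0; split; first by rewrite (ltW a0).
exact: (seqlim_L1 mu (dquot u i) (eball y r) m a K (2 ^+ N) k0 mD mB m1 a01 K0 V0 BV hDD).
Qed.

End local_gradient.

(** * Coverings and lowering of the exponent *)

Section sobolev.
Context {R : realType} {N : nat}.
Local Notation T := (N.-tuple R).
Local Notation mu := (muN R N).

(** Through the largest component; the constant depends on [N] and [q] only. *)
Lemma vnorm_powR (G : 'I_N -> T -> R) (x : T) (q : R) : (0 < N)%N -> 0 <= q ->
  vnorm G x `^ q <= N%:R `^ q * \sum_(i < N) `|G i x| `^ q.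
Proof.
move=> N0 q0; pose i0 := Ordinal N0.
have [j _ hj] := Order.TotalTheory.arg_maxP (i0 := i0) (P := predT) (fun i : 'I_N => `|G i x|) isT.
have vj : vnorm G x <= N%:R * `|G j x|.
  rewrite /vnorm -[leRHS]ger0_norm ?mulr_ge0// -sqrtr_sqr ler_wsqrtr// exprMn.
  apply: (@le_trans _ _ (N%:R * `|G j x| ^+ 2)).
    apply: (@le_trans _ _ (\sum_(i < N) `|G j x| ^+ 2)).
      by apply: ler_sum => i _; rewrite -[leLHS]real_normK ?num_real// lerXn2r ?nnegrE//; exact: hj.
    by rewrite sumr_const card_ord -[leLHS]mulr_natl.
  by apply: ler_wpM2r; rewrite ?exprn_ge0// expr2 ler_peMl ?ler1n.
apply: (le_trans (ler_powR2 _ _ _ q0 (sqrtr_ge0 _) vj)).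
rewrite powRM//; apply: ler_wpM2l; first exact: powR_ge0.
by rewrite (bigD1 j)//= lerDl; apply: sumr_ge0 => i _; exact: powR_ge0.
Qed.

(** The exponent is lowered after dividing by [A], so that the bound carries exactly the power [q]
    of the datum. *)
Lemma int_powR_le (g : T -> R) (y : T) (r A q m X : R) : measurable_fun setT g ->
  0 <= r -> r <= 1 -> 0 < A -> 0 <= q <= m ->
  (\int[mu]_x (\1_(eball y r) x * `|g x| `^ m)%:E <= (A `^ m * X)%:E)%E ->
  (\int[mu]_x (\1_(eball y r) x * `|g x| `^ q)%:E <= (A `^ q * (2 ^+ N + X))%:E)%E.
Proof.
move=> mg r0 r1 A0 qm gX; have mB := measurable_eball y r.
have m1 : measurable_fun setT (fun x => A `^ q * \1_(eball y r) x) by msr.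
have m2 : measurable_fun setT (fun x => \1_(eball y r) x * `|g x| `^ m) by msr.
have m3 : measurable_fun setT (fun x => A `^ q / A `^ m * (\1_(eball y r) x * `|g x| `^ m)) by msr.
have m4 : measurable_fun setT (fun x => A `^ q * \1_(eball y r) x + A `^ q / A `^ m * (\1_(eball y r) x * `|g x| `^ m)) by msr.
have m5 : measurable_fun setT (fun x => \1_(eball y r) x * `|g x| `^ q) by msr.
have m6 : measurable_fun setT (\1_(eball y r) : T -> R) by msr.
have Aq := powR_ge0 A q; have Am : 0 < A `^ m by rewrite powR_gt0.
have c0 : 0 <= A `^ q / A `^ m by rewrite divr_ge0// ltW.
have p1 x : 0 <= A `^ q * \1_(eball y r) x by rewrite mulr_ge0.
have p2 x : 0 <= \1_(eball y r) x * `|g x| `^ m by rewrite mulr_ge0 ?powR_ge0.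
have p3 x : 0 <= A `^ q / A `^ m * (\1_(eball y r) x * `|g x| `^ m) by rewrite mulr_ge0.
have p5 x : 0 <= \1_(eball y r) x * `|g x| `^ q by rewrite mulr_ge0 ?powR_ge0.
have ptw x : \1_(eball y r) x * `|g x| `^ q <=
    A `^ q * \1_(eball y r) x + A `^ q / A `^ m * (\1_(eball y r) x * `|g x| `^ m).
  have h := powR_le1D (`|g x| / A) q m (divr_ge0 (normr_ge0 _) (ltW A0)) qm.
  have -> : A `^ q * \1_(eball y r) x + A `^ q / A `^ m * (\1_(eball y r) x * `|g x| `^ m) =
      \1_(eball y r) x * (A `^ q * (1 + `|g x| `^ m / A `^ m)) by ring.
  apply: ler_wpM2l => //; rewrite -(powR_dvd _ _ m) ?(ltW A0)//.
  apply: (le_trans _ (ler_wpM2l Aq h)).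
  by rewrite powR_dvd ?(ltW A0)// mulrCA divff ?mulr1// gt_eqF// powR_gt0.
apply: (le_trans (intR_le _ _ _ _ _ m5 m4 p5 ptw)).
have p6 x : 0 <= \1_(eball y r) x :> R by [].
rewrite (intRD _ _ _ _ _ m1 m3 p1 p3) (intRZ _ _ _ _ _ m6 p6 Aq).
rewrite (intRZ _ _ _ _ _ m2 p2 c0) integral_indic// setIT mulrDr EFinD.
apply: leeD.
  rewrite EFinM; apply: lee_scale => //; apply: (le_trans (muN_eball_le y _ r0)).
  by rewrite lee_fin lerXn2r ?nnegrE ?mulr_ge0//; move: r1; clear; lra.
have -> : A `^ q * X = A `^ q / A `^ m * (A `^ m * X) by rewrite mulrA divfK// gt_eqF.
by rewrite (EFinM (A `^ q / A `^ m)); exact: lee_scale.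
Qed.

Lemma test_fun_cover (Om : set T) (phi : T -> R) : test_fun Om phi ->
  exists (s : seq T) (e rho : R), [/\ 0 < e, 0 < rho < 1,
    forall y, y \in s -> ball_cc Om y rho &
    forall x h, phi x != 0 -> enorm h < e -> 1 <= cov s (rho / 2) (tadd x h)].
Proof.
(* A point within [rho] of a centre is at distance less than [e + rho <= d / 2] from a point where
   [phi] is nonzero, hence in [Om]; the cap 1/2 keeps the radius below 1, as [local_gradient]
   demands. *)
move=> [_ [d [M [d0 hM]]]]; pose e := d / 4; pose rho := Num.min (d / 4) (1 / 2).
have e0 : 0 < e by rewrite divr_gt0.
have rho0 : 0 < rho by rewrite lt_min !divr_gt0.
pose K := [set x | exists2 z, phi z <> 0 & edist x z < e].
have KM x : K x -> enorm x <= M + e.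
  move=> [z /hM[zM _] xz]; apply: (le_trans (edist_triangle z _ _)).
  by rewrite addrC; apply: lerD => //; exact: ltW.
have [s [sK Ks]] := totally_bounded K (M + e) (rho / 2) (divr_gt0 rho0 (ltr0n _ 2)) KM.
exists s, e, rho; split => //.
- rewrite rho0 /= gt_min; apply/orP; right; clear; lra.
- move=> y /sK[z /hM[_ zO] yz]; split=> // x /= xy; apply: zO; rewrite /eball/=.
  apply: (le_lt_trans (edist_triangle y _ _)); apply: (le_lt_trans (lerD xy (ltW yz))).
  have : rho <= d / 4 by rewrite ge_min lexx.
  by rewrite /e; move: d0; clear; lra.
- move=> x h /eqP px he; have [|y ys yx] := Ks (tadd x h); last exact: cov_ge1 yx.
  by exists x => //; rewrite edistC edist_taddr.
Qed.

Lemma pderiv_test_fun (Om : set T) (phi : T -> R) (i : 'I_N) : test_fun Om phi ->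
  [/\ measurable_fun setT phi, measurable_fun setT (pderiv i phi),
      exists L, forall x, `|phi x| <= L & exists L, forall x, `|pderiv i phi x| <= L].
Proof.
move=> [Cphi [d [M [d0 hM]]]].
have c0 : econtinuous phi by exact: (Cphi 0%N).
have c1 : econtinuous (pderiv i phi) by have [_ /(_ i) []] := Cphi 1%N.
split; [exact: econtinuous_measurable|exact: econtinuous_measurable| |].
  have [L L0 hL] := econtinuous_bounded phi M c0; exists L => x.
  have [->|/hM[xM _]] := pselect (phi x = 0); first by rewrite normr0 ltW.
  exact: hL.
have [L L0 hL] := econtinuous_bounded _ (M + 1) c1; exists L => x.
have [xM|xM] := leP (enorm x) (M + 1); first exact: hL.
rewrite (pderiv_support _ _ _ 1)// ?normr0 ?ltW// => y yx.
apply: contrapT => /hM[yM _].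
have := edist_triangle y x (origin N); rewrite (edistC x y).
by move: yx yM xM; clear; lra.
Qed.

(** The ball is covered by balls of radius [d / 2] whose doubles stay in [Om] and have radius below
    1; adding 1 to [|g| ^ m] allows the exponent to be lowered. *)
Lemma gradient_Lq (g : T -> R) (Om : set T) (q m : R) : measurable_fun setT g -> 0 <= q <= m ->
  eopen Om ->
  (forall y Rr r, ball_cc Om y Rr -> Rr < 1 -> 0 < r -> r < Rr ->
     (\int[mu]_x (\1_(eball y r) x * `|g x| `^ m)%:E < +oo)%E) ->
  Lq_loc q Om g.
Proof.
move=> mg qm oO hg x0 rho bc; split=> //; rewrite /LqpowN.
have [e e0 eO] := ball_cc_margin Om x0 rho oO bc.
pose d := Num.min (e / 2) (1 / 2); have d0 : 0 < d by rewrite lt_min !divr_gt0.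
have de : d <= e / 2 by rewrite ge_min lexx.
have d1 : d < 1 by rewrite gt_min; apply/orP; right; clear; lra.
have KM x : eball x0 rho x -> enorm x <= rho + enorm x0.
  by move=> xr; apply: (le_trans (edist_triangle x0 _ _)); rewrite lerD2r ltW.
have d20 : 0 < d / 2 by rewrite divr_gt0.
have [s [sK Ks]] := totally_bounded (eball x0 rho) _ (d / 2) d20 KM.
have mF : measurable_fun setT (fun x => 1 + `|g x| `^ m) by msr.
have F0 x : 0 <= 1 + `|g x| `^ m by rewrite addr_ge0 ?powR_ge0.
have mB := measurable_eball x0 rho.
have fin : (\int[mu]_x (cov s (d / 2) x * (1 + `|g x| `^ m))%:E < +oo)%E.
  apply: int_cov_lty => // y ys.
  have mb := measurable_eball y (d / 2).
  have m1 : measurable_fun setT (\1_(eball y (d / 2)) : T -> R) by msr.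
  have m2 : measurable_fun setT (fun x => \1_(eball y (d / 2)) x * `|g x| `^ m) by msr.
  have p1 x : 0 <= \1_(eball y (d / 2)) x :> R by [].
  have p2 x : 0 <= \1_(eball y (d / 2)) x * `|g x| `^ m by rewrite mulr_ge0 ?powR_ge0.
  rewrite (eq_integral (fun x => (\1_(eball y (d / 2)) x + \1_(eball y (d / 2)) x * `|g x| `^ m)%:E)); last first.
    by move=> x _; rewrite mulrDr mulr1.
  rewrite (intRD _ _ _ _ _ m1 m2 p1 p2); apply: lte_add_pinfty.
    rewrite integral_indic// setIT; apply: le_lt_trans (ltry _).
    exact: (muN_eball_le y _ (ltW d20)).
  apply: (hg y d) => //; last by move: d0; clear; lra.
  split=> // z /= zy; apply: (eO y); first exact: ltW (sK y ys).
  by apply: (le_lt_trans zy); apply: (le_lt_trans de); move: e0; clear; lra.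
apply: le_lt_trans fin.
rewrite iintR; [|by msr|by move=> x; rewrite mulr_ge0 ?powR_ge0].
have mc := measurable_cov s (d / 2).
apply: intR_le; [by msr|by msr|by move=> x; rewrite mulr_ge0 ?powR_ge0|move=> x].
have [xB|xB] := pselect (eball x0 rho x); last first.
  by rewrite indicE memNset// mul0r mulr_ge0// cov_ge0.
have [y ys yx] := Ks x xB.
apply: ler_pM; rewrite ?powR_ge0//; last exact: powR_le1D.
by apply: le_trans (cov_ge1 _ _ _ _ ys yx); rewrite indicE; case: (_ \in _).
Qed.

Lemma Linf_loc_Lq (u : T -> R) (Om : set T) (q : R) : 0 <= q -> Linf_loc Om u -> Lq_loc q Om u.
Proof.
move=> q0 [mu_ hu] x0 rho bc; split=> //; rewrite /LqpowN.
have [M /aeN_null[E [mE E0 EM]]] := hu x0 rho bc.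
have mB := measurable_eball x0 rho.
have m1 : measurable_fun setT (fun x => \1_(eball x0 rho) x * `|u x| `^ q) by msr.
have m0 : measurable_fun setT (\1_(eball x0 rho) : T -> R) by msr.
have m2 : measurable_fun setT (fun x => \1_(eball x0 rho) x * (\1_(~` E) x * `|u x| `^ q)).
  have mC : measurable (~` E) by exact: measurableC.
  by msr.
have m3 : measurable_fun setT (fun x => `|M| `^ q * \1_(eball x0 rho) x) by msr.
have p1 x : 0 <= \1_(eball x0 rho) x * `|u x| `^ q by rewrite mulr_ge0 ?powR_ge0.
rewrite iintR//.
have E12 x : ~ E x -> \1_(eball x0 rho) x * `|u x| `^ q = \1_(eball x0 rho) x * (\1_(~` E) x * `|u x| `^ q).
  by move=> nE; rewrite (indicE R (~` E)) mem_set// mul1r.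
have [-> _] := integral_null mu _ _ _ mE E0 m1 m2 E12.
apply: (@le_lt_trans _ _ (\int[mu]_x (`|M| `^ q * \1_(eball x0 rho) x)%:E)%E).
  apply: intR_le => // x.
  have [xB|xB] := pselect (eball x0 rho x); last by rewrite indicE memNset// !mul0r mulr0.
  have [Ex|Ex] := pselect (E x).
    by rewrite (indicE R (~` E)) memNset ?mul0r ?mulr0 ?mulr_ge0 ?powR_ge0//; apply.
  rewrite (indicE R (~` E)) mem_set// mul1r mulrC; apply: ler_wpM2r => //.
  by apply: ler_powR2 => //; apply: (le_trans (EM x Ex xB)); exact: ler_norm.
have p0 x : 0 <= \1_(eball x0 rho) x :> R by [].
rewrite (intRZ _ _ _ _ _ m0 p0 (powR_ge0 _ _)) integral_indic// setIT.
apply: lte_mul_pinfty => //.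
apply: le_lt_trans (ltry _); apply: (muN_eball_le x0 rho).
by case: bc => /ltW.
Qed.

End sobolev.

Theorem theorem2 (R : realType) (N : nat) (s1 p sp q : R) :
  (2 <= N)%N -> 0 < s1 < 1 -> 2 <= p -> (p - 1) / p < sp < 1 -> p <= q ->
  exists C kappa : R, 0 < C /\ 0 < kappa /\
  forall (Om : set (N.-tuple R)) (u : N.-tuple R -> R),
    bounded_domain Om ->
    locally_bounded_weak_solution s1 p sp Om u ->
    exists G : 'I_N -> N.-tuple R -> R,
      W1q_loc_grad q Om u G /\
      forall (x0 : N.-tuple R) (Rr r : R),
        ball_cc Om x0 Rr -> Rr < 1 -> 0 < r -> r < Rr ->
        (iint N (fun x => (\1_(eball x0 r) x * vnorm G x `^ q)%:E) <=
         (C * (Linf_norm (eball x0 Rr) u + Tail p sp u x0 Rr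
               + gagliardo sp p (eball x0 Rr) u + 1) `^ q
          / (Rr - r) `^ kappa)%:E)%E.
Proof.
move=> N2 s10 p2 hsp pq.
have N0 : (0 < N)%N by exact: leq_trans N2.
have q0 : 0 <= q by apply: le_trans pq; apply: le_trans p2; exact: ler0n.
have [m [C [kap [qm m1 C0 kap0 H]]]] := @local_gradient R N s1 p sp q p2 s10 hsp.
have qm' : 0 <= q <= m by rewrite q0.
have NN0 : 0 < (N%:R : R) by rewrite ltr0n.
(* [N ^ q] comes from [vnorm_powR], [N] from the sum over the components, and [2 ^ N + C] from
   lowering the exponent from [m] to [q]. *)
exists (N%:R `^ q * N%:R * (2 ^+ N + C)), kap; split.
  by rewrite !mulr_gt0 ?powR_gt0// addr_gt0// exprn_gt0.
split=> // Om u [_ [oO _]] sol; pose G i := seqlim (dquot u i); exists G.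
have [ws Li] := sol; have mu_ : measurable_fun setT u by case: Li.
have mD i k := measurable_dquot u i k mu_.
have mG i : measurable_fun setT (G i) by exact: measurable_seqlim.
split; first split.
- exact: Linf_loc_Lq.
- split=> [i|i phi tphi].
    apply: (gradient_Lq _ _ _ m (mG i) qm' oO) => y Rr r bc R1 r0 rR.
    have [h _] := H Om u sol y Rr r bc R1 r0 rR i.
    by apply: le_lt_trans h _; rewrite ltry.
  have [s [e [rho [e0 /andP[rho0 rho1] sb hcov]]]] := test_fun_cover Om phi tphi.
  have [mphi mpd [L0 hL0] [L hL]] := pderiv_test_fun Om phi i tphi.
  have dphi y : derivable (fun h : R => phi (shift y i h)) 0 1.
    by have [Cphi _] := tphi; have [_ /(_ i) []] := Cphi 1%N.
  have r20 : 0 < rho / 2 by rewrite divr_gt0.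
  have r2r : rho / 2 < rho by move: rho0; clear; lra.
  have hU y : y \in s -> (\int[muN R N]_x (\1_(eball y (rho / 2)) x * `|u x|)%:E < +oo)%E.
    move=> /sb[_ bO]; have [W1 _] := ws.
    have bc : ball_cc Om y (rho / 2).
      by split=> // x /= xy; apply: bO; exact: le_trans xy (ltW r2r).
    have [[_ +] _] := W1 y _ bc; rewrite /LqpowN.
    have mb := measurable_eball y (rho / 2).
    rewrite iintR; [|by msr|by move=> x; rewrite mulr_ge0 ?powR_ge0].
    by under eq_integral do rewrite powRr1//.
  have hG y : y \in s -> exists (C' a : R) (k0 : nat), 0 <= a < 1 /\ forall k, (k0 <= k)%N ->
     (\int[muN R N]_x (\1_(eball y (rho / 2)) x * `|dquot u i k x - G i x|)%:E <= (C' * a ^+ k)%:E)%E.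
    by move=> /sb bc; have [_] := H Om u sol y _ _ bc rho1 r20 r2r i.
  have [i1 i2 E] := weak_gradient_limit u (G i) phi i s (rho / 2) e L0 L mu_ (mG i) mphi mpd e0 hL0 hL
    dphi hcov hU hG.
  have m1' : measurable_fun setT (fun x => u x * pderiv i phi x) by msr.
  have m2' : measurable_fun setT (fun x => G i x * phi x) by have mg := mG i; msr.
  have /integrableP[_ f1] := i1; have /integrableP[_ f2] := i2.
  split; [|split].
  + by split=> //; rewrite iintR//; msr.
  + by split=> //; rewrite iintR//; msr.
  + by rewrite !sintN_E// E fineN.
move=> x0 Rr r bc R1 r0 rR.
have A0 : 0 < datum sp p u x0 Rr by exact: lt_le_trans (datum_ge1 _ _ _ _ _).
rewrite -/(datum sp p u x0 Rr); set A := datum _ _ _ _ _ in A0 *.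
set D := Rr - r; have D0 : 0 < D by rewrite subr_gt0.
have D1 : D <= 1 by move: R1 r0; rewrite /D; clear; lra.
have mB := measurable_eball x0 r.
have mi i : measurable_fun setT (fun x => \1_(eball x0 r) x * `|G i x| `^ q) by have mg := mG i; msr.
have pi_ i x : 0 <= \1_(eball x0 r) x * `|G i x| `^ q by rewrite mulr_ge0 ?powR_ge0.
pose X := A `^ q * (2 ^+ N + C * D `^ (- kap)).
have hi i : (\int[muN R N]_x (\1_(eball x0 r) x * `|G i x| `^ q)%:E <= X%:E)%E.
  have [h _] := H Om u sol x0 Rr r bc R1 r0 rR i.
  exact: (int_powR_le _ _ _ _ _ _ _ (mG i) (ltW r0) (ltW (lt_trans rR R1)) A0 qm' h).
have mv : measurable_fun setT (vnorm G).
  apply: measurableT_comp; first by apply: continuous_measurable_fun; exact: sqrt_continuous.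
  by apply: measurable_sum => i; have mg := mG i; msr.
have msum : measurable_fun setT (fun x => \sum_(i < N) \1_(eball x0 r) x * `|G i x| `^ q).
  exact: measurable_sum.
have psum x : 0 <= \sum_(i < N) \1_(eball x0 r) x * `|G i x| `^ q by apply: sumr_ge0.
have Nq := powR_ge0 (N%:R : R) q.
rewrite iintR; [|by msr|by move=> x; rewrite mulr_ge0 ?powR_ge0].
apply: (@le_trans _ _ (\int[muN R N]_x (N%:R `^ q * \sum_(i < N) \1_(eball x0 r) x * `|G i x| `^ q)%:E)%E).
  apply: intR_le; [by msr|by msr|by move=> x; rewrite mulr_ge0 ?powR_ge0|move=> x].
  by rewrite -mulr_sumr mulrCA; apply: ler_wpM2l => //; exact: vnorm_powR.
rewrite (intRZ _ _ _ _ _ msum psum Nq) -!mulrA EFinM; apply: lee_scale => //.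
under eq_integral do rewrite -sumEFin.
rewrite ge0_integral_sum//; last by move=> i; exact: measurable_EFin_comp.
apply: (le_trans (lee_sum _ (fun i _ => hi i))).
have -> : (\sum_(i < N) X%:E = (N%:R * X)%:E)%E by rewrite sumEFin sumr_const card_ord mulr_natl.
rewrite lee_fin; apply: ler_wpM2l; first exact: ltW.
rewrite /X -powRN mulrCA; apply: ler_wpM2l; first exact: powR_ge0.
(* Since [Rr - r <= 1], the volume term [2 ^ N] may also carry the negative power of the gap. *)
rewrite mulrDl lerD2r ler_peMr ?exprn_ge0// powRN invf_ge1 ?powR_gt0//.
have <- : 1 `^ kap = 1 :> R by rewrite powR1.
apply: ler_powR2 => //; exact: ltW.
Qed.
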